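(* Let $G$ be a finitely generated abelian group, let $n \ge 1$, and let $A \in \mathrm{Mat}_n(\mathbb{C}[G])$. Then: (1) For every residual chain $(N_i)_{i\ge 1}$ in $G$, with associated regularized eigenvalue measures $\mu_{A_i}$, the limit $\lim_{i\to\infty}\mu_{A_i}(\{0\})$ exists. (2) The value of this limit does not depend on the choice of the residual chain $(N_i)_{i \ge 1}$. (3) For every residual chain $(N_i)_{i\ge 1}$ in $G$, the measures $\mu_{A_i}$ converge weakly, as $i\to\infty$, to the Brown measure $\mu_A$ of the operator $r_A$ on $\ell^2(G)^n$ given by right multiplication by $A$.
   Context: Residual chain: a nested sequence $G \unrhd N_1 \ge N_2 \ge \cdots$ of subgroups, each normal and of finite index in $G$, with $\bigcap_i N_i=\{1\}$. Put $G_i = G/N_i$. Regularized eigenvalue measure: $G$ acts on $\mathbb{C}[G_i]\cong\mathbb{C}^{|G_i|}$ by right multiplication; extending linearly, $\mathrm{Mat}_n(\mathbb{C}[G])$ acts on row vectors in $\mathbb{C}[G_i]^n$ by right multiplication. $A_i \in \mathrm{Mat}_{n|G_i|}(\mathbb{C})$ is the matrix of the linear operator $v\mapsto vA$ on $\mathbb{C}[G_i]^n$ in some basis. If $\lambda_1,\dots,\lambda_{n|G_i|}$ are the eigenvalues of $A_i$ with algebraic multiplicity, then $\mu_{A_i} = \frac{1}{|G_i|}\sum_{j=1}^{n|G_i|}\delta_{\lambda_j}$, where $\delta_z$ is the Dirac measure at $z$ (so the total mass is $n$). Brown measure: $r_A$ is the bounded operator $v\mapsto vA$ on $\ell^2(G)^n$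 (row vectors). It lies in the von Neumann algebra $\mathcal{M}$ of bounded operators on $\ell^2(G)^n$ commuting with the left $G$-action, equipped with the (unnormalized) trace $\tau(T)=\sum_{j=1}^n\langle T e_j,e_j\rangle$, where $e_j\in \ell^2(G)^n$ has $1_G$ in position $j$ and $0$ elsewhere (so $\tau(\mathrm{Id})=n$). For $T\in\mathcal{M}$ set $\Delta(T)=\lim_{\epsilon\to 0^+}\exp\big(\tau(\log (TT^*+\epsilon)^{1/2})\big)$. The function $\lambda\mapsto\log\Delta(T-\lambda)$ is subharmonic on $\mathbb{C}$, and the Brown measure $\mu_T$ of $T$ is the Borel measure on $\mathbb{C}$ determined by $$\int_{\mathbb{C}}\varphi\,d\mu_T=\frac{1}{2\pi}\int_{\mathbb{R}^2}\log\Delta(T-\lambda)\,\nabla^2\varphi(\lambda)\,d\lambda_r\,d\lambda_i\qquad\text{for all }\varphi\in C_c^\infty(\mathbb{R}^2),$$ where $\lambda=\lambda_r+i\lambda_i$ and $\nabla^2$ is the Laplacian. Write $\mu_A:=\mu_{r_A}$. *)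

(* Defs.v *)
From HB Require Import structures.
From mathcomp Require Import all_boot all_order all_algebra finmap.
From mathcomp Require Import all_classical all_reals all_analysis.
From mathcomp Require Import complex ring.

Set Implicit Arguments.
Unset Strict Implicit.
Unset Printing Implicit Defensive.

Import Order.TTheory GRing.Theory Num.Theory numFieldNormedType.Exports.
Import ComplexField.Normc.

Local Open Scope classical_set_scope.
Local Open Scope ring_scope.

(* Abelian groups are written additively: a group G is a zmodType, its
   neutral element is 0 and the product g h^-1 is g - h. *)

Definition finitely_generated (G : zmodType) : Prop :=
  exists s : seq G, forall g : G,
    exists c : 'I_(size s) -> int, g = \sum_(k < size s) s`_k *~ c k.

Record residual_chain (G : zmodType) := ResidualChain {
  chain :> nat -> zmodClosed G;
  chain_nested : forall i, {subset chain i.+1 <= chain i};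
  chain_finite_index : forall i, finite_set [set: Quotient.quot (chain i)];
  chain_trivial : forall g, (forall i, g \in chain i) -> g = 0 }.

(* The quotient G / N by a subgroup of finite index, as a finite group. *)
Section FiniteQuotient.
Variables (G : zmodType) (N : zmodClosed G).
Hypothesis finN : finite_set [set: Quotient.quot N].

Definition quot_enum : seq (Quotient.quot N) := fset_set [set: Quotient.quot N].

Lemma quot_enumP : Finite.axiom quot_enum.
Proof.
apply: Finite.uniq_enumP => [|x]; first by rewrite fset_uniq.
rewrite -[LHS]/(x \in fset_set [set: Quotient.quot N]).
by rewrite in_fset_set//; apply/idP; rewrite inE.
Qed.

Definition finquot of finite_set [set: Quotient.quot N] : Type :=
  Quotient.quot N.

HB.instance Definition _ := GRing.Zmodule.on (finquot finN).
HB.instance Definition _ :=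
  Choice_isCountable.Build (finquot finN) (fin_pickleK (f := quot_enumP)).
HB.instance Definition _ := fintype.isFinite.Build (finquot finN) quot_enumP.

Definition quot_proj (g : G) : finquot finN := (\pi_(Quotient.quot N) g)%qT.

Lemma quot_proj_is_zmod_morphism : zmod_morphism quot_proj.
Proof. exact: (raddfB (\pi_(Quotient.quot N))%qT). Qed.

HB.instance Definition _ :=
  GRing.isZmodMorphism.Build G (finquot finN) quot_proj
    quot_proj_is_zmod_morphism.

End FiniteQuotient.

(* An element of C[G] is its finitely supported family of coefficients. *)
Notation "{ 'group_ring' C [ G ] }" := {fsfun G -> C with 0}
  (at level 0, C at level 2, format "{ 'group_ring'  C [ G ] }") : type_scope.

Section EigenvalueMeasure.
Variables (R : realType) (G : zmodType) (Q : finZmodType).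
Variables (pi : {additive G -> Q}) (n : nat).
Let C := R[i].

(* C[Q]^n, row vectors *)
Local Notation fin_module := {ffun 'I_n -> {ffun Q -> C^o}}.

Definition fin_translate (q : Q) (v : {ffun Q -> C^o}) : {ffun Q -> C^o} :=
  [ffun g => v (g - q)].

(* v |-> v A, where a group element h acts on the right on C[Q] through pi h *)
Definition fin_rmul (A : 'M[{group_ring C[G]}]_n) (v : fin_module) :
    fin_module :=
  [ffun k => \sum_(j < n) \sum_(h <- finsupp (A j k))
     A j k h *: fin_translate (pi h) (v j)].

Lemma fin_translate_is_linear q : linear (fin_translate q).
Proof. by move=> c u v; apply/ffunP => g; rewrite !ffunE. Qed.

Lemma fin_rmulE A v k : fin_rmul A v k =
  \sum_(j < n) \sum_(h <- finsupp (A j k)) A j k h *: fin_translate (pi h) (v j).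
Proof. by rewrite ffunE. Qed.

Lemma fin_rmul_is_linear A : linear (fin_rmul A).
Proof.
move=> c u v.
have lin (x y : fin_module) j : (c *: x + y) j = c *: x j + y j.
  by rewrite ffunE; congr (_ + _); rewrite ffunE.
apply/ffunP => k; apply: etrans (esym (lin _ _ k)).
rewrite 3!fin_rmulE (scaler_sumr c) -big_split/=.
apply: eq_bigr => j _; rewrite scaler_sumr -big_split/=.
apply: eq_bigr => h _.
by rewrite lin fin_translate_is_linear scalerDr !scalerA mulrC.
Qed.

HB.instance Definition _ A :=
  GRing.isLinear.Build C fin_module fin_module _ (fin_rmul A)
    (fin_rmul_is_linear A).

(* the matrix A_i, in some basis of C[Q]^n *)
Definition fin_matrix (A : 'M[{group_ring C[G]}]_n) :
    'M[C]_(\dim {: fin_module}) :=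
  passmx.mxof (vbasis {: fin_module}) (vbasis {: fin_module}) (linfun (fin_rmul A)).

(* the roots of the characteristic polynomial, repeated according to their
   multiplicity *)
Definition fin_eigenvalues (A : 'M[{group_ring C[G]}]_n) : seq C :=
  sval (closed_field_poly_normal (char_poly (fin_matrix A))).

End EigenvalueMeasure.

Section Ell2.
Variables (R : realType) (G : zmodType).
Let C := R[i].

Definition square_summable : {pred (G -> C)} :=
  fun x => `[< (\esum_(g in [set: G]) (normc (x g) ^+ 2)%:E < +oo)%E >].

Lemma le_esumZl (c : R) (f : G -> R) : 0 <= c -> (forall g, 0 <= f g) ->
  (\esum_(g in [set: G]) (c * f g)%:E <=
   c%:E * \esum_(g in [set: G]) (f g)%:E)%E.
Proof.
move=> c0 f0; apply: ge_ereal_sup => _ [A [finA _] <-].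
under eq_fsbigr do rewrite EFinM.
rewrite -ge0_mule_fsumr; last by move=> g; rewrite lee_fin.
by apply: lee_wpmul2l; rewrite ?lee_fin//; apply: ereal_sup_ubound; exists A.
Qed.

Lemma normcD2_le (u v : C) :
  normc (u + v) ^+ 2 <= 2 * normc u ^+ 2 + 2 * normc v ^+ 2.
Proof.
case: u v => [a b] [c d]; rewrite /normc/=.
rewrite !sqr_sqrtr ?addr_ge0 ?sqr_ge0// -subr_ge0.
suff -> : 2 * (a ^+ 2 + b ^+ 2) + 2 * (c ^+ 2 + d ^+ 2) -
    ((a + c) ^+ 2 + (b + d) ^+ 2) = (a - c) ^+ 2 + (b - d) ^+ 2.
  by rewrite addr_ge0 ?sqr_ge0.
by ring.
Qed.

Lemma square_summable_submod : submod_closed square_summable.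
Proof.
split=> [|c u v].
  apply/asboolP; rewrite esum1 ?ltry// => g _.
  by rewrite normc0 expr0n.
move=> /asboolP u2 /asboolP v2; apply/asboolP.
pose k : R := 2 * normc c ^+ 2.
have k0 : 0 <= k by rewrite mulr_ge0 ?sqr_ge0.
have := le_esumZl k0 (fun g => sqr_ge0 (normc (u g))).
have := le_esumZl (ler0n R 2) (fun g => sqr_ge0 (normc (v g))).
move=> V U; apply: (@le_lt_trans _ _
  (\esum_(g in [set: G]) (k * normc (u g) ^+ 2)%:E +
   \esum_(g in [set: G]) (2 * normc (v g) ^+ 2)%:E)%E).
  rewrite -esumD; last 2 first.
  - by move=> g _; rewrite lee_fin mulr_ge0 ?sqr_ge0.
  - by move=> g _; rewrite lee_fin mulr_ge0 ?sqr_ge0.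
  apply: le_esum => g _; rewrite -EFinD lee_fin.
  apply: le_trans (normcD2_le _ _) _.
  by rewrite /k normcM exprMn mulrA.
apply: lte_add_pinfty.
  by apply: le_lt_trans U _; rewrite lte_mul_pinfty ?lee_fin.
by apply: le_lt_trans V _; rewrite lte_mul_pinfty ?lee_fin.
Qed.

HB.instance Definition _ :=
  GRing.isSubmodClosed.Build C (G -> C) square_summable square_summable_submod.

Record ell2 := Ell2 {
  ell2_fun :> G -> C;
  ell2_funP : ell2_fun \in square_summable }.

HB.instance Definition _ := [isSub for ell2_fun].
HB.instance Definition _ := [Choice of ell2 by <:].
HB.instance Definition _ := [SubChoice_isSubLmodule of ell2 by <:].

Lemma translate_subproof (h : G) (v : ell2) :
  (fun g => v (g - h)) \in square_summable.
Proof.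
apply/asboolP; have /asboolP := ell2_funP v; apply: le_lt_trans.
rewrite [leRHS](_ : _ =
  \esum_(g in [set (g - h)%R | g in [set: G]]) (normc (v g) ^+ 2)%:E)%E.
  by rewrite esum_image// => x y _ _ /addIr.
congr esum; apply/esym/seteqP; split=> // g _.
by exists (g + h) => //; rewrite addrK.
Qed.

(* right multiplication of v by the group element h *)
Definition translate (h : G) (v : ell2) : ell2 := Ell2 (translate_subproof h v).

Lemma ell2_one_subproof :
  (fun g : G => (g == 0)%:R : C) \in square_summable.
Proof.
apply/asboolP.
rewrite (esumID [set 0])//; last by move=> g _; rewrite lee_fin sqr_ge0.
rewrite setTI esum_set1 ?lee_fin ?sqr_ge0// esum1 ?adde0 ?ltry//.
by move=> g [_ /= /eqP/negPf ->]; rewrite normc0 expr0n.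
Qed.

Definition ell2_one : ell2 := Ell2 ell2_one_subproof.

(* Unconditional sum of an absolutely summable complex family. *)
Definition real_sum (f : G -> R) : R :=
  fine (\esum_(g in [set: G]) (Num.max (f g) 0)%:E) -
  fine (\esum_(g in [set: G]) (Num.max (- f g) 0)%:E).

Definition complex_sum (f : G -> C) : C :=
  (real_sum (fun g => complex.Re (f g)) +i*
   real_sum (fun g => complex.Im (f g)))%C.

End Ell2.

(* The Hilbert space of row vectors over l^2(G), and its operators. *)
Section Operators.
Variables (R : realType) (G : zmodType) (n : nat).
Let C := R[i].

Definition hilbert : lmodType C := {ffun 'I_n -> ell2 R G}.

Definition entry (x : hilbert) (j : 'I_n) : ell2 R G :=
  (x : {ffun 'I_n -> ell2 R G}) j.

Definition inner (x y : hilbert) : C :=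
  \sum_(j < n) complex_sum (fun g => entry x j g * (entry y j g)^*%C).

Definition hnorm (x : hilbert) : R := Num.sqrt (complex.Re (inner x x)).

Definition bounded_operator (T : hilbert -> hilbert) : Prop :=
  linear T /\ exists K : R, forall x, hnorm (T x) <= K * hnorm x.

(* The operator determined by P; the value is junk if P cannot be satisfied. *)
Definition the_operator (P : set (hilbert -> hilbert)) : hilbert -> hilbert :=
  xget (fun=> 0) P.

Definition adjoint (T : hilbert -> hilbert) : hilbert -> hilbert :=
  the_operator [set S | bounded_operator S /\
    forall x y, inner (T x) y = inner x (S y)].

Definition sub_scalar (T : hilbert -> hilbert) (z : C) : hilbert -> hilbert :=
  fun x => T x - z *: x.

Definition spectrum (T : hilbert -> hilbert) : set C :=
  [set z | ~ exists S, [/\ bounded_operator S,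
    cancel (sub_scalar T z) S & cancel S (sub_scalar T z)]].

Definition poly_operator (p : {poly C}) (T : hilbert -> hilbert) :
    hilbert -> hilbert :=
  fun x => \sum_(k < size p) p`_k *: iter k T x.

(* Continuous functional calculus: for a self-adjoint T, whose spectrum is
   real, and f continuous on the spectrum, f(T) is the limit in operator norm
   of the p(T), for polynomials p tending to f uniformly on the spectrum. *)
Definition functional_calculus (f : R -> R) (T : hilbert -> hilbert) :
    hilbert -> hilbert :=
  the_operator [set L | bounded_operator L /\
    forall e : R, 0 < e -> exists p : {poly C},
      (forall t : R, spectrum T t%:C%C ->
         normc (p.[t%:C%C] - (f t)%:C%C) <= e) /\
      (forall x, hnorm (poly_operator p T x - L x) <= e * hnorm x)].

Definition unit_vector (j : 'I_n) : hilbert :=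
  [ffun k => if k == j then ell2_one R G else 0].

Definition trace (T : hilbert -> hilbert) : C :=
  \sum_(j < n) inner (T (unit_vector j)) (unit_vector j).

(* T T^* + e *)
Definition regularized_square (T : hilbert -> hilbert) (e : R) :
    hilbert -> hilbert :=
  fun x => T (adjoint T x) + e%:C%C *: x.

(* The trace of a self-adjoint operator is real, whence the Re. *)
Definition fuglede_kadison (T : hilbert -> hilbert) : R :=
  lim (expR (complex.Re (trace (functional_calculus
    (fun t => ln (Num.sqrt t)) (regularized_square T e)))) @[e --> 0^'+]).

(* log 0 = -oo *)
Definition log_fuglede_kadison (T : hilbert -> hilbert) : \bar R :=
  lne (fuglede_kadison T)%:E.

(* r_A : v |-> v A *)
Definition rmul (A : 'M[{group_ring C[G]}]_n) (v : hilbert) : hilbert :=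
  [ffun k => \sum_(j < n) \sum_(h <- finsupp (A j k))
     A j k h *: translate h (entry v j)].

End Operators.

(* Borel measures on the complex plane, identified with R^2. *)
Notation plane R := (measurableTypeR R * measurableTypeR R)%type.

Section Measures.
Variable R : realType.

Definition to_plane (z : R[i]) : plane R := (complex.Re z, complex.Im z).
Definition of_plane (z : plane R) : R[i] := (z.1 +i* z.2)%C.

(* b = false: the real coordinate; b = true: the imaginary coordinate *)
Definition partial (b : bool) (f : R * R -> R) : R * R -> R :=
  'D_(if b then (0, 1) else (1, 0)) f.

Definition iter_partial (s : seq bool) (f : R * R -> R) : R * R -> R :=
  foldr partial f s.

Definition smooth (f : R * R -> R) : Prop := forall s : seq bool,
  continuous (iter_partial s f) /\
  forall z b, derivable (iter_partial s f) z (if b then (0, 1) else (1, 0)).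

Definition test_function (f : R * R -> R) : Prop :=
  smooth f /\ compact (closure [set z | f z != 0]).

Definition laplacian (f : R * R -> R) : R * R -> R := fun z =>
  iter_partial [:: false; false] f z + iter_partial [:: true; true] f z.

Definition weak_convergence (mu_ : nat -> {measure set (plane R) -> \bar R})
    (mu : {measure set (plane R) -> \bar R}) : Prop :=
  forall f : R * R -> R, continuous f -> [bounded f z | z in [set: R * R]] ->
    (\int[mu_ i]_z (f z)%:E @[i --> \oo] --> \int[mu]_z (f z)%:E)%E.

Definition is_brown_measure (G : zmodType) (n : nat)
    (T : hilbert R G n -> hilbert R G n)
    (mu : {measure set (plane R) -> \bar R}) : Prop :=
  forall f : R * R -> R, test_function f ->
    (\int[mu]_z (f z)%:E = (2 * trigo.pi)^-1%:E *
     \int[@lebesgue_measure R \x @lebesgue_measure R]_z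
       (log_fuglede_kadison (sub_scalar T (of_plane z)) *
        (laplacian f z)%:E))%E.

(* The Brown measure is the only measure with the defining property; the zero
   measure stands for it if there is none. *)
Definition brown_measure (G : zmodType) (n : nat)
    (T : hilbert R G n -> hilbert R G n) : {measure set (plane R) -> \bar R} :=
  if pselect (exists mu, is_brown_measure T mu) is left ex
  then projT1 (cid ex) else mzero.

Definition eigenvalue_measure (G : zmodType) (n : nat)
    (A : 'M[{group_ring R[i][G]}]_n) (N : residual_chain G) (i : nat) :
    {measure set (plane R) -> \bar R} :=
  let pi := quot_proj (chain_finite_index N i) in
  let eigs := fin_eigenvalues pi A in
  mscale ((#|{: finquot (chain_finite_index N i)}|%:R : R)^-1)%:nng
    (msum (fun k => dirac (to_plane (nth 0 eigs k))) (size eigs)).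

End Measures.

(* Main.v *)
(* Fourier analysis on the dual group of G turns right multiplication by A into
   multiplication by its symbol, a matrix of trigonometric polynomials on the
   dual. The eigenvalues of A_i are those of the symbol at the characters of the
   finite quotient G_i, so that mu_{A_i} is an average of root measures of
   characteristic polynomials. For a smooth test function f, the sum of f over
   the roots at a character chi is (1/2 pi) times the integral of
   log |det (z - symbol chi)| Laplacian f(z), which is uniformly approximated by
   trigonometric polynomials in chi; since the average of a character g over the
   dual of G_i is eventually its Haar average, the mu_{A_i} converge weakly to
   the Haar average of the root measures.
   The latter is the Brown measure. By an almost eigenvector supported on Folner
   sets, the eigenvalues of the symbol of a self-adjoint operator belong to its
   spectrum, so that the polynomials approximating log on the spectrum compute
   the trace of log as a Haar integral of log det. Letting epsilon tend to 0, the
   logarithm of the Fuglede-Kadison determinant of r_A - z is the Haar integral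
   of log |det (z - symbol)| for almost all z, and Fubini concludes.
   For the atom at 0, the multiplicity of the eigenvalue 0 at a character is read
   off the vanishing of trigonometric polynomials in the coefficients of the
   characteristic polynomial. The proportion of the characters of G_i at which
   such a polynomial does not vanish is the normalized rank of a convolution
   operator on C[G_i], which is compared with its rank on Folner sets of G; the
   latter does not depend on the chain. *)
Require Import Defs.
From HB Require Import structures.
From mathcomp Require Import all_boot all_order all_algebra finmap.
From mathcomp Require Import all_classical all_reals all_analysis.
From mathcomp Require Import measurable_realfun giry complex ring lra zify.

Set Implicit Arguments.
Unset Strict Implicit.
Unset Printing Implicit Defensive.

Import Order.TTheory GRing.Theory Num.Theory numFieldNormedType.Exports.
Import ComplexField.Normc.

Local Open Scope classical_set_scope.
Local Open Scope ring_scope.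

(** The operators need not be normal, so the traces of the powers of [A] do not determine the limit
    measure; this is why logarithmic potentials are used. Their singularities at the roots are the
    obstacle to a uniform approximation: |det|^2 is replaced by |det|^2 + (d^2)^n, at a cost linear
    in [d] whose constant does not depend on the character, because the roots at all characters lie
    in one disc. The adjoint, the functional calculus and the Brown measure are defined by choice:
    an object with the defining property is exhibited each time, and the chosen one is then known
    through that property alone. The spectrum of a convolution operator is never computed. It
    contains the eigenvalues of the symbol at every character and, for the regularized square, it
    lies where the logarithm is a uniformly convergent power series; these two inclusions suffice.
    The dual group of [G] appears only as a probability space carrying a measurable family of
    characters that satisfies the orthogonality relations of Haar measure. *)

(** * Word balls and Folner sets *)

Lemma bernoulli_ineq (R : realDomainType) (e : R) (i : nat) :
  0 <= e -> 1 + i%:R * e <= (1 + e) ^+ i.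
Proof.
move=> e0; elim: i => [|i IH]; first by rewrite expr0 mul0r addr0.
have i0 : 0 <= i%:R * e by rewrite mulr_ge0.
rewrite exprS; apply: le_trans (_ : (1 + e) * (1 + i%:R * e) <= _).
  rewrite -natr1 mulrDl mul1r mulrDl mul1r mulrDr mulr1.
  rewrite -subr_ge0; have -> : 1 + i%:R * e + (e + e * (i%:R * e)) - (1 + (i%:R * e + e)) = e * (i%:R * e) by ring.
  by rewrite mulr_ge0.
by rewrite ler_wpM2l// addr_ge0.
Qed.

Section WordBalls.
Variables (G : zmodType) (s : seq G).
Let m := size s.

(** The image of a cube of Z^m, so that its cardinal is at most (2L + 1)^m whatever the relations
    between the generators. *)
Definition word_ball (L : nat) : {fset G} :=
  seq_fset tt [seq \sum_(k < m) s`_k *~ ((c k)%:Z - L%:Z)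
              | c : {ffun 'I_m -> 'I_(L.*2.+1)} <- enum {ffun 'I_m -> 'I_(L.*2.+1)}].

Lemma word_ballP (L : nat) (g : G) :
  reflect (exists c : 'I_m -> int,
    (forall k, (`|c k| <= L)%N) /\ g = \sum_(k < m) s`_k *~ c k) (g \in word_ball L).
Proof.
rewrite seq_fsetE; apply: (iffP mapP) => [[c _ ->]|[c [cL ->]]].
  exists (fun k => (c k)%:Z - L%:Z); split=> // k.
  by have := ltn_ord (c k); lia.
exists [ffun k => inord (`|c k + L%:Z|)]; first by rewrite mem_enum.
apply: eq_bigr => k _; rewrite ffunE; congr (_ *~ _).
have ckL : (`|c k| <= L)%N := cL k.
have cLE : (absz (c k + L%:Z))%:Z = c k + L%:Z by rewrite gez0_abs; lia.
rewrite inordK; first by rewrite cLE addrK.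
by rewrite -addnn; lia.
Qed.

Lemma word_ballD (L D : nat) (g h : G) :
  g \in word_ball L -> h \in word_ball D -> g + h \in word_ball (L + D).
Proof.
move=> /word_ballP[c [cL ->]] /word_ballP[d [dD ->]]; apply/word_ballP.
exists (fun k => c k + d k); split=> [k|].
  by have := cL k; have := dD k; lia.
by rewrite -big_split/=; apply: eq_bigr => k _; rewrite mulrzDr.
Qed.

Lemma word_ball_mono (L D : nat) : (L <= D)%N -> (word_ball L `<=` word_ball D)%fset.
Proof.
move=> LD; apply/fsubsetP => g /word_ballP[c [cL ->]]; apply/word_ballP.
by exists c; split=> // k; apply: leq_trans (cL k) LD.
Qed.

Lemma card_word_ball (L : nat) : (#|` word_ball L| <= L.*2.+1 ^ m)%N.
Proof.
rewrite size_seq_fset (leq_trans (size_undup _))// size_map -cardE.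
by rewrite card_ffun !card_ord.
Qed.

Lemma word_ball_cover (F : seq G) :
  (forall g, exists c : 'I_m -> int, g = \sum_(k < m) s`_k *~ c k) ->
  exists D, {subset F <= word_ball D}.
Proof.
move=> gen; elim: F => [|f F [D FD]]; first by exists 0%N.
have [c fc] := gen f.
exists (maxn D (\max_k `|c k|%N)) => g; rewrite inE => /predU1P[->|/FD gD].
  apply/word_ballP; exists c; split=> // k.
  by apply: leq_trans (leq_maxr _ _); apply: (leq_bigmax k).
by move/fsubsetP: (word_ball_mono (leq_maxl D (\max_k `|c k|%N))); apply.
Qed.

End WordBalls.

(* Balls grow polynomially, so the ratio of the cardinals of two balls whose
   radii differ by D cannot stay above 1 + e. *)
Lemma slow_word_ball (R : realType) (G : zmodType) (s : seq G) (D : nat) (e : R) :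
  0 < e -> exists L,
  #|` word_ball s (L + D)|%:R <= (1 + e) * #|` word_ball s L|%:R.
Proof.
move=> e0; apply: contrapT => /forallNP growth.
have grow L : (1 + e) * #|` word_ball s L|%:R <= #|` word_ball s (L + D)|%:R.
  by have /negP := growth L; rewrite -ltNge => /ltW.
pose m := size s.
have low j : (1 + e) ^+ j <= #|` word_ball s (j * D)|%:R.
  elim: j => [|j IH].
    rewrite expr0 mul0n ler1n cardfs_gt0; apply/fset0Pn.
    exists 0; apply/word_ballP; exists (fun=> 0); split=> // .
    by rewrite big1.
  rewrite exprS mulSn addnC; apply: le_trans (grow _).
  by rewrite ler_wpM2l// addr_ge0// ltW.
pose K : R := 1 + 2 * (m.+1 * D)%:R / e.
have K1 : 1 <= K by rewrite lerDl divr_ge0 ?mulr_ge0// ltW.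
have K0 : 0 < K by apply: lt_le_trans K1.
(* After i(m + 1) steps, (1 + ie)^(m+1) <= (1 + e)^(i(m+1)) <= (2i(m+1)D + 1)^m <= (K(1 + ie))^m.
   The exponent on the left exceeds the degree of growth by one, so that 1 + ie is bounded by K^m
   for every [i]. *)
have key i : 1 + i%:R * e <= K ^+ m.
  have x0 : 0 < 1 + i%:R * e by rewrite ltr_pwDl// mulr_ge0// ltW.
  have h1 : (1 + i%:R * e) ^+ m.+1 <= ((i * m.+1 * D).*2.+1 ^ m)%:R.
    apply: le_trans (_ : (1 + e) ^+ (i * m.+1) <= _).
      rewrite exprM lerXn2r ?nnegrE ?exprn_ge0//; [exact: ltW|by rewrite addr_ge0// ltW|].
      by apply: bernoulli_ineq; apply: ltW.
    by apply: le_trans (low _) _; rewrite ler_nat card_word_ball.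
  have h2 : ((i * m.+1 * D).*2.+1 ^ m)%:R <= (K * (1 + i%:R * e)) ^+ m.
    rewrite natrX lerXn2r ?nnegrE//; first by rewrite mulr_ge0// ltW.
    rewrite -natr1 -muln2 !natrM /K natrM.
    have -> : (1 + 2 * (m.+1%:R * D%:R) / e) * (1 + i%:R * e) = 1 + i%:R * e
       + 2 * (m.+1%:R * D%:R) / e + 2 * (m.+1%:R * D%:R) * i%:R.
      by field; rewrite gt_eqF.
    have q : 0 <= 2 * (m.+1%:R * D%:R) / e by rewrite divr_ge0 ?mulr_ge0// ltW.
    have q' : 0 <= i%:R * e by rewrite mulr_ge0// ltW.
    rewrite -subr_ge0.
    have -> : 1 + i%:R * e + 2 * (m.+1%:R * D%:R) / e + 2 * (m.+1%:R * D%:R) * i%:R -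
      (i%:R * m.+1%:R * D%:R * 2 + 1) = i%:R * e + 2 * (m.+1%:R * D%:R) / e by ring.
    by rewrite addr_ge0.
  have := le_trans h1 h2; rewrite exprMn exprS ler_pM2r//.
  by rewrite exprn_gt0.
have := key (Num.bound (K ^+ m / e)).
apply/negP; rewrite -ltNge -ltrBlDl.
have Ke : 0 <= K ^+ m / e by rewrite divr_ge0 ?exprn_ge0// ltW.
have := archi_boundP Ke.
by rewrite ltr_pdivrMr// => H; apply: lt_trans H; rewrite ltrBlDl ltrDr.
Qed.

(** The points of the ball of radius [L] that a translation by an element of [F] moves out of it
    land in the shell between the radii [L] and [L + D], which [slow_word_ball] makes thin. *)
Lemma folner (R : realType) (G : zmodType) (F : seq G) (e : R) :
  finitely_generated G -> 0 < e ->
  exists S : {fset G}, (0 < #|` S|)%N /\ forall f, f \in F ->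
    #|` [fset x in S | (x + f)%R \notin S]%fset|%:R <= e * #|` S|%:R.
Proof.
move=> [s gen] e0.
have [D FD] := word_ball_cover F gen.
have [L LD] := slow_word_ball s D e0.
exists (word_ball s L); split=> [|f fF].
  rewrite cardfs_gt0; apply/fset0Pn; exists 0; apply/word_ballP; exists (fun=> 0).
  by split=> //; rewrite big1.
set B := word_ball s L in LD *; set B' := word_ball s (L + D) in LD.
have BB' : (B `<=` B')%fset by apply: word_ball_mono; rewrite leq_addr.
apply: (@le_trans _ _ (#|` B' `\` B|%fset%:R)).
  set E := [fset x in B | _]%fset.
  have -> : #|` E| = #|` [fset (x + f)%R | x in E]|%fset.
    by rewrite [X in _ = X]card_imfset//=; exact: addIr.
  rewrite ler_nat; apply: fsubset_leq_card; apply/fsubsetP => _ /imfsetP[x /= + ->].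
  rewrite !inE /= => /andP[xB xfB]; rewrite xfB.
  by apply: word_ballD => //; apply: FD.
rewrite cardfsDS// natrB ?fsubset_leq_card//.
by rewrite lerBlDr addrC -[X in X + _]mul1r -mulrDl.
Qed.

(** * Complex exponentials and the Haar measure of the dual group *)

Section Expi.
Variable R : realType.
Implicit Types (x y : R).

Definition expi x : R[i] := (trigo.cos x +i* trigo.sin x)%C.

Lemma expiD x y : expi (x + y) = expi x * expi y.
Proof. by rewrite /expi cosD sinD; simpc; congr (_ +i* _)%C; ring. Qed.

Lemma normc_expi x : normc (expi x) = 1.
Proof. by rewrite /expi /normc cos2Dsin2 sqrtr1. Qed.

Lemma expi_neq0 x : expi x != 0.
Proof.
apply/eqP => /(congr1 (@normc R)); rewrite normc_expi normc0 => /eqP.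
by rewrite oner_eq0.
Qed.

Lemma expi0 : expi 0 = 1.
Proof. by rewrite /expi cos0 sin0. Qed.

Lemma expiN x : expi (- x) = (expi x)^-1.
Proof. by apply: (mulfI (expi_neq0 x)); rewrite -expiD subrr expi0 divff// expi_neq0. Qed.

Lemma expi_natmul n x : expi (n%:R * x) = expi x ^+ n.
Proof.
elim: n => [|n IH]; first by rewrite mul0r expi0.
by rewrite -addn1 natrD mulrDl mul1r expiD IH exprD expr1.
Qed.

Lemma expi_intmul (k : int) x : expi (k%:~R * x) = expi x ^ k.
Proof.
case: k => n; first by rewrite -pmulrn expi_natmul.
by rewrite NegzE mulrNz mulNr expiN -pmulrn expi_natmul exprnN.
Qed.

Lemma expi_2pi : expi (2 * pi) = 1.
Proof. by rewrite /expi mulr_natl cos2pi sin2pi. Qed.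

Lemma expi_eq_cos x y c : expi x = expi y -> trigo.cos (c + x) = trigo.cos (c + y).
Proof. by move=> [cE sE]; rewrite !cosD cE sE. Qed.

Lemma expi_eq1 x : 0 < x < 2 * pi -> expi x != 1.
Proof.
move=> /andP[x0 x2pi]; apply/eqP => -[cx _].
have : 0 < trigo.sin (x / 2).
  by apply: sin_gt0_pi; rewrite divr_gt0//= ltr_pdivrMr// mulrC.
have : trigo.cos (x / 2 *+ 2) = 1 by rewrite -mulr_natr divfK.
rewrite cos_mulr2n => c1 /lt0r_neq0/negP; apply; rewrite -sqrf_eq0 sin2cos2.
by apply/eqP; lra.
Qed.

Lemma sum_root_of_unity (z : R[i]) m : z != 1 -> z ^+ m = 1 ->
  \sum_(j < m) z ^+ j = 0.
Proof.
move=> z1 zm; apply/eqP; have := subrX1 z m; rewrite zm subrr => /esym/eqP.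
by rewrite mulf_eq0 subr_eq0 (negPf z1).
Qed.

End Expi.

Section UniformNat.
Variables (R : realType) (m : nat).

(** The law of the choice of a root when a generator has finite order modulo the previous ones; with
    [m = 0], a point mass for the trivial group. *)
Definition uniform_nat : set nat -> \bar R :=
  mscale (m.+1%:R^-1)%:nng (msum (fun j => \d_j) m.+1).

HB.instance Definition _ := Measure.on uniform_nat.

Lemma ge0_integral_uniform_nat (f : nat -> R) : (forall j, 0 <= f j) ->
  (\int[uniform_nat]_j (f j)%:E = (m.+1%:R^-1 * \sum_(j < m.+1) f j)%:E)%E.
Proof.
move=> f0; rewrite ge0_integral_mscale//; last by move=> ? _; rewrite lee_fin.
rewrite ge0_integral_measure_sum//; last by move=> ? _; rewrite lee_fin.
rewrite EFinM -sumEFin; congr (_ * _)%E.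
by apply: eq_bigr => j _; rewrite integral_dirac// diracT mul1e.
Qed.

Let uniform_nat_setT : uniform_nat [set: nat] = 1%E.
Proof.
rewrite -[LHS]mul1e -integral_cst// (@ge0_integral_uniform_nat (fun=> 1))//.
by rewrite sumr_const card_ord mulVf.
Qed.

HB.instance Definition _ :=
  Measure_isProbability.Build _ _ _ uniform_nat uniform_nat_setT.

End UniformNat.


Lemma FTC2_everywhere (R : realType) (f F : R -> R) (a b : R) : a < b ->
  (forall x : R, is_derive x (1 : R) F (f x)) -> continuous f ->
  (\int[lebesgue_measure]_(x in `[a, b]) (f x)%:E = (F b - F a)%:E)%E.
Proof.
move=> ab dF cf; rewrite (@continuous_FTC2 _ f F)//.
- exact: continuous_subspaceT.
- have cF x : {for x, continuous F}.
    by apply: differentiable_continuous; apply/derivable1_diffP; case: (dF x).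
  split; first by move=> x _; case: (dF x).
  - by apply: cvg_at_right_filter; exact: cF.
  - by apply: cvg_at_left_filter; exact: cF.
- by move=> x _; rewrite derive1E; case: (dF x).
Qed.

Section UniformAngle.
Variable R : realType.

Definition twopi_gt0 : 0 < 2 * pi :> R := mulr_gt0 (ltr0n _ 2) (pi_gt0 R).

(** The summand 1 makes the integrand nonnegative, so that Tonelli's theorem applies to it without
    integrability conditions. *)
Lemma integral_uniform_cos (k : int) (c : R) : k != 0 ->
  (\int[uniform_prob twopi_gt0]_u (1 + trigo.cos (c + k%:~R * u))%:E = 1)%E.
Proof.
move=> k0; have kR0 : (k%:~R : R) != 0 by rewrite intr_eq0.
have da (u : R) : is_derive u 1 (fun u => c + k%:~R * u) k%:~R.
  by apply: is_derive_eq; rewrite /GRing.scale/=; ring.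
pose f (u : R) := 1 + trigo.cos (c + k%:~R * u).
pose F u : R := u + k%:~R^-1 * trigo.sin (c + k%:~R * u).
have dF (u : R) : is_derive u (1 : R) F (f u).
  by apply: is_derive_eq; rewrite /f /GRing.scale/=; field.
have cf : continuous f.
  move=> u; apply: differentiable_continuous; apply/derivable1_diffP.
  by apply: ex_derive.
rewrite integral_uniform; last 2 first.
- by apply/measurable_EFinP; apply: continuous_measurable_fun.
- by move=> u; rewrite lee_fin -lerBlDl sub0r cos_geN1.
rewrite (@FTC2_everywhere _ _ F)// ?twopi_gt0//.
rewrite /F mulr0 addr0 add0r subr0 -EFinM.
have -> : trigo.sin (c + k%:~R * (2 * pi)) = trigo.sin c.
  have : expi (c + k%:~R * (2 * pi)) = expi c.
    by rewrite expiD expi_intmul expi_2pi exp1rz mulr1.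
  by case.
by rewrite addrK mulVf// gt_eqF// twopi_gt0.
Qed.

End UniformAngle.

(* A random real angle al g for each g in the subgroup H, such that expi \o al
   is a character of H whose law is the normalized Haar measure of the dual
   group; the shift c encodes both the cosine and the sine. *)
Definition haar_angle (R : realType) (G : zmodType) (H : G -> Prop) d
    (T : measurableType d) (P : probability T R) (al : G -> T -> R) : Prop :=
  [/\ forall g, H g -> measurable_fun setT (al g),
      forall g h t, H g -> H h ->
        expi (al (g + h) t) = expi (al g t) * expi (al h t) &
      forall g c, H g -> (\int[P]_t (1 + trigo.cos (c + al g t))%:E =
        (1 + (g == 0)%:R * trigo.cos c)%:E)%E].

Section HaarAngleTheory.
Variables (R : realType) (G : zmodType) (H : G -> Prop) (d : measure_display).
Variables (T : measurableType d) (P : probability T R) (al : G -> T -> R).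
Hypothesis H0 : H 0.
Hypothesis HB : forall g h, H g -> H h -> H (g - h).
Hypothesis alP : haar_angle H P al.

Lemma haar_angle0 t : expi (al 0 t) = 1.
Proof.
have [_ alD _] := alP; apply: (mulfI (expi_neq0 (al 0 t))).
by rewrite -alD// addr0 mulr1.
Qed.

Lemma haar_angle_intmul g t (q : int) : H g ->
  expi (al (g *~ q) t) = expi (al g t) ^ q.
Proof.
move=> Hg; have [_ alD _] := alP.
have HN h : H h -> H (- h) by move=> Hh; rewrite -sub0r; apply: HB.
have HM n : H (g *+ n).
  elim: n => [//|n IH]; rewrite mulrSr -[X in _ + X]opprK.
  by apply: HB => //; apply: HN.
have natE n : expi (al (g *+ n) t) = expi (al g t) ^+ n.
  elim: n => [|n IH]; first exact: haar_angle0.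
  by rewrite mulrSr alD// IH exprSr.
case: q => n; first by rewrite -pmulrn natE.
rewrite NegzE mulrNz -pmulrn -exprnN -natE.
apply: (mulfI (expi_neq0 (al (g *+ n.+1) t))).
by rewrite divff ?expi_neq0// -alD ?subrr ?haar_angle0//; apply: HN.
Qed.

End HaarAngleTheory.

(** The angle [be] is the one given to [x]. It must agree with the old character on the multiples of
    [x] that lie in [H], which makes the extension multiplicative whatever decompositions [rep]
    chooses, and it must average out on the other multiples, which gives the vanishing of the Haar
    integral there. *)
Lemma haar_angle_extend (R : realType) (G : zmodType) (H : G -> Prop) (x : G)
    d (T : measurableType d) (P : probability T R) (al : G -> T -> R)
    d2 (U : measurableType d2) (Q : probability U R) (be : T * U -> R) :
  H 0 -> (forall g h, H g -> H h -> H (g - h)) ->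
  haar_angle H P al ->
  measurable_fun [set: T * U] be ->
  (forall k t u, H (x *~ k) -> expi (k%:~R * be (t, u)) = expi (al (x *~ k) t)) ->
  (forall k t c, ~ H (x *~ k) ->
    (\int[Q]_u (1 + trigo.cos (c + k%:~R * be (t, u)))%:E = 1)%E) ->
  exists al' : G -> T * U -> R,
    haar_angle (fun g => exists h k, H h /\ g = h + x *~ k) (P \x Q)%E al'.
Proof.
move=> H0 HB [mal alD alI] mbe beH beN.
have HN g : H g -> H (- g) by move=> Hg; rewrite -sub0r; apply: HB.
have HD g h : H g -> H h -> H (g + h).
  by move=> Hg Hh; rewrite -[h]opprK; apply: HB => //; apply: HN.
pose H' g := exists h k, H h /\ g = h + x *~ k.
pose rep g : G * int := xget (0, 0) [set p | H p.1 /\ g = p.1 + x *~ p.2].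
have repP g : H' g -> H (rep g).1 /\ g = (rep g).1 + x *~ (rep g).2.
  move=> [h [k [Hh gE]]]; rewrite /rep.
  by case: xgetP => [p _ //|/(_ (h, k))]; case; split.
pose al' g (tu : T * U) : R := al (rep g).1 tu.1 + (rep g).2%:~R * be tu.
exists al'; split.
- move=> g /repP[Hh _]; apply: measurable_funD.
    by apply: measurableT_comp (mal _ Hh) _; exact: measurable_fst.
  by apply: measurable_funM => //; exact: measurable_cst.
- move=> g h [t u] Hg Hh.
  have Hgh : H' (g + h).
    move: Hg Hh => [g1 [k1 [Hg1 ->]]] [g2 [k2 [Hg2 ->]]]; exists (g1 + g2), (k1 + k2).
    by split; [apply: HD|rewrite mulrzDr addrACA].
  have [H12 E12] := repP _ Hgh; have [H1 E1] := repP _ Hg; have [H2 E2] := repP _ Hh.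
  rewrite /al' /=; move: E12; set g12 := (rep (g + h)).1 in H12 *; set k12 := (rep (g + h)).2.
  rewrite {1}E1 {1}E2; set g1 := (rep g).1 in H1 *; set g2 := (rep h).1 in H2 *.
  set k1 := (rep g).2; set k2 := (rep h).2 => E.
  (* The decompositions chosen for g, h and g + h differ by a multiple of [x] that lies in [H],
     where [be] and [al] agree. *)
  have xk : x *~ (k12 - k1 - k2) = g1 + g2 - g12.
    have -> : x *~ (k12 - k1 - k2) = x *~ k12 - x *~ k1 - x *~ k2 by rewrite !mulrzBr.
    have -> : x *~ k12 = g1 + x *~ k1 + (g2 + x *~ k2) - g12.
      by rewrite E addrAC subrr add0r.
    by rewrite addrACA -[LHS]addrA -opprD [LHS]addrAC addrK.
  have Hxk : H (x *~ (k12 - k1 - k2)) by rewrite xk; apply: HB => //; apply: HD.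
  have -> : k12%:~R = (k12 - k1 - k2)%:~R + k1%:~R + k2%:~R :> R.
    by rewrite !intrB; ring.
  rewrite !mulrDl !expiD beH// mulrA mulrA -alD// xk [g12 + _]addrC subrK alD//.
  by ring.
- move=> g c Hg; have [Hh gE] := repP _ Hg.
  rewrite /al'; move: Hh gE; set h := (rep g).1; set k := (rep g).2 => Hh gE.
  rewrite fubini_tonelli1; first last.
  + by move=> tu; rewrite lee_fin -lerBlDl sub0r cos_geN1.
  + apply/measurable_EFinP; apply: measurable_funD; first exact: measurable_cst.
    apply: (measurableT_comp (continuous_measurable_fun (@continuous_cos R))).
    apply: measurable_funD; first exact: measurable_cst.
    apply: measurable_funD.
      by apply: measurableT_comp (mal _ Hh) _; exact: measurable_fst.
    by apply: measurable_funM => //; exact: measurable_cst.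
  rewrite /fubini_F /=.
  have [Hxk|NHxk] := pselect (H (x *~ k)); last first.
    have -> : (g == 0) = false.
      apply/negbTE/eqP => g0; apply: NHxk.
      have -> : x *~ k = - h by apply/eqP; rewrite -addr_eq0 addrC -gE g0.
      exact: HN.
    rewrite mul0r addr0.
    under eq_integral do (under eq_integral do rewrite addrA; rewrite beN//).
    by rewrite integral_cst// mul1e; exact: probability_setT.
  rewrite -alI; last by rewrite gE; apply: HD.
  apply: eq_integral => t _.
  under eq_integral => u _.
    rewrite (@expi_eq_cos _ _ (al g t)); last by rewrite expiD beH// -alD// -gE.
    over.
  rewrite integral_cst//; set p := (X in (_ * X)%E).
  by rewrite (_ : p = 1%E) ?mule1//; exact: probability_setT.
Qed.

(** Induction on the generators. If no positive multiple of the new generator [x] lies in the group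
    [H] of the others, its angle is uniform on [0, 2 pi]. Otherwise let [M] be the least such
    multiple: the value at [x] is one of the [M] roots of order [M] of the value at [x *~ M], chosen
    uniformly. *)
Lemma haar_angle_exists (R : realType) (G : zmodType) (s : seq G) :
  exists d (T : measurableType d) (P : probability T R) (al : G -> T -> R),
    haar_angle (fun g => exists c : nat -> int, g = \sum_(k < size s) s`_k *~ c k) P al.
Proof.
elim: s => [|x s [d [T [P [al alP]]]]].
  exists _, nat, (uniform_nat R 0), (fun _ _ => 0); split.
  - by move=> g _; exact: measurable_cst.
  - by move=> *; rewrite expi0 mulr1.
  - move=> _ c [? ->]; rewrite big_ord0 eqxx mul1r addr0.
    by rewrite integral_cst//; set p := (X in (_ * X)%E); rewrite (_ : p = 1%E) ?mule1//; exact: probability_setT.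
pose H g := exists c : nat -> int, g = \sum_(k < size s) s`_k *~ c k.
have H0 : H 0 by exists (fun=> 0); rewrite big1.
have HB g h : H g -> H h -> H (g - h).
  move=> [c ->] [c' ->]; exists (fun k => c k - c' k); rewrite -sumrB.
  by apply: eq_bigr => k _; rewrite mulrzBr.
have HN g : H g -> H (- g) by move=> Hg; rewrite -sub0r; apply: HB.
suff [d2 [U [Q [al' al'P]]]] : exists d2 (U : measurableType d2) (Q : probability U R)
    (al' : G -> T * U -> R),
    haar_angle (fun g => exists h k, H h /\ g = h + x *~ k) (P \x Q)%E al'.
  exists _, (T * U)%type, (P \x Q)%E, al'.
  suff -> : (fun g => exists c : nat -> int, g = \sum_(k < size (x :: s)) (x :: s)`_k *~ c k) =
    (fun g => exists h k, H h /\ g = h + x *~ k) by [].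
  apply/funext => g; apply/propext; split=> [[c ->]|[_ [k [[c ->] ->]]]].
    exists (\sum_(k < size s) s`_k *~ c k.+1), (c 0%N); split; first by exists (fun k => c k.+1).
    by rewrite big_ord_recl addrC.
  exists (fun j => if j is j'.+1 then c j' else k).
  by rewrite big_ord_recl addrC.
have [[m Hm]|noH] := pselect (exists m : nat, H (x *~ m.+1%:Z)); last first.
  exists _, (measurableTypeR R), (uniform_prob (twopi_gt0 R)).
  apply: (@haar_angle_extend _ _ H x _ T P al _ _ (uniform_prob (twopi_gt0 R)) snd) => //.
  - move=> k t u Hk /=; have -> : k = 0.
      case: k Hk => [[//|k] Hk|k Hk]; case: noH; exists k => //.
      by rewrite -[x *~ _]opprK; apply: HN; rewrite -mulrNz.
    by rewrite mulr0z mul0r expi0 (haar_angle0 H0 alP).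
  - move=> k t c NH /=; apply: integral_uniform_cos.
    by apply: contra_notN NH => /eqP ->; rewrite mulr0z.
have [m0 /asboolP Hm0 m0min] := ex_minnP (ex_intro (fun m => `[< H (x *~ m.+1%:Z) >]) m (asboolT Hm)).
pose M : int := m0.+1.
have M0 : (M%:~R : R) != 0 by rewrite intr_eq0.
have HZ g (q : int) : H g -> H (g *~ q).
  by move=> [c ->]; exists (fun k => c k * q); rewrite mulrz_suml; apply: eq_bigr => k _; rewrite mulrzA.
have Hdvd k : H (x *~ k) -> (k = (k %/ M)%Z * M).
  move=> Hk; have := divz_eq k M; set q := (k %/ M)%Z; set r := (k %% M)%Z => kE.
  suff rE : r = 0 by rewrite kE rE addr0.
  have r0 : 0 <= r by apply: modz_ge0.
  have rM : r < M by apply: ltz_pmod.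
  have : H (x *~ r).
    have -> : r = k - q * M by rewrite kE addrAC subrr add0r.
    by rewrite mulrzBr; apply: HB => //; rewrite mulrC mulrzA; apply: HZ.
  case: r r0 rM {kE} => // -[//|r] _ rM Hr.
  have := m0min r (asboolT Hr); rewrite leqNgt => /negP; case.
  by move: rM; rewrite /M; lia.
exists _, nat, (uniform_nat R m0).
pose be (tu : T * nat) := (al (x *~ M) tu.1 + tu.2%:R * (2 * pi)) / M%:~R.
have [mal alD alI] := alP.
apply: (@haar_angle_extend _ _ H x _ T P al _ _ _ be) => //.
- apply: measurable_funM; last exact: measurable_cst.
  apply: measurable_funD.
    by apply: measurableT_comp (mal _ Hm0) _; exact: measurable_fst.
  apply: measurable_funM; last exact: measurable_cst.
  have mn : measurable_fun [set: nat] (fun j : nat => j%:R : R) by [].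
  exact: (measurableT_comp mn measurable_snd).
- move=> k t u Hk; rewrite (Hdvd _ Hk) {Hk}; set q := (k %/ M)%Z.
  rewrite intrM /be /= -mulrA [_%:~R * (_ / _)]mulrC divfK// mulrDr expiD.
  rewrite mulrC [q * M]mulrC mulrzA (haar_angle_intmul H0 HB alP)//.
  by rewrite expi_intmul expi_natmul expi_2pi expr1n exp1rz mul1r expi_intmul.
- move=> k t c NH; rewrite (@ge0_integral_uniform_nat _ _ (fun u => 1 + trigo.cos (c + k%:~R * be (t, u)))).
    rewrite big_split/= sumr_const card_ord mulrDr mulVf// -[RHS]adde0 EFinD; congr (_ + _)%E.
    (* [w] is a root of unity of order dividing [M]. It differs from 1 because [M] does not divide
       [k], so that its powers sum to 0. *)
    pose w := expi (k%:~R * (2 * pi) / M%:~R) : R[i].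
    have w1 : w != 1.
      have := divz_eq k M; set q := (k %/ M)%Z; set r := (k %% M)%Z => kE.
      have -> : w = expi (r%:~R * (2 * pi) / M%:~R).
        rewrite /w; have -> : k%:~R * (2 * pi) / M%:~R = q%:~R * (2 * pi) + r%:~R * (2 * pi) / M%:~R :> R.
          by rewrite {1}kE intrD intrM; field.
        by rewrite expiD expi_intmul expi_2pi exp1rz mul1r.
      have r0 : 0 <= r by apply: modz_ge0.
      have rM : r < M by apply: ltz_pmod.
      have rn0 : r != 0.
        apply/eqP => rE; apply: NH; rewrite kE rE addr0 mulrC mulrzA; exact: HZ.
      apply: expi_eq1; rewrite divr_gt0 ?mulr_gt0 ?pi_gt0 ?ltr0z//=; last by rewrite lt_def rn0.
      rewrite ltr_pdivrMr ?ltr0z// mulrC ltr_pM2l ?mulr_gt0 ?pi_gt0//.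
      by rewrite ltr_int.
    have wm : w ^+ m0.+1 = 1.
      rewrite /w -expi_natmul [_%:R * _]mulrC -[m0.+1%:R]/(M%:~R) divfK// expi_intmul expi_2pi.
      by rewrite exp1rz.
    have : expi (c + k%:~R * (al (x *~ M) t / M%:~R)) * \sum_(j < m0.+1) w ^+ j = 0.
      by rewrite (sum_root_of_unity w1 wm) mulr0.
    rewrite mulr_sumr => /(congr1 (@complex.Re R)); rewrite raddf_sum /= => E.
    rewrite (eq_bigr (fun i : 'I_m0.+1 => complex.Re (expi (c + k%:~R * (al (x *~ M) t / M%:~R)) * w ^+ i))).
      by rewrite E mulr0.
    move=> j _; rewrite /w -expi_natmul -expiD /=; congr trigo.cos.
    by rewrite /be /=; ring.
  by move=> u; rewrite -lerBlDl sub0r cos_geN1.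
Qed.

(** * Characters of a finite abelian group *)

Definition is_character (R : realType) (G : zmodType) (chi : G -> R[i]) : Prop :=
  (forall g h, chi (g + h) = chi g * chi h) /\ (forall g, normc (chi g) = 1).

Section Characters.
Variables (R : realType) (G : zmodType) (chi : G -> R[i]).
Hypothesis chiP : is_character chi.

Lemma character_neq0 g : chi g != 0.
Proof.
have [_ chiN] := chiP; apply/eqP => /(congr1 (@normc R)); rewrite chiN normc0 => /eqP.
by rewrite oner_eq0.
Qed.

Lemma character0 : chi 0 = 1.
Proof.
have [chiD _] := chiP; apply: (mulfI (character_neq0 0)).
by rewrite -chiD addr0 mulr1.
Qed.

Lemma characterN g : chi (- g) = (chi g)^*%C.
Proof.
have [chiD chiN] := chiP; apply: (mulfI (character_neq0 g)).
rewrite -chiD subrr character0; have := chiN g.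
case: (chi g) => a b /= /(congr1 (fun x => x ^+ 2)).
rewrite sqr_sqrtr ?addr_ge0 ?sqr_ge0// expr1n => ab.
by simpc; rewrite -!expr2 ab; congr (_ +i* _)%C; ring.
Qed.

Lemma character_comp (H : zmodType) (f : {additive H -> G}) :
  is_character (chi \o f).
Proof.
have [chiD chiN] := chiP; split=> [g h|g] /=; last exact: chiN.
by rewrite raddfD chiD.
Qed.

End Characters.

Lemma normc_expr_eq1 (R : rcfType) (z : R[i]) m : (0 < m)%N -> z ^+ m = 1 -> normc z = 1.
Proof.
move=> m0 zm; have : `|z| ^+ m = 1 by rewrite -normrX zm normr1.
by move/eqP; rewrite pexpr_eq1// => /eqP /(congr1 (@complex.Re R)).
Qed.

Lemma finite_order (Q : finZmodType) (q : Q) : exists m, (0 < m)%N /\ q *+ m = 0.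
Proof.
have /injectivePn[i [j ij qij]] : ~~ injectiveb (fun i : 'I_(#|Q|.+1) => q *+ i).
  by apply/negP => /injectiveP /leq_card; rewrite card_ord ltnn.
wlog ltij : i j ij qij / (i < j)%N => [th|].
  have := ij; rewrite -val_eqE neq_ltn => /orP[|] lt; first exact: (th i j).
  by apply: (th j i) => //; rewrite eq_sym.
exists (j - i)%N; split; first by rewrite subn_gt0.
by rewrite mulrnBr ?qij ?subrr// ltnW.
Qed.

Lemma Xn_sub_1_factor (R : realType) (m : nat) : exists2 rs : seq R[i],
  uniq rs & \prod_(x <- rs) ('X - x%:P) = 'X^(m.+1) - 1.
Proof.
pose z : R[i] := expi (2 * pi / m.+1%:R).
have zX j : z ^+ j = expi (j%:R * (2 * pi) / m.+1%:R).
  by rewrite -expi_natmul mulrA.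
have prim : m.+1.-primitive_root z.
  apply/andP; split=> //; apply/forallP => i; rewrite unity_rootE zX.
  have [->|im] := eqVneq i.+1 m.+1.
    by rewrite mulrAC divff// mul1r expi_2pi !eqxx.
  apply/eqP/negbTE/expi_eq1.
  rewrite divr_gt0 ?mulr_gt0 ?pi_gt0//= ltr_pdivrMr// mulrC ltr_pM2l ?mulr_gt0 ?pi_gt0//.
  by rewrite ltr_nat ltn_neqAle im ltn_ord.
exists [seq z ^+ i | i <- iota 0 m.+1]; last first.
  by rewrite big_map -(factor_Xn_sub_1 prim) /index_iota subn0.
rewrite map_inj_in_uniq ?iota_uniq// => i j; rewrite !mem_iota !add0n => im jm /eqP.
by rewrite (eq_prim_root_expr prim) !modn_small// => /eqP.
Qed.

(* The translations of C[Q] commute and are diagonalizable; a common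
   diagonalization yields the characters of Q. *)
Lemma finite_dual (R : realType) (Q : finZmodType) :
  exists chi : 'I_#|Q| -> Q -> R[i], (forall k, is_character (chi k)) /\
    forall q, \sum_k chi k q = #|Q|%:R * (q == 0)%:R.
Proof.
have : (0 < #|Q|)%N by apply/card_gt0P; exists 0.
case En : #|Q| => [//|n] _.
pose e (i : 'I_n.+1) : Q := enum_val (cast_ord (esym En) i).
pose e' (q : Q) : 'I_n.+1 := cast_ord En (enum_rank q).
have eK : cancel e e' by move=> i; rewrite /e' /e enum_valK cast_ordKV.
have e'K : cancel e' e by move=> q; rewrite /e' /e cast_ordK enum_rankK.
pose Reg q : 'M[R[i]]_n.+1 := \matrix_(i, j) (e j == e i + q)%:R.
have RegD q q' : Reg (q + q') = Reg q *m Reg q'.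
  apply/matrixP => i j; rewrite !mxE (bigD1 (e' (e i + q)))//= !mxE e'K eqxx mul1r.
  rewrite addrA big1 ?addr0// => k ki; rewrite !mxE.
  by case: eqP => [ek|_]; [rewrite -ek eK eqxx in ki|rewrite mul0r].
have Reg0 : Reg 0 = 1.
  by apply/matrixP => i j; rewrite !mxE addr0 (inj_eq (can_inj eK)) eq_sym.
have RegX q m : Reg (q *+ m) = Reg q ^+ m.
  elim: m => [|m IH]; first by rewrite expr0.
  by rewrite mulrS RegD IH exprS.
pose As := [seq Reg q | q : Q].
have [codiag _] := @codiagonalizableP _ _ As.
have /codiag [P Pu /allP PD] : {in As &, forall f g, comm_mx f g} /\
    (forall f, f \in As -> diagonalizable f).
  split=> [f g /mapP[q _ ->] /mapP[q' _ ->]|f /mapP[q _ ->]].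
    by rewrite /comm_mx -!RegD addrC.
  (* [Reg q] is annihilated by X^m - 1, whose roots are simple. *)
  apply/diagonalizableP; have [m [m0 qm]] := finite_order q.
  case: m m0 qm => // m _ qm.
  have [rs rsU rsE] := Xn_sub_1_factor R m; exists rs => //; rewrite rsE.
  apply: mxminpoly_min; rewrite rmorphB rmorphXn rmorph1 /= horner_mx_X.
  by rewrite -RegX qm Reg0 subrr.
(* The diagonal entries are the characters. The trace of [Reg q] counts the fixed points of the
   translation by [q], whence the orthogonality relation. *)
have [D [DD diagD D0 trD]] : exists D : Q -> 'M[R[i]]_n.+1,
    [/\ forall q q', D (q + q') = D q *m D q', forall q, is_diag_mx (D q),
      D 0 = 1 & forall q, \tr (D q) = n.+1%:R * (q == 0)%:R].
  exists (fun q => P *m Reg q *m invmx P); split=> [q q'|q||q].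
  - by rewrite RegD !mulmxA mulmxKV.
  - by have /PD : Reg q \in As; [apply: map_f; rewrite mem_enum|rewrite /= /similar_to conjumx].
  - by rewrite Reg0 mulmx1 mulmxV.
  - rewrite mxtrace_mulC mulmxA mulVmx// mul1mx /mxtrace.
    under eq_bigr do rewrite mxE -[X in X == _]addr0 (inj_eq (addrI _)) eq_sym.
    by rewrite sumr_const card_ord mulr_natl.
have DM q q' k : D (q + q') k k = D q k k * D q' k k.
  rewrite DD mxE (bigD1 k)//= big1 ?addr0// => l lk.
  by rewrite (is_diag_mxP (diagD q)) ?mul0r// eq_sym.
have DX q m k : D (q *+ m) k k = D q k k ^+ m.
  elim: m => [|m IH]; first by rewrite mulr0n expr0 D0 mxE eqxx.
  by rewrite mulrS DM IH exprS.
exists (fun k q => D q k k); split=> [k|q]; last exact: trD.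
split=> [q q'|q]; first exact: DM.
have [m [m0 qm]] := finite_order q.
by apply: (normc_expr_eq1 m0); rewrite -DX qm D0 mxE eqxx.
Qed.

(** * Characteristic polynomials and the symbol *)

Lemma cotrig_matrix (R : realType) n (M : 'M[R[i]]_n) :
  exists U T : 'M[R[i]]_n, [/\ U \in unitmx, is_trig_mx T & U *m M = T *m U].
Proof.
have [|U /unitarymx_unit Uu /allP UT] := @cotrigonalization R[i] n [:: M].
  by move=> A B; rewrite !inE => /eqP-> /eqP->.
exists U, (U *m M *m invmx U); split=> //; last by rewrite mulmxKV.
by have := UT _ (mem_head _ _); rewrite /= /similar_to conjumx.
Qed.

Lemma char_poly_similar (R : comUnitRingType) n (P A B : 'M[R]_n) : P \in unitmx ->
  P *m A = B *m P -> char_poly A = char_poly B.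
Proof.
move=> Pu PA; rewrite /char_poly /char_poly_mx.
have -> : A = invmx P *m B *m P by rewrite -mulmxA -PA mulKmx.
set Q := map_mx polyC P; set Q' := map_mx polyC (invmx P).
have QQ' : Q' *m Q = 1%:M by rewrite -map_mxM mulVmx// map_mx1.
have -> : 'X%:M - map_mx polyC (invmx P *m B *m P) = Q' *m ('X%:M - map_mx polyC B) *m Q.
  by rewrite !map_mxM mulmxBr mulmxBl mul_mx_scalar -scalemxAl QQ' scalemx1.
by rewrite !det_mulmx mulrAC -det_mulmx QQ' det1 mul1r.
Qed.


(** The equality of the sizes is a hypothesis because the dimension of a space is only provably
    equal to the product that counts an explicit basis. *)
Lemma char_poly_intertwine (F : fieldType) p q (P : 'M[F]_(p, q)) (A : 'M[F]_q) (B : 'M[F]_p) :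
  p = q -> row_free P -> P *m A = B *m P -> char_poly A = char_poly B.
Proof.
move=> pq; case: q / pq P A => P A; rewrite row_free_unit => Pu.
exact: char_poly_similar.
Qed.

Section BlockIndex.
Variables m n : nat.

Lemma block_index_subproof (i : 'I_(m * n)) : (i %/ n < m)%N && (i %% n < n)%N.
Proof.
move: (ltn_ord i); move: (i : nat) => {}i imn.
have n0 : (0 < n)%N by case: n imn => //; rewrite muln0.
by rewrite ltn_divLR// imn ltn_pmod.
Qed.

Definition block_index (i : 'I_(m * n)) : 'I_m * 'I_n :=
  (Ordinal (andP (block_index_subproof i)).1, Ordinal (andP (block_index_subproof i)).2).

Lemma block_index_bij : bijective block_index.
Proof.
apply: inj_card_bij; last by rewrite card_prod !card_ord.
move=> i j [ij1 ij2]; apply: val_inj.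
by rewrite /= (divn_eq i n) (divn_eq j n) ij1 ij2.
Qed.

Lemma block_index_lt (i j : 'I_(m * n)) : (i < j)%N ->
  (block_index i).1 = (block_index j).1 -> ((block_index i).2 < (block_index j).2)%N.
Proof.
move=> + [ij1] /=; rewrite {1}(divn_eq i n) {1}(divn_eq j n) ij1.
by rewrite ltn_add2l.
Qed.

End BlockIndex.

Import passmx.

(* An endomorphism that stabilizes the blocks of a basis, and is triangular on
   each of them. *)
Lemma char_poly_block_trig (F : fieldType) (V : vectType F) (f : 'End(V))
    (e : (\dim {:V}).-tuple V) (m n : nat) (b : 'I_m -> 'I_n -> V)
    (T : 'I_m -> 'M[F]_n) :
  basis_of {:V} e -> (m * n)%N = \dim {:V} ->
  (forall u : 'I_m -> 'I_n -> F, \sum_k \sum_j u k j *: b k j = 0 ->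
     forall k j, u k j = 0) ->
  (forall k j, f (b k j) = \sum_l T k j l *: b k l) ->
  (forall k, is_trig_mx (T k)) ->
  char_poly (mxof e e f) = \prod_k \prod_j ('X - (T k j j)%:P).
Proof.
move=> eb mnE free fb Ttrig.
pose bi := @block_index m n.
pose P : 'M[F]_(m * n, \dim {:V}) := \matrix_i rVof e (b (bi i).1 (bi i).2).
pose TT : 'M[F]_(m * n) := \matrix_(i, i')
  (if (bi i).1 == (bi i').1 then T (bi i).1 (bi i).2 (bi i').2 else 0).
have reind (W : nmodType) (h : 'I_m -> 'I_n -> W) :
    \sum_(i < m * n) h (bi i).1 (bi i).2 = \sum_k \sum_j h k j.
  by rewrite pair_big/= (reindex bi)//; apply: onW_bij; exact: block_index_bij.
have TTtrig : is_trig_mx TT.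
  apply/is_trig_mxP => i j ij; rewrite mxE; case: eqP => // bE.
  by apply: (is_trig_mxP (Ttrig _)); apply: block_index_lt.
have Pfree : row_free P.
  apply: inj_row_free => v vP.
  have v0 : \sum_(i < m * n) v 0 i *: b (bi i).1 (bi i).2 = 0.
    apply/eqP; rewrite -(rVof_eq0 eb) linear_sum; apply/eqP.
    rewrite -[RHS]vP mulmx_sum_row; apply: eq_bigr => i _.
    by rewrite linearZ rowK.
  have [g bgK gbK] := block_index_bij m n.
  pose u k j := v 0 (g (k, j)).
  have /free u0 : \sum_k \sum_j u k j *: b k j = 0.
    rewrite -reind -[RHS]v0; apply: eq_bigr => i _; rewrite /u.
    by rewrite -surjective_pairing bgK.
  apply/rowP => i; rewrite mxE -(u0 (bi i).1 (bi i).2) /u.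
  by rewrite -surjective_pairing bgK.
rewrite (@char_poly_intertwine _ _ _ P _ TT)//; last first.
  apply/row_matrixP => i; rewrite !row_mul rowK -rVof_app// fb linear_sum.
  rewrite mulmx_sum_row.
  rewrite (eq_bigr (fun i' => (if (bi i).1 == (bi i').1 then
     T (bi i).1 (bi i).2 (bi i').2 else 0) *: rVof e (b (bi i').1 (bi i').2))).
    rewrite (reind _ (fun k j => (if (bi i).1 == k then T (bi i).1 (bi i).2 j else 0)
      *: rVof e (b k j))) (bigD1 (bi i).1)//= [X in _ + X]big1 ?addr0.
      by apply: eq_bigr => l _; rewrite eqxx linearZ.
    by move=> k /negPf; rewrite eq_sym => ->; rewrite big1// => j _; rewrite scale0r.
  by move=> i' _; rewrite rowK !mxE.
rewrite char_poly_trig// pair_big/= (reindex bi).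
  by apply: eq_bigr => i _; rewrite mxE eqxx.
by apply: onW_bij; exact: block_index_bij.
Qed.

Definition spectrum_seq (R : realType) n (M : 'M[R[i]]_n) : seq R[i] :=
  sval (closed_field_poly_normal (char_poly M)).

Lemma spectrum_seqE (R : realType) n (M : 'M[R[i]]_n) :
  \prod_(x <- spectrum_seq M) ('X - x%:P) = char_poly M.
Proof.
rewrite /spectrum_seq; case: closed_field_poly_normal => r /=.
by rewrite (monicP (char_poly_monic M)) scale1r.
Qed.

Lemma size_spectrum_seq (R : realType) n (M : 'M[R[i]]_n) : size (spectrum_seq M) = n.
Proof.
have := congr1 (fun p : {poly R[i]} => size p) (spectrum_seqE M).
by rewrite size_prod_XsubC size_char_poly => -[].
Qed.

Definition symbol (R : realType) (G : zmodType) n (A : 'M[{group_ring R[i][G]}]_n)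
    (chi : G -> R[i]) : 'M[R[i]]_n :=
  \matrix_(j, k) \sum_(h <- finsupp (A j k)) A j k h * chi h.

(** The orthogonality relation, read at differences of elements of [Q], provides an inverse of the
    character matrix. *)
Lemma dual_family_free (R : realType) (Q : finZmodType) (chi : 'I_#|Q| -> Q -> R[i])
    (w : 'I_#|Q| -> R[i]) :
  (forall k, is_character (chi k)) ->
  (forall q, \sum_k chi k q = #|Q|%:R * (q == 0)%:R) ->
  (forall q, \sum_k w k * chi k q = 0) -> forall k, w k = 0.
Proof.
move=> chiP chiO w0 k.
pose X := \matrix_(k, i) chi k (enum_val (i : 'I_#|Q|)).
pose X' := \matrix_(i, k) (#|Q|%:R^-1 * chi k (- enum_val (i : 'I_#|Q|))).
have Q0 : (#|Q|%:R : R[i]) != 0.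
  by rewrite pnatr_eq0 -lt0n; apply/card_gt0P; exists 0.
have X'X : X' *m X = 1%:M.
  apply/matrixP => i j; rewrite !mxE.
  under eq_bigr do rewrite !mxE -mulrA -(chiP _).1.
  rewrite -mulr_sumr chiO mulKf// addrC subr_eq0 (inj_eq enum_val_inj).
  by rewrite eq_sym.
have wX : \row_k w k *m X = 0.
  apply/rowP => i; rewrite !mxE; under eq_bigr do rewrite !mxE.
  exact: w0.
have : \row_k w k = 0.
  by rewrite -[LHS]mulmx1 -(mulmx1C X'X) mulmxA wX mul0mx.
by move=> /rowP/(_ k); rewrite !mxE.
Qed.

(** On the tensors of a row vector [w] with the function [psi k], right multiplication by [A]
    multiplies [w] by the symbol at [chi k]. The blocks given by the characters are independent by
    [dual_family_free], and each is triangularized in a basis of its own. *)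
Lemma fin_eigenvalues_symbol (R : realType) (G : zmodType) (Q : finZmodType)
    (pi : {additive G -> Q}) n (A : 'M[{group_ring R[i][G]}]_n)
    (chi : 'I_#|Q| -> Q -> R[i]) :
  (forall k, is_character (chi k)) ->
  (forall q, \sum_k chi k q = #|Q|%:R * (q == 0)%:R) ->
  perm_eq (fin_eigenvalues pi A)
    (flatten [seq spectrum_seq (symbol A (chi k \o pi)) | k <- enum 'I_#|Q|]).
Proof.
move=> chiP chiO; apply: prod_XsubC_eq.
rewrite big_flatten big_map /= big_enum /=.
rewrite (eq_bigr (fun k => char_poly (symbol A (chi k \o pi)))); last first.
  by move=> k _; exact: spectrum_seqE.
pose M k := symbol A (chi k \o pi).
have /choice[UT UTP] : forall k, exists UT : 'M[R[i]]_n * 'M[R[i]]_n,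
    [/\ UT.1 \in unitmx, is_trig_mx UT.2 & UT.1 *m M k = UT.2 *m UT.1].
  by move=> k; have [U [T ?]] := cotrig_matrix (M k); exists (U, T).
(* [fin_translate q] evaluates at g - q; with the opposite sign in [psi], the translation by [pi h]
   has the eigenvalue [chi k (pi h)] and not its inverse. *)
pose psi k : {ffun Q -> R[i]^o} := [ffun g => chi k (- g)].
pose tens (w : 'I_n -> R[i]) k : {ffun 'I_n -> {ffun Q -> R[i]^o}} :=
  [ffun j => w j *: psi k].
pose b k j := tens (fun l => (UT k).1 j l) k.
have rmulE w k : fin_rmul pi A (tens w k) =
    tens (fun l => \sum_j w j * M k j l) k.
  apply/ffunP => l; rewrite !ffunE scaler_suml; apply: eq_bigr => j _.
  rewrite mxE mulr_sumr scaler_suml; apply: eq_bigr => h _.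
  rewrite !ffunE; apply/ffunP => q; rewrite !ffunE /GRing.scale/=.
  by rewrite opprB addrC (chiP k).1; ring.
rewrite /fin_eigenvalues; case: closed_field_poly_normal => r /= rE.
rewrite (monicP (char_poly_monic _)) scale1r in rE; rewrite -rE.
rewrite /fin_matrix (@char_poly_block_trig _ _ _ _ _ _ b (fun k => (UT k).2)).
- apply: eq_bigr => k _; have [Uu Tt E] := UTP k.
  transitivity (char_poly (UT k).2); first exact/esym/(char_poly_trig Tt).
  exact/esym/(char_poly_similar Uu E).
- exact: vbasisP.
- transitivity (#|'I_n| * (#|Q| * 1))%N; last by rewrite dimvf.
  by rewrite card_ord muln1 mulnC.
- move=> u u0 k j; have [Uu _ _] := UTP k.
  have uU : \row_j' u k j' *m (UT k).1 = 0.
    apply/rowP => l; rewrite !mxE.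
    apply: (dual_family_free chiP chiO
      (w := fun k => \sum_j (\row_j' u k j') 0 j * (UT k).1 j l)) => g.
    have u0lg : (\sum_k \sum_j u k j *: b k j : {ffun _ -> {ffun _ -> _}}) l (- g) = 0.
      by rewrite u0 !ffunE.
    rewrite -[RHS]u0lg.
    rewrite sum_ffunE sum_ffunE; apply: eq_bigr => k' _.
    rewrite sum_ffunE sum_ffunE mulr_suml; apply: eq_bigr => j' _.
    by rewrite !ffunE mxE opprK /GRing.scale/=; ring.
  have : \row_j' u k j' = 0 by rewrite -(mulmxK Uu (\row_j' u k j')) uU mul0mx.
  by move=> /rowP/(_ j); rewrite !mxE.
- move=> k j; rewrite lfunE /= rmulE; have [_ _ E] := UTP k.
  apply/ffunP => l; rewrite ffunE sum_ffunE.
  have /matrixP/(_ j l) := E; rewrite !mxE => ->.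
  by rewrite scaler_suml; apply: eq_bigr => l' _; rewrite !ffunE scalerA.
- by move=> k; have [] := UTP k.
Qed.

(** * Trigonometric polynomials on the dual group *)

Section ClosedFamily.
Variables (X : Type) (K : comNzRingType) (S : (X -> K) -> Prop).
Hypothesis S_cst : forall c, S (fun=> c).
Hypothesis S_add : forall f g, S f -> S g -> S (fun x => f x + g x).
Hypothesis S_mul : forall f g, S f -> S g -> S (fun x => f x * g x).

Lemma closed_family_sum I (r : seq I) (P : pred I) (F : I -> X -> K) :
  (forall i, P i -> S (F i)) -> S (fun x => \sum_(i <- r | P i) F i x).
Proof.
move=> SF; rewrite (_ : (fun x => _) = \big[(fun f g x => f x + g x)/(fun=> 0)]_(i <- r | P i) F i).
  by elim/big_ind: _.
apply/funext => x; elim: r => [|i r IH]; first by rewrite !big_nil.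
by rewrite !big_cons IH; case: ifP.
Qed.

Lemma closed_family_prod I (r : seq I) (P : pred I) (F : I -> X -> K) :
  (forall i, P i -> S (F i)) -> S (fun x => \prod_(i <- r | P i) F i x).
Proof.
move=> SF; rewrite (_ : (fun x => _) = \big[(fun f g x => f x * g x)/(fun=> 1)]_(i <- r | P i) F i).
  by elim/big_ind: _.
apply/funext => x; elim: r => [|i r IH]; first by rewrite !big_nil.
by rewrite !big_cons IH; case: ifP.
Qed.

Lemma closed_family_exp f m : S f -> S (fun x => f x ^+ m).
Proof.
move=> Sf; elim: m => [|m IH].
  by rewrite (_ : (fun x => _) = (fun=> 1)) //; apply/funext => x; rewrite expr0.
rewrite (_ : (fun x => _) = (fun x => f x * f x ^+ m)); first exact: S_mul.
by apply/funext => x; rewrite exprS.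
Qed.

Lemma closed_family_det n (M : X -> 'M[K]_n) :
  (forall i j, S (fun x => M x i j)) -> S (fun x => \det (M x)).
Proof.
move=> SM; apply: closed_family_sum => s _; apply: S_mul; first exact: S_cst.
by apply: closed_family_prod => i _; apply: SM.
Qed.

End ClosedFamily.

(* A trigonometric polynomial on the dual group of G, whose coefficients are
   functions of a parameter z in the class K. *)
Definition trig_poly (R : realType) (G : zmodType) (Z : Type)
    (K : (Z -> R[i]) -> Prop) (Phi : Z * (G -> R[i]) -> R[i]) : Prop :=
  exists (I : finType) (c : I -> Z -> R[i]) (g : I -> G),
    (forall i, K (c i)) /\
    forall z chi, is_character chi -> Phi (z, chi) = \sum_i c i z * chi (g i).

Section TrigPoly.
Variables (R : realType) (G : zmodType) (Z : Type) (K : (Z -> R[i]) -> Prop).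
Hypothesis K_cst : forall c, K (fun=> c).
Hypothesis K_mul : forall f g, K f -> K g -> K (fun x => f x * g x).
Hypothesis K_conj : forall f, K f -> K (fun x => (f x)^*%C).
Local Notation trig := (@trig_poly R G Z K).

Lemma trig_coef c : K c -> trig (fun p => c p.1).
Proof.
move=> Kc; exists unit, (fun=> c), (fun=> 0); split=> // z chi chiP.
by rewrite big_const card_unit /= addr0 character0 ?mulr1.
Qed.

Lemma trig_cst c : trig (fun=> c).
Proof. exact: (trig_coef (K_cst c)). Qed.

Lemma trig_eval g : trig (fun p => p.2 g).
Proof.
exists unit, (fun _ _ => 1), (fun=> g); split=> // z chi chiP.
by rewrite big_const card_unit /= addr0 mul1r.
Qed.

Lemma trigD Phi Psi : trig Phi -> trig Psi -> trig (fun p => Phi p + Psi p).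
Proof.
move=> [I [c [g [Kc PhiE]]]] [J [d [h [Kd PsiE]]]].
exists (I + J)%type, (fun k => match k with inl i => c i | inr j => d j end),
  (fun k => match k with inl i => g i | inr j => h j end).
split=> [[]//|z chi chiP]; rewrite PhiE// PsiE//.
by rewrite big_sumType.
Qed.

Lemma trigM Phi Psi : trig Phi -> trig Psi -> trig (fun p => Phi p * Psi p).
Proof.
move=> [I [c [g [Kc PhiE]]]] [J [d [h [Kd PsiE]]]].
exists (I * J)%type, (fun k z => c k.1 z * d k.2 z), (fun k => g k.1 + h k.2).
split=> [k|z chi chiP]; first exact: K_mul.
rewrite PhiE// PsiE// big_distrlr/= pair_big; apply: eq_bigr => k _ /=.
by rewrite chiP.1; ring.
Qed.

Lemma trigJ Phi : trig Phi -> trig (fun p => (Phi p)^*%C).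
Proof.
move=> [I [c [g [Kc PhiE]]]].
exists I, (fun i z => (c i z)^*%C), (fun i => - g i).
split=> [i|z chi chiP]; first exact: K_conj.
rewrite PhiE// rmorph_sum; apply: eq_bigr => i _ /=.
by rewrite rmorphM /= characterN.
Qed.

Lemma trig_symbol n (A : 'M[{group_ring R[i][G]}]_n) j k :
  trig (fun p => symbol A p.2 j k).
Proof.
rewrite (_ : (fun p => _) = (fun p => \sum_(h <- finsupp (A j k)) A j k h * p.2 h)); last first.
  by apply/funext => p; rewrite mxE.
apply: (closed_family_sum (S := trig) trig_cst trigD) => h _.
exact: (trigM (trig_cst _) (trig_eval h)).
Qed.

End TrigPoly.

Lemma trig_char_poly (R : realType) (G : zmodType) n (A : 'M[{group_ring R[i][G]}]_n) l :
  trig_poly (Z := unit) (fun=> True) (fun p => (char_poly (symbol A p.2))`_l).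
Proof.
pose tr := @trig_poly R G unit (fun=> True).
have trc (c : R[i]) : tr (fun=> c) by apply: trig_cst.
have trD := @trigD R G unit (fun=> True).
have trM := @trigM R G unit (fun=> True) (fun _ _ _ _ => I).
(* The closed family consists of polynomial-valued functions all of whose coefficients are
   trigonometric polynomials, so that the determinant is expanded in [{poly R[i]}]. *)
pose S (P : unit * (G -> R[i]) -> {poly R[i]}) := forall l, tr (fun p => (P p)`_l).
have Sc c : S (fun=> c) by move=> k; apply: trc.
have SD f g : S f -> S g -> S (fun x => f x + g x).
  move=> Sf Sg k; rewrite (_ : (fun p => _) = fun p => (f p)`_k + (g p)`_k); first exact: (trD _ _ (Sf k) (Sg k)).
  by apply/funext => p; rewrite coefD.
have SM f g : S f -> S g -> S (fun x => f x * g x).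
  move=> Sf Sg k.
  rewrite (_ : (fun p => _) = fun p => \sum_(i < k.+1) (f p)`_i * (g p)`_(k - i)).
    by apply: (closed_family_sum (S := tr) trc trD) => i _; apply: (trM _ _ (Sf _) (Sg _)).
  by apply/funext => p; rewrite coefM.
suff : S (fun p => char_poly (symbol A p.2)) by apply.
apply: (closed_family_det (S := S)) => // i j k.
rewrite (_ : (fun p => _) = fun p => ('X *+ (i == j) : {poly R[i]})`_k
   + (if k == 0%N then -1 else 0) * symbol A p.2 i j).
  apply: trD; first exact: trc.
  by apply: trM; [exact: trc|apply: trig_symbol].
apply/funext => p; rewrite !mxE coefB coefC; congr (_ + _).
by case: ifP; rewrite ?mul0r ?mulN1r ?oppr0.
Qed.

(** * Multiplicity of the root 0 and ranks of convolutions *)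

(** The right-hand side is divisibility by X^m: a factor X lowers the exponent by one, and a factor
    X - x with x nonzero does not affect it. *)
Lemma count_zero_roots (F : fieldType) (r : seq F) m :
  (m <= count_mem 0%R r)%N =
  [forall l : 'I_m, (\prod_(x <- r) ('X - x%:P))`_l == 0].
Proof.
elim: r m => [|x r IH] m /=.
  rewrite big_nil leqn0; case: m => [|m]; first by apply/esym/forallP => -[].
  by apply/esym/negP => /forallP/(_ ord0); rewrite coef1 eqxx oner_eq0.
rewrite big_cons; set p := \prod_(j <- r) _ in IH *.
have [->|x0] := eqVneq x 0.
  rewrite subr0; case: m => [|m]; first by apply/esym/forallP => -[].
  rewrite add1n ltnS IH; apply/forallP/forallP => H l.
    by rewrite coefXM; case: l => -[|l] lm //=; apply: (H (Ordinal (_ : l < m)%N)).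
  have lm : (l.+1 < m.+1)%N by rewrite ltnS.
  by have := H (Ordinal lm); rewrite coefXM.
rewrite add0n IH; apply/forallP/forallP => H.
  case=> l lm /=; rewrite mulrBl coefB coefXM coefCM.
  case: l lm => [|l] lm /=; first by rewrite (eqP (H (Ordinal lm))) mulr0 subr0.
  rewrite (eqP (H (Ordinal lm))) mulr0 subr0.
  exact: (H (Ordinal (ltnW lm))).
case=> l lm /=; elim: l lm => [|l IHl] lm; have := H (Ordinal lm);
  rewrite /= mulrBl coefB coefXM coefCM /= ?(eqP (IHl (ltnW lm))) sub0r oppr_eq0 mulf_eq0 (negPf x0).
all: by [].
Qed.

(** Writes a multiplicity as a sum of indicators, each of which will be the vanishing of one
    trigonometric polynomial. *)
Lemma count_sum_leq c n : (c <= n)%N -> (\sum_(m < n) (m < c) = c)%N.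
Proof.
move=> cn; rewrite -[RHS]card_ord -sum1_card (big_ord_widen n (fun=> 1%N)) //.
by rewrite [RHS]big_mkcond; apply: eq_bigr => i _; case: ltnP.
Qed.

Lemma mxrank_le_nonzero_rows (F : fieldType) p q (A : 'M[F]_(p, q)) :
  (\rank A <= #|[pred i | row i A != 0%R]|)%N.
Proof.
have sub : (A <= \sum_i <<row i A>>)%MS.
  by apply/row_subP => i; apply: submx_trans (sumsmx_sup i _ (submx_refl _)); rewrite // genmxE.
apply: leq_trans (mxrankS sub) _.
apply: (@leq_trans (\sum_i \rank (<<row i A>>%MS))).
  elim/big_rec2: _ => [|i a B _ IH]; first by rewrite mxrank0.
  by apply: leq_trans (mxrank_adds_leqif _ _) _; rewrite leq_add2l.
rewrite -sum1_card [X in (_ <= X)%N]big_mkcond; apply: leq_sum => i _.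
by rewrite mxrank_gen rank_rV inE; case: ifP.
Qed.

Lemma row_free_rowsub (F : fieldType) p q r (A : 'M[F]_(p, q)) (f : 'I_r -> 'I_p) :
  injective f -> row_free A -> row_free (rowsub f A).
Proof.
move=> finj Afree; rewrite rowsubE /row_free mxrankMfree//.
apply: inj_row_free => v; move=> /rowP vf; apply/rowP => i; rewrite mxE.
have := vf (f i); rewrite !mxE (bigD1 i)//= !mxE eqxx mulr1 big1 ?addr0// => j ji.
by rewrite !mxE (inj_eq finj) (negPf ji) mulr0.
Qed.

Lemma mxrank_diag (F : fieldType) p (d : 'rV[F]_p) :
  \rank (diag_mx d) = #|[pred i | d 0 i != 0]|.
Proof.
apply/eqP; rewrite eqn_leq; apply/andP; split.
  apply: leq_trans (mxrank_le_nonzero_rows _) _; apply: subset_leq_card.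
  apply/fintype.subsetP => i; rewrite !inE; apply: contra => /eqP di0.
  by apply/eqP/rowP => j; rewrite !mxE di0 mul0rn.
set Z := [pred i | d 0 i != 0].
have : row_free (rowsub (fun i : 'I_#|Z| => enum_val i) (diag_mx d)).
  apply: inj_row_free => v /rowP vd; apply/rowP => i; rewrite mxE.
  have := vd (enum_val i); rewrite !mxE (bigD1 i)//= !mxE eqxx mulr1n big1 ?addr0.
    move/eqP; rewrite mulf_eq0 => /orP[/eqP//|].
    by have := enum_valP i; rewrite inE => /negPf ->.
  by move=> j ji; rewrite !mxE (inj_eq enum_val_inj) (negPf ji) mulr0n mulr0.
move=> /eqP <-; apply: mxrankS; rewrite rowsubE; exact: submxMl.
Qed.

Section ConvolutionRank.
Variables (R : realType) (G : zmodType) (Q : finZmodType) (pi : {additive G -> Q}).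
Variables (I : finType) (c : I -> R[i]) (g : I -> G).
Variables (chi : 'I_#|Q| -> Q -> R[i]).
Hypothesis chiP : forall k, is_character (chi k).
Hypothesis chiO : forall q, \sum_k chi k q = #|Q|%:R * (q == 0)%:R.

Definition conv_mx : 'M[R[i]]_#|Q| :=
  \matrix_(a, b) \sum_(i | enum_val a + pi (g i) == enum_val b) c i.

(** The convolution on [G] itself, seen through a finite window. It depends on no quotient, which is
    why the limit is common to all chains. *)
Definition local_conv_mx (s s' : seq G) : 'M[R[i]]_(size s, size s') :=
  \matrix_(a, b) \sum_(i | s`_a + g i == s'`_b) c i.

(** The character matrix [Y] diagonalizes the convolution, with the values of the trigonometric
    polynomial on the diagonal. *)
Lemma mxrank_conv :
  \rank conv_mx = #|[pred k | \sum_i c i * chi k (pi (g i)) != 0]|.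
Proof.
pose Y := \matrix_(b < #|Q|, k < #|Q|) chi k (enum_val b).
have Yfree : Y^T \in unitmx.
  rewrite -row_free_unit; apply: inj_row_free => w wY; apply/rowP => k; rewrite [RHS]mxE.
  apply: (dual_family_free chiP chiO (w := fun k => w 0 k)) => q.
  have /rowP/(_ (enum_rank q)) := wY; rewrite !mxE => wYq; rewrite -[RHS]wYq.
  by apply: eq_bigr => k' _; rewrite !mxE enum_rankK.
rewrite unitmx_tr in Yfree.
pose d := \row_k \sum_i c i * chi k (pi (g i)).
have MY : conv_mx *m Y = Y *m diag_mx d.
  apply/matrixP => a k; rewrite mul_mx_diag !mxE.
  under eq_bigr do rewrite !mxE mulr_suml.
  rewrite (exchange_big_dep predT)//= mulr_sumr; apply: eq_bigr => i _.
  rewrite (bigD1 (enum_rank (enum_val a + pi (g i)))) /=; last by rewrite enum_rankK.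
  rewrite enum_rankK (chiP k).1 big1 ?addr0; first by ring.
  by move=> b /andP[/eqP ->]; rewrite enum_valK eqxx.
transitivity (\rank (diag_mx d)); last first.
  by rewrite mxrank_diag; apply: eq_card => k; rewrite !inE mxE.
rewrite -(mxrankMfree _ (B := Y)) ?row_free_unit// MY.
by rewrite -mxrank_tr trmx_mul mxrankMfree ?row_free_unit ?unitmx_tr// mxrank_tr.
Qed.

Variables (s s' : seq G).
Hypothesis us : uniq s.
Hypothesis us' : uniq s'.
Hypothesis ss' : {subset s <= s'}.
Hypothesis gs' : forall x i, x \in s -> x + g i \in s'.
Hypothesis pi_inj : {in s' &, injective pi}.

Let sel (t : Q) (a : 'I_(size s)) : 'I_#|Q| := enum_rank (t + pi s`_a).

(** The rows of [conv_mx] at t + pi(s) vanish outside the columns at t + pi(s'), and [pi] is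
    injective on [s']: every translate of [s] carries a copy of the local matrix, bordered by zero
    columns. *)
Let rank_shift t : \rank (rowsub (sel t) conv_mx) = \rank (local_conv_mx s s').
Proof.
pose sel' (b : 'I_(size s')) : 'I_#|Q| := enum_rank (t + pi s'`_b).
have entry a x i : (a < size s)%N -> x \in s' ->
    (t + pi s`_a + pi (g i) == t + pi x) = (s`_a + g i == x).
  move=> sa xs'; rewrite -addrA (inj_eq (addrI _)) -raddfD.
  by apply/eqP/eqP => [/pi_inj|->//]; apply=> //; apply: gs'; apply: mem_nth.
have -> : local_conv_mx s s' = colsub sel' (rowsub (sel t) conv_mx).
  apply/matrixP => a b; rewrite !mxE; apply: eq_bigl => i.
  by rewrite !enum_rankK entry// mem_nth.
apply/eqP; rewrite eqn_leq; apply/andP; split; last first.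
  by rewrite -mxrank_tr -[X in (_ <= X)%N]mxrank_tr trmx_mxsub rowsubE; exact: mxrankM_maxr.
rewrite [X in (\rank X <= _)%N](_ : _ = colsub sel' (rowsub (sel t) conv_mx) *m rowsub sel' 1%:M).
  exact: mxrankM_maxl.
  apply/matrixP => a b; rewrite [RHS]mxE.
  have [/existsP[e /eqP <-]|/existsPn nob] := boolP [exists e, sel' e == b].
    rewrite (bigD1 e)//= !mxE eqxx mulr1 [X in _ + X]big1 ?addr0// => e' e'e; rewrite !mxE.
    suff /negPf -> : sel' e' != sel' e by rewrite mulr0.
    apply: contra e'e => /eqP /enum_rank_inj /addrI /pi_inj es.
    by apply/eqP/val_inj/(uniqP 0 us'); rewrite ?inE ?ltn_ord//; apply: es; exact: mem_nth.
  rewrite mxE [RHS]big1; last by move=> e _; rewrite !mxE (negPf (nob e)) mulr0.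
  rewrite mxE big1// => i; rewrite enum_rankK => /eqP bE.
  have xs' : s`_a + g i \in s' by apply: gs'; apply: mem_nth.
  have := xs'; rewrite -index_mem => lt; have := nob (Ordinal lt); rewrite /sel' /= nth_index//.
  by rewrite raddfD addrA bE enum_valK eqxx.
Qed.

(* Average over the translates of s the number of elements of a row basis of
   conv_mx that they contain. *)
Lemma conv_rank_le :
  (\rank conv_mx * size s <= #|Q| * \rank (local_conv_mx s s'))%N.
Proof.
pose f := maxrankfun conv_mx.
have -> : (\rank conv_mx * size s =
    \sum_(t : Q) #|[pred a : 'I_(size s) | sel t a \in codom f]|)%N.
  under eq_bigr do rewrite -sum1_card big_mkcond.
  rewrite exchange_big /= -[X in (_ * X)%N]card_ord mulnC -sum_nat_const.
  apply: eq_bigr => a _; rewrite -big_mkcond sum1_card.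
  rewrite -[LHS](card_ord) -(card_codom (maxrankfun_inj (A := conv_mx))).
  have inj : injective (fun q : 'I_#|Q| => enum_val q - pi s`_a).
    by move=> q q' /addIr /enum_val_inj.
  rewrite -(fintype.card_image inj).
    apply: eq_card => t; apply/fintype.imageP/idP => [[q qf ->]|h].
      by change (sel (enum_val q - pi s`_a) a \in codom f); rewrite /sel subrK enum_valK.
    by exists (sel t a) => //; rewrite enum_rankK addrK.
rewrite -sum_nat_const; apply: leq_sum => t _.
rewrite -(rank_shift t); set E := [pred a | _].
have /eqP <- : row_free (rowsub (fun e : 'I_#|E| => enum_val e) (rowsub (sel t) conv_mx)).
  have /choice[h hP] : forall e : 'I_#|E|, exists b, f b = sel t (enum_val e).
    by move=> e; have := enum_valP e; rewrite inE => /codomP[b ->]; exists b.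
  have -> : rowsub (fun e : 'I_#|E| => enum_val e) (rowsub (sel t) conv_mx)
    = rowsub h (rowsub f conv_mx) by apply/matrixP => e b; rewrite !mxE hP.
  apply: row_free_rowsub; last exact: maxrowsub_free.
  move=> e e' /(congr1 f); rewrite !hP => /enum_rank_inj /addrI /pi_inj ee.
  apply/enum_val_inj/val_inj/(uniqP 0 us); rewrite ?inE ?ltn_ord//.
  by apply: ee; apply: ss'; exact: mem_nth.
by apply: mxrankS; rewrite rowsubE; exact: submxMl.
Qed.

(* Same counting with a column basis. *)
Lemma conv_rank_ge :
  (#|Q| * \rank (local_conv_mx s s') <= \rank conv_mx * size s')%N.
Proof.
pose f := maxrankfun conv_mx^T.
have fE : (rowsub f conv_mx^T :=: conv_mx^T)%MS by exact: eq_maxrowsub.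
(* A column whose index lies outside t + pi(s') vanishes on the rows at t + pi(s), so that only the
   basis columns inside contribute to the rank. *)
have bound t : (\rank (local_conv_mx s s') <=
    #|[pred b | ((enum_val (f b) - t)%R \in [seq pi x | x <- s'])]|)%N.
  rewrite -(rank_shift t) -mxrank_tr.
  have -> : (rowsub (sel t) conv_mx)^T = conv_mx^T *m (rowsub (sel t) 1%:M)^T.
    by rewrite -trmx_mul -rowsubE.
  rewrite (eqmxMr _ (eqmx_sym fE)).
  apply: leq_trans (mxrank_le_nonzero_rows _) _; apply: subset_leq_card.
  apply/fintype.subsetP => b; rewrite !inE; apply: contraR => nin.
  apply/eqP/rowP => a; rewrite [RHS]mxE rowE mulmxA -rowE.
  have -> : (row b (rowsub f conv_mx^T) *m (rowsub (sel t) 1%:M)^T) 0 a = conv_mx (sel t a) (f b).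
    rewrite mxE (bigD1 (sel t a))//= !mxE eqxx mulr1 [X in _ + X]big1 ?addr0//.
    by move=> e ea; rewrite !mxE eq_sym (negPf ea) mulr0.
  rewrite mxE big1// => i /eqP; rewrite enum_rankK => fbE; case/negP: nin.
  rewrite -fbE addrC -[t + _ + _]addrA addKr -raddfD.
  by apply: map_f; apply: gs'; apply: mem_nth.
rewrite -sum_nat_const; apply: leq_trans (leq_sum _ (fun t _ => bound t)) _.
under eq_bigr do rewrite -sum1_card big_mkcond.
rewrite exchange_big /= -[X in (X * _)%N]mxrank_tr -[X in (X * _)%N]card_ord -sum_nat_const.
apply: leq_sum => b _; rewrite -big_mkcond sum1_card.
rewrite -(size_map pi); apply: leq_trans (card_size _).
have inj : injective (fun t : Q => enum_val (f b) - t).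
  by move=> t t' /addrI /oppr_inj.
rewrite -(fintype.card_image inj).
by apply: subset_leq_card; apply/fintype.subsetP => _ /fintype.imageP[t ht ->].
Qed.

End ConvolutionRank.

(** * Residual chains and the atom at 0 *)

Lemma chain_mono (G : zmodType) (N : residual_chain G) i j g :
  (i <= j)%N -> g \in chain N j -> g \in chain N i.
Proof.
elim: j => [|j IH]; first by rewrite leqn0 => /eqP ->.
by rewrite leq_eqVlt => /predU1P[->//|/IH ij] /chain_nested.
Qed.

Lemma chain_separates (G : zmodType) (N : residual_chain G) (s : seq G) :
  exists i0, forall i, (i0 <= i)%N -> forall g, g \in s -> g \in chain N i -> g = 0.
Proof.
elim: s => [|g s [i0 IH]]; first by exists 0%N.
have [->|g0] := eqVneq g 0.
  by exists i0 => i i0i h; rewrite inE => /predU1P[//|]; apply: IH.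
have [i1 gi1] : exists i, g \notin chain N i.
  apply: contrapT => /forallNP gN; move/eqP: g0; apply; apply: (@chain_trivial _ N) => i.
  by have /negP := gN i; rewrite negbK.
exists (maxn i0 i1) => i; rewrite geq_max => /andP[i0i i1i] h.
rewrite inE => /predU1P[->|hs]; last exact: IH.
by move=> /(chain_mono i1i); rewrite (negPf gi1).
Qed.

Lemma quot_proj_eq0 (G : zmodType) (N : zmodClosed G)
    (finN : finite_set [set: Quotient.quot N]) g :
  (quot_proj finN g == 0) = (g \in N).
Proof.
rewrite -[in RHS](subr0 g) Quotient.idealrBE -(raddf0 (quot_proj finN)).
by apply/eqP/eqP.
Qed.

Lemma chain_proj_inj (G : zmodType) (N : residual_chain G) (s : seq G) :
  exists i0, forall i, (i0 <= i)%N ->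
    {in s &, injective (quot_proj (chain_finite_index N i))}.
Proof.
have [i0 H] := chain_separates N [seq x - y | x <- s, y <- s].
exists i0 => i i0i x y xs ys xy; apply/eqP; rewrite -subr_eq0; apply/eqP/(H i i0i).
  by apply/allpairsP; exists (x, y).
rewrite -(quot_proj_eq0 (chain_finite_index N i)) raddfB.
by apply/eqP; rewrite [X in X - _](_ : _ = quot_proj (chain_finite_index N i) y) ?subrr.
Qed.

(** The center [c] depends on [e] only: it makes every sequence Cauchy and forces any two of them to
    have the same limit. It will be a normalized rank on a Folner set. *)
Lemma common_limit (R : realType) (X : Type) (u : X -> nat -> R) :
  (forall e, 0 < e -> exists c, forall x, exists i0, forall i, (i0 <= i)%N ->
     `|u x i - c| <= e) ->
  exists l : R, forall x, u x i @[i --> \oo] --> l.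
Proof.
move=> H; have [[x0]|noX] := pselect (exists x : X, True); last first.
  by exists 0 => x; exfalso; apply: noX; exists x.
have e2 (e : R) : 0 < e -> 0 < e / 2 by move=> e0; rewrite divr_gt0.
have cau : cvgn (u x0).
  apply/cauchy_cvgP/cauchy_exP => e e0.
  have [c /(_ x0)[i0 cP]] := H _ (e2 _ e0); exists c; exists i0 => // i /= /cP ci.
  rewrite -ball_normE /ball_ /= distrC; apply: le_lt_trans ci _.
  by rewrite ltr_pdivrMr// ltr_pMr// ltr1n.
exists (limn (u x0)) => x; apply/cvgrPdist_le => e e0.
have [c cP] := H _ (e2 _ e0).
have [i0 ui0] := cP x; have [i1 ui1] := cP x0.
have lc : `|limn (u x0) - c| <= e / 2.
  have cv : (fun i => `|u x0 i - c|) @ \oo --> `|limn (u x0) - c|.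
    by apply: cvg_norm; apply: cvgB => //; exact: cvg_cst.
  apply: (cvgr_to_le cv); first by exists i1 => // i /=; exact: ui1.
exists i0 => // i /= /ui0 uc.
rewrite (splitr e) -[X in `|X|](subrKA c) -(opprB (u x i) c).
by apply: le_trans (ler_normB _ _) _; rewrite lerD.
Qed.

(** Let [s] be a Folner set and [s'] the union of [s] and its translates by the [g i]. The fraction
    lies between r / |s'| and r / |s|, with r the rank of the local matrix, and |s'| <= (1 + e)
    |s|. *)
Lemma nonzero_fraction (R : realType) (G : zmodType) (Phi : unit * (G -> R[i]) -> R[i]) :
  finitely_generated G -> trig_poly (fun=> True) Phi ->
  forall e : R, 0 < e -> exists c : R, forall N : residual_chain G, exists i0,
    forall i, (i0 <= i)%N ->
    let Q := finquot (chain_finite_index N i) in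
    let pi := quot_proj (chain_finite_index N i) in
    forall chi : 'I_#|{: Q}| -> Q -> R[i],
    (forall k, is_character (chi k)) ->
    (forall q, \sum_k chi k q = #|{: Q}|%:R * (q == 0)%:R) ->
    `| #|[pred k | Phi (tt, chi k \o pi) != 0]|%:R / #|{: Q}|%:R - c| <= e.
Proof.
move=> fgG [I [c [g [_ PhiE]]]] e e0.
have I0 : 0 < #|I|.+1%:R :> R by [].
(* The tolerance is shared among the [g i]; the successor in [#|I|.+1] keeps the divisor nonzero
   when [I] is empty. *)
have [S [S0 SF]] := folner [seq g i | i <- enum I] fgG (divr_gt0 e0 I0).
pose s : seq G := S.
pose out i := [seq x + g i | x <- s & x + g i \notin S].
pose s' := undup (s ++ flatten [seq out i | i <- enum I]).
have us : uniq s by exact: fset_uniq.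
have us' : uniq s' by exact: undup_uniq.
have ss' : {subset s <= s'} by move=> x xs; rewrite mem_undup mem_cat xs.
have gs' x i : x \in s -> x + g i \in s'.
  move=> xs; rewrite mem_undup mem_cat; case: (boolP (x + g i \in s)) => //= xi.
  apply/flattenP; exists (out i); first by apply: map_f; rewrite mem_enum.
  by apply/mapP; exists x => //; rewrite mem_filter xi.
have ss : (size s <= size s')%N by apply: uniq_leq_size.
have s0 : 0 < (size s)%:R :> R by rewrite ltr0n.
have s0' : 0 < (size s')%:R :> R by rewrite ltr0n (leq_trans S0).
have s's : (size s')%:R <= (1 + e) * (size s)%:R :> R.
  apply: (@le_trans _ _ ((size s)%:R + \sum_(i : I) e / #|I|.+1%:R * (size s)%:R)).
    apply: (@le_trans _ _ ((size s)%:R + (\sum_(i : I) size (out i))%:R)).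
      rewrite -natrD ler_nat; apply: leq_trans (size_undup _) _.
      by rewrite size_cat leq_add2l size_flatten /shape -map_comp sumnE big_map big_enum.
    rewrite lerD2l natr_sum; apply: ler_sum => i _.
    have := SF (g i) (map_f _ (mem_enum _ i)); apply: le_trans.
    rewrite ler_nat /out size_map; apply: uniq_leq_size; first exact: filter_uniq.
    by move=> x; rewrite mem_filter !inE andbC.
  rewrite mulrDl mul1r lerD2l sumr_const -[X in X <= _]mulr_natr.
  have -> : e / #|I|.+1%:R * (size s)%:R * #|I|%:R = e * (size s)%:R * (#|I|%:R / #|I|.+1%:R) by ring.
  by rewrite ler_piMr ?mulr_ge0 ?(ltW e0)// ler_pdivrMr// mul1r ler_nat.
pose c' i := c i tt.
pose r := \rank (local_conv_mx c' g s s').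
exists (r%:R / (size s)%:R) => N.
have [i0 i0P] := chain_proj_inj N s'; exists i0 => i i0i Q pi chi chiP chiO.
have pinj : {in s' &, injective pi} := i0P i i0i.
have Q0 : 0 < #|{: Q}|%:R :> R by rewrite ltr0n; apply/card_gt0P; exists 0.
set z := #|_|.
have zE : z = \rank (conv_mx pi c' g).
  rewrite (mxrank_conv _ _ _ chiP chiO); apply: eq_card => k; rewrite !inE PhiE//.
  exact: character_comp.
have up : z%:R / #|{: Q}|%:R <= r%:R / (size s)%:R :> R.
  rewrite ler_pdivrMr// mulrAC ler_pdivlMr// -!natrM ler_nat zE mulnC [X in (_ <= X)%N]mulnC.
  by rewrite mulnC conv_rank_le.
have lo : r%:R / (size s')%:R <= z%:R / #|{: Q}|%:R :> R.
  rewrite ler_pdivrMr// mulrAC ler_pdivlMr// -!natrM ler_nat zE mulnC.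
  exact: conv_rank_ge.
have rs : r%:R <= (size s)%:R :> R by rewrite ler_nat rank_leq_row.
rewrite ler_norml; apply/andP; split; last by apply: le_trans (ltW e0); rewrite subr_le0.
apply: le_trans (_ : r%:R / (size s')%:R - r%:R / (size s)%:R <= _); last by rewrite lerD2r.
rewrite -opprB lerN2.
have -> : r%:R / (size s)%:R - r%:R / (size s')%:R =
   r%:R / (size s)%:R * (((size s')%:R - (size s)%:R) / (size s')%:R) :> R.
  by field; rewrite !gt_eqF.
apply: (@le_trans _ _ (1 * (((size s')%:R - (size s)%:R) / (size s')%:R))).
  by rewrite ler_wpM2r ?ler_pdivrMr ?mul1r// divr_ge0 ?subr_ge0 ?ler_nat.
rewrite mul1r ler_pdivrMr// lerBlDr; apply: le_trans s's _.
by rewrite mulrDl mul1r addrC lerD2r ler_pM2l// ler_nat.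
Qed.

Lemma eigenvalue_measureE (R : realType) (G : zmodType) n (A : 'M[{group_ring R[i][G]}]_n)
    (N : residual_chain G) i (E : set (plane R)) :
  eigenvalue_measure A N i E =
  ((#|{: finquot (chain_finite_index N i)}|%:R : R)^-1 *
   \sum_(x <- fin_eigenvalues (quot_proj (chain_finite_index N i)) A)
      \1_E (to_plane x))%:E.
Proof.
rewrite /eigenvalue_measure /mscale /= EFinM; congr (_ * _)%E.
set e := fin_eigenvalues _ _.
transitivity (\sum_(k < size e) (@dirac _ (plane R) (to_plane e`_k) R) E)%E; first by [].
by rewrite (big_nth 0) big_mkord -sumEFin; apply: eq_bigr => k _; rewrite diracE.
Qed.

Lemma to_plane_inj (R : realType) : injective (@to_plane R).
Proof. by move=> [a b] [c d] [-> ->]. Qed.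

(* Multiplicity of the eigenvalue 0 of the symbol: it is at least m + 1 iff
   the sum of the |c_l|^2, l <= m, vanishes. *)
Definition zero_order_form (R : realType) (G : zmodType) n
    (A : 'M[{group_ring R[i][G]}]_n) (m : nat) (p : unit * (G -> R[i])) : R[i] :=
  \sum_(l < m.+1) (char_poly (symbol A p.2))`_l * ((char_poly (symbol A p.2))`_l)^*%C.

Lemma trig_zero_order_form (R : realType) (G : zmodType) n
    (A : 'M[{group_ring R[i][G]}]_n) m :
  trig_poly (fun=> True) (zero_order_form A m).
Proof.
apply: (closed_family_sum (S := @trig_poly R G unit (fun=> True))) => [c|f g|l _].
- exact: trig_cst.
- exact: trigD.
- apply: trigM => //; first exact: trig_char_poly.
  apply: (@trigJ _ _ _ (fun=> True) (fun _ _ => I) (fun p => (char_poly (symbol A p.2))`_l)).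
  exact: trig_char_poly.
Qed.

Lemma count_zero_spectrum (R : realType) (G : zmodType) n
    (A : 'M[{group_ring R[i][G]}]_n) (chi : G -> R[i]) :
  count_mem 0 (spectrum_seq (symbol A chi)) =
  (\sum_(m < n) (zero_order_form A m (tt, chi) == 0%R))%N.
Proof.
rewrite -[LHS](@count_sum_leq _ n); last first.
  by rewrite -[X in (_ <= X)%N](size_spectrum_seq (symbol A chi)) count_size.
apply: eq_bigr => m _; congr nat_of_bool; rewrite count_zero_roots spectrum_seqE.
have ge0 (l : 'I_m.+1) : 0 <= (char_poly (symbol A chi))`_l * ((char_poly (symbol A chi))`_l)^*%C.
  exact: mulcJ_ge0.
apply/forallP/eqP => [H|H l].
  by rewrite /zero_order_form big1// => l _; rewrite /= (eqP (H l)) mul0r.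
have /psumr_eq0P -/(_ (fun l _ => ge0 l)) /(_ l erefl) /eqP := H.
by rewrite mulf_eq0 conjc_eq0 orbb.
Qed.

Lemma sum_indic_zero (R : realType) (s : seq R[i]) :
  \sum_(x <- s) \1_[set to_plane 0] (to_plane x) = (count_mem 0 s)%:R :> R.
Proof.
elim: s => [|x s IH]; first by rewrite big_nil.
rewrite big_cons IH /= natrD indicE; congr ((nat_of_bool _)%:R + _).
by apply/idP/eqP => [|->]; rewrite inE //= => /to_plane_inj.
Qed.

Lemma sum_eq0_card (V : eqType) (v : V) (I : finType) (z : I -> V) :
  (\sum_k (z k == v) + #|[pred k | z k != v]| = #|I|)%N.
Proof.
rewrite -[RHS]sum1_card -sum1_card [X in (_ + X)%N]big_mkcond -big_split.
by apply: eq_bigr => k _; rewrite inE; case: eqP.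
Qed.

(** The atom is the sum over m < n of the proportion of the characters at which the multiplicity of
    0 exceeds m, that is, of 1 minus the proportion at which [zero_order_form A m] does not
    vanish. *)
Lemma zero_eigenvalue_limit (R : realType) (G : zmodType) n
    (A : 'M[{group_ring R[i][G]}]_n) :
  finitely_generated G -> exists l : R, forall N : residual_chain G,
    eigenvalue_measure A N i [set to_plane 0] @[i --> \oo] --> l%:E.
Proof.
move=> fgG.
pose Q N i := finquot (@chain_finite_index G N i).
have dual (N : residual_chain G) i := finite_dual R (Q N i).
pose chi N i := sval (cid (dual N i)).
have chiP N i := (svalP (cid (dual N i))).1; have chiO N i := (svalP (cid (dual N i))).2.
pose u m (N : residual_chain G) i : R :=
  #|[pred k | zero_order_form A m (tt, chi N i k \o quot_proj (chain_finite_index N i)) != 0]|%:R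
   / #|{: Q N i}|%:R.
have /choice[l lP] : forall m, exists l : R, forall N, u m N i @[i --> \oo] --> l.
  move=> m; apply: common_limit => e e0.
  have [c cP] := nonzero_fraction fgG (trig_zero_order_form A m) e0.
  exists c => N; have [i0 i0P] := cP N; exists i0 => i i0i.
  exact: (i0P i i0i (chi N i) (chiP N i) (chiO N i)).
exists (\sum_(m < n) (1 - l m)) => N.
rewrite (_ : (fun i => _) = (fun i => (\sum_(m < n) (1 - u m N i))%:E)).
  apply: cvg_EFin; first by near=> i.
  apply: cvg_big => [|m _]; first exact: add_continuous.
  apply: cvgB; first exact: cvg_cst.
  exact: lP.
apply/funext => i; rewrite eigenvalue_measureE; congr EFin.
rewrite (perm_big _ (fin_eigenvalues_symbol (quot_proj (chain_finite_index N i)) A (chiP N i) (chiO N i))) /=.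
rewrite big_flatten big_map big_enum /=.
have Q0 : (#|{: Q N i}|%:R : R) != 0.
  by rewrite pnatr_eq0 -lt0n; apply/card_gt0P; exists 0.
pose z m k := zero_order_form A m (tt, chi N i k \o quot_proj (chain_finite_index N i)).
transitivity ((#|{: Q N i}|%:R : R)^-1 * \sum_k \sum_(m < n) (z m k == 0)%:R).
  congr (_ * _); apply: eq_bigr => k _.
  by rewrite sum_indic_zero count_zero_spectrum natr_sum.
rewrite exchange_big mulr_sumr; apply: eq_bigr => m _ /=.
apply: (mulfI Q0); rewrite mulVKf// mulrBr mulr1 /u mulrCA divff// mulr1.
apply/eqP; rewrite eq_sym subr_eq -natr_sum -natrD eqr_nat; apply/eqP.
by rewrite -[LHS]card_ord (sum_eq0_card 0 (z m)).
Unshelve. all: end_near.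
Qed.

(** * Measurability and integration on the plane *)

Section PlaneMeasure.
Variable R : realType.
Local Notation mu := (@lebesgue_measure R).
Local Notation mu2 := (@lebesgue_measure R \x @lebesgue_measure R)%E.

Definition grid (n : nat) (x : R) : R := (Num.floor (x * n.+1%:R))%:~R / n.+1%:R.

Lemma grid_dist n x : `|x - grid n x| <= n.+1%:R^-1.
Proof.
have n0 : 0 < n.+1%:R :> R by [].
have -> : x - grid n x = (x * n.+1%:R - (Num.floor (x * n.+1%:R))%:~R) / n.+1%:R.
  by rewrite mulrBl mulfK// gt_eqF.
have fl := floor_le_tmp (x * n.+1%:R).
have fl1 := floorD1_gt (x * n.+1%:R).
rewrite ger0_norm ?divr_ge0 ?subr_ge0// -[leRHS]mul1r ler_pM2r ?invr_gt0//.
by rewrite lerBlDl -[1]/(1%:~R) -intrD ltW.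
Qed.

Lemma cvg_grid x : grid n x @[n --> \oo] --> x.
Proof.
apply/cvgrPdist_le => e e0.
near=> n; apply: le_trans (grid_dist n x) _.
by near: n; apply: filterS (near_infty_natSinv_lt (PosNum e0)) => n /ltW.
Unshelve. all: end_near.
Qed.

Lemma cvg_grid2 (z : R * R) : (grid n z.1, grid n z.2) @[n --> \oo] --> z.
Proof. by case: z => x y /=; apply: (@cvg_pair _ _ _ \oo (nbhs x) (nbhs y)); exact: cvg_grid. Qed.

Lemma cvg_grid_continuous (h : R * R -> R) (z : R * R) : continuous h ->
  h (grid n z.1, grid n z.2) @[n --> \oo] --> h z.
Proof.
by move=> ch; apply: (@cvg_comp _ _ _ (fun n => (grid n z.1, grid n z.2)) h _ _ _ (@cvg_grid2 z)); exact: ch.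
Qed.

(* Approximate h by its values at the points of finer and finer grids. *)
Lemma continuous_measurable_plane (h : R * R -> R) :
  continuous h -> measurable_fun [set: plane R] h.
Proof.
move=> ch.
apply: (@measurable_fun_cvg _ _ _ _ (fun n z => h (grid n z.1, grid n z.2))); last first.
  move=> [x y] _ /=.
  exact: (cvg_grid_continuous (z := (x, y)) ch).
move=> n _ Y mY; rewrite setTI.
pose N : R := n.+1%:R.
pose rect (ij : int * int) : set (plane R) :=
  (fun x : measurableTypeR R => Num.floor (x * N)) @^-1` [set ij.1] `*`
  (fun x : measurableTypeR R => Num.floor (x * N)) @^-1` [set ij.2].
pose F (k : nat) : set (plane R) := if (choice.unpickle k : option (int * int)) is Some ij
  then [set z | rect ij z /\ Y (h (ij.1%:~R / N, ij.2%:~R / N))] else set0.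
rewrite (_ : _ @^-1` Y = \bigcup_k F k); last first.
  apply/seteqP; split=> [[x y] /= hY|[x y] [k _]].
    exists (choice.pickle (Num.floor (x * N), Num.floor (y * N))); first exact: I.
    by rewrite /F choice.pickleK; split.
  by rewrite /F; case: (choice.unpickle k) => // -[i j] [[/= <- <-]].
apply: bigcup_measurable => k _; rewrite /F; case: (choice.unpickle k) => // ij.
have mfl i : measurable ((fun x : measurableTypeR R => Num.floor (x * N)) @^-1` [set i]).
  have N0 : 0 < N by [].
  rewrite (_ : _ @^-1` _ = `[i%:~R / N, (i + 1)%:~R / N[%classic).
    exact: measurable_itv.
  apply/seteqP; split=> x /=; rewrite in_itv /= ler_pdivrMr// ltr_pdivlMr//.
    by move=> <-; rewrite floor_le_tmp floorD1_gt.
  by move=> H; apply/eqP; rewrite floor_eq.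
have [Yh|NYh] := pselect (Y (h (ij.1%:~R / N, ij.2%:~R / N))).
  rewrite (_ : [set z | _] = rect ij); first exact: (measurableX (mfl ij.1) (mfl ij.2)).
  by apply/seteqP; split=> z //= [].
by rewrite (_ : [set z | _] = set0) // -subset0 => z [].
Qed.

Definition box (a b c d : R) : set (plane R) := `[a, b]%classic `*` `[c, d]%classic.

Lemma measurable_box a b c d : measurable (box a b c d).
Proof. by apply: measurableX; exact: measurable_itv. Qed.

Lemma box_measure_lty a b c d : (mu2 (box a b c d) < +oo)%E.
Proof.
rewrite /box product_measure1E; [|exact: measurable_itv..].
have fin (u v : R) : (mu `[u, v]%classic < +oo)%E.
  by rewrite lebesgue_measure_itv/=; case: ifP; rewrite ?ltry// -EFinB ltry.
have finn : (mu `[a, b]%classic : \bar R) \is a fin_num by rewrite ge0_fin_numE ?fin.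
by apply: lte_mul_pinfty; [|exact: finn|exact: fin].
Qed.

Lemma continuous_box_bounded (h : R * R -> R) a b c d : continuous h ->
  exists M, forall z, box a b c d z -> `|h z| <= M.
Proof.
move=> ch.
have cb : compact (box a b c d : set (R * R)).
  by apply: compact_setX; exact: segment_compact.
have : compact (h @` (box a b c d : set (R * R))).
  apply: continuous_compact => //; exact: continuous_subspaceT.
move=> /compact_bounded [M [_ HM]]; exists (M + 1) => z zb.
by apply: (HM (M + 1)); rewrite ?ltrDl//; exists z.
Qed.

Lemma continuous_box_integrable (h : R * R -> R) a b c d : continuous h ->
  mu2.-integrable (box a b c d) (EFin \o h).
Proof.
move=> ch; apply: measurable_bounded_integrable.
- exact: measurable_box.
- exact: box_measure_lty.
- exact: measurable_funTS (continuous_measurable_plane ch).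
- have [M HM] := continuous_box_bounded a b c d ch.
  exists M; split; first exact: num_real.
  by move=> x Mx z zb; apply: le_trans (HM z zb) (ltW Mx).
Qed.

Lemma box_fubini (h : R * R -> R) a b c d :
  mu2.-integrable (box a b c d) (EFin \o h) ->
  (\int[mu2]_(z in box a b c d) (h z)%:E =
   \int[mu]_(x in `[a, b]) \int[mu]_(y in `[c, d]) (h (x, y))%:E)%E /\
  (\int[mu2]_(z in box a b c d) (h z)%:E =
   \int[mu]_(y in `[c, d]) \int[mu]_(x in `[a, b]) (h (x, y))%:E)%E.
Proof.
move=> ih; have mb := measurable_box a b c d.
have ih' : mu2.-integrable setT ((EFin \o h) \_ (box a b c d)).
  by apply/(integrable_mkcond _ mb).
rewrite integral_mkcond; split.
  rewrite -(integral12_prod_meas1 ih') [RHS]integral_mkcond.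
  apply: eq_integral => x _; rewrite /fubini_F patchE; case: ifPn => xI.
    rewrite [RHS]integral_mkcond; apply: eq_integral => y _; rewrite !patchE.
    rewrite (_ : ((x, y) \in box a b c d) = (y \in `[c, d]%classic))//.
    by rewrite inE in xI; apply/idP/idP; rewrite !inE; [case|split].
  rewrite -[RHS]/(0%E) integral0_eq// => y _; rewrite patchE ifF//; apply/negbTE.
  by apply: contraNN xI; rewrite !inE => -[].
rewrite -(integral21_prod_meas1 ih') [RHS]integral_mkcond.
apply: eq_integral => y _; rewrite /fubini_G patchE; case: ifPn => xI.
  rewrite [RHS]integral_mkcond; apply: eq_integral => x _; rewrite !patchE.
  rewrite (_ : ((x, y) \in box a b c d) = (x \in `[a, b]%classic))//.
  by rewrite inE in xI; apply/idP/idP; rewrite !inE; [case|split].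
rewrite -[RHS]/(0%E) integral0_eq// => x _; rewrite patchE ifF//; apply/negbTE.
by apply: contraNN xI; rewrite !inE => -[].
Qed.

End PlaneMeasure.

(** * Calculus on slices, test functions and the regularization defect *)

Section LogPotential1D.
Variable R : realType.
Implicit Types a k x : R.

Lemma sqrD_gt0 (u k : R) : 0 < k -> 0 < u ^+ 2 + k.
Proof. by move=> k0; apply: ltr_wpDl => //; exact: sqr_ge0. Qed.

Lemma is_derive_sqrD a k x : is_derive x (1 : R) (fun t => (t - a) ^+ 2 + k) (2 * (x - a)).
Proof.
have d1 : is_derive x (1 : R) (fun t => t - a) 1.
  by apply: is_derive_eq; rewrite ?subr0.
have := is_deriveD (is_deriveM d1 d1) (is_derive_cst k x 1).
by move/is_derive_eq; apply; rewrite /GRing.scale/=; ring.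
Qed.

Lemma is_derive_half_ln a k x : 0 < k ->
  is_derive x (1 : R) (fun t => 2^-1 * ln ((t - a) ^+ 2 + k)) ((x - a) / ((x - a) ^+ 2 + k)).
Proof.
move=> k0; have q0 := sqrD_gt0 (x - a) k0.
have dl : is_derive x (1 : R) (fun t => ln ((t - a) ^+ 2 + k))
    (((x - a) ^+ 2 + k)^-1 * (2 * (x - a))).
  exact: (@is_derive1_comp R (@ln R) (fun t => (t - a) ^+ 2 + k) x _ _ (is_derive1_ln q0) (is_derive_sqrD a k x)).
have := is_deriveZ (2^-1 : R) dl.
by move/is_derive_eq; apply; rewrite /GRing.scale/=; field; rewrite gt_eqF.
Qed.

Lemma is_derive_half_ln2 a k x : 0 < k ->
  is_derive x (1 : R) (fun t => (t - a) / ((t - a) ^+ 2 + k))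
   ((k - (x - a) ^+ 2) / ((x - a) ^+ 2 + k) ^+ 2).
Proof.
move=> k0; have q0 := sqrD_gt0 (x - a) k0.
have d1 : is_derive x (1 : R) (fun t => t - a) 1.
  by apply: is_derive_eq; rewrite ?subr0.
have dV := @is_deriveV R (fun t => (t - a) ^+ 2 + k) x _ _ (lt0r_neq0 q0) (is_derive_sqrD a k x).
have := is_deriveM d1 dV.
by move/is_derive_eq; apply; rewrite /GRing.scale/=; field; rewrite gt_eqF.
Qed.

Lemma is_derive_atan_scaled (b c x : R) : 0 < c ->
  is_derive x (1 : R) (fun t => atan ((t - b) / c)) (c / ((x - b) ^+ 2 + c ^+ 2)).
Proof.
move=> c0.
have d1 : is_derive x (1 : R) (fun t => (t - b) / c) c^-1.
  by apply: is_derive_eq; rewrite /GRing.scale/= ?subr0; ring.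
have := @is_derive1_comp R (@atan R) (fun t => (t - b) / c) x _ _ (is_derive1_atan ((x - b) / c)) d1.
move/is_derive_eq; apply; field.
by rewrite !gt_eqF//; apply: sqrD_gt0; rewrite exprn_gt0.
Qed.

Lemma atan_le_pihalf x : atan x <= pi / 2. Proof. exact/ltW/atan_ltpi2. Qed.

End LogPotential1D.

Section ContinuityPlane.
Variable R : realType.
Implicit Types h g : R * R -> R.

Lemma cont_fst : continuous (fun z : R * R => z.1).
Proof. by move=> z; exact: cvg_fst. Qed.

Lemma cont_snd : continuous (fun z : R * R => z.2).
Proof. by move=> z; exact: cvg_snd. Qed.

Lemma cont_cst (c : R) : continuous (fun _ : R * R => c).
Proof. by move=> z; exact: cvg_cst. Qed.

Lemma contD h g : continuous h -> continuous g -> continuous (fun z => h z + g z).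
Proof. by move=> ch cg z; apply: cvgD; [exact: ch|exact: cg]. Qed.

Lemma contN h : continuous h -> continuous (fun z => - h z).
Proof. by move=> ch z; apply: cvgN; exact: ch. Qed.

Lemma contB h g : continuous h -> continuous g -> continuous (fun z => h z - g z).
Proof. by move=> ch cg z; apply: cvgB; [exact: ch|exact: cg]. Qed.

Lemma contM h g : continuous h -> continuous g -> continuous (fun z => h z * g z).
Proof. by move=> ch cg z; apply: cvgM; [exact: ch|exact: cg]. Qed.

Lemma contX h n : continuous h -> continuous (fun z => h z ^+ n).
Proof.
move=> ch; elim: n => [|n IH]; first exact: cont_cst.
by under eq_fun do rewrite exprS; exact: contM.
Qed.

Lemma contV h : (forall z, h z != 0) -> continuous h -> continuous (fun z => (h z)^-1).
Proof. by move=> h0 ch z; apply: cvgV; [exact: h0|exact: ch]. Qed.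

Lemma cont_ln h : (forall z, 0 < h z) -> continuous h -> continuous (fun z => ln (h z)).
Proof.
move=> h0 ch z; apply: (@cvg_comp _ _ _ h (@ln R) _ (nbhs (h z))); first exact: ch.
exact: continuous_ln.
Qed.

End ContinuityPlane.

Section TestFunctions.
Variables (R : realType) (f : R * R -> R).
Hypothesis tf : test_function f.
Lemma test_continuous s : continuous (iter_partial s f).
Proof. by case: tf => sf _; case: (sf s). Qed.

Lemma test_slice_x s x y : is_derive x (1 : R) (fun t => iter_partial s f (t, y))
  (iter_partial (false :: s) f (x, y)).
Proof.
case: tf => sf _; have [_ /(_ (x, y) false)] := sf s.
set h := iter_partial s f => dh.
have E : (fun t => t^-1 *: (h (t *: (1, 0) + (x, y)) - h (x, y))) =
    (fun t : R => t^-1 *: (h (t *: (1 : R) + x, y) - h (x, y))).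
  apply/funext => t; congr (_ *: (h _ - _)).
  by rewrite /GRing.add/= /add_pair/= /GRing.scale/= mulr0 add0r.
split; first by rewrite /derivable -E.
by rewrite /derive -E.
Qed.

Lemma test_slice_y s x y : is_derive y (1 : R) (fun t => iter_partial s f (x, t))
  (iter_partial (true :: s) f (x, y)).
Proof.
case: tf => sf _; have [_ /(_ (x, y) true)] := sf s.
set h := iter_partial s f => dh.
have E : (fun t => t^-1 *: (h (t *: (0, 1) + (x, y)) - h (x, y))) =
    (fun t : R => t^-1 *: (h (x, t *: (1 : R) + y) - h (x, y))).
  apply/funext => t; congr (_ *: (h _ - _)).
  by rewrite /GRing.add/= /add_pair/= /GRing.scale/= mulr0 add0r.
split; first by rewrite /derivable -E.
by rewrite /derive -E.
Qed.

Lemma test_support : exists2 rho : R, 0 < rho &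
  forall s x y, rho <= `|x| \/ rho <= `|y| -> iter_partial s f (x, y) = 0.
Proof.
case: tf => _ /compact_bounded [M [_ HM]].
(* One unit for the strict inequality that [compact_bounded] asks for, one more so that the points
   of norm [rho] are already off the support. *)
pose rho := Num.max M 0 + 1 + 1.
have M1 : M < Num.max M 0 + 1 by rewrite ltr_pwDr// le_max lexx.
exists rho; first by rewrite /rho -addrA ltr_wpDl// le_max lexx orbT.
set S := closure _ in HM.
have out x y : rho <= `|x| \/ rho <= `|y| -> (~` S) (x, y).
  move=> xy /(HM _ M1) /=; apply/negP; rewrite -ltNge prod_normE/= lt_max.
  have lt1 : Num.max M 0 + 1 < rho by rewrite /rho ltrDl.
  by case: xy => h; rewrite (lt_le_trans lt1 h) ?orbT.
suff Z s z : (~` S) z -> iter_partial s f z = 0 by move=> s x y /out /Z.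
have oS : open (~` S) by apply: closed_openC; exact: closed_closure.
elim: s z => [|b s IH] z zS.
  apply: contrapT => /eqP fz; apply: zS; exact: subset_closure.
rewrite /iter_partial /= -/(iter_partial s f) /partial.
rewrite (@near_eq_derive _ _ _ _ (cst 0)) ?derive_cst//.
have : nbhs z (~` S) by apply: open_nbhs_nbhs.
by apply: filterS => w /IH ->.
Qed.

Lemma laplacian_continuous : continuous (laplacian f).
Proof. by apply: contD; exact: test_continuous. Qed.

End TestFunctions.

Section Defect.
Variable R : realType.
Local Notation mu := (@lebesgue_measure R).
Local Notation mu2 := (@lebesgue_measure R \x @lebesgue_measure R)%E.
Implicit Types a b B d : R.

Lemma box_tonelli (h : R * R -> R) a b c d :
  measurable_fun [set: plane R] h -> (forall z, 0 <= h z) ->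
  (\int[mu2]_(z in box a b c d) (h z)%:E =
   \int[mu]_(y in `[c, d]) \int[mu]_(x in `[a, b]) (h (x, y))%:E)%E.
Proof.
move=> mh h0; have mb := measurable_box a b c d.
rewrite integral_mkcond.
have mp : measurable_fun [set: plane R] ((EFin \o h) \_ (box a b c d)).
  by apply/(measurable_restrict _ mb) => //; rewrite setTI; apply/measurable_EFinP; exact: measurable_funTS.
have p0 z : (0 <= ((EFin \o h) \_ (box a b c d)) z)%E.
  by rewrite patchE; case: ifP => // _; rewrite lee_fin.
rewrite (fubini_tonelli2 _ mp p0) [RHS]integral_mkcond.
apply: eq_integral => y _; rewrite /fubini_G patchE; case: ifPn => xI.
  rewrite [RHS]integral_mkcond; apply: eq_integral => x _; rewrite !patchE.
  rewrite (_ : ((x, y) \in box a b c d) = (x \in `[a, b]%classic))//.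
  by rewrite inE in xI; apply/idP/idP; rewrite !inE; [case|split].
rewrite -[RHS]/(0%E) integral0_eq// => x _; rewrite patchE ifF//; apply/negbTE.
by apply: contraNN xI; rewrite !inE => -[].
Qed.

Definition rsq a b (z : R * R) : R := (z.1 - a) ^+ 2 + (z.2 - b) ^+ 2.

Lemma rsq_ge0 a b z : 0 <= rsq a b z.
Proof. by rewrite addr_ge0// sqr_ge0. Qed.

Lemma rsq_continuous a b : continuous (rsq a b).
Proof.
apply: contD; apply: contX; apply: contB.
- exact: cont_fst.
- exact: cont_cst.
- exact: cont_snd.
- exact: cont_cst.
Qed.

Lemma measurable_inv_fun dT (T : measurableType dT) (g : T -> R) :
  measurable_fun setT g -> (forall t, 0 <= g t) -> measurable_fun setT (fun t => (g t)^-1).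
Proof.
move=> mg g0; rewrite (_ : (fun t => _) = (fun x => x `^ (-1)) \o g).
  by apply: measurableT_comp => //; exact: measurable_powR.
by apply/funext => t /=; rewrite powR_inv1.
Qed.

(** The error (1/2) ln (r^2 + k) - (1/2) ln r^2 made in regularizing the logarithm of the distance r
    to (a, b). At (a, b) itself, division by 0 gives the value 0. *)
Definition defect a b k (z : R * R) : R := 2^-1 * ln (1 + k / rsq a b z).

Lemma measurable_defect a b k : measurable_fun [set: plane R] (defect a b k).
Proof.
apply: measurable_funM; first exact: measurable_cst.
apply: (measurableT_comp (@measurable_ln R)).
apply: measurable_funD; first exact: measurable_cst.
apply: measurable_funM; first exact: measurable_cst.
apply: measurable_inv_fun; last by move=> z; exact: rsq_ge0.
exact: continuous_measurable_plane (@rsq_continuous a b).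
Qed.

Lemma defect_ge0 a b k z : 0 <= k -> 0 <= defect a b k z.
Proof.
move=> k0; rewrite mulr_ge0// ln_ge0// lerDl divr_ge0//; exact: rsq_ge0.
Qed.

(** The antiderivative is explicit, with logarithms and arctangents. The logarithms contribute at
    most d^2 / B, by ln (1 + u) <= u, and the arctangents at most pi d, because D - e <= d. The
    bound does not depend on the height [e] of the slice. *)
Lemma integral_defect_slice a B d e : 0 < B -> 0 < d -> 0 < e ->
  (\int[mu]_(x in `[(a - B)%R, (a + B)%R]) (2^-1 * ln (1 + d ^+ 2 / ((x - a) ^+ 2 + e ^+ 2)))%:E
    <= (d ^+ 2 / B + pi * d)%:E)%E.
Proof.
move=> B0 d0 e0; pose D := Num.sqrt (d ^+ 2 + e ^+ 2).
have e20 : 0 < e ^+ 2 by rewrite exprn_gt0.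
have d20 : 0 < d ^+ 2 by rewrite exprn_gt0.
have D2 : D ^+ 2 = d ^+ 2 + e ^+ 2 by rewrite sqr_sqrtr// addr_ge0// ltW.
have D20 : 0 < D ^+ 2 by rewrite D2 addr_gt0.
have D0 : 0 < D by rewrite sqrtr_gt0 addr_gt0.
have eD : e <= D by rewrite -(ler_pXn2r (ltn0Sn 1)) ?nnegrE ?(ltW e0) ?(ltW D0)// D2 lerDr ltW.
have Dde : D <= d + e.
  rewrite -(ler_pXn2r (ltn0Sn 1)) ?nnegrE ?(ltW D0) ?addr_ge0 ?ltW// D2 sqrrD.
  by rewrite addrAC ltrDl mulrn_wgt0// mulr_gt0.
pose F (x : R) := (x - a) * (2^-1 * ln ((x - a) ^+ 2 + D ^+ 2))
   - (x - a) * (2^-1 * ln ((x - a) ^+ 2 + e ^+ 2))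
   + (D * atan ((x - a) / D) - e * atan ((x - a) / e)).
pose g (x : R) := 2^-1 * ln ((x - a) ^+ 2 + D ^+ 2) - 2^-1 * ln ((x - a) ^+ 2 + e ^+ 2).
have dF (x : R) : is_derive x (1 : R) F (g x).
  have d1 : is_derive x (1 : R) (fun t => t - a) 1.
    by apply: is_derive_eq; rewrite ?subr0.
  have dD := is_deriveM d1 (is_derive_half_ln a x D20).
  have de := is_deriveM d1 (is_derive_half_ln a x e20).
  have aD := is_deriveZ D (is_derive_atan_scaled a x D0).
  have ae := is_deriveZ e (is_derive_atan_scaled a x e0).
  have := is_deriveD (is_deriveB dD de) (is_deriveB aD ae).
  move/is_derive_eq; apply; rewrite /g /GRing.scale/=; field.
  by rewrite !gt_eqF//; apply: sqrD_gt0.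
have cg : continuous g.
  move=> x; apply: differentiable_continuous; apply/derivable1_diffP.
  have := is_deriveB (is_derive_half_ln a x D20) (is_derive_half_ln a x e20).
  by case.
rewrite (_ : (\int[mu]_(x in _) _)%E = (\int[mu]_(x in `[(a - B)%R, (a + B)%R]) (g x)%:E)%E); last first.
  apply: eq_integral => x _; congr EFin; rewrite /g -mulrBr; congr (_ * _).
  have q0 := sqrD_gt0 (x - a) e20; have Q0 := sqrD_gt0 (x - a) D20.
  rewrite -ln_div ?posrE//; congr ln; rewrite D2; field.
  by rewrite gt_eqF.
rewrite (FTC2_everywhere _ dF)//; last by rewrite ltrD2l gtrN.
have -> : F (a + B) - F (a - B) = 2 * (B * (2^-1 * (ln (B ^+ 2 + D ^+ 2) - ln (B ^+ 2 + e ^+ 2)))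
   + (D * atan (B / D) - e * atan (B / e))).
  rewrite /F !(addrC a) !addrK sqrrN !mulNr !atanN; ring.
rewrite lee_fin mulrDr; apply: lerD.
  rewrite -ln_div ?posrE ?sqrD_gt0//.
  have -> : (B ^+ 2 + D ^+ 2) / (B ^+ 2 + e ^+ 2) = 1 + d ^+ 2 / (B ^+ 2 + e ^+ 2).
    by rewrite D2; field; rewrite gt_eqF// sqrD_gt0.
  have h : ln (1 + d ^+ 2 / (B ^+ 2 + e ^+ 2)) <= d ^+ 2 / B ^+ 2.
    have p : 0 <= d ^+ 2 / (B ^+ 2 + e ^+ 2) by rewrite divr_ge0// ltW// sqrD_gt0.
    apply: le_trans (le_ln1Dx _) _; first by rewrite (lt_le_trans _ p)// ltrN10.
    rewrite ler_pM2l// lef_pV2 ?posrE ?sqrD_gt0 ?exprn_gt0//.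
    by rewrite lerDl ltW.
  have -> : 2 * (B * (2^-1 * ln (1 + d ^+ 2 / (B ^+ 2 + e ^+ 2)))) =
     B * ln (1 + d ^+ 2 / (B ^+ 2 + e ^+ 2)) by field.
  have -> : d ^+ 2 / B = B * (d ^+ 2 / B ^+ 2) by field; rewrite gt_eqF.
  by rewrite ler_pM2l.
have mono : atan (B / D) <= atan (B / e).
  by apply: le_atan; rewrite ler_pM2l// lef_pV2.
have ate : 0 <= atan (B / e).
  by rewrite -(atan0 R); apply: le_atan; rewrite divr_ge0// ltW.
apply: (@le_trans _ _ (2 * ((D - e) * atan (B / e)))).
  by rewrite ler_pM2l// mulrBl lerD2r ler_pM2l.
apply: (@le_trans _ _ (2 * (d * (pi / 2)))); last by rewrite le_eqVlt; apply/orP; left; apply/eqP; field.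
rewrite ler_pM2l// ler_pM ?subr_ge0//; first by rewrite lerBlDr.
exact: atan_le_pihalf.
Qed.

Lemma integral_defect a b B d c e : 0 < B -> 0 < d -> c <= e ->
  (\int[mu2]_(z in box (a - B) (a + B) c e) (defect a b (d ^+ 2) z)%:E
    <= ((d ^+ 2 / B + pi * d) * (e - c))%:E)%E.
Proof.
move=> B0 d0 ce.
have md := @measurable_defect a b (d ^+ 2).
have p0 z : 0 <= defect a b (d ^+ 2) z by apply: defect_ge0; rewrite sqr_ge0.
rewrite box_tonelli//.
have mG : measurable_fun setT (fun y : measurableTypeR R =>
    \int[mu]_(x in `[(a - B)%R, (a + B)%R]) (defect a b (d ^+ 2) (x, y))%:E)%E.
  under eq_fun do rewrite integral_mkcond.
  pose h : plane R -> \bar R := (fun z => (defect a b (d ^+ 2) z)%:E) \_ (`[(a - B)%R, (a + B)%R]%classic `*` setT).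
  have mI : measurable (`[(a - B)%R, (a + B)%R]%classic `*` setT : set (plane R)).
    by apply: measurableX => //; exact: measurable_itv.
  have mh : measurable_fun setT h.
    by apply/(measurable_restrict _ mI) => //; rewrite setTI; apply/measurable_EFinP; exact: measurable_funTS.
  have h0 z : (0 <= h z)%E by rewrite /h patchE; case: ifP => // _; rewrite lee_fin.
  have := @measurable_fun_fubini_tonelli_G _ _ (measurableTypeR R) (measurableTypeR R) R mu _ mh h0.
  rewrite /fubini_G; congr (measurable_fun _ _).
  apply/funext => y; apply: eq_integral => x _; rewrite /h !patchE.
  by rewrite in_setX in_setT andbT.
(* The slice through (a, b) is removed, since the bound on slices requires a positive height. *)
rewrite -(@integral_setD1 _ _ b); last 2 first.
- by apply: measurableD => //; exact: measurable_itv.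
- exact: measurable_funTS.
apply: (@le_trans _ _ (\int[mu]_(y in `[c, e] `\ b) (cst (d ^+ 2 / B + pi * d)%:E y))%E).
  apply: ge0_le_integral => //.
  - by apply: measurableD => //; exact: measurable_itv.
  - by move=> y _; apply: integral_ge0 => x _; rewrite lee_fin.
  - exact: measurable_funTS.
  - move=> y [_ /= yb].
    have e0 : 0 < `|y - b| by rewrite normr_gt0 subr_eq0; apply/eqP.
    rewrite /defect /rsq /=.
    have := integral_defect_slice a B0 d0 e0.
    by rewrite real_normK ?num_real.
rewrite integral_setD1; last 2 first.
- by apply: measurableD => //; exact: measurable_itv.
- exact: measurable_cst.
rewrite integral_cst//.
rewrite [X in (_ * X)%E](_ : _ = (e - c)%:E) ?EFinM//.
transitivity (mu `[c, e]%classic) => //; rewrite lebesgue_measure_itv/= lte_fin.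
by move: ce; rewrite le_eqVlt => /orP[/eqP ->|->]; rewrite ?ltxx ?subrr// EFinB.
Qed.

End Defect.

Section Slices.
Variable R : realType.
Local Notation mu := (@lebesgue_measure R).
Implicit Types c B K k x : R.

Lemma is_derive_continuous (h h' : R -> R) :
  (forall x, is_derive x (1 : R) h (h' x)) -> continuous h.
Proof.
move=> dh x; apply: differentiable_continuous; apply/derivable1_diffP.
by case: (dh x).
Qed.

Let continuous_sqrD_inv c K : 0 < K -> continuous (fun x : R => ((x - c) ^+ 2 + K)^-1).
Proof.
move=> K0 x; apply: cvgV; first by rewrite gt_eqF// sqrD_gt0.
exact: (is_derive_continuous (is_derive_sqrD c K)).
Qed.

Let continuous_kernel c K : 0 < K ->
  continuous (fun x : R => (K - (x - c) ^+ 2) / ((x - c) ^+ 2 + K) ^+ 2).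
Proof.
move=> K0 x; under eq_fun do rewrite -exprVn.
have c1 : (y - c) ^+ 2 @[y --> x] --> (x - c) ^+ 2.
  by apply: cvgM; (apply: cvgB; [exact: cvg_id|exact: cvg_cst]).
apply: cvgM; first by apply: cvgB => //; exact: cvg_cst.
by apply: cvgM; exact: continuous_sqrD_inv.
Qed.

(** Green's second identity in one variable. The integrand is v u'' - v'' u with v the regularized
    logarithm, the derivative of v u' - v' u, which vanishes at both ends. *)
Lemma green_slice (u u' u'' : R -> R) c B K : 0 < B -> 0 < K ->
  (forall x, is_derive x (1 : R) u (u' x)) ->
  (forall x, is_derive x (1 : R) u' (u'' x)) -> continuous u'' ->
  u (c - B) = 0 -> u (c + B) = 0 -> u' (c - B) = 0 -> u' (c + B) = 0 ->
  (\int[mu]_(x in `[(c - B)%R, (c + B)%R])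
    (2^-1 * ln ((x - c) ^+ 2 + K) * u'' x
     - (K - (x - c) ^+ 2) / ((x - c) ^+ 2 + K) ^+ 2 * u x)%:E = 0)%E.
Proof.
move=> B0 K0 du du' cu'' u1 u2 v1 v2.
pose F x := 2^-1 * ln ((x - c) ^+ 2 + K) * u' x - (x - c) / ((x - c) ^+ 2 + K) * u x.
pose g x := 2^-1 * ln ((x - c) ^+ 2 + K) * u'' x
     - (K - (x - c) ^+ 2) / ((x - c) ^+ 2 + K) ^+ 2 * u x.
have dF x : is_derive x (1 : R) F (g x).
  have := is_deriveB (is_deriveM (is_derive_half_ln c x K0) (du' x))
    (is_deriveM (is_derive_half_ln2 c x K0) (du x)).
  by move/is_derive_eq; apply; rewrite /g /GRing.scale/=; ring.
rewrite -[LHS]/(\int[mu]_(x in `[(c - B)%R, (c + B)%R]) (g x)%:E)%E.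
rewrite (FTC2_everywhere _ dF).
- by rewrite /F u1 u2 v1 v2 !mulr0 !subrr.
- by rewrite ltrD2l gtrN.
- move=> x; apply: cvgB; apply: cvgM.
  + exact: (is_derive_continuous (fun x => is_derive_half_ln c x K0)).
  + exact: cu''.
  + exact: continuous_kernel.
  + exact: (is_derive_continuous du).
Qed.

Lemma log_second_derivative_slice c B K : 0 < B -> 0 < K ->
  (\int[mu]_(x in `[(c - B)%R, (c + B)%R])
    ((K - (x - c) ^+ 2) / ((x - c) ^+ 2 + K) ^+ 2)%:E = (2 * B / (B ^+ 2 + K))%:E)%E.
Proof.
move=> B0 K0; pose F x := (x - c) / ((x - c) ^+ 2 + K).
have dF x : is_derive x (1 : R) F ((K - (x - c) ^+ 2) / ((x - c) ^+ 2 + K) ^+ 2).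
  exact: is_derive_half_ln2.
rewrite (FTC2_everywhere _ dF).
- have E1 : c + B - c = B by ring.
  have E2 : c - B - c = - B by ring.
  congr EFin; rewrite /F E1 E2 sqrrN; field.
  by rewrite gt_eqF// sqrD_gt0.
- by rewrite ltrD2l gtrN.
- exact: continuous_kernel.
Qed.

Lemma lorentzian_integral c B C : 0 < B -> 0 < C ->
  (\int[mu]_(x in `[(c - B)%R, (c + B)%R]) (2 * B / ((x - c) ^+ 2 + C ^+ 2))%:E
    = (4 * (B / C) * atan (B / C))%:E)%E.
Proof.
move=> B0 C0; pose F x := (2 * B / C) * atan ((x - c) / C).
have dF x : is_derive x (1 : R) F (2 * B / ((x - c) ^+ 2 + C ^+ 2)).
  have := is_deriveZ (2 * B / C) (is_derive_atan_scaled c x C0).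
  move/is_derive_eq; apply; rewrite /GRing.scale/=; field.
  by rewrite !gt_eqF// sqrD_gt0// exprn_gt0.
rewrite (FTC2_everywhere _ dF).
- have E1 : c + B - c = B by ring.
  have E2 : c - B - c = - B by ring.
  congr EFin; rewrite /F E1 E2 mulNr atanN; field.
  by rewrite gt_eqF.
- by rewrite ltrD2l gtrN.
- move=> x; apply: cvgM; first exact: cvg_cst.
  by apply: continuous_sqrD_inv; rewrite exprn_gt0.
Qed.

End Slices.

(** * Green's identity on squares and the logarithmic potential *)

Section LogPotential.
Variable R : realType.
Local Notation mu := (@lebesgue_measure R).
Local Notation mu2 := (@lebesgue_measure R \x @lebesgue_measure R)%E.
Implicit Types a b B d k : R.

Definition reg_log a b k (z : R * R) : R := 2^-1 * ln (rsq a b z + k).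

(** The Laplacian of [reg_log a b k]: a nonnegative kernel that concentrates at (a, b), with mass
    tending to 2 pi, as [k] tends to 0. *)
Definition poisson_kernel a b k (z : R * R) : R := 2 * k / (rsq a b z + k) ^+ 2.

Definition square a b B : set (plane R) := box (a - B) (a + B) (b - B) (b + B).

Lemma rsqD_gt0 a b k z : 0 < k -> 0 < rsq a b z + k.
Proof. by move=> k0; rewrite ltr_wpDl// rsq_ge0. Qed.

Lemma reg_log_continuous a b k : 0 < k -> continuous (reg_log a b k).
Proof.
move=> k0; apply: contM; first exact: cont_cst.
apply: cont_ln => [z|]; first exact: rsqD_gt0.
by apply: contD; [exact: rsq_continuous|exact: cont_cst].
Qed.

Let continuous_inv_sq a b k : 0 < k -> continuous (fun z => ((rsq a b z + k) ^+ 2)^-1).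
Proof.
move=> k0; apply: contV => [z|]; first by rewrite expf_neq0// gt_eqF// rsqD_gt0.
by apply: contX; apply: contD; [exact: rsq_continuous|exact: cont_cst].
Qed.

Lemma poisson_kernel_continuous a b k : 0 < k -> continuous (poisson_kernel a b k).
Proof. by move=> k0; apply: contM; [exact: cont_cst|exact: continuous_inv_sq]. Qed.

Lemma poisson_kernel_ge0 a b k z : 0 < k -> 0 <= poisson_kernel a b k z.
Proof.
move=> k0; rewrite /poisson_kernel divr_ge0//; first by rewrite mulr_ge0// ltW.
by rewrite exprn_ge0// ltW// rsqD_gt0.
Qed.

(* The two pure second derivatives of [reg_log a b k]. *)
Let kx a b k (z : R * R) := ((z.2 - b) ^+ 2 + k - (z.1 - a) ^+ 2) / (rsq a b z + k) ^+ 2.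
Let ky a b k (z : R * R) := ((z.1 - a) ^+ 2 + k - (z.2 - b) ^+ 2) / (rsq a b z + k) ^+ 2.

Let kxyE a b k z : kx a b k z + ky a b k z = poisson_kernel a b k z.
Proof. by rewrite /kx /ky /poisson_kernel -mulrDl; congr (_ / _); ring. Qed.

Let cx : continuous (fun z : R * R => z.1). Proof. exact: cont_fst. Qed.
Let cy : continuous (fun z : R * R => z.2). Proof. exact: cont_snd. Qed.

Let kx_continuous a b k : 0 < k -> continuous (kx a b k).
Proof.
move=> k0; apply: contM; last exact: continuous_inv_sq.
apply: contB; [apply: contD; [|exact: cont_cst]|];
  by apply: contX; apply: contB => //; exact: cont_cst.
Qed.

Let ky_continuous a b k : 0 < k -> continuous (ky a b k).
Proof.
move=> k0; apply: contM; last exact: continuous_inv_sq.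
apply: contB; [apply: contD; [|exact: cont_cst]|];
  by apply: contX; apply: contB => //; exact: cont_cst.
Qed.

Let box_int h a b B : continuous h -> mu2.-integrable (square a b B) (EFin \o h).
Proof. exact: continuous_box_integrable. Qed.

(** Each pure second derivative is integrated along its own variable first. The inner integral is a
    Lorentzian in the other variable, and both derivatives contribute the same arctangent. *)
Lemma poisson_kernel_mass a b B k : 0 < B -> 0 < k ->
  \int[mu2]_(z in square a b B) poisson_kernel a b k z =
  8 * (B / Num.sqrt (B ^+ 2 + k)) * atan (B / Num.sqrt (B ^+ 2 + k)).
Proof.
move=> B0 k0; pose C := Num.sqrt (B ^+ 2 + k).
have C20 : 0 < B ^+ 2 + k by rewrite sqrD_gt0.
have C0 : 0 < C by rewrite sqrtr_gt0.
have C2 : C ^+ 2 = B ^+ 2 + k by rewrite sqr_sqrtr// ltW.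
have X : (\int[mu2]_(z in square a b B) (kx a b k z)%:E = (4 * (B / C) * atan (B / C))%:E)%E.
  rewrite (proj2 (box_fubini (box_int a b B (kx_continuous k0)))).
  rewrite -(lorentzian_integral b B0 C0); apply: eq_integral => y _.
  have K0 : 0 < (y - b) ^+ 2 + k by rewrite sqrD_gt0.
  rewrite -[in RHS](_ : (B ^+ 2 + ((y - b) ^+ 2 + k)) = (y - b) ^+ 2 + C ^+ 2); last by rewrite C2; ring.
  rewrite -(log_second_derivative_slice a B0 K0); apply: eq_integral => x _.
  by rewrite /kx /rsq /= addrA.
have Y : (\int[mu2]_(z in square a b B) (ky a b k z)%:E = (4 * (B / C) * atan (B / C))%:E)%E.
  rewrite (proj1 (box_fubini (box_int a b B (ky_continuous k0)))).
  rewrite -(lorentzian_integral a B0 C0); apply: eq_integral => y _.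
  have K0 : 0 < (y - a) ^+ 2 + k by rewrite sqrD_gt0.
  rewrite -[in RHS](_ : (B ^+ 2 + ((y - a) ^+ 2 + k)) = (y - a) ^+ 2 + C ^+ 2); last by rewrite C2; ring.
  rewrite -(log_second_derivative_slice b B0 K0); apply: eq_integral => x _.
  by rewrite /ky /rsq /= addrCA addrA.
under eq_Rintegral do rewrite -kxyE.
rewrite RintegralD; [|exact: measurable_box|exact/box_int/kx_continuous|exact/box_int/ky_continuous].
by rewrite /Rintegral X Y /= -/C; ring.
Qed.

Lemma poisson_kernel_mass_cvg B : 0 < B ->
  8 * (B / Num.sqrt (B ^+ 2 + d ^+ 2)) * atan (B / Num.sqrt (B ^+ 2 + d ^+ 2))
    @[d --> (0 : R)] --> 2 * pi.
Proof.
move=> B0.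
have c1 : B / Num.sqrt (B ^+ 2 + d ^+ 2) @[d --> (0 : R)] --> (1 : R).
  have <- : B / Num.sqrt (B ^+ 2 + 0 ^+ 2) = 1.
    by rewrite expr0n addr0 sqrtr_sqr gtr0_norm// divff// gt_eqF.
  apply: cvgM; first exact: cvg_cst.
  apply: cvgV; first by rewrite gt_eqF// sqrtr_gt0 expr0n addr0 exprn_gt0.
  apply: (@cvg_comp _ _ _ _ (@Num.sqrt R) _ (nbhs (B ^+ 2 + 0 ^+ 2))); last exact: sqrt_continuous.
  by apply: cvgD; [exact: cvg_cst|apply: (@cvgM _ _ _ _ id id); exact: cvg_id].
rewrite (_ : 2 * pi = 8 * 1 * atan 1); last by rewrite atan1; field.
apply: cvgM; first by apply: cvgM => //; exact: cvg_cst.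
apply: (@cvg_comp _ _ _ _ (@atan R) _ (nbhs (1 : R))) => //; exact: continuous_atan.
Qed.

(** Within distance [r] of (a, b), [h] oscillates by at most [e]; farther away the kernel is at most
    2k / r^4. The radius comes from [h] and [e], so that [C] is independent of [k]. *)
Lemma near_poisson_kernel (h : R * R -> R) a b B e : 0 < B -> 0 < e -> continuous h ->
  exists C, forall k, 0 < k -> k <= 1 ->
   `|\int[mu2]_(z in square a b B) (poisson_kernel a b k z * h z) -
     h (a, b) * \int[mu2]_(z in square a b B) poisson_kernel a b k z| <=
    e * \int[mu2]_(z in square a b B) poisson_kernel a b k z + C * k.
Proof.
move=> B0 e0 ch; have ms : measurable (square a b B) by exact: measurable_box.
have ck k : 0 < k -> continuous (poisson_kernel a b k) by exact: poisson_kernel_continuous.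
have [M HM] := continuous_box_bounded (a - B) (a + B) (b - B) (b + B) ch.
have M0 : 0 <= M.
  apply: le_trans (normr_ge0 _) (HM (a, b) _).
  by split; rewrite /= in_itv/= ?gerBl ?lerDl ltW.
have [r r0 Hr] : exists2 r, 0 < r & forall z, rsq a b z < r ^+ 2 -> `|h z - h (a, b)| <= e.
  have /cvgrPdist_le /(_ e e0) := ch (a, b).
  move=> /nbhs_ballP[r /= r0 Hr]; exists r => // z zr.
  rewrite distrC; apply: Hr; split => /=.
    rewrite /ball/= -(ltr_pXn2r (ltn0Sn 1)) ?nnegrE ?(ltW r0)// real_normK ?num_real//.
    by rewrite -sqrrN opprB; apply: le_lt_trans zr; rewrite /rsq lerDl sqr_ge0.
  rewrite /ball/= -(ltr_pXn2r (ltn0Sn 1)) ?nnegrE ?(ltW r0)// real_normK ?num_real//.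
  by rewrite -sqrrN opprB; apply: le_lt_trans zr; rewrite /rsq lerDr sqr_ge0.
pose C0 := 2 * M * 2 / r ^+ 4.
have C00 : 0 <= C0 by rewrite divr_ge0 ?mulr_ge0 ?exprn_ge0// ltW.
exists (C0 * fine (mu2 (square a b B))) => k k0 k1.
have I1 := box_int a b B (ck _ k0).
have I2 := box_int a b B (contM (ck _ k0) ch).
have I3 := box_int a b B (contM (@cont_cst R (h (a, b))) (ck _ k0)).
have I4 := box_int a b B (contB (contM (ck _ k0) ch) (contM (@cont_cst R (h (a, b))) (ck _ k0))).
have I5 := box_int a b B (contD (contM (@cont_cst R e) (ck _ k0)) (@cont_cst R (C0 * k))).
have I6 := box_int a b B (contM (@cont_cst R e) (ck _ k0)).
have I7 := box_int a b B (@cont_cst R (C0 * k)).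
rewrite -RintegralZl// -RintegralB//.
apply: le_trans (le_normr_Rintegral _ _) _ => //.
rewrite -RintegralZl// (mulrAC C0) -Rintegral_cst// -RintegralD//.
apply: le_Rintegral => //.
  by have := integrable_abse I4.
move=> z zb.
rewrite (mulrC (h _)) -mulrBr normrM (ger0_norm (poisson_kernel_ge0 a b z k0)).
have [zr|rz] := ltP (rsq a b z) (r ^+ 2).
  apply: ler_wpDr; first by rewrite mulr_ge0 ?(ltW k0).
  rewrite [leRHS]mulrC; apply: ler_wpM2l; first exact: poisson_kernel_ge0.
  exact: Hr.
apply: ler_wpDl; first by rewrite mulr_ge0 ?(ltW e0) ?poisson_kernel_ge0.
have h2 : `|h z - h (a, b)| <= 2 * M.
  rewrite mulr2n mulrDl mul1r; apply: le_trans (ler_normB _ _) (lerD (HM z zb) (HM (a, b) _)).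
  by split; rewrite /= in_itv/= ?gerBl ?lerDl ltW.
rewrite (_ : C0 * k = (2 * k / r ^+ 4) * (2 * M)); last by rewrite /C0; ring.
apply: ler_pM => //; first exact: poisson_kernel_ge0.
rewrite /poisson_kernel ler_pM2l ?mulr_gt0// lef_pV2 ?posrE ?exprn_gt0 ?rsqD_gt0//.
rewrite (_ : r ^+ 4 = (r ^+ 2) ^+ 2); last by rewrite -exprM.
rewrite ler_pXn2r ?nnegrE ?exprn_ge0 ?(ltW (rsqD_gt0 _ _ _ k0)) ?(ltW r0)//.
by rewrite ler_wpDr// ltW.
Qed.

Section Test.
Variable f : R * R -> R.
Hypothesis tf : test_function f.

(** The two pure second derivatives are treated separately, each on the slices along its own
    variable. The square contains the support, so that there are no boundary terms. *)
Lemma green_square a b B k rho : 0 < B -> 0 < k -> 0 < rho ->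
  (forall s x y, rho <= `|x| \/ rho <= `|y| -> iter_partial s f (x, y) = 0) ->
  rho + `|a| <= B -> rho + `|b| <= B ->
  \int[mu2]_(z in square a b B) (reg_log a b k z * laplacian f z) =
  \int[mu2]_(z in square a b B) (poisson_kernel a b k z * f z).
Proof.
move=> B0 k0 rho0 Hf aB bB; apply/eqP; rewrite -subr_eq0; apply/eqP.
have tc s := test_continuous tf s.
have cl := @reg_log_continuous a b k k0; have cp := @poisson_kernel_continuous a b k k0.
have cf : continuous f := tc [::].
have cL := laplacian_continuous tf.
have ms : measurable (square a b B) by exact: measurable_box.
rewrite -RintegralB//; [|exact: box_int a b B (contM cl cL)|exact: box_int a b B (contM cp cf)].
pose hx z := reg_log a b k z * iter_partial [:: false; false] f z - kx a b k z * f z.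
pose hy z := reg_log a b k z * iter_partial [:: true; true] f z - ky a b k z * f z.
have chx : continuous hx := contB (contM cl (tc _)) (contM (kx_continuous k0) cf).
have chy : continuous hy := contB (contM cl (tc _)) (contM (ky_continuous k0) cf).
rewrite (_ : (\int[mu2]_(z in _) _) = \int[mu2]_(z in square a b B) (hx z + hy z)); last first.
  by apply: eq_Rintegral => z _; rewrite -kxyE /hx /hy /laplacian mulrDr mulrDl opprD addrACA.
rewrite RintegralD//; [|exact: box_int|exact: box_int].
have edge u : rho + `|u| <= B -> (rho <= `|u - B|) /\ (rho <= `|u + B|).
  move=> uB; split.
    rewrite distrC; apply: le_trans (ler_norm _); rewrite lerBrDr; apply: le_trans uB.
    by rewrite lerD2l ler_norm.
  apply: le_trans (ler_norm _); rewrite -lerBlDl; apply: le_trans uB.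
  by rewrite lerD2l -normrN ler_norm.
have [a1 a2] := edge a aB; have [b1 b2] := edge b bB.
have X : (\int[mu2]_(z in square a b B) (hx z)%:E = 0)%E.
  rewrite (proj2 (box_fubini (box_int a b B chx))) integral0_eq// => y _.
  have K0 : 0 < (y - b) ^+ 2 + k by rewrite sqrD_gt0.
  rewrite -[RHS](@green_slice R (fun x => f (x, y)) (fun x => iter_partial [:: false] f (x, y))
    (fun x => iter_partial [:: false; false] f (x, y)) a B _ B0 K0).
  - by apply: eq_integral => x _; rewrite /hx /reg_log /kx /rsq /= addrA.
  - by move=> x; exact: (test_slice_x tf [::]).
  - by move=> x; exact: (test_slice_x tf [:: false]).
  - exact: (is_derive_continuous (fun x => test_slice_x tf [:: false; false] x y)).
  - by apply: (Hf [::]); left.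
  - by apply: (Hf [::]); left.
  - by apply: Hf; left.
  - by apply: Hf; left.
have Y : (\int[mu2]_(z in square a b B) (hy z)%:E = 0)%E.
  rewrite (proj1 (box_fubini (box_int a b B chy))) integral0_eq// => x _.
  have K0 : 0 < (x - a) ^+ 2 + k by rewrite sqrD_gt0.
  rewrite -[RHS](@green_slice R (fun y => f (x, y)) (fun y => iter_partial [:: true] f (x, y))
    (fun y => iter_partial [:: true; true] f (x, y)) b B _ B0 K0).
  - by apply: eq_integral => y _; rewrite /hy /reg_log /ky /rsq /= addrCA addrA.
  - by move=> y; exact: (test_slice_y tf [::]).
  - by move=> y; exact: (test_slice_y tf [:: true]).
  - exact: (is_derive_continuous (fun y => test_slice_y tf [:: true; true] x y)).
  - by apply: (Hf [::]); right.
  - by apply: (Hf [::]); right.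
  - by apply: Hf; right.
  - by apply: Hf; right.
by rewrite /Rintegral X Y addr0.
Qed.

End Test.
End LogPotential.

Section FundamentalSolution.
Variable R : realType.
Local Notation mu := (@lebesgue_measure R).
Local Notation mu2 := (@lebesgue_measure R \x @lebesgue_measure R)%E.
Implicit Types a b B d k : R.

(* Junk value [0] at the singularity. *)
Definition log_dist a b (z : R * R) : R := 2^-1 * ln (rsq a b z).

Lemma plane_point_null (p : R * R) : mu2 [set p] = 0%E.
Proof.
rewrite (_ : [set p] = [set p.1] `*` [set p.2]).
  rewrite product_measure1E//; try exact: measurable_set1.
  by rewrite [X in (X * _)%E]lebesgue_measure_set1 mul0e.
by case: p => u v; apply/seteqP; split=> [z ->//|[u' v'] [/= -> ->]].
Qed.

Lemma measurable_plane_point (p : R * R) : measurable ([set p] : set (plane R)).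
Proof.
rewrite (_ : [set p] = [set p.1] `*` [set p.2]).
  by apply: measurableX; exact: measurable_set1.
by case: p => u v; apply/seteqP; split=> [z ->//|[u' v'] [/= -> ->]].
Qed.

Lemma rsq_eq0 a b z : (rsq a b z == 0) = (z == (a, b)).
Proof.
by case: z => x y; rewrite /rsq paddr_eq0 ?sqr_ge0// !sqrf_eq0 !subr_eq0.
Qed.

Lemma log_dist_split a b k z : 0 < k -> z != (a, b) ->
  log_dist a b z = reg_log a b k z - defect a b k z.
Proof.
move=> k0; rewrite -rsq_eq0 => z0; have q0 : 0 < rsq a b z by rewrite lt0r z0 rsq_ge0.
have e0 : 0 < 1 + k / rsq a b z by rewrite addr_gt0// divr_gt0.
rewrite /log_dist /reg_log /defect -mulrBr; congr (_ * _).
rewrite -ln_div ?posrE//; last by rewrite addr_gt0.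
congr ln; field.
by rewrite !gt_eqF// addr_gt0.
Qed.

Lemma log_dist_defect_le a b z : `|log_dist a b z| <= rsq a b z + defect a b 1 z.
Proof.
have [/eqP|z0] := boolP (z == (a, b)).
  by move=> /eqP; rewrite -rsq_eq0 /log_dist /defect => /eqP ->; rewrite invr0 mulr0 addr0 ln1 ln0// mulr0 normr0 addr0.
rewrite (log_dist_split ltr01 z0); apply: le_trans (ler_normB _ _) _.
rewrite (ger0_norm (defect_ge0 _ _ _ ler01)) lerD2r /reg_log.
have q0 := rsq_ge0 a b z.
rewrite ger0_norm; last by rewrite mulr_ge0// ln_ge0// lerDr.
have h : ln (rsq a b z + 1) <= rsq a b z.
  rewrite addrC; apply: le_ln1Dx; exact: lt_le_trans (ltrN10 R) q0.
by have := rsq_ge0 a b z; lra.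
Qed.

Lemma measurable_rsq a b : measurable_fun [set: plane R] (rsq a b).
Proof. exact: continuous_measurable_plane (@rsq_continuous R a b). Qed.

Lemma measurable_log_dist a b : measurable_fun [set: plane R] (log_dist a b).
Proof.
apply: measurable_funM; first exact: measurable_cst.
exact: (measurableT_comp (@measurable_ln R) (measurable_rsq a b)).
Qed.

Section Test.
Variable f : R * R -> R.
Hypothesis tf : test_function f.

Lemma square_support a b M rho z : `|a| <= M -> `|b| <= M ->
  (forall s x y, rho <= `|x| \/ rho <= `|y| -> iter_partial s f (x, y) = 0) ->
  ~ square a b (rho + M) z -> laplacian f z = 0.
Proof.
move=> aM bM Hf zs; rewrite /laplacian; case: z zs => x y zs.
suff xy : rho <= `|x| \/ rho <= `|y| by rewrite !Hf// addr0.
have [|xr] := leP rho `|x|; first by left.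
have [|yr] := leP rho `|y|; first by right.
have edge u c : `|u| < rho -> `|c| <= M -> (u \in `[c - (rho + M), c + (rho + M)]).
  by rewrite in_itv/= !ltr_norml !ler_norml => /andP[? ?] /andP[? ?]; apply/andP; split; lra.
by exfalso; apply: zs; split; apply: edge.
Qed.

(** Green's identity for the regularization by d^2, as d tends to 0: replacing the logarithm costs a
    multiple of d, and the kernel concentrates the mass 2 pi at (a, b). What matters later is that
    [C] depends on [M] only; the square of half-side rho + M around any such (a, b) contains the
    support. *)
Lemma log_potential M : 0 <= M -> exists C : R, 0 <= C /\
  forall a b, `|a| <= M -> `|b| <= M ->
  [/\ mu2.-integrable [set: plane R] (EFin \o (fun z => log_dist a b z * laplacian f z)),
      (\int[mu2]_z `|log_dist a b z * laplacian f z|%:E <= C%:E)%E,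
      forall d, 0 < d -> d <= 1 ->
        (\int[mu2]_z (defect a b (d ^+ 2) z * `|laplacian f z|)%:E <= (C * d)%:E)%E
    & (\int[mu2]_z (log_dist a b z * laplacian f z)%:E = (2 * pi * f (a, b))%:E)%E].
Proof.
move=> M0; have [rho rho0 Hf] := test_support tf.
pose B := rho + M; have B0 : 0 < B by rewrite ltr_pwDl.
have cL := laplacian_continuous tf; have mL := continuous_measurable_plane cL.
have [S0 HS0] : exists S0 : R, forall z, `|laplacian f z| <= S0.
  have [S HS] := continuous_box_bounded (- B) B (- B) B cL.
  exists S => z; have [zs|zs] := pselect (square 0 0 B z).
    by apply: HS; move: zs; rewrite /square !sub0r !add0r.
  rewrite (square_support _ _ Hf zs) ?normr0//.
  apply: le_trans (HS (0, 0) _); first exact: normr_ge0.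
  by split; rewrite /= in_itv/= oppr_le0 ltW.
have S00 : 0 <= S0 := le_trans (normr_ge0 _) (HS0 (0, 0)).
pose D d := (d ^+ 2 / B + pi * d) * (2 * B).
(* On the square r^2 <= 2B^2, the Laplacian is at most [S0] and the area is (2B)^2, which bounds the
   regular part; the last summand bounds the defect for d = 1. *)
pose C1 := 2 * B ^+ 2 * S0 * (2 * B * (2 * B)) + S0 * D 1.
have D1 : 0 <= D 1.
  apply: mulr_ge0; last by rewrite mulr_ge0 ?(ltW B0).
  by apply: addr_ge0; rewrite ?divr_ge0 ?mulr_ge0 ?exprn_ge0 ?pi_ge0 ?(ltW B0).
have S1 : 0 <= 2 * B ^+ 2 * S0 by rewrite !mulr_ge0 ?exprn_ge0 ?(ltW B0).
have S2 : 0 <= 2 * B ^+ 2 * S0 * (2 * B * (2 * B)) by rewrite mulr_ge0// !mulr_ge0 ?(ltW B0).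
have C10 : 0 <= C1 by apply: addr_ge0 => //; apply: mulr_ge0.
exists C1; split=> // a b aM bM.
have ms : measurable (square a b B) by exact: measurable_box.
have off z : ~ square a b B z -> laplacian f z = 0 := square_support aM bM Hf.
have restr (h : R * R -> R) : (fun z => (h z * laplacian f z)%:E) =
    (fun z => (h z * laplacian f z)%:E) \_ (square a b B).
  apply/funext => z; rewrite patchE; case: ifPn => // zs.
  rewrite -[RHS]/(0%E); rewrite notin_setE in zs.
  by rewrite (off z zs) mulr0.
have restra (h : R * R -> R) : (fun z => (h z * `|laplacian f z|)%:E) =
    (fun z => (h z * `|laplacian f z|)%:E) \_ (square a b B).
  apply/funext => z; rewrite patchE; case: ifPn => // zs.
  rewrite -[RHS]/(0%E); rewrite notin_setE in zs.
  by rewrite (off z zs) normr0 mulr0.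
have defect_le d : 0 < d ->
    (\int[mu2]_(z in square a b B) (defect a b (d ^+ 2) z * `|laplacian f z|)%:E <= (S0 * D d)%:E)%E.
  move=> d0; apply: (@le_trans _ _ (\int[mu2]_(z in square a b B) (S0%:E * (defect a b (d ^+ 2) z)%:E))%E).
    apply: ge0_le_integral => //.
    - by move=> z _; rewrite lee_fin mulr_ge0// defect_ge0// sqr_ge0.
    - apply/measurable_EFinP/measurable_funTS; apply: measurable_funM; first exact: measurable_defect.
      exact: (measurableT_comp (@normr_measurable R setT)).
    - apply/measurable_EFinP/measurable_funTS; apply: measurable_funM; first exact: measurable_cst.
      exact: measurable_defect.
    - by move=> z _; rewrite -EFinM lee_fin mulrC ler_wpM2r// defect_ge0// sqr_ge0.
  rewrite ge0_integralZl//; last 2 first.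
  - by apply/measurable_EFinP/measurable_funTS; exact: measurable_defect.
  - by move=> z _; rewrite lee_fin defect_ge0// sqr_ge0.
  rewrite EFinM lee_wpmul2l ?lee_fin//; apply: le_trans (integral_defect _ _ B0 d0 _) _.
    by rewrite lerD2l; lra.
  by rewrite lee_fin /D; lra.
have bound : (\int[mu2]_z `|log_dist a b z * laplacian f z|%:E <= C1%:E)%E.
  rewrite (_ : (fun z => _) = (fun z => (`|log_dist a b z| * `|laplacian f z|)%:E)); last first.
    by apply/funext => z; rewrite normrM.
  rewrite restra -integral_mkcond.
  apply: (@le_trans _ _ (\int[mu2]_(z in square a b B)
      ((2 * B ^+ 2 * S0)%:E + (defect a b (1 ^+ 2) z * `|laplacian f z|)%:E))%E).
    apply: ge0_le_integral => //.
    - apply/measurable_EFinP/measurable_funTS; apply: measurable_funM;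
        apply: (measurableT_comp (@normr_measurable R setT)) => //; exact: measurable_log_dist.
    - apply/measurable_EFinP/measurable_funTS; apply: measurable_funD; first exact: measurable_cst.
      apply: measurable_funM; first exact: measurable_defect.
      exact: (measurableT_comp (@normr_measurable R setT)).
    - move=> z zs; rewrite -EFinD lee_fin expr1n.
      apply: le_trans (ler_wpM2r (normr_ge0 _) (log_dist_defect_le a b z)) _.
      rewrite mulrDl lerD2r; apply: ler_pM => //; first exact: rsq_ge0.
      have sq u c : u \in `[c - B, c + B] -> (u - c) ^+ 2 <= B ^+ 2.
        rewrite in_itv/= => /andP[u1 u2]; rewrite -subr_ge0 subr_sqr mulr_ge0//; lra.
      by rewrite mulr2n mulrDl mul1r; case: zs => z1 z2; apply: lerD; apply: sq.
  rewrite ge0_integralD//; last 2 first.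
  - by move=> z _; rewrite lee_fin mulr_ge0// defect_ge0// sqr_ge0.
  - apply/measurable_EFinP/measurable_funTS; apply: measurable_funM; first exact: measurable_defect.
    exact: (measurableT_comp (@normr_measurable R setT)).
  rewrite EFinD leeD//; last exact: defect_le.
  rewrite integral_cst//= [leRHS]EFinM lee_wpmul2l ?lee_fin//.
  rewrite /square /box product_measure1E; [|exact: measurable_itv..].
  rewrite [X in (X * _)%E]lebesgue_measure_itv [X in (_ * X)%E]lebesgue_measure_itv/= !lte_fin.
  by rewrite !ltrD2l gtrN// -!EFinB -EFinM lee_fin; lra.
have mlL : measurable_fun [set: plane R] (fun z => log_dist a b z * laplacian f z).
  by apply: measurable_funM => //; exact: measurable_log_dist.
have intg : mu2.-integrable [set: plane R] (EFin \o (fun z => log_dist a b z * laplacian f z)).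
  apply/integrableP; split; first exact/measurable_EFinP.
  by apply: le_lt_trans bound (ltry _).
split=> //.
  move=> d d0 d1; rewrite restra -integral_mkcond; apply: le_trans (defect_le d d0) _.
  rewrite lee_fin; apply: (@le_trans _ _ (S0 * D 1 * d)); last first.
    by rewrite ler_wpM2r ?(ltW d0)// /C1 lerDr.
  rewrite -mulrA; apply: ler_wpM2l => //.
  rewrite /D [leRHS]mulrAC; apply: ler_wpM2r; first by rewrite mulr_ge0 ?(ltW B0).
  rewrite [leRHS]mulrDl expr1n mulr1; apply: lerD => //.
  rewrite div1r [leLHS]mulrC; apply: ler_wpM2l; first by rewrite invr_ge0 ltW.
  by rewrite expr2 ler_piMl// ltW.
pose I := \int[mu2]_(z in square a b B) (log_dist a b z * laplacian f z).
have iB : mu2.-integrable (square a b B) (EFin \o (fun z => log_dist a b z * laplacian f z)).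
  exact: integrableS intg.
have IE : (\int[mu2]_z (log_dist a b z * laplacian f z)%:E = I%:E)%E.
  by rewrite restr -integral_mkcond /I /Rintegral fineK//; exact: integrable_fin_num.
rewrite IE; congr EFin.
have aB : rho + `|a| <= B by rewrite lerD2l.
have bB : rho + `|b| <= B by rewrite lerD2l.
pose m d := 8 * (B / Num.sqrt (B ^+ 2 + d ^+ 2)) * atan (B / Num.sqrt (B ^+ 2 + d ^+ 2)).
have cm : m d @[d --> 0^'+] --> 2 * pi by apply: cvg_at_right_filter; exact: poisson_kernel_mass_cvg.
have cf : continuous f by exact: (@test_continuous _ _ tf [::]).
have approx d : 0 < d -> d <= 1 ->
    `|I - \int[mu2]_(z in square a b B) (poisson_kernel a b (d ^+ 2) z * f z)| <= S0 * D d.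
  move=> d0 d1; have k0 : 0 < d ^+ 2 by rewrite exprn_gt0.
  rewrite -(green_square tf B0 k0 rho0 Hf aB bB).
  have cr := contM (@reg_log_continuous R a b _ k0) cL.
  have ir : mu2.-integrable (square a b B) (EFin \o (fun z => reg_log a b (d ^+ 2) z * laplacian f z)).
    exact: continuous_box_integrable.
  rewrite /I -RintegralB//.
  have iD : mu2.-integrable (square a b B) (EFin \o (fun z => log_dist a b z * laplacian f z
      - reg_log a b (d ^+ 2) z * laplacian f z)).
    by rewrite (_ : EFin \o _ = fun z => ((log_dist a b z * laplacian f z)%:E - (reg_log a b (d ^+ 2) z * laplacian f z)%:E)%E)//; exact: integrableB.
  apply: le_trans (le_normr_Rintegral _ iD) _ => //.
  rewrite -lee_fin; apply: le_trans (defect_le d d0).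
  rewrite /Rintegral fineK; last by apply: integrable_fin_num => //; exact: integrable_abse iD.
  rewrite le_eqVlt; apply/orP; left; apply/eqP; apply: ae_eq_integral => //.
  - by have /integrableP[] := integrable_abse iD.
  - apply/measurable_EFinP/measurable_funTS; apply: measurable_funM; first exact: measurable_defect.
    exact: (measurableT_comp (@normr_measurable R setT)).
  - exists [set (a, b)]; split; [exact: measurable_plane_point|exact: plane_point_null|].
    move=> z /= h; apply/eqP/negPn/negP => z0; apply: h => _; congr EFin.
    rewrite (log_dist_split k0 z0).
    rewrite -mulrBl normrM addrAC subrr add0r normrN; congr (_ * _).
    by apply: ger0_norm; apply: defect_ge0; apply: ltW.
(* For fixed [e], letting [d] tend to 0 removes every error term except [e] times the limit mass 2
   pi. *)
have key e : 0 < e -> `|I - f (a, b) * (2 * pi)| <= e * (2 * pi).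
  move=> e0; have [C HC] := near_poisson_kernel a b B0 e0 cf.
  have cl : `|I - f (a, b) * m d| @[d --> 0^'+] --> `|I - f (a, b) * (2 * pi)|.
    by apply: cvg_norm; apply: cvgB; [exact: cvg_cst|apply: cvgMr].
  have cr : S0 * D d + (e * m d + C * d ^+ 2) @[d --> 0^'+] --> S0 * D 0 + (e * (2 * pi) + C * 0 ^+ 2).
    have ci : (d : R) @[d --> 0^'+] --> (0 : R) by apply: cvg_at_right_filter; exact: cvg_id.
    have c2 : (d : R) ^+ 2 @[d --> 0^'+] --> (0 : R) ^+ 2 by rewrite !expr2; apply: cvgM.
    apply: cvgD; last by apply: cvgD; [exact: cvgMr|exact: cvgMr].
    apply: cvgMr; apply: cvgMl; apply: cvgD; [exact: cvgMl|exact: cvgMr].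
  have -> : e * (2 * pi) = S0 * D 0 + (e * (2 * pi) + C * 0 ^+ 2).
    by rewrite /D expr0n !(mul0r, mulr0, addr0, add0r).
  apply: (ler_cvg_to cl cr); near=> d.
  have d0 : 0 < d by [].
  have d1 : d <= 1 by near: d; apply: nbhs_right_le.
  have k0 : 0 < d ^+ 2 by rewrite exprn_gt0.
  have k1 : d ^+ 2 <= 1 by rewrite expr_le1// ltW.
  have := HC _ k0 k1; rewrite (poisson_kernel_mass a b B0 k0) => h.
  exact: le_trans (ler_distD _ _ _) (lerD (approx d d0 d1) h).
have pi2 : 0 < 2 * pi :> R by rewrite mulr_gt0// pi_gt0.
apply/eqP; rewrite mulrC -subr_eq0 -normr_le0; apply/ler_addgt0Pr => e e0; rewrite add0r.
by have := key (e / (2 * pi)) (divr_gt0 e0 pi2); rewrite divfK// gt_eqF.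
Unshelve. all: by end_near. Qed.

End Test.
End FundamentalSolution.

(** * The logarithmic series, bounds on roots, products of distances *)

Section LogSeries.
Variable R : realType.

(** The remainder vanishes at 0 and its derivative is - x^m / (1 - x), so that the mean value
    theorem bounds it. *)
Lemma log_series_bound (rho w : R) m : 0 <= rho -> rho < 1 -> `|w| <= rho ->
  `|ln (1 - w) + \sum_(j < m) w ^+ j.+1 / j.+1%:R| <= rho ^+ m / (1 - rho).
Proof.
move=> rho0 rho1 wr.
pose E (x : R) := ln (1 - x) + \sum_(j < m) x ^+ j.+1 / j.+1%:R.
pose dE (x : R) := - (x ^+ m / (1 - x)).
have dEP (x : R) : x < 1 -> is_derive x (1 : R) E (dE x).
  move=> x1; have p : 0 < 1 - x by rewrite subr_gt0.
  have d1 : is_derive x (1 : R) (fun t => 1 - t) (-1).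
    have := is_deriveB (is_derive_cst (1 : R) x (1 : R)) (is_derive_id x (1 : R)).
    by move/is_derive_eq; apply; rewrite sub0r.
  have dl : is_derive x (1 : R) (fun t => ln (1 - t)) ((1 - x)^-1 * -1).
    exact: (@is_derive1_comp R (@ln R) (fun t => 1 - t) x _ _ (is_derive1_ln p) d1).
  have ds (k : nat) : is_derive x (1 : R) (fun t => \sum_(j < k) t ^+ j.+1 / j.+1%:R) (\sum_(j < k) x ^+ j).
    elim: k => [|k IH].
      under eq_fun do rewrite big_ord0.
      by rewrite big_ord0; exact: is_derive_cst.
    under eq_fun do rewrite big_ord_recr/=.
    rewrite big_ord_recr/=.
    have dp : is_derive x (1 : R) (fun t : R => t ^+ k.+1) (k.+1%:R * x ^+ k).
      elim: {IH} k => [|k IH]; first by apply: is_derive_eq; rewrite expr0 mulr1.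
      have := is_deriveM (is_derive_id x (1 : R)) IH; move/is_derive_eq; apply.
      by rewrite /GRing.scale/= -[k.+2%:R]natr1 exprS; ring.
    have dq : is_derive x (1 : R) (fun t : R => t ^+ k.+1 / k.+1%:R) (x ^+ k).
      have := is_deriveM dp (is_derive_cst (k.+1%:R^-1 : R) x (1 : R)).
      move/is_derive_eq; apply; rewrite /GRing.scale/= mulr0 add0r mulrA mulVf ?mul1r//.
    exact: is_deriveD IH dq.
  have := is_deriveD dl (ds m); move/is_derive_eq; apply.
  rewrite /dE; have := subrX1 x m => h.
  have -> : \sum_(j < m) x ^+ j = (1 - x ^+ m) / (1 - x).
    apply: (mulIf (lt0r_neq0 p)); rewrite divfK ?gt_eqF//.
    by rewrite mulrC -(opprB x) mulNr -h opprB.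
  by field; rewrite gt_eqF.
have dEb (x : R) : `|x| <= rho -> `|dE x| <= rho ^+ m / (1 - rho).
  move=> xr; rewrite /dE normrN normrM normrX normfV; apply: ler_pM => //.
  - by rewrite lerXn2r ?nnegrE.
  - have := le_lt_trans (le_trans (ler_norm x) xr) rho1 => x1.
    rewrite gtr0_norm ?subr_gt0// lef_pV2 ?posrE ?subr_gt0//.
    by rewrite lerD2l lerN2 (le_trans (ler_norm x)).
have E0 : E 0 = 0.
  by rewrite /E subr0 ln1 add0r big1// => j _; rewrite expr0n mul0r.
have w1 := ler_normlW wr; have cE a b : a <= b -> b < 1 -> {within `[a, b], continuous E}.
  move=> ab b1; apply: derivable_within_continuous => x; rewrite in_itv/= => /andP[_ xb].
  by case: (dEP x (le_lt_trans xb b1)).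
have C0 : 0 <= rho ^+ m / (1 - rho) by rewrite divr_ge0 ?exprn_ge0// subr_ge0 ltW.
have fin c : `|c| <= rho -> `|dE c * w| <= rho ^+ m / (1 - rho).
  move=> cr; rewrite normrM; apply: le_trans (ler_wpM2r (normr_ge0 _) (dEb c cr)) _.
  by rewrite ler_piMr// (le_trans wr)// ltW.
have w1' : w < 1 by apply: le_lt_trans (le_trans (ler_norm w) wr) rho1.
have [w0|w0] := leP 0 w.
  have d1 (x : R) : x \in `]0, w[ -> is_derive x (1 : R) E (dE x).
    by rewrite in_itv/= => /andP[_ xw]; exact: dEP (lt_trans xw w1').
  have [c cI] := @MVT_segment R E dE 0 w w0 d1 (cE _ _ w0 w1').
  rewrite E0 !subr0 -/(E w) => ->; apply: fin.
  move: cI; rewrite in_itv/= => /andP[c0 cw].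
  by rewrite ger0_norm// (le_trans cw)// (le_trans (ler_norm _)).
have d1 (x : R) : x \in `]w, 0[ -> is_derive x (1 : R) E (dE x).
  by rewrite in_itv/= => /andP[_ x0]; exact: dEP (lt_trans x0 ltr01).
have [c cI] := @MVT_segment R E dE w 0 (ltW w0) d1 (cE _ _ (ltW w0) ltr01).
rewrite E0 sub0r sub0r mulrN => /oppr_inj; rewrite -/(E w) => ->; apply: fin.
move: cI; rewrite in_itv/= => /andP[wc c0].
by rewrite ler0_norm// (le_trans _ wr)// ler0_norm ?lerN2// ltW.
Qed.

Lemma geometric_small (rho e : R) : 0 <= rho -> rho < 1 -> 0 < e ->
  exists m, rho ^+ m / (1 - rho) <= e.
Proof.
move=> rho0 rho1 e0; have p : 0 < 1 - rho by rewrite subr_gt0.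
have : rho ^+ m @[m --> \oo] --> (0 : R) by apply: cvg_expr; rewrite ger0_norm.
move=> /cvgrPdist_le /(_ _ (mulr_gt0 e0 p)) [m _ Hm]; exists m.
have := Hm m (leqnn _); rewrite sub0r normrN ger0_norm ?exprn_ge0//.
by rewrite ler_pdivrMr.
Qed.

End LogSeries.

Section RootBound.
Variable R : realType.

Lemma sqr_normc_ReIm (z : R[i]) : normc z ^+ 2 = complex.Re z ^+ 2 + complex.Im z ^+ 2.
Proof. by case: z => a b; rewrite /normc sqr_sqrtr// addr_ge0 ?sqr_ge0. Qed.

Lemma mulc_conj (z : R[i]) : z * z^*%C = (normc z ^+ 2)%:C%C.
Proof.
rewrite sqr_normc_ReIm; case: z => a b; apply/eqP; rewrite eq_complex/=.
by apply/andP; split; apply/eqP; ring.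
Qed.

Lemma Re_le_normc (z : R[i]) : `|complex.Re z| <= normc z.
Proof.
rewrite -(ler_pXn2r (ltn0Sn 1)) ?nnegrE ?normr_ge0//; last by case: z => a b; rewrite sqrtr_ge0.
by rewrite sqr_normc_ReIm real_normK ?num_real// lerDl sqr_ge0.
Qed.

Lemma Im_le_normc (z : R[i]) : `|complex.Im z| <= normc z.
Proof.
rewrite -(ler_pXn2r (ltn0Sn 1)) ?nnegrE ?normr_ge0//; last by case: z => a b; rewrite sqrtr_ge0.
by rewrite sqr_normc_ReIm real_normK ?num_real// lerDr sqr_ge0.
Qed.

Lemma normc_ge0 (z : R[i]) : 0 <= normc z.
Proof. exact: le_trans (normr_ge0 _) (Re_le_normc z). Qed.

Lemma le_normc_sum I (r : seq I) (P : pred I) (F : I -> R[i]) :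
  normc (\sum_(i <- r | P i) F i) <= \sum_(i <- r | P i) normc (F i).
Proof.
elim/big_rec2: _ => [|i y x _ IH]; first by rewrite normc0.
by apply: le_trans (le_normcD _ _) _; rewrite lerD2l.
Qed.

Lemma normc_prod I (r : seq I) (P : pred I) (F : I -> R[i]) :
  normc (\prod_(i <- r | P i) F i) = \prod_(i <- r | P i) normc (F i).
Proof.
elim/big_rec2: _ => [|i y x _ <-]; [exact: normc1|exact: normcM].
Qed.

Lemma mem_spectrum_seq n (M : 'M[R[i]]_n) x :
  (x \in spectrum_seq M) = eigenvalue M x.
Proof. by rewrite eigenvalue_root_char -spectrum_seqE root_prod_XsubC. Qed.

(** The eigenvector equation is read at a coordinate of maximal modulus. *)
Lemma eigenvalue_le n (M : 'M[R[i]]_n) x : eigenvalue M x ->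
  normc x <= \sum_j \sum_k normc (M j k).
Proof.
move=> /eigenvalueP[v vM v0].
have [j0 vj0] : exists j, v 0 j != 0.
  by apply/existsP; apply: contra_neqT v0 => /existsPn v0; apply/rowP => j; rewrite mxE; apply/eqP/negPn/v0.
have [j jmax] : exists j, forall k, normc (v 0 k) <= normc (v 0 j).
  by have [j _ jm] := @Order.TotalTheory.arg_maxP _ _ _ j0 xpredT (fun k => normc (v 0 k)) isT; exists j => k; exact: jm.
have vj : 0 < normc (v 0 j).
  apply: lt_le_trans (jmax j0); rewrite lt0r normc_ge0 andbT.
  by apply: contra vj0 => /eqP/eq0_normc ->.
rewrite -(ler_pM2r vj) -normcM.
have -> : x * v 0 j = \sum_k v 0 k * M k j.
  by have := congr1 (fun u : 'rV_n => u 0 j) vM; rewrite !mxE.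
apply: le_trans (le_normc_sum _ _ _) _; rewrite mulr_suml; apply: ler_sum => k _.
rewrite normcM mulrC; apply: ler_pM => //; try exact: normc_ge0.
by rewrite (bigD1 j)//= lerDl sumr_ge0// => i _; exact: normc_ge0.
Qed.

Lemma symbol_root_bound (G : zmodType) n (A : 'M[{group_ring R[i][G]}]_n) :
  exists M : R, 0 <= M /\ forall chi, is_character chi ->
    forall x, x \in spectrum_seq (symbol A chi) -> normc x <= M.
Proof.
exists (\sum_j \sum_k \sum_(h <- finsupp (A j k)) normc (A j k h)); split.
  by do 3 (apply: sumr_ge0 => ? _); exact: normc_ge0.
move=> chi chiP x; rewrite mem_spectrum_seq => /eigenvalue_le/le_trans; apply.
apply: ler_sum => j _; apply: ler_sum => k _; rewrite mxE.
apply: le_trans (le_normc_sum _ _ _) _; apply: ler_sum => h _.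
by rewrite normcM chiP.2 mulr1.
Qed.

Lemma horner_char_poly n (M : 'M[R[i]]_n) z :
  (char_poly M).[z] = \det (z%:M - M).
Proof.
rewrite horner_sum; apply: eq_bigr => s _.
rewrite hornerM horner_exp !hornerE; congr (_ * _).
rewrite (big_morph _ (fun p q => hornerM p q z) (hornerC 1 z)).
by apply: eq_bigr => i _; rewrite !mxE !(hornerE, hornerMn).
Qed.

Lemma rsq_normc (x z : R[i]) :
  rsq (complex.Re x) (complex.Im x) (to_plane z) = normc (z - x) ^+ 2.
Proof. by rewrite sqr_normc_ReIm !raddfB. Qed.

Lemma sqr_normc_det n (M : 'M[R[i]]_n) z :
  normc (\det (z%:M - M)) ^+ 2 =
  \prod_(x <- spectrum_seq M) rsq (complex.Re x) (complex.Im x) (to_plane z).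
Proof.
rewrite -horner_char_poly -spectrum_seqE horner_prod normc_prod -prodrXl.
by apply: eq_bigr => x _; rewrite rsq_normc hornerXsubC.
Qed.

End RootBound.

Section LogProduct.
Variable R : realType.
Local Notation mu2 := (@lebesgue_measure R \x @lebesgue_measure R)%E.

Lemma plane_seq_negligible (s : seq (R * R)) : mu2.-negligible [set z | z \in s].
Proof.
elim: s => [|p s IH].
  by rewrite (_ : [set z | _] = set0); [exact: negligible_set0|apply/seteqP; split].
rewrite (_ : [set z | _] = [set p] `|` [set z | z \in s]).
  apply: negligibleU => //; exists [set p]; split=> //.
  - exact: measurable_plane_point.
  - exact: plane_point_null.
apply/seteqP; split=> z /=; rewrite inE.
  by case/orP => [/eqP ->|?]; [left|right].
by case=> [->|->]; rewrite ?eqxx ?orbT.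
Qed.

Lemma one_plus_prod_le I (s : seq I) (F : I -> R) : (0 < size s)%N ->
  (forall i, 0 <= F i) -> 1 + \prod_(i <- s) F i <= \prod_(i <- s) (1 + F i).
Proof.
case: s => // i s _ F0; rewrite !big_cons.
elim: s i => [|j s IH] i; first by rewrite !big_nil !mulr1.
rewrite !big_cons.
have P0 : 0 <= \prod_(k <- s) F k by exact: prodr_ge0.
apply: le_trans (ler_wpM2l (_ : 0 <= 1 + F i) (IH j)); last by rewrite addr_ge0.
rewrite -subr_ge0; set P := \prod_(k <- s) F k in P0 *.
by rewrite (_ : _ - _ = F i + F j * P); [rewrite addr_ge0 ?mulr_ge0|ring].
Qed.

Lemma ln_prod I (s : seq I) (F : I -> R) : (forall i, 0 < F i) ->
  ln (\prod_(i <- s) F i) = \sum_(i <- s) ln (F i).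
Proof.
move=> F0; elim: s => [|i s IH]; first by rewrite !big_nil ln1.
by rewrite !big_cons lnM ?posrE ?IH// prodr_gt0.
Qed.

(* Off the roots, [1 + prod (k / r_j) <= prod (1 + k / r_j)]. *)
Lemma reg_log_prod (s : seq (R * R)) k z : (0 < size s)%N -> 0 < k ->
  (forall p, p \in s -> z != p) ->
  \sum_(p <- s) log_dist p.1 p.2 z <=
    2^-1 * ln (\prod_(p <- s) rsq p.1 p.2 z + k ^+ size s) /\
  2^-1 * ln (\prod_(p <- s) rsq p.1 p.2 z + k ^+ size s) <=
    \sum_(p <- s) log_dist p.1 p.2 z + \sum_(p <- s) defect p.1 p.2 k z.
Proof.
(* The value 1 off [s] makes [F] positive everywhere, as [ln_prod] demands. *)
move=> s0 k0 zs; pose F (p : R * R) := if p \in s then rsq p.1 p.2 z else 1.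
have F0 p : 0 < F p.
  rewrite /F; case: ifPn => // ps; rewrite lt0r rsq_ge0 andbT rsq_eq0.
  by rewrite -surjective_pairing zs.
rewrite -(eq_big_seq _ (_ : {in s, F =1 fun p => rsq p.1 p.2 z})); last by move=> p ps; rewrite /F ps.
rewrite (eq_big_seq (fun p => 2^-1 * ln (F p))); last by move=> p ps; rewrite /F ps.
rewrite (_ : \sum_(p <- s) defect _ _ _ _ = \sum_(p <- s) 2^-1 * ln (1 + k / F p)); last by
  apply: eq_big_seq; move=> p ps; rewrite /F ps.
rewrite -!mulr_sumr -mulrDr -!ln_prod//; last by move=> p; rewrite addr_gt0// divr_gt0.
have P0 : 0 < \prod_(p <- s) F p by exact: prodr_gt0.
have Q0 : 0 < \prod_(p <- s) (1 + k / F p) by apply: prodr_gt0 => p _; rewrite addr_gt0// divr_gt0.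
rewrite -lnM ?posrE// !ler_pM2l// !ler_ln ?posrE ?mulr_gt0 ?addr_gt0 ?exprn_gt0//.
split; first by rewrite lerDl exprn_ge0// ltW.
apply: le_trans (ler_wpM2l (ltW P0) (one_plus_prod_le (F := fun p => k / F p) s0 _)); last first.
  by move=> p; rewrite divr_ge0// ltW.
rewrite mulrDr mulr1 lerD2l -big_split/= (eq_bigr (fun=> k)); last first.
  by move=> p _; rewrite mulrC divfK// gt_eqF.
by rewrite big_const_seq count_predT iter_mulr_1.
Qed.

End LogProduct.

(** * Sums of a test function over the eigenvalues *)

Section EigenvalueSums.
Variables (R : realType) (G : zmodType) (f : R * R -> R).
Hypothesis tf : test_function f.
Local Notation mu2 := (@lebesgue_measure R \x @lebesgue_measure R)%E.
Local Notation L := (laplacian f).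

Let cL : continuous L. Proof. exact: laplacian_continuous. Qed.

(* [laplacian f] vanishes outside a square, so every continuous function is
   integrable against it. *)
Lemma test_integrable (h : R * R -> R) : continuous h ->
  mu2.-integrable [set: plane R] (EFin \o (fun z => h z * L z)).
Proof.
move=> ch; have [rho rho0 Hf] := test_support tf.
have ms : measurable (square 0 0 (rho + 0) : set (plane R)) by exact: measurable_box.
have n0 : `|0 : R| <= 0 by rewrite normr0.
rewrite (_ : EFin \o _ = (EFin \o (fun z => h z * L z)) \_ (square 0 0 (rho + 0))).
  apply/(integrable_mkcond _ ms); apply: continuous_box_integrable; exact: contM.
apply/funext => z; rewrite patchE; case: ifPn => // zs.
rewrite -[RHS]/(0%E); rewrite notin_setE in zs.
by rewrite /= (square_support n0 n0 Hf zs) mulr0.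
Qed.

Definition laplacian_pairing (h : R * R -> R) : R := \int[mu2]_z (h z * L z).
Local Notation J := laplacian_pairing.

Lemma laplacian_pairingD (h k : R * R -> R) : continuous h -> continuous k ->
  J (fun z => h z + k z) = J h + J k.
Proof.
move=> ch ck; rewrite /J -RintegralD//; [|exact: test_integrable..].
by apply: eq_Rintegral => z _; rewrite mulrDl.
Qed.

Lemma laplacian_pairingZ (c : R) (h : R * R -> R) : continuous h -> J (fun z => c * h z) = c * J h.
Proof.
move=> ch; rewrite /J -RintegralZl//; last exact: test_integrable.
by apply: eq_Rintegral => z _; rewrite mulrA.
Qed.

Lemma cont_sum I (r : seq I) (F : I -> R * R -> R) :
  (forall i, continuous (F i)) -> continuous (fun z => \sum_(i <- r) F i z).
Proof.
move=> cF; elim: r => [|i r IH].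
  by under eq_fun do rewrite big_nil; exact: cont_cst.
by under eq_fun do rewrite big_cons; exact: contD.
Qed.

Lemma laplacian_pairing_sum I (r : seq I) (F : I -> R * R -> R) :
  (forall i, continuous (F i)) ->
  J (fun z => \sum_(i <- r) F i z) = \sum_(i <- r) J (F i).
Proof.
move=> cF; elim: r => [|i r IH].
  rewrite big_nil -[RHS](mul0r (J (fun=> 0))) -laplacian_pairingZ; last exact: cont_cst.
  by congr J; apply/funext => z; rewrite big_nil mul0r.
rewrite big_cons -IH -laplacian_pairingD//; last exact: cont_sum.
by congr J; apply/funext => z; rewrite big_cons.
Qed.

(** Closeness is asked only where the Laplacian does not vanish, because the polynomials that
    approximate the logarithm do so on bounded sets only. *)
Lemma laplacian_pairing_le h k : continuous h -> continuous k ->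
  forall eta, (forall z, L z != 0 -> `|h z - k z| <= eta) ->
  `|J h - J k| <= eta * \int[mu2]_z `|L z|.
Proof.
move=> ch ck eta hk.
have ih := test_integrable ch; have ik := test_integrable ck.
have ihk : mu2.-integrable [set: plane R] (EFin \o (fun z => h z * L z - k z * L z)).
  rewrite (_ : EFin \o _ = fun z => ((h z * L z)%:E - (k z * L z)%:E)%E)//.
  exact: integrableB.
have iL : mu2.-integrable [set: plane R] (EFin \o (fun z => `|L z|)).
  have := integrable_abse (test_integrable (@cont_cst R 1)).
  by congr (_.-integrable _ _); apply/funext => z /=; rewrite mul1r.
rewrite /J -RintegralB// -RintegralZl//.
apply: le_trans (le_normr_Rintegral _ ihk) _ => //.
apply: le_Rintegral => //.
- exact: (integrable_abse ihk).
- rewrite (_ : EFin \o _ = fun z => (eta%:E * (`|L z|)%:E)%E)//; exact: integrableZl.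
move=> z _; rewrite -mulrBl normrM; have [->|Lz] := eqVneq (L z) 0.
  by rewrite normr0 !mulr0.
by rewrite ler_wpM2r// hk.
Qed.

Definition cont_coef (c : R * R -> R[i]) : Prop :=
  continuous (fun z => complex.Re (c z)) /\ continuous (fun z => complex.Im (c z)).

Lemma cont_coef_cst c : cont_coef (fun=> c).
Proof. by split; exact: cont_cst. Qed.

Lemma cont_coefM c d : cont_coef c -> cont_coef d -> cont_coef (fun z => c z * d z).
Proof.
move=> [c1 c2] [d1 d2]; split.
  rewrite (_ : (fun z => _) = fun z => complex.Re (c z) * complex.Re (d z)
     - complex.Im (c z) * complex.Im (d z)).
    by apply: contB; exact: contM.
  by apply/funext => z; case: (c z) (d z) => [? ?] [? ?].
rewrite (_ : (fun z => _) = fun z => complex.Re (c z) * complex.Im (d z)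
   + complex.Im (c z) * complex.Re (d z)).
  by apply: contD; exact: contM.
by apply/funext => z; case: (c z) (d z) => [? ?] [? ?].
Qed.

Lemma cont_coefJ c : cont_coef c -> cont_coef (fun z => (c z)^*%C).
Proof.
move=> [c1 c2]; split.
  by rewrite (_ : (fun z => _) = fun z => complex.Re (c z))//; apply/funext => z; case: (c z).
rewrite (_ : (fun z => _) = fun z => - complex.Im (c z)); first exact: contN.
by apply/funext => z; case: (c z).
Qed.

Lemma cont_coef_of_plane : cont_coef (@of_plane R).
Proof. by split; [exact: cont_fst|exact: cont_snd]. Qed.

Local Notation trig := (@trig_poly R G (R * R) cont_coef).

Let trC := @trig_cst R G _ cont_coef cont_coef_cst.
Let trD := @trigD R G _ cont_coef.
Let trM := @trigM R G _ cont_coef cont_coefM.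

Lemma trig_det n (A : 'M[{group_ring R[i][G]}]_n) :
  trig (fun p => \det ((of_plane p.1)%:M - symbol A p.2)).
Proof.
apply: (closed_family_det (S := trig) trC trD trM) => i j.
rewrite (_ : (fun p => _) = (fun p => of_plane p.1 * (i == j)%:R + (-1) * symbol A p.2 i j)).
  apply: trD; apply: trM.
  - exact: (@trig_coef R G _ cont_coef _ cont_coef_of_plane).
  - exact: trC.
  - exact: trC.
  - exact: (trig_symbol cont_coef_cst cont_coefM).
by apply/funext => p; rewrite [LHS]mxE [X in X + _]mxE [X in _ + X]mxE mulr_natr mulN1r.
Qed.

Lemma trig_sqr_normc Phi : trig Phi -> trig (fun p => (normc (Phi p) ^+ 2)%:C%C).
Proof.
move=> tP; rewrite (_ : (fun p => _) = fun p => Phi p * (Phi p)^*%C).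
  by apply: trM => //; exact: (trigJ cont_coefJ).
by apply/funext => p; rewrite mulc_conj.
Qed.

(* The [c i] are the integrals of the coefficients against [laplacian f]. *)
Lemma trig_pairing (Phi : (R * R) * (G -> R[i]) -> R) : trig (fun p => (Phi p)%:C%C) ->
  exists (I : finType) (c : I -> R[i]) (g : I -> G), forall chi, is_character chi ->
    continuous (fun z => Phi (z, chi)) /\
    J (fun z => Phi (z, chi)) = complex.Re (\sum_i c i * chi (g i)).
Proof.
move=> [I [c [g [cc PhiE]]]].
exists I, (fun i => (J (fun z => complex.Re (c i z)) +i* J (fun z => complex.Im (c i z)))%C), g.
move=> chi chiP.
pose F i z := complex.Re (chi (g i)) * complex.Re (c i z) +
  (- complex.Im (chi (g i))) * complex.Im (c i z).
have cF i : continuous (F i).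
  by apply: contD; apply: contM; (try exact: cont_cst); case: (cc i).
have E : (fun z => Phi (z, chi)) = (fun z => \sum_i F i z).
  apply/funext => z; rewrite -[LHS]/(complex.Re (Phi (z, chi))%:C%C) PhiE// raddf_sum.
  by apply: eq_bigr => i _; rewrite /F; case: (c i z) (chi (g i)) => [a b] [a' b'] /=; ring.
rewrite E; split; first exact: cont_sum.
rewrite laplacian_pairing_sum// raddf_sum; apply: eq_bigr => i _.
rewrite laplacian_pairingD; [|apply: contM; (try exact: cont_cst); by case: (cc i)..].
rewrite !laplacian_pairingZ; [|by case: (cc i)..].
by case: (chi (g i)) => [a' b'] /=; ring.
Qed.

Variables (n : nat) (A : 'M[{group_ring R[i][G]}]_n).
Hypothesis n0 : (0 < n)%N.

Definition eigenvalue_sum (chi : G -> R[i]) : R :=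
  \sum_(x <- spectrum_seq (symbol A chi)) f (to_plane x).

Let pts chi := [seq to_plane x | x <- spectrum_seq (symbol A chi)].

Lemma sqr_normc_det_points chi z :
  normc (\det ((of_plane z)%:M - symbol A chi)) ^+ 2 = \prod_(p <- pts chi) rsq p.1 p.2 z.
Proof. by rewrite sqr_normc_det /pts big_map; case: z. Qed.

Let Fd d chi (z : R * R) : R :=
  2^-1 * ln (normc (\det ((of_plane z)%:M - symbol A chi)) ^+ 2 + d).

Lemma sqr_normc_det_continuous chi : is_character chi ->
  continuous (fun z => normc (\det ((of_plane z)%:M - symbol A chi)) ^+ 2).
Proof.
move=> chiP; have [I [c [g H]]] := trig_pairing (trig_sqr_normc (trig_det A)).
by have [] := H chi chiP.
Qed.

Let Fd_continuous d chi : 0 < d -> is_character chi -> continuous (Fd d chi).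
Proof.
move=> d0 chiP; apply: contM; first exact: cont_cst.
apply: cont_ln => [z|]; first by rewrite ltr_wpDl// sqr_ge0.
by apply: contD; [exact: sqr_normc_det_continuous|exact: cont_cst].
Qed.

Lemma regularized_eigenvalue_sum : exists C : R, 0 <= C /\ forall d chi,
  0 < d -> d <= 1 -> is_character chi ->
  `|J (Fd ((d ^+ 2) ^+ n) chi) - 2 * pi * eigenvalue_sum chi| <= C * d.
Proof.
have [M [M0 HM]] := symbol_root_bound A.
have [C [C0 HC]] := log_potential tf M0.
exists (n%:R * C); split=> [|d chi d0 d1 chiP]; first by rewrite mulr_ge0.
have k0 : 0 < d ^+ 2 by rewrite exprn_gt0.
have kn0 : 0 < (d ^+ 2) ^+ n by rewrite exprn_gt0.
have ps p : p \in pts chi -> `|p.1| <= M /\ `|p.2| <= M.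
  move=> /mapP[x xs ->]; split; apply: le_trans (HM chi chiP x xs).
  - exact: Re_le_normc.
  - exact: Im_le_normc.
have sz : size (pts chi) = n by rewrite size_map size_spectrum_seq.
pose S z := \sum_(p <- pts chi) log_dist p.1 p.2 z.
have SL : mu2.-integrable [set: plane R] (EFin \o (fun z => S z * L z)) /\
    \int[mu2]_z (S z * L z) = 2 * pi * eigenvalue_sum chi.
  rewrite /S (_ : eigenvalue_sum chi = \sum_(p <- pts chi) f (p.1, p.2)); last first.
    by rewrite /eigenvalue_sum /pts big_map.
  elim: (pts chi) ps => [|p s IH] ps.
    rewrite (_ : (fun z => _) = fun=> 0); last by apply/funext => z; rewrite big_nil mul0r.
    split; first exact: integrable0.
    by rewrite big_nil mulr0 /Rintegral integral0.
  have [|i1 e1] := IH; first by move=> q qs; apply: ps; rewrite inE qs orbT.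
  have [p1 p2] := ps p (mem_head _ _); have [i2 _ _ e2] := HC _ _ p1 p2.
  rewrite (_ : (fun z => _) = fun z => log_dist p.1 p.2 z * L z +
     (\sum_(q <- s) log_dist q.1 q.2 z) * L z); last first.
    by apply/funext => z; rewrite big_cons mulrDl.
  split.
    rewrite (_ : EFin \o _ = (EFin \o (fun z => log_dist p.1 p.2 z * L z)) \+
       (EFin \o (fun z => (\sum_(q <- s) log_dist q.1 q.2 z) * L z)))//.
    exact: integrableD.
  by rewrite RintegralD// e1 big_cons [RHS]mulrDr; congr (_ + _); rewrite /Rintegral e2.
have [iS eS] := SL.
have iF := test_integrable (Fd_continuous kn0 chiP).
rewrite -eS /J -RintegralB//.
have iD : mu2.-integrable [set: plane R] (EFin \o (fun z => Fd ((d ^+ 2) ^+ n) chi z * L z - S z * L z)).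
  rewrite (_ : EFin \o _ = fun z => ((Fd ((d ^+ 2) ^+ n) chi z * L z)%:E - (S z * L z)%:E)%E)//.
  exact: integrableB.
apply: le_trans (le_normr_Rintegral _ iD) _ => //.
rewrite -lee_fin /Rintegral fineK; last by apply: integrable_fin_num => //; exact: integrable_abse iD.
have mDef p : measurable_fun [set: plane R] (fun z => (defect p.1 p.2 (d ^+ 2) z * `|L z|)%:E).
  apply/measurable_EFinP; apply: measurable_funM; first exact: measurable_defect.
  by apply: (measurableT_comp (@normr_measurable R setT)); exact: continuous_measurable_plane.
have Def0 p z : (0 <= (defect p.1 p.2 (d ^+ 2) z * `|L z|)%:E)%E.
  by rewrite lee_fin mulr_ge0// defect_ge0// ltW.
apply: (@le_trans _ _ (\int[mu2]_z \sum_(p <- pts chi) (defect p.1 p.2 (d ^+ 2) z * `|L z|)%:E)%E).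
  apply: ae_ge0_le_integral => //.
  - by have /integrableP[] := integrable_abse iD.
  - by move=> z _; exact: sume_ge0.
  - exact: emeasurable_sum.
  - have [N [mN N0 sN]] := plane_seq_negligible (pts chi).
    exists N; split=> // z /= h; apply: sN => /=; apply/negPn/negP => zs; apply: h => _.
    rewrite sumEFin lee_fin -mulr_suml -mulrBl normrM ler_wpM2r//.
    have zp p : p \in pts chi -> z != p by apply: contraTneq => <-.
    have pts0 : (0 < size (pts chi))%N by rewrite sz.
    have := reg_log_prod pts0 k0 zp; rewrite -/(S z) sz -sqr_normc_det_points.
    rewrite -[_ * ln _]/(Fd _ _ _) => -[h1 h2].
    by rewrite ger0_norm ?subr_ge0// lerBlDl.
rewrite ge0_integral_sum//.
apply: (@le_trans _ _ (\sum_(p <- pts chi) (C * d)%:E)%E).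
  rewrite big_seq [leRHS]big_seq; apply: lee_sum => p /ps[p1 p2].
  by have [_ _ h _] := HC _ _ p1 p2; exact: h.
by rewrite sumEFin lee_fin big_const_seq count_predT sz iter_addr_0 -mulrA mulr_natl.
Qed.

(** On the support |det|^2 takes values y in [0, X], with [X] independent of the character. Then y +
    delta = (X + delta)(1 - w) with 0 <= w <= r < 1, and the truncated logarithmic series in w is a
    polynomial in |det|^2, hence a trigonometric polynomial in the character. *)
Lemma eigenvalue_sum_approx e : 0 < e ->
  exists (I : finType) (c : I -> R[i]) (g : I -> G), forall chi, is_character chi ->
    `|eigenvalue_sum chi - complex.Re (\sum_i c i * chi (g i))| <= e.
Proof.
move=> e0; have [C [C0 HC]] := regularized_eigenvalue_sum.
have [M [M0 HM]] := symbol_root_bound A.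
have [rho rho0 Hf] := test_support tf.
have pi0 : 0 < pi :> R by exact: pi_gt0.
(* The regularization and the truncation share the error 2 pi e equally: [d] ensures that C d <= e
   pi, and [eta] below plays the same role for the series. *)
pose d := Num.min 1 (e * pi / (C + 1)).
have C1 : 0 < C + 1 by rewrite ltr_wpDl.
have d0 : 0 < d by rewrite lt_min ltr01 !mulr_gt0// invr_gt0.
have d1 : d <= 1 by rewrite ge_min lexx.
have Cd : C * d <= e * pi.
  apply: (@le_trans _ _ ((C + 1) * d)); first by rewrite ler_wpM2r ?(ltW d0)// lerDl.
  by rewrite mulrC -ler_pdivlMr// ge_min lexx orbT.
pose delta := (d ^+ 2) ^+ n; have delta0 : 0 < delta by rewrite !exprn_gt0.
pose X := (((rho + M) ^+ 2) *+ 2) ^+ n.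
have X0 : 0 <= X by rewrite exprn_ge0// mulrn_wge0// sqr_ge0.
have Xd : 0 < X + delta by rewrite ltr_wpDl.
pose N1 := \int[mu2]_z `|L z|.
have N10 : 0 <= N1 by apply: Rintegral_ge0.
pose eta := e * pi / (N1 + 1); have eta0 : 0 < eta by rewrite !mulr_gt0// invr_gt0 ltr_wpDl.
pose r := X / (X + delta).
have r0 : 0 <= r by rewrite divr_ge0// ltW.
have r1 : r < 1 by rewrite ltr_pdivrMr// mul1r ltrDl.
have [m Hm] := geometric_small r0 r1 (mulr_gt0 (ltr0Sn _ 1) eta0).
pose Q (x : R) := 2^-1 * (ln (X + delta) - \sum_(j < m) ((X - x) / (X + delta)) ^+ j.+1 / j.+1%:R).
pose x (p : (R * R) * (G -> R[i])) := normc (\det ((of_plane p.1)%:M - symbol A p.2)) ^+ 2.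
have tx : trig (fun p => (x p)%:C%C) by exact: (trig_sqr_normc (trig_det A)).
have tQ : trig (fun p => (Q (x p))%:C%C).
  have realM a b : ((a * b)%:C = a%:C * b%:C :> R[i])%C by exact: rmorphM.
  pose W p := ((X + delta)^-1)%:C%C * (X%:C%C + (-1) * (x p)%:C%C) : R[i].
  have tW : trig W by apply: trM; [exact: trC|apply: trD; [exact: trC|apply: trM => //; exact: trC]].
  rewrite (_ : (fun p => _) = fun p => (2^-1)%:C%C * ((ln (X + delta))%:C%C +
      \sum_(j < m) (- (j.+1%:R)^-1)%:C%C * W p ^+ j.+1)).
    apply: trM; first exact: trC.
    apply: trD; first exact: trC.
    apply: (closed_family_sum (S := trig) trC trD) => j _.
    by apply: trM; [exact: trC|exact: (closed_family_exp (S := trig) trC trM)].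
  apply/funext => p; rewrite /Q realM; congr (_ * _).
  rewrite rmorphB /= -[X in _ = _ + X]opprK -[X in _ = _ - X]sumrN; congr (_ - _).
  rewrite rmorph_sum; apply: eq_bigr => j _ /=.
  rewrite [LHS]realM [LHS]mulrC -[RHS]mulNr; congr (_ * _).
    by rewrite -(rmorphN (real_complex R)) opprK.
  rewrite rmorphXn /=; congr (_ ^+ _).
  by rewrite /W mulrC realM mulN1r rmorphB.
have [I [c [g Hc]]] := trig_pairing tQ.
exists I, (fun i => ((2 * pi)^-1)%:C%C * c i), g => chi chiP.
have [cQ JQ] := Hc chi chiP.
have h1 := HC d chi d0 d1 chiP; rewrite -/delta in h1.
have h2 : `|J (Fd delta chi) - J (fun z => Q (x (z, chi)))| <= e * pi.
  apply: le_trans (laplacian_pairing_le (Fd_continuous delta0 chiP) cQ (eta := eta) _) _; last first.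
    rewrite -/N1 /eta mulrAC ler_pdivrMr; last by rewrite ltr_wpDl.
    by rewrite ler_pM2l ?mulr_gt0// lerDl.
  move=> z Lz.
  have zr : `|z.1| <= rho /\ `|z.2| <= rho.
    split; rewrite leNgt; apply/negP => zr; case/eqP: Lz; case: z zr => a b /= zr;
      rewrite /laplacian !Hf ?addr0//; [left|left|right|right]; exact: ltW.
  pose y := x (z, chi).
  have yX : 0 <= y <= X.
    rewrite sqr_ge0/= /y /x sqr_normc_det_points /X.
    have -> : ((rho + M) ^+ 2 *+ 2) ^+ n = \prod_(p <- pts chi) ((rho + M) ^+ 2 *+ 2).
      by rewrite big_const_seq count_predT iter_mulr_1 size_map size_spectrum_seq.
    rewrite big_seq [leRHS]big_seq; apply: ler_prod => p /mapP[u us ->].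
    rewrite rsq_ge0/= /rsq mulr2n.
    have sq (a b : R) : `|a| <= rho -> `|b| <= M -> (a - b) ^+ 2 <= (rho + M) ^+ 2.
      move=> a1 b1; rewrite -real_normK ?num_real// lerXn2r ?nnegrE ?addr_ge0 ?(ltW rho0)//.
      by apply: le_trans (ler_normB _ _) (lerD a1 b1).
    have un := HM chi chiP u us.
    by apply: lerD; apply: sq; rewrite ?(proj1 zr) ?(proj2 zr)//; apply: le_trans un; [exact: Re_le_normc|exact: Im_le_normc].
  case/andP: yX => y0 yX.
  rewrite /Fd -[normc _ ^+ 2]/y /Q -/y.
  pose w := (X - y) / (X + delta).
  have wr : `|w| <= r.
    rewrite ger0_norm; last by rewrite divr_ge0 ?subr_ge0// ltW.
    by rewrite ler_wpM2r ?invr_ge0 ?(ltW Xd)// gerBl.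
  have -> : y + delta = (X + delta) * (1 - w) by rewrite /w; field; rewrite gt_eqF.
  have w1 : 0 < 1 - w by rewrite subr_gt0 (le_lt_trans (le_trans (ler_norm w) wr)).
  rewrite lnM ?posrE// -mulrBr normrM gtr0_norm// opprB addrA [X in X - _]addrAC -addrA.
  rewrite [X in `|X|]addrAC subrr add0r addrC.
  rewrite mulrC ler_pdivrMr//; apply: le_trans (log_series_bound m r0 r1 wr) _.
  by rewrite (mulrC eta).
have pi2 : 0 < 2 * pi :> R by rewrite mulr_gt0.
have -> : complex.Re (\sum_i (((2 * pi)^-1)%:C%C * c i) * chi (g i)) =
    J (fun z => Q (x (z, chi))) / (2 * pi).
  rewrite JQ (eq_bigr (fun i => ((2 * pi)^-1)%:C%C * (c i * chi (g i)))); last first.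
    by move=> i _; rewrite mulrA.
  rewrite -mulr_sumr; case: (\sum_i _) => [a b] /=; ring.
rewrite -(ler_pM2l pi2) -[X in X * `|_|]gtr0_norm// -normrM mulrBr [X in _ - X]mulrC divfK ?gt_eqF//.
apply: le_trans (ler_distD (J (Fd delta chi)) _ _) _.
rewrite distrC; apply: le_trans (lerD (le_trans h1 Cd) h2) _.
by rewrite le_eqVlt; apply/orP; left; apply/eqP; ring.
Qed.

End EigenvalueSums.

(** * Smooth functions on the line and tensor products *)

Section SmoothLine.
Variable R : realType.
Implicit Types (g h : R -> R) (x y : R).

(* Infinite differentiability as membership in a class of functions closed
   under derivation, so that closure properties need no iterated derivatives. *)
Definition smooth_line g : Prop := exists2 S : set (R -> R), S g &
  forall h, S h -> exists2 h', S h' & forall x, is_derive x (1 : R) h (h' x).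

Lemma smooth_line_derive g : smooth_line g ->
  exists2 g', smooth_line g' & forall x, is_derive x (1 : R) g (g' x).
Proof.
by move=> [S Sg HS]; have [g' Sg' dg] := HS g Sg; exists g' => //; exists S.
Qed.

Lemma smooth_line_continuous g : smooth_line g -> continuous g.
Proof. by move=> /smooth_line_derive[g' _ dg]; exact: is_derive_continuous dg. Qed.

Lemma smooth_line_cst (c : R) : smooth_line (fun=> c).
Proof.
exists [set h | exists c, h = fun=> c]; first by exists c.
by move=> _ [d ->]; exists (fun=> 0); [exists 0|move=> x; exact: is_derive_cst].
Qed.

Lemma smooth_lineD g h : smooth_line g -> smooth_line h -> smooth_line (fun x => g x + h x).
Proof.
move=> sg sh; exists [set u | exists a b, [/\ smooth_line a, smooth_line b & u = fun x => a x + b x]].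
  by exists g, h.
move=> _ [a [b [sa sb ->]]].
have [a' sa' da] := smooth_line_derive sa; have [b' sb' db] := smooth_line_derive sb.
by exists (fun x => a' x + b' x) => [|x]; [exists a', b'|exact: is_deriveD].
Qed.

(** Single products are not stable under derivation, but finite sums of products of smooth functions
    are, by the Leibniz rule. *)
Lemma smooth_lineM g h : smooth_line g -> smooth_line h -> smooth_line (fun x => g x * h x).
Proof.
move=> sg sh.
pose S (u : R -> R) := exists l : seq ((R -> R) * (R -> R)),
  (forall p, List.In p l -> smooth_line p.1 /\ smooth_line p.2) /\
  u = fun x => \sum_(p <- l) p.1 x * p.2 x.
exists S.
  exists [:: (g, h)]; split; first by move=> p [<-|[]].
  by apply/funext => x; rewrite big_seq1.
move=> _ [l [sl ->]]; elim: l sl => [|[a b] l IH] sl.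
  exists (fun=> 0); first by exists [::]; split=> //; apply/funext => x; rewrite big_nil.
  by move=> x; under eq_fun do rewrite big_nil; exact: is_derive_cst.
have [/= sa sb] := sl (a, b) (or_introl erefl).
have [a' sa' da] := smooth_line_derive sa; have [b' sb' db] := smooth_line_derive sb.
have [|h' [l' [sl' ->]] dh'] := IH; first by move=> p pl; apply: sl; right.
exists (fun x => \sum_(p <- [:: (a', b), (a, b') & l']) p.1 x * p.2 x).
  by exists [:: (a', b), (a, b') & l']; split=> // p [<-|[<-|/sl'//]].
move=> x; under eq_fun do rewrite big_cons.
rewrite !big_cons /= addrA.
have := is_deriveD (is_deriveM (da x) (db x)) (dh' x).
by move/is_derive_eq; apply; rewrite /GRing.scale/=; ring.
Qed.

Lemma smooth_line_affine g (k c : R) : smooth_line g -> smooth_line (fun x => g (k * x + c)).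
Proof.
move=> sg; exists [set u | exists a (d : R), smooth_line a /\ u = fun x => d * a (k * x + c)].
  by exists g, 1; split=> //; apply/funext => x; rewrite mul1r.
move=> _ [a [d [sa ->]]]; have [a' sa' da] := smooth_line_derive sa.
exists (fun x => d * k * a' (k * x + c)); first by exists a', (d * k).
move=> x.
have dk : is_derive x (1 : R) (fun t : R => k * t + c) k.
  by apply: is_derive_eq; rewrite /GRing.scale/= ?addr0 ?mulr1; ring.
have := @is_derive1_comp R a (fun t => k * t + c) x _ _ (da (k * x + c)) dk.
move=> dc; have := is_deriveZ d dc; move/is_derive_eq; apply.
by rewrite /GRing.scale/=; ring.
Qed.

(** The stable class consists of the quotients a / h^m, whose derivatives are (a' h - m a h') /
    h^(m+1). *)
Lemma smooth_line_div g h : smooth_line g -> smooth_line h -> (forall x, 0 < h x) ->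
  smooth_line (fun x => g x / h x).
Proof.
move=> sg sh h0; have [h' sh' dh] := smooth_line_derive sh.
exists [set u | exists a m, smooth_line a /\ u = fun x => a x * (h x)^-1 ^+ m].
  by exists g, 1%N.
move=> _ [a [m [sa ->]]]; have [a' sa' da] := smooth_line_derive sa.
exists (fun x => (a' x * h x + (- m%:R) * (a x * h' x)) * (h x)^-1 ^+ m.+1).
  exists (fun x => a' x * h x + (- m%:R) * (a x * h' x)), m.+1; split=> //.
  apply: smooth_lineD; first exact: smooth_lineM.
  by apply: smooth_lineM; [exact: smooth_line_cst|exact: smooth_lineM].
move=> x; have hx : h x != 0 by rewrite gt_eqF.
have di : is_derive x (1 : R) (fun t => (h t)^-1) (- (h x)^-1 ^+ 2 * h' x).
  have := @is_deriveV R h x _ _ hx (dh x).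
  by move/is_derive_eq; apply; rewrite /GRing.scale/= exprVn.
have dp k : is_derive x (1 : R) (fun t => (h t)^-1 ^+ k) (- k%:R * h' x * (h x)^-1 ^+ k.+1).
  elim: k => [|k IH]; first by rewrite mulr0n oppr0 !mul0r; exact: is_derive_cst.
  under eq_fun do rewrite exprS.
  have := is_deriveM di IH; move/is_derive_eq; apply.
  by rewrite /GRing.scale/= -[k.+1%:R]natr1 !exprS expr0; ring.
have := is_deriveM (da x) (dp m); move/is_derive_eq; apply.
by rewrite /GRing.scale/= !exprS; field.
Qed.

(** The usual flat function is the case [q = 1]; letting the polynomial vary makes the class stable
    under derivation. *)
Definition flat_exp (q : {poly R}) x : R :=
  if 0 < x then q.[x^-1] * expR (- x^-1) else 0.

(** From exp y >= (y / k)^k, where [k] exceeds the size of [q] by two so as to absorb the factor y^2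
    as well. *)
Lemma horner_le_exp (q : {poly R}) : exists C : R, forall y, 1 <= y ->
  `|q.[y]| * expR (- y) * y ^+ 2 <= C.
Proof.
pose k := (size q).+2; pose C0 : R := \sum_(i < size q) `|q`_i|.
have C00 : 0 <= C0 by exact: sumr_ge0.
exists (C0 * k%:R ^+ k) => y y1; have y0 : 0 < y := lt_le_trans ltr01 y1.
have q1 : `|q.[y]| <= C0 * y ^+ size q.
  rewrite horner_coef; apply: le_trans (ler_norm_sum _ _ _) _.
  rewrite mulr_suml; apply: ler_sum => i _; rewrite normrM ler_wpM2l//.
  by rewrite normrX gtr0_norm// ler_weXn2l// ltnW.
have k0 : 0 < k%:R :> R by rewrite ltr0n.
have e1 : y ^+ k <= k%:R ^+ k * expR y.
  have -> : expR y = expR (y / k%:R) ^+ k.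
    by rewrite -expRM_natl mulrC divfK// gt_eqF.
  rewrite -exprMn lerXn2r ?nnegrE ?mulr_ge0 ?expR_ge0 ?(ltW y0)//.
  rewrite -ler_pdivrMl// mulrC; apply: le_trans (expR_ge1Dx _).
  by rewrite lerDr.
rewrite mulrAC; apply: (@le_trans _ _ (C0 * y ^+ k * expR (- y))).
  rewrite ler_wpM2r ?expR_ge0//.
  apply: le_trans (ler_wpM2r _ q1) _; first by rewrite sqr_ge0.
  by rewrite -mulrA -exprD addn2.
rewrite -mulrA ler_wpM2l// expRN ler_pdivrMr ?expR_gt0//.
Qed.

Lemma is_derive_flat0 g (C : R) : g 0 = 0 -> 0 <= C ->
  (forall t, `|t| <= 1 -> `|g t| <= C * t ^+ 2) -> is_derive (0 : R) (1 : R) g 0.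
Proof.
move=> g0 C0 Hg.
have cv : t^-1 *: (g (t *: (1 : R) + 0) - g 0) @[t --> 0^'] --> (0 : R).
  apply/cvgrPdist_le => e e0; near=> t.
  rewrite sub0r normrN addr0 g0 subr0 /GRing.scale/= mulr1.
  have t0 : t != 0 by near: t; exact: nbhs_dnbhs_neq.
  have t1 : `|t| <= Num.min 1 (e / (C + 1)).
    near: t; apply: dnbhs0_le; rewrite lt_min ltr01 divr_gt0//.
    by rewrite ltr_wpDl.
  move: t1; rewrite le_min => /andP[t1 te].
  rewrite normrM normfV mulrC ler_pdivrMr ?normr_gt0//.
  apply: le_trans (Hg t t1) _; rewrite -(real_normK (num_real t)) expr2 mulrA ler_wpM2r//.
  apply: le_trans (ler_wpM2l C0 te) _; rewrite mulrCA ger_pMr// ler_pdivrMr ?mul1r ?lerDl//.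
  by rewrite ltr_wpDl.
by split; [apply/cvg_ex; exists 0|exact: (cvg_lim _ cv)].
Unshelve. all: by end_near. Qed.

Lemma is_derive_flat_exp q x :
  is_derive x (1 : R) (flat_exp q) (flat_exp ('X^2 * (q - q^`())) x).
Proof.
have [x0|x0|->] := ltgtP x 0.
- rewrite /flat_exp [in X in is_derive _ _ _ X]ltNge (ltW x0)/=.
  apply: near_eq_is_derive (is_derive_cst (0 : R) x (1 : R)).
  near=> t; rewrite ltNge (_ : t <= 0)//; near: t; exact: lt_le_nbhsl.
- have xn : x != 0 by rewrite gt_eqF.
  rewrite {2}/flat_exp x0.
  have di : is_derive x (1 : R) (fun t : R => t^-1) (- x^-1 ^+ 2).
    have := @is_deriveV R id x _ _ xn (is_derive_id x (1 : R)).
    by move/is_derive_eq; apply; rewrite /GRing.scale/= mulr1 exprVn.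
  have dq : is_derive x (1 : R) (fun t : R => q.[t^-1]) (q^`().[x^-1] * (- x^-1 ^+ 2)).
    have dp : is_derive (x^-1) (1 : R) (fun t => q.[t]) (q^`().[x^-1]).
      exact: is_derive_poly.
    exact: (@is_derive1_comp R (fun t => q.[t]) (fun t : R => t^-1) x _ _ dp di).
  have de : is_derive x (1 : R) (fun t : R => expR (- t^-1)) (expR (- x^-1) * x^-1 ^+ 2).
    have dn : is_derive x (1 : R) (fun t : R => - t^-1) (x^-1 ^+ 2).
      by have := is_deriveN di; rewrite opprK.
    exact: (@is_derive1_comp R (@expR R) (fun t : R => - t^-1) x _ _ (is_derive_expR _) dn).
  have dm : is_derive x (1 : R) (fun t : R => q.[t^-1] * expR (- t^-1))
      (('X^2 * (q - q^`())).[x^-1] * expR (- x^-1)).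
    have := is_deriveM dq de; move/is_derive_eq; apply.
    by rewrite /GRing.scale/= hornerM hornerXn hornerD hornerN; ring.
  apply: near_eq_is_derive dm; near=> t.
  by rewrite /flat_exp (_ : 0 < t)//; near: t; exact: lt_nbhsr.
- rewrite [X in is_derive _ _ _ X](_ : _ = 0); last by rewrite /flat_exp ltxx.
  have [C HC] := horner_le_exp q.
  have C0 : 0 <= C by apply: le_trans (HC 1 (lexx _)); rewrite !mulr_ge0 ?expR_ge0.
  apply: (@is_derive_flat0 _ C) => //; first by rewrite /flat_exp ltxx.
  move=> t t1; rewrite /flat_exp; case: ifPn => t0; last first.
    by rewrite normr0 mulr_ge0// sqr_ge0.
  have tn : t != 0 by rewrite gt_eqF.
  have := HC (t^-1); rewrite normrM (gtr0_norm (expR_gt0 _)) exprVn ler_pdivrMr ?exprn_gt0//; apply.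
  by rewrite invf_ge1// (le_trans (ler_norm t)).
Unshelve. all: by end_near. Qed.

Lemma smooth_line_flat_exp q : smooth_line (flat_exp q).
Proof.
exists [set u | exists q, u = flat_exp q]; first by exists q.
move=> _ [p ->]; exists (flat_exp ('X^2 * (p - p^`()))); first by eexists.
exact: is_derive_flat_exp.
Qed.

Definition smooth_step x : R :=
  flat_exp 1 x / (flat_exp 1 x + flat_exp 1 (1 - x)).

Lemma flat_exp1_ge0 x : 0 <= flat_exp 1 x.
Proof. by rewrite /flat_exp; case: ifP => // _; rewrite hornerC mul1r expR_ge0. Qed.

Lemma flat_exp1_gt0 x : 0 < x -> 0 < flat_exp 1 x.
Proof. by move=> x0; rewrite /flat_exp x0 hornerC mul1r expR_gt0. Qed.

Lemma flat_exp1_mono x y : x <= y -> flat_exp 1 x <= flat_exp 1 y.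
Proof.
move=> xy; have [x0|x0] := ltP 0 x; last by rewrite {1}/flat_exp ltNge x0 flat_exp1_ge0.
have y0 := lt_le_trans x0 xy.
by rewrite /flat_exp x0 y0 !hornerC !mul1r ler_expR lerN2 lef_pV2 ?posrE.
Qed.

Lemma step_denominator_gt0 x : 0 < flat_exp 1 x + flat_exp 1 (1 - x).
Proof.
have [x0|x0] := ltP 0 x; first by rewrite ltr_pwDl ?flat_exp1_gt0 ?flat_exp1_ge0.
by rewrite ltr_wpDl ?flat_exp1_ge0// flat_exp1_gt0// subr_gt0 (le_lt_trans x0).
Qed.

Lemma smooth_step_smooth : smooth_line smooth_step.
Proof.
have s1 : smooth_line (fun x => flat_exp 1 (1 - x)).
  rewrite (_ : (fun x => _) = fun x => flat_exp 1 (-1 * x + 1)).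
    exact: smooth_line_affine (smooth_line_flat_exp 1).
  by apply/funext => x; rewrite mulN1r addrC.
apply: smooth_line_div; [exact: smooth_line_flat_exp| |exact: step_denominator_gt0].
by apply: smooth_lineD => //; exact: smooth_line_flat_exp.
Qed.

Lemma smooth_step0 x : x <= 0 -> smooth_step x = 0.
Proof. by move=> x0; rewrite /smooth_step {1}/flat_exp ltNge x0 mul0r. Qed.

Lemma smooth_step1 x : 1 <= x -> smooth_step x = 1.
Proof.
move=> x1; rewrite /smooth_step [X in _ + X](_ : _ = 0) ?addr0.
  by rewrite divff// gt_eqF// flat_exp1_gt0// (lt_le_trans ltr01).
by rewrite /flat_exp subr_gt0 ltNge x1.
Qed.

Lemma smooth_step_mono x y : x <= y -> smooth_step x <= smooth_step y.
Proof.
move=> xy; rewrite /smooth_step ler_pdivrMr ?step_denominator_gt0//.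
rewrite mulrAC ler_pdivlMr ?step_denominator_gt0//.
rewrite !mulrDr [X in X + _ <= _]mulrC lerD2l; apply: ler_pM; rewrite ?flat_exp1_ge0//.
  exact: flat_exp1_mono.
by apply: flat_exp1_mono; rewrite lerD2l lerN2.
Qed.

Lemma smooth_step_ge0 x : 0 <= smooth_step x.
Proof. by rewrite divr_ge0 ?flat_exp1_ge0// ltW// step_denominator_gt0. Qed.

End SmoothLine.

Section TensorTest.
Variable R : realType.

(** Partial derivatives of such products are products of the same kind, so that smoothness on the
    plane reduces to smoothness on the line. *)
Definition tensor (g h : R -> R) (z : R * R) : R := g z.1 * h z.2.

Lemma tensor_partial g h : smooth_line g -> smooth_line h -> forall b : bool,
  exists g' h', [/\ smooth_line g', smooth_line h', partial b (tensor g h) = tensor g' h'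
    & forall z, derivable (tensor g h) z (if b then (0, 1) else (1, 0))].
Proof.
move=> sg sh b.
have [g' sg' dg] := smooth_line_derive sg; have [h' sh' dh] := smooth_line_derive sh.
have dx x y : is_derive (x, y) ((1, 0) : R * R) (tensor g h) (g' x * h y).
  have E : (fun t => t^-1 *: (tensor g h (t *: (1, 0) + (x, y)) - tensor g h (x, y))) =
    (fun t : R => t^-1 *: (g (t *: (1 : R) + x) * h y - g x * h y)).
    apply/funext => t; rewrite /tensor /=; congr (_ *: (_ - _)).
    by rewrite /GRing.scale/= mulr0 add0r.
  have := is_deriveM (dg x) (is_derive_cst (h y) x (1 : R)).
  move=> [D1 D2]; split; first by rewrite /derivable E.
  by rewrite /derive E; move: D2; rewrite /derive => ->; rewrite /GRing.scale/=; ring.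
have dy x y : is_derive (x, y) ((0, 1) : R * R) (tensor g h) (g x * h' y).
  have E : (fun t => t^-1 *: (tensor g h (t *: (0, 1) + (x, y)) - tensor g h (x, y))) =
    (fun t : R => t^-1 *: (g x * h (t *: (1 : R) + y) - g x * h y)).
    apply/funext => t; rewrite /tensor /=; congr (_ *: (_ - _)).
    by rewrite /GRing.scale/= mulr0 add0r.
  have := is_deriveM (is_derive_cst (g x) y (1 : R)) (dh y).
  move=> [D1 D2]; split; first by rewrite /derivable E.
  by rewrite /derive E; move: D2; rewrite /derive => ->; rewrite /GRing.scale/=; ring.
case: b.
  exists g, h'; split=> //; last by move=> [x y]; case: (dy x y).
  by apply/funext => -[x y]; case: (dy x y).
exists g', h; split=> //; last by move=> [x y]; case: (dx x y).
by apply/funext => -[x y]; case: (dx x y).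
Qed.

Lemma tensor_smooth g h : smooth_line g -> smooth_line h -> smooth (tensor g h).
Proof.
move=> sg sh s.
have [g' [h' [sg' sh' ->]]] : exists g' h', [/\ smooth_line g', smooth_line h' &
    iter_partial s (tensor g h) = tensor g' h'].
  elim: s => [|b s [g' [h' [sg' sh' E]]]]; first by exists g, h.
  by have [a [c [sa sc E' _]]] := tensor_partial sg' sh' b; exists a, c; rewrite /= E.
split; last by move=> z b; have [? [? [_ _ _]]] := tensor_partial sg' sh' b.
apply: contM => z.
  apply: (@cvg_comp _ _ _ fst g' _ (nbhs z.1)); first exact: cvg_fst.
  exact: smooth_line_continuous.
apply: (@cvg_comp _ _ _ snd h' _ (nbhs z.2)); first exact: cvg_snd.
exact: smooth_line_continuous.
Qed.

Lemma tensor_test_function g h (B : R) : smooth_line g -> smooth_line h ->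
  (forall x, g x != 0 -> `|x| <= B) -> (forall x, h x != 0 -> `|x| <= B) ->
  test_function (tensor g h).
Proof.
move=> sg sh gB hB; split; first exact: tensor_smooth.
have cB : compact (box (- B) B (- B) B : set (R * R)).
  by apply: compact_setX; exact: segment_compact.
apply: (subclosed_compact _ cB); first exact: closed_closure.
have clB : closed (box (- B) B (- B) B : set (R * R)).
  by apply: compact_closed => //; exact: norm_hausdorff.
rewrite ((closure_id _).1 clB); apply: closureS => -[x y] /=.
rewrite /tensor mulf_eq0 negb_or => /andP[/gB xB /hB yB].
by split; rewrite /= in_itv/= -ler_norml.
Qed.

End TensorTest.

(** * Open rectangles and the determination of a measure by test functions *)

Section OpenRectangles.
Variable R : realType.

(** Vanishes off ]a, b[ and increases to its indicator with [k], as monotone convergence demands. *)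
Definition bump (a b : R) k x : R :=
  smooth_step (k.+1%:R * (x - a)) * smooth_step (k.+1%:R * (b - x)).

Lemma bump_smooth a b k : smooth_line (bump a b k).
Proof.
apply: smooth_lineM.
  rewrite (_ : (fun x => _) = fun x => smooth_step (k.+1%:R * x + - (k.+1%:R * a))).
    exact: smooth_line_affine (@smooth_step_smooth R).
  by apply/funext => x; rewrite mulrBr.
rewrite (_ : (fun x => _) = fun x => smooth_step (- k.+1%:R * x + k.+1%:R * b)).
  exact: smooth_line_affine (@smooth_step_smooth R).
by apply/funext => x; rewrite mulrBr addrC mulNr.
Qed.

Lemma bump_eq0 a b k x : ~~ (a < x < b) -> bump a b k x = 0.
Proof.
rewrite negb_and -!leNgt => /orP[xa|bx]; rewrite /bump.
  by rewrite smooth_step0 ?mul0r// mulr_ge0_le0// subr_le0.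
by rewrite [X in _ * X]smooth_step0 ?mulr0// mulr_ge0_le0// subr_le0.
Qed.

Lemma bump_support a b k x : bump a b k x != 0 -> `|x| <= `|a| + `|b|.
Proof.
move=> x0; have /andP[ax xb] : a < x < b by apply: contraNT x0 => /bump_eq0 ->.
rewrite ler_norml; apply/andP; split; last first.
  by apply: le_trans (ltW xb) _; apply: le_trans (ler_norm b) _; rewrite lerDr.
rewrite opprD; apply: le_trans (ltW ax); apply: le_trans (_ : - `|a| <= _).
  by rewrite gerDl oppr_le0.
by rewrite lerNl -normrN ler_norm.
Qed.

Lemma bump_ge0 a b k x : 0 <= bump a b k x.
Proof. by rewrite mulr_ge0// smooth_step_ge0. Qed.

Lemma bump_mono a b k l x : (k <= l)%N -> bump a b k x <= bump a b l x.
Proof.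
move=> kl; have [/andP[ax xb]|/bump_eq0 ->] := boolP (a < x < b); last exact: bump_ge0.
by apply: ler_pM; rewrite ?smooth_step_ge0//; apply: smooth_step_mono;
  rewrite ler_wpM2r ?ler_nat// subr_ge0 ltW.
Qed.

Lemma bump_eventually a b x : exists k0, forall k, (k0 <= k)%N ->
  bump a b k x = ((a < x < b)%R)%:R.
Proof.
have [/andP[ax xb]|/bump_eq0 H] := boolP (a < x < b); last by exists 0%N => k _; rewrite H.
have large u : 0 < u -> exists k0, forall k, (k0 <= k)%N -> 1 <= k.+1%:R * u :> R.
  move=> u0; exists (Num.truncn u^-1) => k uk.
  rewrite mulrC -ler_pdivrMl// mulr1; apply: ltW.
  by apply: lt_le_trans (truncnS_gt _) _; rewrite ler_nat.
have [k1 H1] : exists k0, forall k, (k0 <= k)%N -> 1 <= k.+1%:R * (x - a).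
  by apply: large; rewrite subr_gt0.
have [k2 H2] : exists k0, forall k, (k0 <= k)%N -> 1 <= k.+1%:R * (b - x).
  by apply: large; rewrite subr_gt0.
exists (maxn k1 k2) => k; rewrite geq_max => /andP[/H1 h1 /H2 h2].
by rewrite /bump !smooth_step1// mulr1.
Qed.

Definition open_rect (a b c d : R) : set (plane R) := `]a, b[%classic `*` `]c, d[%classic.

Definition open_rects : set (set (plane R)) :=
  [set E | exists a b c d, E = open_rect a b c d].

Definition rect_bump a b c d k : R * R -> R := tensor (bump a b k) (bump c d k).

Lemma rect_bump_test a b c d k : test_function (rect_bump a b c d k).
Proof.
apply: (@tensor_test_function _ _ _ (`|a| + `|b| + (`|c| + `|d|))); try exact: bump_smooth.
- by move=> x /bump_support/le_trans; apply; rewrite lerDl.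
- by move=> x /bump_support/le_trans; apply; rewrite lerDr.
Qed.

Lemma rect_bump_ge0 a b c d k z : 0 <= rect_bump a b c d k z.
Proof. by rewrite mulr_ge0// bump_ge0. Qed.

Lemma rect_bump_mono a b c d k l z : (k <= l)%N ->
  rect_bump a b c d k z <= rect_bump a b c d l z.
Proof. by move=> kl; apply: ler_pM; rewrite ?bump_ge0// bump_mono. Qed.

Lemma rect_bump_cvg a b c d z :
  rect_bump a b c d k z @[k --> \oo] --> (\1_(open_rect a b c d) z : R).
Proof.
have [k1 H1] := bump_eventually a b z.1; have [k2 H2] := bump_eventually c d z.2.
apply: cvg_near_cst; exists (maxn k1 k2) => // k /=; rewrite geq_max => /andP[/H1 h1 /H2 h2].
rewrite /rect_bump /tensor h1 h2 -natrM mulnb indicE; congr (nat_of_bool _)%:R.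
apply/idP/idP; last first.
  by rewrite inE /open_rect => -[] /=; rewrite !in_itv/= => -> ->.
by move=> /andP[h h']; rewrite inE; split; rewrite /= in_itv/=.
Qed.

Lemma open_rects_setI : setI_closed open_rects.
Proof.
move=> _ _ [a [b [c [d ->]]]] [a' [b' [c' [d' ->]]]].
exists (Num.max a a'), (Num.min b b'), (Num.max c c'), (Num.min d d').
apply/seteqP; split=> -[x y] /=; rewrite /open_rect /= !in_itv/= !gt_max !lt_min.
  by move=> [[/andP[-> ->] /andP[-> ->]] [/andP[-> ->] /andP[-> ->]]].
by move=> [/andP[/andP[-> ->] /andP[-> ->]] /andP[/andP[-> ->] /andP[-> ->]]].
Qed.

Lemma measurable_open_rect a b c d : measurable (open_rect a b c d).
Proof. by apply: measurableX; exact: measurable_itv. Qed.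

Lemma open_rects_cover : \bigcup_k open_rect (- k%:R) k%:R (- k%:R) k%:R = setT.
Proof.
apply/seteqP; split=> // -[x y] _.
have [k Hk] : exists k, `|x| + `|y| < k%:R :> R.
  by exists (Num.truncn (`|x| + `|y|)).+1; exact: truncnS_gt.
exists k => //; split; rewrite /= in_itv/= -ltr_norml; apply: le_lt_trans Hk.
  by rewrite lerDl.
by rewrite lerDr.
Qed.

(** An open strip is a countable union of open rectangles, so that both projections are measurable
    for the sigma-algebra that the rectangles generate. *)
Lemma measurable_planeE : @measurable _ (plane R) = <<s open_rects >>.
Proof.
apply/seteqP; split; last first.
  apply: smallest_sub; first exact: sigma_algebra_measurable.
  by move=> _ [a [b [c [d ->]]]]; exact: measurable_open_rect.
pose T := g_sigma_algebraType open_rects.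
have mO (E : set T) : open_rects E -> measurable E by exact: sub_sigma_algebra.
have mf : measurable_fun setT (fst : T -> measurableTypeR R).
  apply: (measurability _ (RGenOpens.measurableE R)).
  move=> _ [_ [x [y ->]] <-]; rewrite setTI.
  rewrite (_ : _ @^-1` _ = \bigcup_k open_rect x y (- k%:R) k%:R).
    by apply: bigcupT_measurable => k; apply: mO; do 4 eexists.
  rewrite -[LHS]setIT -open_rects_cover setI_bigcupr; apply/seteqP; split=> -[u v] [k _].
    by move=> [uI [_ vI]]; exists k.
  move=> [/= uI vI]; have : (\bigcup_k open_rect (- k%:R) k%:R (- k%:R) k%:R) (u, v) by rewrite open_rects_cover.
  by move=> [l _ lP]; exists l.
have ms : measurable_fun setT (snd : T -> measurableTypeR R).
  apply: (measurability _ (RGenOpens.measurableE R)).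
  move=> _ [_ [x [y ->]] <-]; rewrite setTI.
  rewrite (_ : _ @^-1` _ = \bigcup_k open_rect (- k%:R) k%:R x y).
    by apply: bigcupT_measurable => k; apply: mO; do 4 eexists.
  rewrite -[LHS]setIT -open_rects_cover setI_bigcupr; apply/seteqP; split=> -[u v] [k _].
    by move=> [vI [uI _]]; exists k.
  move=> [/= uI vI]; have : (\bigcup_k open_rect (- k%:R) k%:R (- k%:R) k%:R) (u, v) by rewrite open_rects_cover.
  by move=> [l _ lP]; exists l.
rewrite measurable_prod_measurableType; apply: smallest_sub; first exact: smallest_sigma_algebra.
move=> _ [A mA] [B mB] <-.
have -> : A `*` B = (setT `&` fst @^-1` A) `&` (setT `&` snd @^-1` B) by rewrite !setTI.
by apply: (@measurableI _ T); [exact: mf|exact: ms].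
Qed.

(** By monotone convergence of bumps the measures agree on open rectangles, a family stable under
    intersection; a test function that dominates the indicator of a rectangle makes it of finite
    measure. *)
Lemma test_function_measure_unique (m1 m2 : {measure set (plane R) -> \bar R}) :
  (forall f, test_function f -> (\int[m1]_z (f z)%:E = \int[m2]_z (f z)%:E)%E) ->
  (forall f, test_function f -> (\int[m1]_z (f z)%:E < +oo)%E) ->
  forall E, measurable E -> m1 E = m2 E.
Proof.
move=> m12 fin.
have lim (m : {measure set (plane R) -> \bar R}) a b c d :
    (\int[m]_z (rect_bump a b c d k z)%:E @[k --> \oo] --> m (open_rect a b c d))%E.
  have mE := measurable_open_rect a b c d.
  rewrite -[open_rect a b c d]setIT -(integral_indic m measurableT mE).
  rewrite (_ : \int[m]_z _ = \int[m]_z limn (fun k => (rect_bump a b c d k z)%:E))%E; last first.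
    apply: eq_integral => z _; apply/esym/cvg_lim => //.
    by apply: cvg_EFin; [near=> k|exact: rect_bump_cvg].
  apply: cvg_monotone_convergence => //.
  - move=> k; apply/measurable_EFinP; apply: continuous_measurable_plane.
    exact: (@test_continuous _ _ (rect_bump_test a b c d k) [::]).
  - by move=> k z _; rewrite lee_fin rect_bump_ge0.
  - by move=> z _ k l kl; rewrite lee_fin rect_bump_mono.
have eqr a b c d : m1 (open_rect a b c d) = m2 (open_rect a b c d).
  rewrite -(cvg_lim _ (lim m1 a b c d))// -(cvg_lim _ (lim m2 a b c d))//.
  by congr (limn _); apply/funext => k; apply: m12; exact: rect_bump_test.
(* With a margin of 1 on each side, the bump of index 0 already equals 1 on ]-k, k[. *)
have step_k (k : nat) x : `|x| < k%:R -> bump (- k.+1%:R) k.+1%:R 0 x = 1 :> R.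
  rewrite ltr_norml => /andP[x1 x2]; rewrite /bump !mul1r !smooth_step1 ?mulr1//;
    rewrite -natr1; lra.
move=> E mE; apply: (measure_unique open_rects (fun k => open_rect (- k%:R) k%:R (- k%:R) k%:R)) => //.
- exact: measurable_planeE.
- exact: open_rects_setI.
- by move=> k; do 4 eexists.
- exact: open_rects_cover.
- by move=> _ [a [b [c [d ->]]]].
move=> k; pose f := rect_bump (- k.+1%:R) k.+1%:R (- k.+1%:R) k.+1%:R 0.
have tf : test_function f by exact: rect_bump_test.
apply: le_lt_trans (fin f tf); have mE' := measurable_open_rect (- k%:R) k%:R (- k%:R) k%:R.
rewrite -[open_rect _ _ _ _]setIT -(integral_indic m1 measurableT mE'); apply: ge0_le_integral => //.
- by apply/measurable_EFinP; exact: measurable_indic.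
- apply/measurable_EFinP; apply: continuous_measurable_plane.
  exact: (@test_continuous _ _ tf [::]).
move=> z _; rewrite lee_fin indicE; case: (boolP (z \in _)); last by rewrite rect_bump_ge0.
rewrite inE => -[/=]; rewrite !in_itv/= -!ltr_norml => h1 h2.
by rewrite /f /rect_bump /tensor !step_k// mulr1.
Unshelve. all: by end_near. Qed.

End OpenRectangles.

(** * Haar families of characters and averages over quotients *)

Section HaarFamily.
Variables (R : realType) (G : zmodType).

(** The orthogonality relations are all that is kept of Haar measure: they determine the integrals
    of trigonometric polynomials, and the other integrals are reached by uniform approximation. *)
Definition haar_family d (T : measurableType d) (P : probability T R)
    (chi : T -> G -> R[i]) : Prop :=
  [/\ forall t, is_character (chi t),
      forall g, measurable_fun setT (fun t => complex.Re (chi t g)),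
      forall g, measurable_fun setT (fun t => complex.Im (chi t g)),
      forall g, \int[P]_t complex.Re (chi t g) = (g == 0)%:R
    & forall g, \int[P]_t complex.Im (chi t g) = 0].

Lemma bounded_measurable_integrable d (T : measurableType d) (P : probability T R)
    (u : T -> R) M : measurable_fun setT u -> (forall t, `|u t| <= M) ->
  P.-integrable setT (EFin \o u).
Proof.
move=> mu uM; apply: measurable_bounded_integrable => //.
  by apply: le_lt_trans (probability_le1 P measurableT) _; rewrite ltry.
exists M; split; first exact: num_real.
by move=> x Mx t _; apply: le_trans (uM t) (ltW Mx).
Qed.

Lemma Rintegral_prob_cst d (T : measurableType d) (P : probability T R) (c : R) :
  \int[P]_t c = c.
Proof. by rewrite /Rintegral integral_cst//= probability_setT mule1. Qed.

Lemma haar_family_exists : finitely_generated G ->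
  exists d (T : measurableType d) (P : probability T R) chi, @haar_family d T P chi.
Proof.
move=> [s sP]; have [d [T [P [al [mal alD alI]]]]] := haar_angle_exists R s.
have H g : exists c : nat -> int, g = \sum_(k < size s) s`_k *~ c k.
  have [c gc] := sP g; exists (fun k => oapp c 0 (insub k)); rewrite gc.
  by apply: eq_bigr => k _; rewrite valK.
have mcos g : measurable_fun setT (fun t => trigo.cos (al g t)).
  apply: (measurableT_comp (continuous_measurable_fun (@continuous_cos R))); exact: mal.
have msin g : measurable_fun setT (fun t => trigo.sin (al g t)).
  apply: (measurableT_comp (continuous_measurable_fun (@continuous_sin R))); exact: mal.
(* The shift 0 gives the real parts, and the shift pi / 2 the imaginary parts up to sign. *)
have shifted c g : \int[P]_t (trigo.cos (c + al g t)) = (g == 0)%:R * trigo.cos c.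
  have ic : P.-integrable setT (EFin \o (fun t => trigo.cos (c + al g t))).
    apply: (@bounded_measurable_integrable _ _ _ _ 1) => [|t]; last exact: cos_max.
    apply: (measurableT_comp (continuous_measurable_fun (@continuous_cos R))).
    by apply: measurable_funD => //; exact: mal.
  have i1 : P.-integrable setT (EFin \o (fun=> 1 : R)).
    by apply: (@bounded_measurable_integrable _ _ _ _ 1) => // t; rewrite normr1.
  have := RintegralD measurableT i1 ic; rewrite /= Rintegral_prob_cst.
  by rewrite {1}/Rintegral alI//= => /addrI.
exists d, T, P, (fun t g => expi (al g t)); split => //.
- move=> t; split=> [g h|g]; first exact: alD.
  exact: normc_expi.
- by move=> g; have := shifted 0 g; rewrite cos0 mulr1 => <-; apply: eq_Rintegral => t _; rewrite add0r.
- move=> g; have := shifted (trigo.pi / 2) g; rewrite cos_pihalf mulr0 => h.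
  rewrite -[RHS]oppr0 -h -mulN1r -RintegralZl//.
    by apply: eq_Rintegral => t _; rewrite /= addrC cosDpihalf mulN1r opprK.
  apply: (@bounded_measurable_integrable _ _ _ _ 1) => [|t]; last exact: cos_max.
  apply: (measurableT_comp (continuous_measurable_fun (@continuous_cos R))).
  by apply: measurable_funD => //; exact: mal.
Qed.

End HaarFamily.

Section Averages.
Variables (R : realType) (G : zmodType) (d : measure_display) (T : measurableType d).
Variables (P : probability T R) (chi : T -> G -> R[i]).
Hypothesis haarP : haar_family P chi.

Let chiP t : is_character (chi t). Proof. by case: haarP. Qed.
Let mRe g : measurable_fun setT (fun t => complex.Re (chi t g)). Proof. by case: haarP. Qed.
Let mIm g : measurable_fun setT (fun t => complex.Im (chi t g)). Proof. by case: haarP. Qed.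

Lemma Re_mulc (a b : R[i]) :
  complex.Re (a * b) = complex.Re a * complex.Re b - complex.Im a * complex.Im b.
Proof. by case: a b => [? ?] [? ?]. Qed.

Let iRe g : P.-integrable setT (EFin \o (fun t => complex.Re (chi t g))).
Proof.
apply: (@bounded_measurable_integrable _ _ _ _ _ 1) => // t.
by apply: le_trans (Re_le_normc _) _; rewrite (chiP t).2.
Qed.

Let iIm g : P.-integrable setT (EFin \o (fun t => complex.Im (chi t g))).
Proof.
apply: (@bounded_measurable_integrable _ _ _ _ _ 1) => // t.
by apply: le_trans (Im_le_normc _) _; rewrite (chiP t).2.
Qed.

Lemma measurable_Re_sum (I : finType) (c : I -> R[i]) (g : I -> G) :
  measurable_fun setT (fun t => complex.Re (\sum_i c i * chi t (g i))).
Proof.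
rewrite (_ : (fun t => _) = fun t => \sum_i (complex.Re (c i) * complex.Re (chi t (g i))
   - complex.Im (c i) * complex.Im (chi t (g i)))).
  by apply: measurable_sum => i; apply: measurable_funB; apply: measurable_funM => //; exact: measurable_cst.
by apply/funext => t; rewrite raddf_sum; apply: eq_bigr => i _; exact: Re_mulc.
Qed.

Lemma Re_sum_bounded (I : finType) (c : I -> R[i]) (g : I -> G) t :
  `|complex.Re (\sum_i c i * chi t (g i))| <= \sum_i normc (c i).
Proof.
apply: le_trans (Re_le_normc _) _; apply: le_trans (le_normc_sum _ _ _) _.
by apply: ler_sum => i _; rewrite normcM (chiP t).2 mulr1.
Qed.

Lemma haar_integral_Re_sum (I : finType) (c : I -> R[i]) (g : I -> G) :
  \int[P]_t complex.Re (\sum_i c i * chi t (g i)) =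
  complex.Re (\sum_i c i * (g i == 0)%:R).
Proof.
have H (s : seq I) : P.-integrable setT (EFin \o (fun t => complex.Re (\sum_(i <- s) c i * chi t (g i)))) /\
    \int[P]_t complex.Re (\sum_(i <- s) c i * chi t (g i)) =
    complex.Re (\sum_(i <- s) c i * (g i == 0)%:R).
  elim: s => [|i s [IH1 IH2]].
    rewrite (_ : (fun t => _) = fun=> 0); last by apply/funext => t; rewrite big_nil.
    by split; [exact: integrable0|rewrite big_nil Rintegral_prob_cst].
  pose u t := complex.Re (c i) * complex.Re (chi t (g i)) - complex.Im (c i) * complex.Im (chi t (g i)).
  have i1 : P.-integrable setT (EFin \o (fun t => complex.Re (c i) * complex.Re (chi t (g i)))).
    by rewrite (_ : EFin \o _ = fun t => ((complex.Re (c i))%:E * (complex.Re (chi t (g i)))%:E)%E)//; exact: (integrableZl measurableT _ (iRe (g i))).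
  have i2 : P.-integrable setT (EFin \o (fun t => complex.Im (c i) * complex.Im (chi t (g i)))).
    by rewrite (_ : EFin \o _ = fun t => ((complex.Im (c i))%:E * (complex.Im (chi t (g i)))%:E)%E)//; exact: (integrableZl measurableT _ (iIm (g i))).
  have iu : P.-integrable setT (EFin \o u).
    rewrite (_ : EFin \o u = fun t => ((complex.Re (c i) * complex.Re (chi t (g i)))%:E -
      (complex.Im (c i) * complex.Im (chi t (g i)))%:E)%E)//; exact: integrableB.
  rewrite (_ : (fun t => complex.Re _) = fun t => u t + complex.Re (\sum_(i <- s) c i * chi t (g i))); last first.
    by apply/funext => t; rewrite big_cons raddfD /= Re_mulc.
  split.
    rewrite (_ : EFin \o _ = (EFin \o u) \+ (EFin \o (fun t => complex.Re (\sum_(i <- s) c i * chi t (g i)))))//.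
    exact: integrableD.
  rewrite RintegralD// IH2 big_cons raddfD /=; congr (_ + _).
  rewrite /u RintegralB// !RintegralZl//; case: haarP => _ _ _ -> ->.
  by rewrite Re_mulc; case: (g i == 0); rewrite ?mulr0 ?mulr1 ?subr0.
by have [_ ->] := H (index_enum I).
Qed.

Variables (n : nat) (A : 'M[{group_ring R[i][G]}]_n).
Hypothesis n0 : (0 < n)%N.

(** The enumeration of the roots is not known to be measurable in [t]; their sum under a test
    function is, as a uniform limit of trigonometric polynomials. *)
Lemma measurable_eigenvalue_sum f : test_function f ->
  measurable_fun setT (fun t => eigenvalue_sum f A (chi t)).
Proof.
move=> tf.
have /choice[u uP] : forall k : nat, exists u : T -> R, measurable_fun setT u /\
    forall t, `|eigenvalue_sum f A (chi t) - u t| <= k.+1%:R^-1.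
  move=> k; have k0 : 0 < k.+1%:R^-1 :> R by rewrite invr_gt0.
  have [I [c [g H]]] := eigenvalue_sum_approx tf A n0 k0.
  exists (fun t => complex.Re (\sum_i c i * chi t (g i))); split; first exact: measurable_Re_sum.
  by move=> t; exact: H.
apply: (measurable_fun_cvg (h := u)) => [k|t _]; first exact: (uP k).1.
apply/cvgrPdist_le => e e0; near=> k.
apply: le_trans ((uP k).2 t) _; apply: ltW.
by near: k; exact: (near_infty_natSinv_lt (PosNum e0)).
Unshelve. all: by end_near. Qed.

Lemma eigenvalue_sum_bounded f : test_function f ->
  exists M : R, forall psi, `|eigenvalue_sum f A psi| <= M.
Proof.
move=> tf; have [rho rho0 Hf] := test_support tf.
have cf : continuous f by exact: (@test_continuous _ _ tf [::]).
have [S HS] := continuous_box_bounded (- rho) rho (- rho) rho cf.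
have S0 : 0 <= S.
  by apply: le_trans (HS (0, 0) _); [exact: normr_ge0|split; rewrite /= in_itv/= oppr_le0 ltW].
exists (n%:R * S) => psi; apply: le_trans (ler_norm_sum _ _ _) _.
apply: (@le_trans _ _ (\sum_(x <- spectrum_seq (symbol A psi)) S)).
  apply: ler_sum => x _; have [xb|xb] := pselect (box (- rho) rho (- rho) rho (to_plane x)).
    exact: HS.
  suff -> : f (to_plane x) = 0 by rewrite normr0.
  apply: (Hf [::]); apply: contrapT => /not_orP[/negP + /negP]; rewrite -!ltNge => x1 x2.
  by apply: xb; split; rewrite /= in_itv/= -ler_norml ltW.
by rewrite big_const_seq count_predT size_spectrum_seq iter_addr_0 mulr_natl.
Qed.

(** For a trigonometric polynomial, the average over the dual of G_i equals the Haar average as soon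
    as no nonzero frequency [g i] lies in N_i. The eigenvalue sum is within e / 2 of such a
    polynomial at every character. *)
Lemma average_cvg f (N : residual_chain G) : test_function f ->
  (#|{: finquot (chain_finite_index N i)}|%:R : R)^-1 *
    \sum_(x <- fin_eigenvalues (quot_proj (chain_finite_index N i)) A) f (to_plane x)
  @[i --> \oo] --> \int[P]_t eigenvalue_sum f A (chi t).
Proof.
move=> tf; apply/cvgrPdist_le => e e0.
have e2 : 0 < e / 2 by rewrite divr_gt0.
have [I [c [g H]]] := eigenvalue_sum_approx tf A n0 e2.
have [i0 Hi0] := chain_proj_inj N (0 :: [seq g i | i <- index_enum I]).
exists i0 => // i /= i0i.
have inj := Hi0 i i0i; set pi := quot_proj (chain_finite_index N i) in inj *.
set Q := finquot (chain_finite_index N i) in pi inj *.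
have Q0 : 0 < (#|{: Q}|%:R : R) by rewrite ltr0n; apply/card_gt0P; exists 0.
have [psi [psiP psiO]] := finite_dual R Q.
have psiP' k : is_character (psi k \o pi) by exact: character_comp.
rewrite (perm_big _ (fin_eigenvalues_symbol pi A psiP psiO)) /=.
rewrite big_flatten big_map big_enum /=.
pose V chi := complex.Re (\sum_i c i * chi (g i)).
have avg : \sum_k V (psi k \o pi) = #|{: Q}|%:R * complex.Re (\sum_i c i * (g i == 0)%:R).
  have Re_nat (m : nat) (z : R[i]) : m%:R * complex.Re z = complex.Re (m%:R * z).
    by rewrite !mulr_natl raddfMn.
  rewrite -raddf_sum exchange_big Re_nat mulr_sumr; congr complex.Re.
  apply: eq_bigr => j _; rewrite -mulr_sumr psiO mulrCA; congr (_ * (_ * _%:R)).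
  have pi0 : pi 0 = 0 by exact: (raddf0 (quot_proj (chain_finite_index N i))).
  congr nat_of_bool; apply/eqP/eqP => [h|->]; last exact: pi0.
  apply: inj; rewrite ?inE ?eqxx//; last by rewrite h pi0.
  by rewrite map_f ?orbT// mem_index_enum.
have intV : P.-integrable setT (EFin \o (fun t => V (chi t))).
  by apply: bounded_measurable_integrable; [exact: measurable_Re_sum|exact: Re_sum_bounded].
have intS : P.-integrable setT (EFin \o (fun t => eigenvalue_sum f A (chi t))).
  have [M HM] := eigenvalue_sum_bounded tf.
  by apply: bounded_measurable_integrable; [exact: measurable_eigenvalue_sum|move=> t; exact: HM].
apply: le_trans (ler_distD (complex.Re (\sum_i c i * (g i == 0)%:R)) _ _) _.
rewrite [leRHS](splitr e); apply: lerD.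
  rewrite -haar_integral_Re_sum -RintegralB//.
  have iD : P.-integrable setT (EFin \o (fun t => eigenvalue_sum f A (chi t) - V (chi t))).
    rewrite (_ : EFin \o _ = fun t => ((eigenvalue_sum f A (chi t))%:E - (V (chi t))%:E)%E)//.
    exact: integrableB.
  apply: le_trans (le_normr_Rintegral _ iD) _ => //.
  rewrite -[leRHS](Rintegral_prob_cst P); apply: le_Rintegral => //.
  - exact: (integrable_abse iD).
  - by apply: (@bounded_measurable_integrable _ _ _ _ _ (e / 2)) => // t; rewrite gtr0_norm.
  - by move=> t _; exact: H.
rewrite -(ler_pM2l Q0) -{1}(gtr0_norm Q0) -normrM mulrBr -avg mulVKf ?gt_eqF//.
rewrite -sumrB; apply: le_trans (ler_norm_sum _ _ _) _.
apply: (@le_trans _ _ (\sum_(k < #|{: Q}|) e / 2)).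
  by apply: ler_sum => k _; rewrite distrC; exact: H.
by rewrite sumr_const card_ord mulr_natl.
Qed.

End Averages.

(** * Root measures, their Haar average and weak convergence *)

Section RootMeasure.
Variable R : realType.

Definition root_measure (s : seq R[i]) : {measure set (plane R) -> \bar R} :=
  msum (fun k => @dirac _ (plane R) (to_plane (nth 0 s k)) R) (size s).

Lemma root_measureE s E : root_measure s E = (\sum_(x <- s) \1_E (to_plane x))%:E.
Proof.
transitivity (\sum_(k < size s) (@dirac _ (plane R) (to_plane s`_k) R) E)%E; first by [].
by rewrite (big_nth 0) big_mkord -sumEFin; apply: eq_bigr => k _; rewrite diracE.
Qed.

Lemma integral_root_measure s (h : R * R -> R) :
  measurable_fun [set: plane R] h -> (forall z, 0 <= h z) ->
  (\int[root_measure s]_z (h z)%:E = (\sum_(x <- s) h (to_plane x))%:E)%E.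
Proof.
move=> mh h0; have mh' : measurable_fun [set: plane R] (EFin \o h) by exact/measurable_EFinP.
rewrite /root_measure ge0_integral_measure_sum//; last by move=> z _; rewrite lee_fin.
rewrite (big_nth 0) big_mkord -sumEFin; apply: eq_bigr => k _.
by rewrite integral_dirac// diracE in_setT mul1e.
Qed.

(** Reduces bounded functions to nonnegative ones, whose integrals against sums and mixtures of
    measures are computed directly. *)
Lemma integral_shift (m : {measure set (plane R) -> \bar R}) (h : R * R -> R) (c M : R) :
  m setT = c%:E -> measurable_fun [set: plane R] h -> (forall z, `|h z| <= M) ->
  (\int[m]_z (h z)%:E = \int[m]_z (h z + M)%:E - (M * c)%:E)%E.
Proof.
move=> mT mh hM.
have fin (u : R * R -> R) K : measurable_fun [set: plane R] u -> (forall z, `|u z| <= K) ->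
    m.-integrable setT (EFin \o u).
  move=> mu uK; apply: measurable_bounded_integrable => //; first by rewrite mT ltry.
  exists K; split; first exact: num_real.
  by move=> x Kx z _; apply: le_trans (uK z) (ltW Kx).
have ih := fin h M mh hM.
have ic := fin (fun=> M) `|M| (@measurable_cst _ _ _ _ _ _) (fun=> lexx _).
under [X in (_ = X - _)%E]eq_integral do rewrite EFinD.
rewrite integralD//= integral_cst// mT -EFinM addeK//.
Qed.

Lemma unif_continuous_box (h : R * R -> R) M e : continuous h -> 0 < e ->
  exists2 r : R, 0 < r & forall x y u v, `|x| <= M -> `|y| <= M ->
    `|x - u| < r -> `|y - v| < r -> `|h (x, y) - h (u, v)| <= e.
Proof.
move=> ch e0; have cB : compact (box (- M) M (- M) M : set (R * R)).
  by apply: compact_setX; exact: segment_compact.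
have := (compact_near_coveringP (box (- M) M (- M) M : set (R * R))).1 cB R
  (0^'+) (fun r z => forall w, ball z r w -> `|h z - h w| <= e) _.
move=> H; have {H} : \forall r \near 0^'+, box (- M) M (- M) M `<=` (fun z => forall w, ball z r w -> `|h z - h w| <= e).
  apply: H => z _.
  have e2 : 0 < e / 2 by rewrite divr_gt0.
  have /cvgrPdist_le /(_ _ e2) /nbhs_ballP[r /= r0 Hr] := ch z.
  have r2 : 0 < r / 2 by rewrite divr_gt0.
  exists (ball z (r / 2), [set s | s < r / 2]).
    by split; [exact: nbhsx_ballx|exact: nbhs_right_lt].
  move=> [z' s] /= [zz' sr] w z'w.
  have h1 : `|h z - h z'| <= e / 2.
    by apply: Hr; apply: le_ball zz'; rewrite ler_pdivrMr// ler_peMr ?(ltW r0)// ler1n.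
  have h2 : `|h z - h w| <= e / 2.
    by apply: Hr; rewrite (splitr r); apply: ball_triangle zz' _; apply: le_ball z'w; exact: ltW.
  by rewrite (splitr e); apply: le_trans (ler_distD (h z) _ _) _; rewrite distrC lerD.
move=> H; have [r [r0 Hr]] : exists r, 0 < r /\ (box (- M) M (- M) M `<=` (fun z => forall w, ball z r w -> `|h z - h w| <= e)).
  by near (0:R)^'+ => r; exists r; split=> //; near: r.
exists r => // x y u v xM yM xu yv; apply: Hr; last by split.
by split; rewrite /= in_itv/= -ler_norml.
Unshelve. all: by end_near. Qed.

(** A bump supported where |N x - c| <= 1. As differences of shifted smooth steps, the hats at
    consecutive integers telescope and form a partition of unity. *)
Definition hat (N : nat) (c : R) x : R :=
  smooth_step (N%:R * x - c + 1) - smooth_step (N%:R * x - c).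

Lemma hat_smooth N c : smooth_line (hat N c).
Proof.
rewrite (_ : hat N c = fun x => smooth_step (N%:R * x + (- c + 1)) + (-1) * smooth_step (N%:R * x + (- c))).
  apply: smooth_lineD; first exact: smooth_line_affine (@smooth_step_smooth R).
  apply: smooth_lineM; first exact: smooth_line_cst.
  exact: smooth_line_affine (@smooth_step_smooth R).
by apply/funext => x; rewrite /hat addrA mulN1r.
Qed.

Lemma hat_ge0 N c x : 0 <= hat N c x.
Proof. by rewrite subr_ge0; apply: smooth_step_mono; rewrite lerDl. Qed.

Lemma hat_support N c x : hat N c x != 0 -> `|N%:R * x - c| < 1.
Proof.
apply: contraNT; rewrite -leNgt ler_normr => /orP[h|h]; rewrite /hat.
  by rewrite !smooth_step1 ?subrr// (le_trans h)// lerDl.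
by rewrite !smooth_step0 ?subrr//; lra.
Qed.

Lemma hat_sum N K x : `|x| * N%:R <= K%:R ->
  \sum_(i < K.*2.+1) hat N (i%:R - K%:R) x = 1.
Proof.
move=> xK; have /andP[x1 x2] : - K%:R <= N%:R * x <= K%:R.
  by rewrite -ler_norml normrM normr_nat mulrC.
have tele m : \sum_(i < m.+1) hat N (i%:R - K%:R) x =
    smooth_step (N%:R * x + K%:R + 1) - smooth_step (N%:R * x + K%:R - m%:R).
  elim: m => [|m IH]; first by rewrite big_ord1 /hat sub0r opprK subr0.
  rewrite big_ord_recr/= IH /hat.
  have -> : N%:R * x - (m.+1%:R - K%:R) + 1 = N%:R * x + K%:R - m%:R by rewrite -natr1; ring.
  by rewrite opprB addrA addrA subrK.
rewrite tele smooth_step1; last by lra.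
by rewrite smooth_step0 ?subr0// -addnn natrD; lra.
Qed.

(** The values of [h] at the points of a grid of mesh 1 / N are spread by the products of hats, a
    partition of unity; 1 / N is below the modulus of uniform continuity of [h] for [e]. *)
Lemma test_approximation (h : R * R -> R) M e : continuous h -> 0 < e ->
  exists (I : finType) (c : I -> R) (f : I -> R * R -> R),
    (forall i, test_function (f i)) /\
    forall x y, `|x| <= M -> `|y| <= M ->
      `|h (x, y) - \sum_i c i * f i (x, y)| <= e.
Proof.
move=> ch e0; have [r r0 Hr] := unif_continuous_box M ch e0.
pose N := (Num.truncn r^-1).+1; have N0 : 0 < N%:R :> R by rewrite ltr0n.
have Nr : N%:R^-1 < r by rewrite invf_plt ?posrE// truncnS_gt.
pose K := (Num.truncn (M * N%:R)).+1.
have MK : M * N%:R <= K%:R by rewrite ltW// truncnS_gt.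
pose p (i : 'I_(K.*2.+1)) : R := i%:R - K%:R.
exists ('I_(K.*2.+1) * 'I_(K.*2.+1))%type, (fun i => h (p i.1 / N%:R, p i.2 / N%:R)),
  (fun i => tensor (hat N (p i.1)) (hat N (p i.2))).
have near_p i x : hat N (p i) x != 0 -> `|x - p i / N%:R| < r.
  move=> /hat_support hx; apply: lt_trans Nr.
  rewrite -(ltr_pM2l N0) mulfV ?gt_eqF// -{1}(gtr0_norm N0) -normrM mulrBr.
  by rewrite mulrCA mulfV ?gt_eqF// mulr1.
have hb i x : hat N (p i) x != 0 -> `|x| <= K.*2.+1%:R.
  move=> /hat_support hx.
  have pK : `|p i| <= (K.*2)%:R.
    have K2 : (K.*2)%:R = K%:R + K%:R :> R by rewrite -addnn natrD.
    have iK : i%:R <= K%:R + K%:R :> R by rewrite -K2 ler_nat -ltnS.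
    have i0 := ler0n R i; have k0 := ler0n R K.
    by rewrite /p ler_norml K2; apply/andP; split; lra.
  have xN : `|x| <= `|N%:R * x| by rewrite normrM normr_nat ler_peMl// ler1n.
  apply: le_trans xN _; rewrite -[X in `|X|](subrK (p i)); apply: le_trans (ler_normD _ _) _.
  by rewrite -natr1 addrC lerD// ltW.
split=> [i|].
  by apply: (@tensor_test_function _ _ _ (K.*2.+1)%:R); try exact: hat_smooth; exact: hb.
move=> x y xM yM.
have sum1 u : `|u| <= M -> \sum_i hat N (p i) u = 1.
  by move=> uM; apply: hat_sum; apply: le_trans MK; rewrite ler_wpM2r.
rewrite -(pair_big xpredT xpredT (fun i j => h (p i / N%:R, p j / N%:R) * tensor (hat N (p i)) (hat N (p j)) (x, y)))/=.
have -> : h (x, y) = \sum_i \sum_j h (x, y) * (hat N (p i) x * hat N (p j) y).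
  under eq_bigr do rewrite -mulr_sumr -mulr_sumr sum1// mulr1.
  by rewrite -mulr_sumr sum1// mulr1.
rewrite -sumrB; under eq_bigr do rewrite -sumrB.
have -> : e = \sum_i \sum_j e * (hat N (p i) x * hat N (p j) y).
  under eq_bigr do rewrite -mulr_sumr -mulr_sumr sum1// mulr1.
  by rewrite -mulr_sumr sum1// mulr1.
apply: le_trans (ler_norm_sum _ _ _) _; apply: ler_sum => i _.
apply: le_trans (ler_norm_sum _ _ _) _; apply: ler_sum => j _.
have h0 : 0 <= hat N (p i) x * hat N (p j) y by rewrite mulr_ge0 ?hat_ge0.
rewrite -[tensor _ _ _]/(hat N (p i) x * hat N (p j) y) -mulrBl normrM (ger0_norm h0).
have [->|hx] := eqVneq (hat N (p i) x) 0; first by rewrite mul0r !mulr0.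
have [->|hy] := eqVneq (hat N (p j) y) 0; first by rewrite !mulr0.
rewrite ler_wpM2r//.
by apply: Hr => //; exact: near_p.
Qed.

End RootMeasure.

Section TorusMeasure.
Variables (R : realType) (G : zmodType) (d : measure_display) (T : measurableType d).
Variables (P : probability T R) (chi : T -> G -> R[i]).
Hypothesis haarP : haar_family P chi.
Variables (n : nat) (A : 'M[{group_ring R[i][G]}]_n).
Hypothesis n0 : (0 < n)%N.

Let roots t := spectrum_seq (symbol A (chi t)).

Let nR : 0 < n%:R :> R. Proof. by rewrite ltr0n. Qed.

Let count_indic E t : eigenvalue_sum (\1_E) A (chi t) = \sum_(x <- roots t) \1_E (to_plane x).
Proof. by []. Qed.

(** A monotone class argument that starts from the open rectangles, whose indicators are limits of
    bumps. *)
Lemma measurable_root_count (E : set (plane R)) : measurable E ->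
  measurable_fun setT (fun t => eigenvalue_sum (\1_E) A (chi t)).
Proof.
rewrite measurable_planeE.
have cvg_sums (F : nat -> R * R -> R) (g : R * R -> R) :
    (forall z, F k z @[k --> \oo] --> g z) ->
    forall t, eigenvalue_sum (F k) A (chi t) @[k --> \oo] --> eigenvalue_sum g A (chi t).
  move=> Fg t; apply: cvg_big => [|x _]; first exact: add_continuous.
  exact: Fg.
apply: (@lambda_system_subset _ _ (@open_rects_setI R) setT
  [set E | measurable_fun setT (fun t => eigenvalue_sum (\1_E) A (chi t))]) => //.
- split=> //.
  + rewrite /= (_ : (fun t => _) = fun=> n%:R); first exact: measurable_cst.
    apply/funext => t; rewrite count_indic (eq_bigr (fun=> 1)) => [|x _].
      by rewrite big_const_seq count_predT size_spectrum_seq iter_addr_0.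
    by rewrite indicT.
  + move=> B C CB mB mC /=.
    rewrite (_ : (fun t => _) = fun t => eigenvalue_sum (\1_B) A (chi t) - eigenvalue_sum (\1_C) A (chi t)).
      exact: measurable_funB.
    apply/funext => t; rewrite /eigenvalue_sum -sumrB; apply: eq_bigr => x _.
    rewrite !indicE in_setD; have [xC|xC] := boolP (to_plane x \in C).
      by rewrite (_ : to_plane x \in B) ?subrr//; move: xC; rewrite !inE => /CB.
    by rewrite andbT subr0.
  + move=> F ndF mF /=; apply: (measurable_fun_cvg (h := fun k t => eigenvalue_sum (\1_(F k)) A (chi t))) => // t _.
    apply: (cvg_sums (fun k => \1_(F k))) => z; apply: cvg_near_cst.
    have [[k0 _ k0z]|nz] := pselect ((\bigcup_k F k) z).
      exists k0 => // k /= kk; rewrite !indicE mem_set; first by rewrite mem_set//; exists k0.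
      by have /subsetPset := ndF _ _ kk; apply.
    exists 0%N => // k _; rewrite /= !indicE !memNset// => Fz; apply: nz; by exists k.
- move=> _ [a [b [c [e ->]]]] /=.
  apply: (measurable_fun_cvg (h := fun k t => eigenvalue_sum (rect_bump a b c e k) A (chi t))) => [k|t _].
    by apply: (measurable_eigenvalue_sum haarP A n0); exact: rect_bump_test.
  by apply: cvg_sums => z; exact: rect_bump_cvg.
Qed.

(** Divided by [n] because the Giry monad mixes measures of mass at most 1; [torus_measure] restores
    the factor. *)
Definition empirical t : set (plane R) -> \bar R :=
  mscale ((n%:R : R)^-1)%:nng (root_measure (roots t)).

HB.instance Definition _ t := Measure.on (empirical t).

Let empiricalE t E : empirical t E = ((n%:R)^-1 * eigenvalue_sum (\1_E) A (chi t))%:E.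
Proof. by rewrite /empirical /mscale /= root_measureE -EFinM. Qed.

Let empirical_le1 t : (empirical t setT <= 1)%E.
Proof.
rewrite empiricalE lee_fin count_indic (eq_bigr (fun=> 1)) => [|x _].
  by rewrite big_const_seq count_predT size_spectrum_seq iter_addr_0 mulVf// gt_eqF.
by rewrite indicT.
Qed.

HB.instance Definition _ t :=
  Measure_isSubProbability.Build _ _ _ (empirical t) (empirical_le1 t).

Let empirical_giry t : giry (plane R) R := empirical t.

Let measurable_empirical : measurable_fun setT empirical_giry.
Proof.
apply: measurable_giry_codensity => // B mB.
rewrite (_ : (fun t => _) = EFin \o (fun t => (n%:R)^-1 * eigenvalue_sum (\1_B) A (chi t))).
  apply/measurable_EFinP; apply: measurable_funM; first exact: measurable_cst.
  exact: measurable_root_count.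
by apply/funext => t; exact: empiricalE.
Qed.

Definition torus_measure : {measure set (plane R) -> \bar R} :=
  mscale (n%:R : R)%:nng (giry_bind (P : giry T R) measurable_empirical).

Let ge0_torus_integral (h : R * R -> R) :
  measurable_fun [set: plane R] h -> (forall z, 0 <= h z) ->
  measurable_fun setT (fun t => eigenvalue_sum h A (chi t)) /\
  (\int[torus_measure]_z (h z)%:E = \int[P]_t (eigenvalue_sum h A (chi t))%:E)%E.
Proof.
move=> mh h0; have mh' : measurable_fun [set: plane R] (EFin \o h) by exact/measurable_EFinP.
have h0' z : (0 <= (EFin \o h) z)%E by rewrite lee_fin.
have giE t : giry_int (empirical_giry t) (EFin \o h) = ((n%:R)^-1 * eigenvalue_sum h A (chi t))%:E.
  rewrite /giry_int /empirical_giry /empirical ge0_integral_mscale//.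
  by rewrite integral_root_measure.
have mg : measurable_fun setT (fun t => giry_int (empirical_giry t) (EFin \o h)).
  by apply: (measurableT_comp (measurable_giry_int mh' h0')); exact: measurable_empirical.
have E : (fun t => (eigenvalue_sum h A (chi t))%:E) =
    (fun t => (n%:R)%:E * giry_int (empirical_giry t) (EFin \o h))%E.
  by apply/funext => t; rewrite giE -EFinM mulVKf// gt_eqF.
split.
  by have := measurable_funeM n%:R%:E mg; rewrite -E => /measurable_EFinP.
transitivity (\int[P]_t (n%:R%:E * giry_int (empirical_giry t) (EFin \o h)))%E; last first.
  by apply: eq_integral => t _; rewrite giE -EFinM mulVKf// gt_eqF.
have -> : (\int[P]_t (n%:R%:E * giry_int (empirical_giry t) (EFin \o h)) =
    n%:R%:E * \int[P]_t giry_int (empirical_giry t) (EFin \o h))%E.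
  by apply: ge0_integralZl => // t _; exact: integral_ge0.
rewrite /torus_measure ge0_integral_mscale//; last by move=> z _; rewrite lee_fin.
congr (_ * _)%E.
exact: (giry_int_bind (P : giry T R) measurable_empirical mh' h0').
Qed.

Let torus_mass : torus_measure setT = n%:R%:E.
Proof.
have := (ge0_torus_integral (h := fun=> 1) (@measurable_cst _ _ _ _ _ _) (fun=> ler01)).2.
rewrite integral_cst// mul1e => ->.
rewrite (_ : (fun t => _) = fun=> n%:R%:E); first by rewrite integral_cst//= probability_setT mule1.
by apply/funext => t; rewrite /eigenvalue_sum big_const_seq count_predT size_spectrum_seq iter_addr_0.
Qed.

Lemma torus_integral (h : R * R -> R) M :
  measurable_fun [set: plane R] h -> (forall z, `|h z| <= M) ->
  P.-integrable setT (EFin \o (fun t => eigenvalue_sum h A (chi t))) /\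
  (\int[torus_measure]_z (h z)%:E = (\int[P]_t eigenvalue_sum h A (chi t))%:E)%E.
Proof.
move=> mh hM.
have mhM : measurable_fun [set: plane R] (fun z => h z + M).
  by apply: measurable_funD => //; exact: measurable_cst.
have hM0 z : 0 <= h z + M by have := hM z; rewrite ler_norml => /andP[]; lra.
have [mS IS] := ge0_torus_integral mhM hM0.
have SE t : eigenvalue_sum (fun z => h z + M) A (chi t) = eigenvalue_sum h A (chi t) + M * n%:R.
  rewrite /eigenvalue_sum big_split/=; congr (_ + _).
  by rewrite big_const_seq count_predT size_spectrum_seq iter_addr_0 mulr_natr.
have mSh : measurable_fun setT (fun t => eigenvalue_sum h A (chi t)).
  rewrite (_ : (fun t => _) = fun t => eigenvalue_sum (fun z => h z + M) A (chi t) - M * n%:R).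
    by apply: measurable_funB => //; exact: measurable_cst.
  by apply/funext => t; rewrite SE addrK.
have iSh : P.-integrable setT (EFin \o (fun t => eigenvalue_sum h A (chi t))).
  apply: (@bounded_measurable_integrable _ _ _ _ _ (n%:R * M)) => // t.
  apply: le_trans (ler_norm_sum _ _ _) _.
  apply: (@le_trans _ _ (\sum_(x <- roots t) M)); first by apply: ler_sum => x _; exact: hM.
  by rewrite big_const_seq count_predT size_spectrum_seq iter_addr_0 mulr_natl.
split=> //; rewrite (integral_shift torus_mass mh hM) IS.
under eq_integral do rewrite SE EFinD.
have ic : P.-integrable setT (EFin \o (fun=> M * n%:R)).
  by apply: (@bounded_measurable_integrable _ _ _ _ _ `|M * n%:R|).
rewrite integralD//= integral_cst//= probability_setT mule1 addeK//.
by rewrite /Rintegral fineK//; exact: integrable_fin_num.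
Qed.

Lemma size_fin_eigenvalues (Q : finZmodType) (pi : {additive G -> Q}) :
  size (fin_eigenvalues pi A) = (#|{: Q}| * n)%N.
Proof.
have [psi [psiP psiO]] := finite_dual R Q.
rewrite (perm_size (fin_eigenvalues_symbol pi A psiP psiO)) size_flatten /shape -map_comp.
rewrite (eq_map (g := fun=> n)); last by move=> k; exact: size_spectrum_seq.
by rewrite sumnE big_map big_enum /= sum_nat_const card_ord.
Qed.

Lemma eigenvalue_integral (N : residual_chain G) i (h : R * R -> R) M :
  measurable_fun [set: plane R] h -> (forall z, `|h z| <= M) ->
  (\int[eigenvalue_measure A N i]_z (h z)%:E =
   ((#|{: finquot (chain_finite_index N i)}|%:R : R)^-1 *
     \sum_(x <- fin_eigenvalues (quot_proj (chain_finite_index N i)) A) h (to_plane x))%:E)%E.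
Proof.
move=> mh hM; set Q := finquot (chain_finite_index N i).
set e := fin_eigenvalues _ _.
have Q0 : (#|{: Q}|%:R : R) != 0.
  by rewrite pnatr_eq0 -lt0n; apply/card_gt0P; exists 0.
have ge0 (u : R * R -> R) : measurable_fun [set: plane R] u -> (forall z, 0 <= u z) ->
    (\int[eigenvalue_measure A N i]_z (u z)%:E = ((#|{: Q}|%:R : R)^-1 * \sum_(x <- e) u (to_plane x))%:E)%E.
  move=> mu u0; have mu' : measurable_fun [set: plane R] (EFin \o u) by exact/measurable_EFinP.
  rewrite /eigenvalue_measure ge0_integral_mscale//; last by move=> z _; rewrite lee_fin.
  by rewrite EFinM -integral_root_measure.
have sz : size e = (#|{: Q}| * n)%N by exact: size_fin_eigenvalues.
have mass : eigenvalue_measure A N i setT = n%:R%:E.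
  rewrite eigenvalue_measureE (eq_bigr (fun=> 1)) => [|x _]; last by rewrite indicT.
  by rewrite big_const_seq count_predT sz iter_addr_0 natrM mulKf.
rewrite (integral_shift mass mh hM) ge0; last 2 first.
- by apply: measurable_funD => //; exact: measurable_cst.
- by move=> z; have := hM z; rewrite ler_norml => /andP[]; lra.
rewrite -EFinB big_split/= big_const_seq count_predT sz iter_addr_0; congr EFin.
by rewrite -[M *+ _]mulr_natl natrM mulrDr -mulrA mulKf// [n%:R * M]mulrC addrK.
Qed.

(** The roots at all characters lie in one square, where a continuous function is uniformly close to
    a combination of test functions; hence no mass escapes, and [average_cvg] applies to the
    combination. *)
Lemma weak_convergence_torus (N : residual_chain G) :
  weak_convergence (eigenvalue_measure A N) torus_measure.
Proof.
move=> h ch [B [_ HB]].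
have hB z : `|h z| <= B + 1 by apply: HB => //; rewrite ltrDl.
have mh := continuous_measurable_plane ch.
have [ih ->] := torus_integral mh hB.
under eq_fun do rewrite (eigenvalue_integral N _ mh hB).
apply: cvg_EFin; first by near=> i.
have [M [M0 HM]] := symbol_root_bound A.
apply/cvgrPdist_le => e e0.
(* Each character has [n] roots, among which the tolerance e / 3 is shared. *)
have e3 : 0 < e / 3 / n%:R by rewrite !divr_gt0.
have [I [c [f [tf Hf]]]] := test_approximation M ch e3.
pose g z := \sum_i c i * f i z.
have sumE psi : eigenvalue_sum g A psi = \sum_i c i * eigenvalue_sum (f i) A psi.
  rewrite /eigenvalue_sum /g exchange_big /=; apply: eq_bigr => i _.
  by rewrite mulr_sumr.
have close psi : is_character psi -> `|eigenvalue_sum h A psi - eigenvalue_sum g A psi| <= e / 3.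
  move=> psiP; rewrite /eigenvalue_sum -sumrB; apply: le_trans (ler_norm_sum _ _ _) _.
  apply: (@le_trans _ _ (\sum_(x <- spectrum_seq (symbol A psi)) e / 3 / n%:R)).
    rewrite big_seq [leRHS]big_seq; apply: ler_sum => x xs.
    have xM := HM psi psiP x xs.
    by apply: Hf; apply: le_trans xM; [exact: Re_le_normc|exact: Im_le_normc].
  by rewrite big_const_seq count_predT size_spectrum_seq iter_addr_0 -[_ *+ n]mulr_natr divfK// gt_eqF.
have itf i : P.-integrable setT (EFin \o (fun t => eigenvalue_sum (f i) A (chi t))).
  have [K HK] := eigenvalue_sum_bounded A (tf i).
  by apply: bounded_measurable_integrable; [exact: (measurable_eigenvalue_sum haarP)|move=> t; exact: HK].
have [ig Ig] : P.-integrable setT (EFin \o (fun t => eigenvalue_sum g A (chi t))) /\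
    \int[P]_t eigenvalue_sum g A (chi t) = \sum_i c i * \int[P]_t eigenvalue_sum (f i) A (chi t).
  rewrite (_ : (fun t => eigenvalue_sum g A (chi t)) = fun t => \sum_i c i * eigenvalue_sum (f i) A (chi t)); last first.
    by apply/funext => t; exact: sumE.
  elim: (index_enum I) => [|i s [IH1 IH2]].
    rewrite (_ : (fun t => _) = fun=> 0); last by apply/funext => t; rewrite big_nil.
    by split; [exact: integrable0|rewrite big_nil Rintegral_prob_cst].
  rewrite (_ : (fun t => _) = fun t => c i * eigenvalue_sum (f i) A (chi t) + \sum_(j <- s) c j * eigenvalue_sum (f j) A (chi t)); last first.
    by apply/funext => t; rewrite big_cons.
  have i1 : P.-integrable setT (EFin \o (fun t => c i * eigenvalue_sum (f i) A (chi t))).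
    rewrite (_ : EFin \o _ = fun t => ((c i)%:E * (eigenvalue_sum (f i) A (chi t))%:E)%E)//.
    exact: (integrableZl measurableT _ (itf i)).
  split.
    rewrite (_ : EFin \o _ = (EFin \o (fun t => c i * eigenvalue_sum (f i) A (chi t))) \+
      (EFin \o (fun t => \sum_(j <- s) c j * eigenvalue_sum (f j) A (chi t))))//.
    exact: integrableD.
  by rewrite RintegralD// IH2 big_cons RintegralZl.
have cg : (#|{: finquot (chain_finite_index N i)}|%:R : R)^-1 *
     \sum_(x <- fin_eigenvalues (quot_proj (chain_finite_index N i)) A) g (to_plane x)
     @[i --> \oo] --> \int[P]_t eigenvalue_sum g A (chi t).
  rewrite Ig (_ : (fun i => _) = fun i => \sum_j c j * ((#|{: finquot (chain_finite_index N i)}|%:R : R)^-1 *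
     \sum_(x <- fin_eigenvalues (quot_proj (chain_finite_index N i)) A) f j (to_plane x))).
    apply: cvg_big => [|j _]; first exact: add_continuous.
    apply: (@cvgM _ _ _ _ (fun=> c j)); first exact: cvg_cst.
    exact: (average_cvg haarP n0 N (tf j)).
  apply/funext => i; rewrite /g exchange_big /= mulr_sumr; apply: eq_bigr => j _.
  by rewrite -mulr_sumr mulrCA.
have e30 : 0 < e / 3 by rewrite divr_gt0.
have /cvgrPdist_le /(_ _ e30) [i0 _ Hi0] := cg.
exists i0 => // i /= i0i.
apply: le_trans (ler_distD (\int[P]_t eigenvalue_sum g A (chi t)) _ _) _.
rewrite (_ : e = e / 3 + (e / 3 + e / 3)); last by field.
apply: lerD.
  rewrite -RintegralB//.
  have iD : P.-integrable setT (EFin \o (fun t => eigenvalue_sum h A (chi t) - eigenvalue_sum g A (chi t))).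
    rewrite (_ : EFin \o _ = fun t => ((eigenvalue_sum h A (chi t))%:E - (eigenvalue_sum g A (chi t))%:E)%E)//.
    exact: integrableB.
  apply: le_trans (le_normr_Rintegral _ iD) _ => //.
  rewrite -[leRHS](Rintegral_prob_cst P); apply: le_Rintegral => //.
  - exact: (integrable_abse iD).
  - by apply: (@bounded_measurable_integrable _ _ _ _ _ (e / 3)) => // t; rewrite gtr0_norm.
  - by move=> t _; apply: close; case: haarP.
apply: le_trans (ler_distD _ _ _) (lerD (Hi0 i i0i) _).
set Q := finquot (chain_finite_index N i).
have Q0 : 0 < (#|{: Q}|%:R : R) by rewrite ltr0n; apply/card_gt0P; exists 0.
have [psi [psiP psiO]] := finite_dual R Q.
have psiP' k : is_character (psi k \o quot_proj (chain_finite_index N i)) by exact: character_comp.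
rewrite -(ler_pM2l Q0) -{1}(gtr0_norm Q0) -normrM mulrBr !mulVKf ?gt_eqF//.
have split_dual u : \sum_(x <- fin_eigenvalues (quot_proj (chain_finite_index N i)) A) u (to_plane x)
    = \sum_k eigenvalue_sum u A (psi k \o quot_proj (chain_finite_index N i)).
  rewrite (perm_big _ (fin_eigenvalues_symbol _ A psiP psiO)) /=.
  by rewrite big_flatten big_map big_enum.
rewrite !split_dual -sumrB.
apply: le_trans (ler_norm_sum _ _ _) _.
apply: (@le_trans _ _ (\sum_(k < #|{: Q}|) e / 3)).
  by apply: ler_sum => k _; rewrite distrC; exact: close.
by rewrite sumr_const card_ord mulr_natl.
Unshelve. all: by end_near. Qed.

Lemma torus_measure_test f : test_function f ->
  (\int[torus_measure]_z (f z)%:E = (\int[P]_t eigenvalue_sum f A (chi t))%:E)%E.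
Proof.
move=> tf; have cf : continuous f by exact: (@test_continuous _ _ tf [::]).
have [rho rho0 Hf] := test_support tf.
have [S HS] := continuous_box_bounded (- rho) rho (- rho) rho cf.
suff fS z : `|f z| <= S by have [] := torus_integral (continuous_measurable_plane cf) fS.
have [zb|zb] := pselect (box (- rho) rho (- rho) rho z); first exact: HS.
have -> : f z = 0.
  case: z zb => x y zb; apply: (Hf [::]).
  apply: contrapT => /not_orP[/negP + /negP]; rewrite -!ltNge => x1 x2.
  by apply: zb; split; rewrite /= in_itv/= -ler_norml ltW.
rewrite normr0; apply: le_trans (HS (0, 0) _); first exact: normr_ge0.
by split; rewrite /= in_itv/= oppr_le0 ltW.
Qed.

End TorusMeasure.

(** * The Hilbert space of row vectors over l^2(G) *)

Section UnconditionalSums.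
Variables (R : realType) (G : zmodType).
Local Notation C := R[i].

(** Convergence along the finite subsets of [G]. The algebraic identities are proved for it and
    transferred, through [complex_sum_has] and uniqueness of the sum, to [complex_sum], which
    separates positive and negative parts. *)
Definition has_sum (f : G -> C) (s : C) : Prop := forall e : R, 0 < e ->
  exists S0 : {fset G}, forall S : {fset G}, (S0 `<=` S)%fset ->
    normc (\sum_(g <- S) f g - s) <= e.

Lemma normc_eq0_le (z : C) : (forall e : R, 0 < e -> normc z <= e) -> z = 0.
Proof.
move=> H; apply: eq0_normc; apply/eqP; rewrite eq_le normc_ge0 andbT.
by apply/ler_addgt0Pr => e e0; rewrite add0r; exact: H.
Qed.

Lemma has_sum_unique f s s' : has_sum f s -> has_sum f s' -> s = s'.
Proof.
move=> fs fs'; apply/eqP; rewrite -subr_eq0; apply/eqP/normc_eq0_le => e e0.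
have e2 : 0 < e / 2 by rewrite divr_gt0.
have [S1 H1] := fs _ e2; have [S2 H2] := fs' _ e2.
have h1 := H1 _ (fsubsetUl S1 S2); have h2 := H2 _ (fsubsetUr S1 S2).
rewrite (splitr e); set t := \sum_(g <- _) _ in h1 h2.
rewrite (_ : s - s' = (t - s') - (t - s)); last by ring.
by apply: le_trans (le_normcD _ _) _; rewrite normcN addrC lerD.
Qed.

Lemma has_sumD f g s t : has_sum f s -> has_sum g t -> has_sum (fun x => f x + g x) (s + t).
Proof.
move=> fs gt e e0; have e2 : 0 < e / 2 by rewrite divr_gt0.
have [S1 H1] := fs _ e2; have [S2 H2] := gt _ e2.
exists (S1 `|` S2)%fset => S; rewrite fsubUset => /andP[/H1 h1 /H2 h2].
rewrite big_split/= (splitr e) opprD addrACA.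
by apply: le_trans (le_normcD _ _) (lerD h1 h2).
Qed.

Lemma has_sumZ c f s : has_sum f s -> has_sum (fun x => c * f x) (c * s).
Proof.
move=> fs e e0; have c0 : 0 < normc c + 1 by rewrite ltr_wpDl// normc_ge0.
have [S0 H] := fs _ (divr_gt0 e0 c0); exists S0 => S /H h.
rewrite -mulr_sumr -mulrBr normcM; apply: le_trans (ler_wpM2l (normc_ge0 _) h) _.
by rewrite mulrCA ger_pMr// ler_pdivrMr ?mul1r ?lerDl.
Qed.

Lemma has_sumJ f s : has_sum f s -> has_sum (fun x => (f x)^*%C) (s^*%C).
Proof.
move=> fs e e0; have [S0 H] := fs _ e0; exists S0 => S /H.
rewrite -(rmorph_sum (@conjc R)) -(rmorphB (@conjc R)).
by case: (_ - s) => a b; rewrite /normc/= sqrrN.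
Qed.

Lemma has_sum_shift h f s : has_sum f s -> has_sum (fun g => f (g - h)) s.
Proof.
move=> fs e e0; have [S0 H] := fs _ e0.
exists [fset (g + h)%R | g in S0]%fset => S S0S.
have inj : injective (fun g : G => g - h) by move=> x y /addIr.
have -> : \sum_(g <- S) f (g - h) = \sum_(g <- [fset (g - h)%R | g in S]%fset) f g.
  by rewrite big_imfset //= => x y _ _; exact: inj.
apply: H; apply/fsubsetP => g gS; apply/imfsetP; exists (g + h); last by rewrite addrK.
by apply: (fsubsetP S0S); apply/imfsetP; exists g.
Qed.

Lemma has_sum_finite f (S0 : {fset G}) : (forall g, g \notin S0 -> f g = 0) ->
  has_sum f (\sum_(g <- S0) f g).
Proof.
move=> f0 e e0; exists S0 => S S0S.
rewrite (big_fset_incl _ S0S) ?subrr ?normc0 ?ltW// => g _ /f0 ->; by [].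
Qed.

Lemma esum_fset_le (f : G -> R) (S : {fset G}) : (forall g, 0 <= f g) ->
  ((\sum_(g <- S) f g)%:E <= \esum_(g in [set: G]) (f g)%:E)%E.
Proof.
move=> f0; apply: esum_ge; exists [set` S]; first by split=> //; exact: finite_fset.
by rewrite fsbig_finite/= ?set_fsetK -?sumEFin//; exact: finite_fset.
Qed.

Lemma esum_le_bound (f : G -> R) B : (forall S : {fset G}, \sum_(g <- S) f g <= B) ->
  (\esum_(g in [set: G]) (f g)%:E <= B%:E)%E.
Proof.
move=> H; apply: ge_ereal_sup => _ [A [finA _] <-].
by rewrite fsbig_finite//= sumEFin lee_fin.
Qed.

Let nonneg_sum (f : G -> R) B : (forall g, 0 <= f g) ->
  (forall S : {fset G}, \sum_(g <- S) f g <= B) ->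
  forall e, 0 < e -> exists S0 : {fset G}, forall S : {fset G}, (S0 `<=` S)%fset ->
    `|\sum_(g <- S) f g - fine (\esum_(g in [set: G]) (f g)%:E)| <= e.
Proof.
move=> f0 fB e e0; set s := esum _ _.
have sfin : s \is a fin_num.
  rewrite ge0_fin_numE; last by apply: esum_ge0 => g _; rewrite lee_fin.
  exact: le_lt_trans (esum_le_bound fB) (ltry _).
have sle (S : {fset G}) : \sum_(g <- S) f g <= fine s.
  by rewrite -lee_fin fineK//; exact: esum_fset_le.
have [A [finA _] sA] : exists2 A, fsets [set: G] A & (s - e%:E < \sum_(x \in A) (f x)%:E)%E.
  have [_ [A fA <-] h] := ub_ereal_sup_adherent e0 sfin; by exists A.
exists (fset_set A) => S AS.
have mono : \sum_(g <- fset_set A) f g <= \sum_(g <- S) f g.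
  rewrite (big_fsetID _ (fun g => g \in fset_set A) S) /=.
  rewrite (_ : [fset x | x in S & x \in fset_set A]%fset = fset_set A).
    by rewrite lerDl; apply: sumr_ge0.
  apply/fsetP => x; rewrite !inE /= andb_idl// => xA; exact: (fsubsetP AS).
move: sA; rewrite fsbig_finite//= sumEFin -(fineK sfin) -EFinB lte_fin => sA.
rewrite distrC ger0_norm ?subr_ge0// lerBlDr -lerBlDl.
by apply: le_trans mono; apply: ltW.
Qed.

Lemma normc_ReIm_le (z : C) : normc z <= `|complex.Re z| + `|complex.Im z|.
Proof.
rewrite -(ler_pXn2r (ltn0Sn 1)) ?nnegrE ?normc_ge0 ?addr_ge0//.
rewrite sqr_normc_ReIm sqrrD !real_normK ?num_real// addrAC lerDl mulrn_wge0// mulr_ge0.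
Qed.

Lemma complex_sum_has (f : G -> C) B :
  (forall S : {fset G}, \sum_(g <- S) normc (f g) <= B) -> has_sum f (complex_sum f).
Proof.
move=> fB.
have real (u : G -> R) : (forall g, `|u g| <= normc (f g)) ->
    forall e, 0 < e -> exists S0 : {fset G}, forall S : {fset G}, (S0 `<=` S)%fset ->
      `|\sum_(g <- S) u g - real_sum u| <= e.
  move=> uf e e0; have e2 : 0 < e / 2 by rewrite divr_gt0.
  have bnd (v : G -> R) : (forall g, v g <= `|u g|) -> forall S : {fset G}, \sum_(g <- S) v g <= B.
    by move=> vu S; apply: le_trans (fB S); apply: ler_sum => g _; exact: le_trans (vu g) (uf g).
  have p1 g : 0 <= Num.max (u g) 0 by rewrite le_max lexx orbT.
  have p2 g : 0 <= Num.max (- u g) 0 by rewrite le_max lexx orbT.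
  have q1 g : Num.max (u g) 0 <= `|u g| by rewrite ge_max normr_ge0 ler_norm.
  have q2 g : Num.max (- u g) 0 <= `|u g| by rewrite ge_max normr_ge0 -normrN ler_norm.
  have [S1 H1] := nonneg_sum p1 (bnd _ q1) e2.
  have [S2 H2] := nonneg_sum p2 (bnd _ q2) e2.
  exists (S1 `|` S2)%fset => S; rewrite fsubUset => /andP[/H1 h1 /H2 h2].
  have -> : \sum_(g <- S) u g = \sum_(g <- S) Num.max (u g) 0 - \sum_(g <- S) Num.max (- u g) 0.
    rewrite -sumrB; apply: eq_bigr => g _.
    by case: (leP (u g) 0) => u0; case: (leP (- u g) 0) => u1; lra.
  rewrite /real_sum; apply: le_trans (_ : _ <= e / 2 + e / 2) _; last by rewrite -splitr.
  apply: le_trans (lerD h1 h2); apply: le_trans (ler_normB _ _).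
  by rewrite le_eqVlt; apply/orP; left; apply/eqP; congr `|_|; ring.
move=> e e0; have e2 : 0 < e / 2 by rewrite divr_gt0.
have [S1 H1] := real _ (fun g => Re_le_normc (f g)) _ e2.
have [S2 H2] := real _ (fun g => Im_le_normc (f g)) _ e2.
exists (S1 `|` S2)%fset => S; rewrite fsubUset => /andP[/H1 h1 /H2 h2].
apply: le_trans (normc_ReIm_le _) _; rewrite (splitr e); apply: lerD.
  by rewrite [complex.Re _]raddfB raddf_sum.
by rewrite [complex.Im _]raddfB raddf_sum.
Qed.

End UnconditionalSums.

Section Ell2Inner.
Variables (R : realType) (G : zmodType).
Local Notation C := R[i].
Implicit Types x y z : ell2 R G.

Definition dot x y : C := complex_sum (fun g => x g * (y g)^*%C).

Lemma ell2_bounded x : exists B : R, forall S : {fset G}, \sum_(g <- S) normc (x g) ^+ 2 <= B.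
Proof.
have /asboolP xs := ell2_funP x.
exists (fine (\esum_(g in [set: G]) (normc (x g) ^+ 2)%:E)) => S.
rewrite -lee_fin fineK; last first.
  by rewrite ge0_fin_numE//; apply: esum_ge0 => g _; rewrite lee_fin sqr_ge0.
by apply: esum_fset_le => g; exact: sqr_ge0.
Qed.

Lemma bounded_square_summable (f : G -> C) B :
  (forall S : {fset G}, \sum_(g <- S) normc (f g) ^+ 2 <= B) -> f \in @square_summable R G.
Proof.
by move=> H; apply/asboolP; apply: le_lt_trans (esum_le_bound H) (ltry _).
Qed.

Lemma normcJ' (z : C) : normc z^*%C = normc z.
Proof. by case: z => a b; rewrite /normc /= sqrrN. Qed.

Lemma dot_has x y : has_sum (fun g => x g * (y g)^*%C) (dot x y).
Proof.
have [B xB] := ell2_bounded x; have [D yD] := ell2_bounded y.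
apply: (@complex_sum_has _ _ _ (B + D)) => S.
apply: le_trans (lerD (xB S) (yD S)); rewrite -big_split; apply: ler_sum => g _ /=.
rewrite normcM normcJ'; set a := normc _; set b := normc _.
have a0 : 0 <= a := normc_ge0 _; have b0 : 0 <= b := normc_ge0 _.
by have := sqr_ge0 (a - b); have := mulr_ge0 a0 b0; rewrite sqrrB; nra.
Qed.

Lemma dot_linear c x y z : dot (c *: x + y) z = c * dot x z + dot y z.
Proof.
apply: (has_sum_unique (dot_has _ _)).
rewrite (_ : (fun g => _) = fun g => c * (x g * (z g)^*%C) + y g * (z g)^*%C).
  by apply: has_sumD; [apply: has_sumZ|]; exact: dot_has.
by apply/funext => g; rewrite mulrA -mulrDl.
Qed.

Lemma dotJ x y : dot y x = (dot x y)^*%C.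
Proof.
apply: (has_sum_unique (dot_has _ _)).
rewrite (_ : (fun g => _) = fun g => (x g * (y g)^*%C)^*%C); first exact: has_sumJ (dot_has _ _).
by apply/funext => g; rewrite rmorphM /= conjcK mulrC.
Qed.

Lemma dot_self x : exists2 s : R, dot x x = s%:C%C &
  (forall S : {fset G}, \sum_(g <- S) normc (x g) ^+ 2 <= s) /\
  (forall e, 0 < e -> exists S0 : {fset G}, forall S : {fset G}, (S0 `<=` S)%fset ->
     s - \sum_(g <- S) normc (x g) ^+ 2 <= e).
Proof.
exists (complex.Re (dot x x)).
  have := dotJ x x; case: (dot x x) => a b /= [] h; congr (_ +i* _)%C; lra.
have E (S : {fset G}) : complex.Re (\sum_(g <- S) x g * (x g)^*%C) = \sum_(g <- S) normc (x g) ^+ 2.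
  by rewrite raddf_sum; apply: eq_bigr => g _; rewrite mulc_conj.
split=> [S|e e0].
  apply/ler_addgt0Pr => e e0; have [S0 H] := dot_has x x e0.
  have := H _ (fsubsetUr S S0) => /(le_trans (Re_le_normc _)); rewrite raddfB /= E ler_norml => /andP[_ h].
  apply: (@le_trans _ _ (\sum_(g <- (S `|` S0)%fset) normc (x g) ^+ 2)); last by rewrite -lerBlDl.
  rewrite [leRHS](big_fsetID _ (fun g => g \in S)) /=.
  rewrite (_ : [fset x | x in (S `|` S0)%fset & x \in S]%fset = S).
    by rewrite lerDl; apply: sumr_ge0 => g _; exact: sqr_ge0.
  by apply/fsetP => u; rewrite !inE /= andb_idl// => ->.
have [S0 H] := dot_has x x e0; exists S0 => S /H/(le_trans (Re_le_normc _)).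
by rewrite raddfB /= E distrC => /(le_trans (ler_norm _)).
Qed.

Lemma dot_translate h x y : dot (translate h x) y = dot x (translate (- h) y).
Proof.
apply: (has_sum_unique (dot_has _ _)).
rewrite (_ : (fun g => _) = fun g => x (g - h) * (translate (- h) y (g - h))^*%C).
  exact: has_sum_shift (dot_has x (translate (- h) y)).
by apply/funext => g /=; rewrite opprK subrK.
Qed.

End Ell2Inner.

Section SemiInner.
Variables (R : realType) (V : lmodType R[i]) (B : V -> V -> R[i]).
Hypothesis B_linear : forall c x y z, B (c *: x + y) z = c * B x z + B y z.
Hypothesis B_conj : forall x y, B y x = (B x y)^*%C.
Hypothesis B_ge0 : forall x, 0 <= complex.Re (B x x).

(** The form may be degenerate, since besides the inner product it will be <K x, y> with K positive.
    Positivity at x - t B(x, y) y gives a quadratic in the real t, which is affine when B(y, y) =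
    0. *)
Lemma semi_cauchy_schwarz x y :
  normc (B x y) ^+ 2 <= complex.Re (B x x) * complex.Re (B y y).
Proof.
have Blr c u v w : B w (c *: u + v) = c^*%C * B w u + B w v.
  by rewrite B_conj B_linear rmorphD rmorphM /= -!B_conj.
have im u : complex.Im (B u u) = 0.
  by have := B_conj u u; case: (B u u) => a b /= [] h; lra.
have key (t : R) : 0 <= complex.Re (B y y) * (t ^+ 2 * normc (B x y) ^+ 2)
    - 2 * t * normc (B x y) ^+ 2 + complex.Re (B x x).
  have := B_ge0 ((- t%:C%C * B x y) *: y + x).
  rewrite B_linear !Blr (B_conj x y) !sqr_normc_ReIm.
  have := im x; have := im y; case: (B x y) => a b; case: (B x x) => a1 b1; case: (B y y) => a2 b2 /= -> _.
  by move=> h; apply: (le_trans h); rewrite le_eqVlt; apply/orP; left; apply/eqP; ring.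
set b2 := normc (B x y) ^+ 2 in key *; have b20 : 0 <= b2 by exact: sqr_ge0.
have [y0|y0] := eqVneq (complex.Re (B y y)) 0.
  rewrite y0 mulr0; have {}key t := key t; rewrite y0 in key.
  rewrite leNgt; apply/negP => b0.
  (* At this value of t the affine function equals -1. *)
  have := key ((complex.Re (B x x) + 1) / (2 * b2)); rewrite mul0r add0r.
  have -> : 2 * ((complex.Re (B x x) + 1) / (2 * b2)) * b2 = complex.Re (B x x) + 1.
    by field; rewrite gt_eqF.
  lra.
have yp : 0 < complex.Re (B y y) by rewrite lt0r y0 B_ge0.
have := key (complex.Re (B y y))^-1.
have -> : complex.Re (B y y) * ((complex.Re (B y y))^-1 ^+ 2 * b2) - 2 * (complex.Re (B y y))^-1 * b2
    + complex.Re (B x x) = complex.Re (B x x) - b2 / complex.Re (B y y) by field.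
by rewrite subr_ge0 ler_pdivrMr.
Qed.

End SemiInner.

Section HilbertGeometry.
Variables (R : realType) (G : zmodType) (n : nat).
Local Notation C := R[i].
Local Notation H := (hilbert R G n).
Implicit Types x y z : H.

Lemma entryD x y j : entry (x + y) j = entry x j + entry y j.
Proof. by rewrite /entry ffunE. Qed.

Lemma entryZ c x j : entry (c *: x) j = c *: entry x j.
Proof. by rewrite /entry ffunE. Qed.

Lemma inner_dot x y : inner x y = \sum_j dot (entry x j) (entry y j).
Proof. by []. Qed.

Lemma inner_linear c x y z : inner (c *: x + y) z = c * inner x z + inner y z.
Proof.
rewrite !inner_dot mulr_sumr -big_split; apply: eq_bigr => j _ /=.
by rewrite entryD entryZ dot_linear.
Qed.

Lemma innerJ x y : inner y x = (inner x y)^*%C.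
Proof. by rewrite !inner_dot rmorph_sum; apply: eq_bigr => j _; exact: dotJ. Qed.

Definition hsq x : R := complex.Re (inner x x).

Lemma inner_self x : inner x x = (hsq x)%:C%C.
Proof.
by rewrite /hsq; have := innerJ x x; case: (inner x x) => a b /= [] h; congr (_ +i* _)%C; lra.
Qed.

Definition partial_hsq (S : {fset G}) x : R := \sum_j \sum_(g <- S) normc (entry x j g) ^+ 2.

Lemma hsqE x : hsq x = \sum_j complex.Re (dot (entry x j) (entry x j)).
Proof. by rewrite /hsq inner_dot raddf_sum. Qed.

Lemma partial_hsq_le S x : partial_hsq S x <= hsq x.
Proof.
rewrite hsqE; apply: ler_sum => j _.
by have [s -> [H1 _]] := dot_self (entry x j); exact: H1.
Qed.

Lemma hsq_ge0 x : 0 <= hsq x.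
Proof.
apply: le_trans (partial_hsq_le fset0 x).
by apply: sumr_ge0 => j _; apply: sumr_ge0 => g _; exact: sqr_ge0.
Qed.

Lemma hsq_le_bound x B : (forall S, partial_hsq S x <= B) -> hsq x <= B.
Proof.
move=> HB; apply/ler_addgt0Pr => e e0.
have en : 0 < e / n.+1%:R by rewrite divr_gt0.
have /choice[F FP] : forall j : 'I_n, exists S0 : {fset G}, forall S : {fset G}, (S0 `<=` S)%fset ->
    complex.Re (dot (entry x j) (entry x j)) - \sum_(g <- S) normc (entry x j g) ^+ 2 <= e / n.+1%:R.
  by move=> j; have [s -> [_ H2]] := dot_self (entry x j); exact: H2.
pose S := (\bigcup_(j <- enum 'I_n) F j)%fset.
have : hsq x - partial_hsq S x <= e.
  rewrite hsqE -sumrB; apply: (@le_trans _ _ (\sum_(j < n) e / n.+1%:R)).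
    apply: ler_sum => j _; apply: FP; apply: bigfcup_sup => //; exact: mem_enum.
  rewrite sumr_const card_ord -[_ *+ _]mulr_natr -mulrA ler_piMr ?(ltW e0)//.
  by rewrite mulrC ler_pdivrMr// mul1r ler_nat.
by have := HB S; lra.
Qed.

Lemma hsq_eq0 x : hsq x = 0 -> x = 0.
Proof.
move=> x0; apply/ffunP => j; rewrite ffunE; apply/val_inj/funext => g.
apply: eq0_normc; apply/eqP; rewrite -sqrf_eq0 eq_le sqr_ge0 andbT.
apply: le_trans (_ : _ <= hsq x) _; last by rewrite x0.
apply: le_trans (partial_hsq_le [fset g]%fset x).
rewrite /partial_hsq (bigD1 j)//= big_seq_fset1 lerDl.
by apply: sumr_ge0 => k _; apply: sumr_ge0 => h _; exact: sqr_ge0.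
Qed.

Lemma hnormE x : hnorm x ^+ 2 = hsq x.
Proof. by rewrite /hnorm sqr_sqrtr// hsq_ge0. Qed.

Lemma hnorm_ge0 x : 0 <= hnorm x. Proof. exact: sqrtr_ge0. Qed.

Lemma hnorm_le_sq x c : 0 <= c -> hsq x <= c ^+ 2 -> hnorm x <= c.
Proof. by move=> c0; rewrite -hnormE ler_pXn2r ?nnegrE// hnorm_ge0. Qed.

Lemma cauchy_schwarz x y : normc (inner x y) <= hnorm x * hnorm y.
Proof.
rewrite -(ler_pXn2r (ltn0Sn 1)) ?nnegrE ?normc_ge0 ?mulr_ge0 ?hnorm_ge0//.
rewrite exprMn !hnormE.
by apply: (semi_cauchy_schwarz inner_linear innerJ) => u; exact: hsq_ge0.
Qed.

Lemma hsqD x y : hsq (x + y) = hsq x + hsq y + 2 * complex.Re (inner x y).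
Proof.
have iD (u v w : H) : inner (u + v) w = inner u w + inner v w.
  by have := inner_linear 1 u v w; rewrite scale1r mul1r.
have iDr (u v w : H) : inner w (u + v) = inner w u + inner w v.
  by rewrite (innerJ (u + v) w) iD rmorphD /= -!innerJ.
rewrite /hsq iD !iDr (innerJ x y).
by case: (inner x x) (inner y y) (inner x y) => [a b] [a' b'] [c d] /=; ring.
Qed.

Lemma hnormD x y : hnorm (x + y) <= hnorm x + hnorm y.
Proof.
apply: hnorm_le_sq; first by rewrite addr_ge0 ?hnorm_ge0.
rewrite hsqD sqrrD !hnormE -[_ *+ 2]mulr_natl.
by have := le_trans (ler_norm _) (le_trans (Re_le_normc _) (cauchy_schwarz x y)); lra.
Qed.

Lemma innerZ c x y : inner (c *: x) y = c * inner x y.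
Proof.
have := inner_linear c x 0 y; rewrite addr0 => ->.
by have := inner_linear 1 0 0 y; rewrite scale1r mul1r addr0 => /eqP; rewrite -subr_eq0 opprD addNKr oppr_eq0 => /eqP ->; rewrite addr0.
Qed.

Lemma hsqZ c x : hsq (c *: x) = normc c ^+ 2 * hsq x.
Proof.
rewrite /hsq innerZ (innerJ (c *: x) x) innerZ sqr_normc_ReIm.
rewrite rmorphM /= -(innerJ x x) inner_self.
by case: c => a b /=; ring.
Qed.

Lemma hnormZ c x : hnorm (c *: x) = normc c * hnorm x.
Proof.
rewrite /hnorm -!/(hsq _) hsqZ sqrtrM ?sqr_ge0// sqrtr_sqr ger0_norm//.
exact: normc_ge0.
Qed.

Lemma hnorm0 : hnorm (0 : H) = 0.
Proof. by rewrite -(scale0r (0 : H)) hnormZ normc0 mul0r. Qed.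

Lemma hnormN x : hnorm (- x) = hnorm x.
Proof. by rewrite -scaleN1r hnormZ normcN normc1 mul1r. Qed.

Lemma hnorm_eq0 x : hnorm x <= 0 -> x = 0.
Proof.
move=> x0; apply: hsq_eq0; rewrite -hnormE; apply/eqP; rewrite sqrf_eq0 eq_le x0.
exact: hnorm_ge0.
Qed.

Lemma coordinate_le x j g : normc (entry x j g) <= hnorm x.
Proof.
rewrite -(ler_pXn2r (ltn0Sn 1)) ?nnegrE ?normc_ge0 ?hnorm_ge0// hnormE.
apply: le_trans (partial_hsq_le [fset g]%fset x).
rewrite /partial_hsq (bigD1 j)//= big_seq_fset1 lerDl.
by apply: sumr_ge0 => k _; apply: sumr_ge0 => h _; exact: sqr_ge0.
Qed.

(** The limit is described by its distances to all [w], so that sums of squared distances pass to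
    the limit as real numbers. *)
Lemma complex_cauchy (u : nat -> C) (b : nat -> R) :
  b m @[m --> \oo] --> (0 : R) ->
  (forall m k, (m <= k)%N -> normc (u k - u m) <= b m) ->
  exists l : C, forall w, normc (u k - w) @[k --> \oo] --> normc (l - w).
Proof.
move=> b0 ub.
have real (v : nat -> R) : (forall m k, (m <= k)%N -> `|v k - v m| <= b m) ->
    exists l : R, v m @[m --> \oo] --> l.
  move=> vb; suff cv : cvgn v by exists (limn v).
  apply/cauchy_cvgP/cauchy_ballP => e e0; rewrite !near_map2.
  have e2 : 0 < e / 2 by rewrite divr_gt0.
  have /cvgrPdist_lt /(_ _ e2) [m0 _ Hm0] := b0.
  have bm : b m0 < e / 2 by have := Hm0 m0 (leqnn _); rewrite sub0r normrN; apply: le_lt_trans (ler_norm _).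
  exists ([set k | (m0 <= k)%N], [set k | (m0 <= k)%N]); first by split; exists m0.
  move=> [k l] /= [mk ml]; rewrite /ball/= (splitr e).
  apply: le_lt_trans (ler_distD (v m0) _ _) _; apply: ltrD.
    exact: le_lt_trans (vb _ _ mk) bm.
  by rewrite distrC; exact: le_lt_trans (vb _ _ ml) bm.
have [l1 L1] : exists l : R, complex.Re (u m) @[m --> \oo] --> l.
  apply: real => m k mk; apply: le_trans (ub m k mk); apply: le_trans (Re_le_normc _).
  by rewrite [complex.Re (_ - _)]raddfB.
have [l2 L2] : exists l : R, complex.Im (u m) @[m --> \oo] --> l.
  apply: real => m k mk; apply: le_trans (ub m k mk); apply: le_trans (Im_le_normc _).
  by rewrite [complex.Im (_ - _)]raddfB.
exists (l1 +i* l2)%C => w.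
have E (z : C) : normc z = Num.sqrt (complex.Re z ^+ 2 + complex.Im z ^+ 2) by case: z.
rewrite E; under eq_fun do rewrite E.
apply: (@cvg_comp _ _ _ _ (@Num.sqrt R) _ (nbhs (complex.Re ((l1 +i* l2)%C - w) ^+ 2 + complex.Im ((l1 +i* l2)%C - w) ^+ 2))); last exact: sqrt_continuous.
have c1 : complex.Re (u k - w) @[k --> \oo] --> complex.Re ((l1 +i* l2)%C - w).
  rewrite raddfB (_ : (fun k => _) = fun k => complex.Re (u k) - complex.Re w).
    by apply: cvgB; [exact: L1|exact: cvg_cst].
  by apply/funext => k; rewrite raddfB.
have c2 : complex.Im (u k - w) @[k --> \oo] --> complex.Im ((l1 +i* l2)%C - w).
  rewrite raddfB (_ : (fun k => _) = fun k => complex.Im (u k) - complex.Im w).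
    by apply: cvgB; [exact: L2|exact: cvg_cst].
  by apply/funext => k; rewrite raddfB.
by apply: cvgD; apply: cvgM.
Qed.

(** Completeness with a rate. The limit is taken coordinatewise; the bound passes to it on every
    finite set of coordinates, and from there to the norm. *)
Lemma hilbert_cauchy (u : nat -> H) (b : nat -> R) :
  b m @[m --> \oo] --> (0 : R) ->
  (forall m k, (m <= k)%N -> hnorm (u k - u m) <= b m) ->
  exists l : H, forall m, hnorm (l - u m) <= b m.
Proof.
move=> b0 ub.
have entryB x y j g : entry (x - y) j g = entry x j g - entry y j g.
  by rewrite entryD -scaleN1r entryZ -[LHS]/(entry x j g + -1 * entry y j g) mulN1r.
have /choice[L LP] : forall jg : 'I_n * G, exists l : C, forall w,
    normc (entry (u k) jg.1 jg.2 - w) @[k --> \oo] --> normc (l - w).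
  move=> [j g]; apply: complex_cauchy b0 _ => m k mk /=.
  by rewrite -entryB; apply: le_trans (coordinate_le _ _ _) (ub m k mk).
have bge0 m : 0 <= b m := le_trans (hnorm_ge0 _) (ub m m (leqnn m)).
have sums m (S : {fset G}) :
    \sum_j \sum_(g <- S) normc (L (j, g) - entry (u m) j g) ^+ 2 <= b m ^+ 2.
  have cv : \sum_j \sum_(g <- S) normc (entry (u k) j g - entry (u m) j g) ^+ 2 @[k --> \oo] -->
      \sum_j \sum_(g <- S) normc (L (j, g) - entry (u m) j g) ^+ 2.
    apply: cvg_big => [|j _]; first exact: add_continuous.
    apply: cvg_big => [|g _]; first exact: add_continuous.
    by apply: cvgM; exact: (LP (j, g)).
  apply: (ler_cvg_to cv (@cvg_cst _ (b m ^+ 2) _ _ _)); near=> k.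
  have mk : (m <= k)%N by near: k; exists m.
  apply: le_trans (_ : partial_hsq S (u k - u m) <= _).
    by rewrite le_eqVlt; apply/orP; left; apply/eqP; apply: eq_bigr => j _; apply: eq_bigr => g _; rewrite entryB.
  apply: le_trans (partial_hsq_le _ _) _.
  by rewrite -hnormE lerXn2r ?nnegrE ?hnorm_ge0// ub.
have Lsum j : (fun g => L (j, g)) \in @square_summable R G.
  rewrite (_ : (fun g => _) = (fun g => L (j, g) - entry (u 0%N) j g) + entry (u 0%N) j).
    apply: rpredD; last exact: ell2_funP.
    apply: (@bounded_square_summable _ _ _ (b 0%N ^+ 2)) => S; apply: le_trans (sums 0%N S).
    rewrite [leRHS](bigD1 j)//= lerDl.
    by apply: sumr_ge0 => k _; apply: sumr_ge0 => h _; exact: sqr_ge0.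
  by apply/funext => g; rewrite fctE subrK.
exists ([ffun j => Ell2 (Lsum j)] : H) => m; apply: hnorm_le_sq => //.
apply: hsq_le_bound => S; apply: le_trans (sums m S).
rewrite le_eqVlt; apply/orP; left; apply/eqP; apply: eq_bigr => j _; apply: eq_bigr => g _.
by rewrite entryB /entry ffunE.
Unshelve. all: by end_near. Qed.

(** Serves twice: with all coefficients equal to 1 for the Neumann series, and with those of the
    logarithm for the functional calculus. Geometric tails make the partial sums Cauchy. *)
Lemma power_series_operator (K : H -> H) (c : nat -> C) rho :
  linear K -> 0 <= rho -> rho < 1 -> (forall x, hnorm (K x) <= rho * hnorm x) ->
  (forall k, normc (c k) <= 1) ->
  exists L : H -> H, linear L /\ forall m x,
    hnorm (L x - \sum_(k < m) c k *: iter k K x) <= rho ^+ m / (1 - rho) * hnorm x.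
Proof.
move=> Kl r0 r1 Kr c1; have p : 0 < 1 - rho by rewrite subr_gt0.
have iterl k a x y : iter k K (a *: x + y) = a *: iter k K x + iter k K y.
  by elim: k => //= k ->; rewrite Kl.
have iterr k x : hnorm (iter k K x) <= rho ^+ k * hnorm x.
  elim: k => [|k IH] /=; first by rewrite mul1r.
  by apply: le_trans (Kr _) _; rewrite exprS -mulrA ler_wpM2l.
pose s x m := \sum_(k < m) c k *: iter k K x.
have tail x m k : (m <= k)%N -> hnorm (s x k - s x m) <= rho ^+ m / (1 - rho) * hnorm x.
  move=> /subnK <-; elim: (k - m)%N => [|q IH] {k}.
    by rewrite add0n subrr hnorm0 !mulr_ge0 ?exprn_ge0 ?invr_ge0 ?(ltW p)// hnorm_ge0.
  have {IH} : hnorm (s x (q + m)%N - s x m) <= rho ^+ m * (1 - rho ^+ q) / (1 - rho) * hnorm x.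
    elim: q {IH} => [|q IH]; first by rewrite add0n subrr hnorm0 subrr mulr0 !mul0r.
    rewrite /s addSn big_ord_recr /= -/(s x _) addrAC.
    apply: le_trans (hnormD _ _) _.
    have h : hnorm (c (q + m)%N *: iter (q + m) K x) <= rho ^+ (q + m) * hnorm x.
      rewrite hnormZ; apply: le_trans (ler_wpM2r (hnorm_ge0 _) (c1 _)) _.
      by rewrite mul1r.
    apply: le_trans (lerD IH h) _; rewrite -mulrDl ler_wpM2r ?hnorm_ge0//.
    rewrite le_eqVlt; apply/orP; left; apply/eqP; rewrite exprD exprS; field.
    by rewrite gt_eqF.
  move=> IH; rewrite /s addSn big_ord_recr /= -/(s x _) addrAC.
  apply: le_trans (hnormD _ _) _.
  have h : hnorm (c (q + m)%N *: iter (q + m) K x) <= rho ^+ (q + m) * hnorm x.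
    rewrite hnormZ; apply: le_trans (ler_wpM2r (hnorm_ge0 _) (c1 _)) _.
    by rewrite mul1r.
  apply: le_trans (lerD IH h) _; rewrite -mulrDl ler_wpM2r ?hnorm_ge0//.
  have -> : rho ^+ m * (1 - rho ^+ q) / (1 - rho) + rho ^+ (q + m) = rho ^+ m * (1 - rho ^+ q.+1) / (1 - rho).
    by rewrite exprD exprS; field; rewrite gt_eqF.
  rewrite ler_wpM2r ?invr_ge0 ?(ltW p)// ler_piMr ?exprn_ge0//.
  by rewrite gerBl exprn_ge0.
have b0 x : rho ^+ m / (1 - rho) * hnorm x @[m --> \oo] --> (0 : R).
  rewrite -(mul0r (hnorm x)) -{1}(mul0r (1 - rho)^-1).
  apply: cvgM; last exact: cvg_cst.
  by apply: cvgM; [apply: cvg_expr; rewrite ger0_norm|exact: cvg_cst].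
have /choice[L LP] : forall x, exists l, forall m, hnorm (l - s x m) <= rho ^+ m / (1 - rho) * hnorm x.
  by move=> x; apply: hilbert_cauchy (b0 x) _ => m k; exact: tail.
exists L; split=> [a x y|m x]; last exact: LP.
apply/eqP; rewrite -subr_eq0; apply/eqP/hnorm_eq0.
have sl m : s (a *: x + y) m = a *: s x m + s y m.
  rewrite /s scaler_sumr -big_split; apply: eq_bigr => k _ /=.
  by rewrite iterl scalerDr !scalerA mulrC.
pose e m := rho ^+ m / (1 - rho) * hnorm (a *: x + y) +
  (normc a * (rho ^+ m / (1 - rho) * hnorm x) + rho ^+ m / (1 - rho) * hnorm y).
have ce : e m @[m --> \oo] --> (0 : R).
  rewrite -[0](_ : 0 + (normc a * 0 + 0) = 0); last by rewrite mulr0 !addr0.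
  apply: cvgD; first exact: b0.
  by apply: cvgD; [apply: cvgM; [exact: cvg_cst|exact: b0]|exact: b0].
apply: (ler_cvg_to (@cvg_cst _ (hnorm (L (a *: x + y) - (a *: L x + L y))) _ _ _) ce); near=> m.
have -> : L (a *: x + y) - (a *: L x + L y) = (L (a *: x + y) - s (a *: x + y) m)
    - (a *: (L x - s x m) + (L y - s y m)).
  by rewrite sl scalerBr [X in _ = _ - X]addrACA -opprD opprB addrA subrK.
apply: le_trans (hnormD _ _) _; apply: lerD; first exact: LP.
rewrite hnormN; apply: le_trans (hnormD _ _) _; apply: lerD; last exact: LP.
by rewrite hnormZ ler_wpM2l ?normc_ge0.
Unshelve. all: by end_near. Qed.

End HilbertGeometry.

(** * Convolution operators *)

Section ConvolutionOperators.
Variables (R : realType) (G : zmodType) (n : nat).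
Local Notation C := R[i].
Local Notation H := (hilbert R G n).
Local Notation Mn := 'M[C]_n.
Implicit Types (x y : H) (g h : G) (M : Mn).

Lemma ell2_sumE I (r : seq I) (F : I -> ell2 R G) g :
  (\sum_(i <- r) F i) g = \sum_(i <- r) F i g.
Proof.
elim: r => [|i r IH]; first by rewrite !big_nil.
by rewrite !big_cons -IH.
Qed.

Lemma dot_suml I (r : seq I) (c : I -> C) (u : I -> ell2 R G) v :
  dot (\sum_(i <- r) c i *: u i) v = \sum_(i <- r) c i * dot (u i) v.
Proof.
elim: r => [|i r IH]; last by rewrite !big_cons dot_linear IH.
rewrite !big_nil; have := dot_linear (-1) 0 0 v; rewrite scaler0 addr0 => ->.
by rewrite mulN1r addNr.
Qed.

Lemma dot_sumr I (r : seq I) (c : I -> C) (u : I -> ell2 R G) v :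
  dot v (\sum_(i <- r) c i *: u i) = \sum_(i <- r) (c i)^*%C * dot v (u i).
Proof.
rewrite dotJ dot_suml rmorph_sum; apply: eq_bigr => i _ /=.
by rewrite (dotJ (u i) v) rmorphM.
Qed.

(* The operator [x |-> (x g) M], with [g] translating the entries. *)
Definition conv_term g M x : H :=
  [ffun k => \sum_j M j k *: translate g (entry x j)].

Lemma entry_conv_term g M x k h :
  entry (conv_term g M x) k h = \sum_j M j k * entry x j (h - g).
Proof. by rewrite /entry ffunE ell2_sumE. Qed.

Lemma hilbert_ext x y : (forall k h, entry x k h = entry y k h) -> x = y.
Proof. by move=> xy; apply/ffunP => k; apply/val_inj/funext => h; exact: xy. Qed.

Lemma entryDE x y k h : entry (x + y) k h = entry x k h + entry y k h.
Proof. by rewrite entryD. Qed.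

Lemma entryZE c x k h : entry (c *: x) k h = c * entry x k h.
Proof. by rewrite entryZ. Qed.

Lemma entry_sumE I (r : seq I) (F : I -> H) k h :
  entry (\sum_(i <- r) F i) k h = \sum_(i <- r) entry (F i) k h.
Proof.
elim: r => [|i r IH]; first by rewrite !big_nil /entry ffunE.
by rewrite !big_cons entryDE IH.
Qed.

Lemma conv_term_linear g M : linear (conv_term g M).
Proof.
move=> c x y; apply: hilbert_ext => k h; rewrite entryDE entryZE !entry_conv_term.
rewrite mulr_sumr -big_split; apply: eq_bigr => j _ /=.
by rewrite entryDE entryZE mulrDr mulrCA.
Qed.

Lemma conv_term_comp g M g' M' x :
  conv_term g M (conv_term g' M' x) = conv_term (g + g') (M' *m M) x.
Proof.
apply: hilbert_ext => k h; rewrite !entry_conv_term.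
under eq_bigr do rewrite entry_conv_term mulr_sumr.
rewrite exchange_big /=; apply: eq_bigr => i _.
rewrite mxE mulr_suml; apply: eq_bigr => j _.
by rewrite mulrCA mulrA opprD addrA.
Qed.

Definition adjmx M : Mn := \matrix_(j, k) (M k j)^*%C.

Lemma conv_term_adjoint g M x y :
  inner (conv_term g M x) y = inner x (conv_term (- g) (adjmx M) y).
Proof.
rewrite !inner_dot.
under eq_bigr do rewrite /entry ffunE dot_suml.
rewrite exchange_big /=; apply: eq_bigr => j _.
rewrite [in RHS]/entry ffunE dot_sumr; apply: eq_bigr => k _.
by rewrite mxE conjcK dot_translate.
Qed.

Lemma sqr_normc_sum_le I (r : seq I) (F : I -> C) :
  normc (\sum_(i <- r) F i) ^+ 2 <= 2 ^+ size r * \sum_(i <- r) normc (F i) ^+ 2.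
Proof.
elim: r => [|i r IH]; first by rewrite !big_nil normc0 expr0n mulr0.
rewrite !big_cons; apply: le_trans (normcD2_le _ _) _.
have a0 := sqr_ge0 (normc (F i)).
have k1 : 1 <= 2 ^+ size r :> R by rewrite exprn_ege1// ler1n.
rewrite /= [2 ^+ (size r).+1]exprS -[leRHS]mulrA -mulrDr ler_pM2l// mulrDr lerD//.
by rewrite ler_peMl.
Qed.

Lemma hsq_conv_term_le g M : exists K : R, forall x, hsq (conv_term g M x) <= K * hsq x.
Proof.
pose c := \sum_j \sum_k normc (M j k) ^+ 2.
have cM j k : normc (M j k) ^+ 2 <= c.
  rewrite /c (bigD1 j)//= (bigD1 k)//= -addrA lerDl addr_ge0//.
    by apply: sumr_ge0 => i _; exact: sqr_ge0.
  by apply: sumr_ge0 => i _; apply: sumr_ge0 => i' _; exact: sqr_ge0.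
have c0 : 0 <= c by apply: sumr_ge0 => i _; apply: sumr_ge0 => i' _; exact: sqr_ge0.
exists (n%:R * (2 ^+ n * c)) => x; apply: hsq_le_bound => S.
apply: (@le_trans _ _ (\sum_(k < n) 2 ^+ n * c * hsq x)); last first.
  by rewrite sumr_const card_ord -[_ *+ n]mulr_natl mulrA.
apply: ler_sum => k _.
apply: (@le_trans _ _ (\sum_(h <- S) 2 ^+ n * c * \sum_j normc (entry x j (h - g)) ^+ 2)).
  apply: ler_sum => h _; rewrite entry_conv_term.
  have := sqr_normc_sum_le (enum 'I_n) (fun j => M j k * entry x j (h - g)).
  rewrite !big_enum size_enum_ord /= => /le_trans; apply; rewrite -mulrA ler_pM2l ?exprn_gt0//.
  rewrite mulr_sumr; apply: ler_sum => j _.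
  by rewrite normcM exprMn ler_wpM2r ?sqr_ge0.
rewrite -mulr_sumr; apply: ler_wpM2l; first by rewrite mulr_ge0// exprn_ge0.
rewrite exchange_big /=.
apply: le_trans (partial_hsq_le [fset (h - g)%R | h in S]%fset x).
apply: ler_sum => j _; rewrite big_imfset //= => u v _ _; exact: addIr.
Qed.

(** An operator is presented by a finite list in which group elements may repeat, so that sums,
    compositions and adjoints are plain operations on lists. *)
Definition opr (s : seq (G * Mn)) x : H := \sum_(p <- s) conv_term p.1 p.2 x.

Lemma opr_linear s : linear (opr s).
Proof.
move=> c x y; rewrite /opr scaler_sumr -big_split; apply: eq_bigr => p _ /=.
exact: conv_term_linear.
Qed.

Lemma opr_bounded s : exists K : R, 0 <= K /\ forall x, hnorm (opr s x) <= K * hnorm x.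
Proof.
elim: s => [|[g M] s [K [K0 HK]]].
  by exists 0; split=> // x; rewrite /opr big_nil hnorm0 mul0r.
have [k Hk] := hsq_conv_term_le g M.
exists (Num.sqrt `|k| + K); split; first by rewrite addr_ge0 ?sqrtr_ge0.
move=> x; rewrite /opr big_cons mulrDl; apply: le_trans (hnormD _ _) (lerD _ (HK x)).
apply: hnorm_le_sq; first by rewrite mulr_ge0 ?sqrtr_ge0 ?hnorm_ge0.
rewrite exprMn sqr_sqrtr// hnormE; apply: le_trans (Hk x) _.
by rewrite ler_wpM2r ?hsq_ge0// ler_norm.
Qed.

Lemma opr_bounded_operator s : bounded_operator (opr s).
Proof.
split; first exact: opr_linear.
by have [K [_ HK]] := opr_bounded s; exists K.
Qed.

Lemma opr_cat s s' x : opr (s ++ s') x = opr s x + opr s' x.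
Proof. by rewrite /opr big_cat. Qed.

(** The matrices act on row vectors from the right, hence the reversed product. *)
Definition opr_comp (s s' : seq (G * Mn)) : seq (G * Mn) :=
  [seq (p.1 + q.1, q.2 *m p.2) | p <- s, q <- s'].

Lemma conv_term_sum g M I (r : seq I) (F : I -> H) :
  conv_term g M (\sum_(i <- r) F i) = \sum_(i <- r) conv_term g M (F i).
Proof.
elim: r => [|i r IH].
  rewrite !big_nil; have := conv_term_linear g M (-1) 0 0.
  by rewrite scaler0 addr0 => ->; rewrite scaleN1r addNr.
by rewrite !big_cons -IH; have := conv_term_linear g M 1 (F i) (\sum_(j <- r) F j); rewrite !scale1r.
Qed.

Lemma opr_compE s s' x : opr (opr_comp s s') x = opr s (opr s' x).
Proof.
rewrite /opr_comp [LHS]/opr big_allpairs_dep; apply: eq_bigr => p _.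
rewrite [in RHS]/opr conv_term_sum; apply: eq_bigr => q _.
by rewrite conv_term_comp.
Qed.

Definition opr_adj (s : seq (G * Mn)) : seq (G * Mn) :=
  [seq (- p.1, adjmx p.2) | p <- s].

Lemma inner_suml I (r : seq I) (F : I -> H) y :
  inner (\sum_(i <- r) F i) y = \sum_(i <- r) inner (F i) y.
Proof.
elim: r => [|i r IH]; first by rewrite !big_nil -(scale0r (0 : H)) innerZ mul0r.
by rewrite !big_cons -IH -{1}(scale1r (F i)) inner_linear mul1r.
Qed.

Lemma inner_sumr I (r : seq I) (F : I -> H) y :
  inner y (\sum_(i <- r) F i) = \sum_(i <- r) inner y (F i).
Proof.
by rewrite innerJ inner_suml rmorph_sum; apply: eq_bigr => i _ /=; rewrite -innerJ.
Qed.

Lemma opr_adjE s x y : inner (opr s x) y = inner x (opr (opr_adj s) y).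
Proof.
rewrite /opr inner_suml big_map inner_sumr; apply: eq_bigr => p _.
exact: conv_term_adjoint.
Qed.

Lemma inner_inj x y : (forall z, inner z x = inner z y) -> x = y.
Proof.
move=> xy; apply/eqP; rewrite -subr_eq0; apply/eqP/hsq_eq0.
have iB z : inner z (x - y) = inner z x - inner z y.
  rewrite (innerJ (x - y) z) addrC -scaleN1r inner_linear mulN1r addrC rmorphB /=.
  by rewrite -!innerJ.
by rewrite /hsq iB xy subrr.
Qed.

(** [adjoint] chooses an operator with the defining property; [opr (opr_adj s)] has this property,
    which at most one operator can have. *)
Lemma adjoint_opr s : adjoint (opr s) = opr (opr_adj s).
Proof.
rewrite /adjoint /the_operator.
set P := [set S | _]; have PP : P (opr (opr_adj s)).
  by split; [exact: opr_bounded_operator|move=> x y; exact: opr_adjE].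
have [_ adjP] := xgetPex (fun=> 0) (ex_intro P _ PP).
apply/funext => y; apply: inner_inj => z.
by rewrite -opr_adjE -adjP.
Qed.

Definition opr_symbol (s : seq (G * Mn)) (chi : G -> C) : Mn :=
  \sum_(p <- s) chi p.1 *: p.2.

Lemma opr_symbol_comp s s' chi : is_character chi ->
  opr_symbol (opr_comp s s') chi = opr_symbol s' chi *m opr_symbol s chi.
Proof.
move=> chiP; rewrite /opr_symbol big_allpairs_dep mulmx_sumr.
apply: eq_bigr => p _; rewrite mulmx_suml; apply: eq_bigr => q _ /=.
by rewrite -scalemxAl -scalemxAr scalerA chiP.1 mulrC.
Qed.

Lemma opr_symbol_adj s chi : is_character chi ->
  opr_symbol (opr_adj s) chi = adjmx (opr_symbol s chi).
Proof.
move=> chiP; rewrite /opr_symbol big_map; apply/matrixP => j k.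
rewrite mxE !summxE rmorph_sum; apply: eq_bigr => p _ /=.
by rewrite !mxE rmorphM /= characterN.
Qed.

Lemma opr_symbol_cat s s' chi : opr_symbol (s ++ s') chi = opr_symbol s chi + opr_symbol s' chi.
Proof. by rewrite /opr_symbol big_cat. Qed.

Lemma conv_term_scalar c x : conv_term 0 c%:M x = c *: x.
Proof.
apply: hilbert_ext => k h; rewrite entry_conv_term entryZE (bigD1 k)//= !mxE eqxx mulr1n subr0.
rewrite big1 ?addr0// => j jk; by rewrite mxE (negPf jk) mulr0n mul0r.
Qed.

Definition opr_of (A : 'M[{group_ring C[G]}]_n) : seq (G * Mn) :=
  flatten [seq [seq (h, A jk.1 jk.2 h *: delta_mx jk.1 jk.2) | h <- finsupp (A jk.1 jk.2)]
    | jk <- enum {: 'I_n * 'I_n}].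

Lemma opr_of_sum (V : zmodType) (F : G -> Mn -> V) A :
  \sum_(p <- opr_of A) F p.1 p.2 =
  \sum_j \sum_k \sum_(h <- finsupp (A j k)) F h (A j k h *: delta_mx j k).
Proof.
rewrite /opr_of big_flatten big_map big_enum /= pair_big /=.
by apply: eq_bigr => jk _; rewrite big_map.
Qed.

Lemma rmul_opr A : rmul A = opr (opr_of A).
Proof.
apply/funext => x; apply: hilbert_ext => k h.
rewrite {1}/rmul /entry ffunE -/(entry _ _) ell2_sumE.
rewrite /opr (opr_of_sum (fun g M => conv_term g M x)) entry_sumE; apply: eq_bigr => j _.
rewrite ell2_sumE entry_sumE (bigD1 k)//= [X in _ + X]big1 ?addr0.
  rewrite entry_sumE; apply: eq_bigr => g _.
  rewrite entry_conv_term (bigD1 j)//= big1 ?addr0 => [|i ij].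
    by rewrite !mxE !eqxx mulr1.
  by rewrite !mxE (negPf ij) mulr0 mul0r.
move=> l lk; rewrite entry_sumE big1// => g _; rewrite entry_conv_term big1// => i _.
by rewrite !mxE [k == l]eq_sym (negPf lk) andbF mulr0 mul0r.
Qed.

Lemma symbol_opr_of A chi : opr_symbol (opr_of A) chi = symbol A chi.
Proof.
rewrite /opr_symbol (opr_of_sum (fun g M => chi g *: M)).
apply/matrixP => j k; rewrite summxE (bigD1 j)//= [X in _ + X]big1 ?addr0; last first.
  move=> i ij; rewrite summxE big1// => l _; rewrite summxE big1// => g _.
  by rewrite !mxE eq_sym (negPf ij) !mulr0.
rewrite summxE (bigD1 k)//= [X in _ + X]big1 ?addr0; last first.
  by move=> l lk; rewrite summxE big1// => g _; rewrite !mxE [k == l]eq_sym (negPf lk) andbF !mulr0.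
rewrite summxE mxE; apply: eq_bigr => g _.
by rewrite !mxE !eqxx mulr1 mulrC.
Qed.

Lemma entry_unit_vector (j k : 'I_n) g : entry (unit_vector R G j) k g = ((k == j) && (g == 0))%:R.
Proof. by rewrite /entry ffunE; case: eqP. Qed.

Lemma dot_unit (u : ell2 R G) : dot u (ell2_one R G) = u 0.
Proof.
apply: (has_sum_unique (dot_has _ _)).
have -> : u 0 = \sum_(g <- [fset (0 : G)]%fset) u g * (ell2_one R G g)^*%C.
  by rewrite big_seq_fset1 /= eqxx rmorph1 mulr1.
apply: has_sum_finite => g; rewrite inE /= => /negPf ->.
by rewrite rmorph0 mulr0.
Qed.

Lemma inner_unit_vector x (j : 'I_n) : inner x (unit_vector R G j) = entry x j 0.
Proof.
have uE k : entry (unit_vector R G j) k = if k == j then ell2_one R G else 0.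
  by rewrite /entry ffunE.
rewrite inner_dot (bigD1 j)//= uE eqxx dot_unit big1 ?addr0// => k kj.
rewrite uE (negPf kj).
rewrite dotJ; have := dot_suml ([::] : seq unit) (fun=> 0) (fun=> 0) (entry x k).
by rewrite !big_nil => ->; rewrite rmorph0.
Qed.

Lemma hnorm_unit_vector (j : 'I_n) : hnorm (unit_vector R G j) = 1.
Proof.
rewrite /hnorm inner_unit_vector entry_unit_vector !eqxx.
by rewrite -[complex.Re _]/(1 : R) sqrtr1.
Qed.

Lemma trace_opr s : trace (opr s) = \sum_(p <- s) (p.1 == 0)%:R * \tr p.2.
Proof.
rewrite /trace; under eq_bigr do rewrite inner_unit_vector /opr entry_sumE.
rewrite exchange_big /=; apply: eq_bigr => p _.
rewrite /mxtrace mulr_sumr; apply: eq_bigr => j _.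
rewrite entry_conv_term (bigD1 j)//= entry_unit_vector eqxx sub0r oppr_eq0 mulrC big1 ?addr0// => k kj.
by rewrite entry_unit_vector (negPf kj) mulr0.
Qed.

End ConvolutionOperators.

(** * Singular values and the spectrum of a convolution operator *)

Section GramSpectrum.
Variables (R : realType) (n : nat).
Local Notation C := R[i].
Implicit Types D : 'M[C]_n.

Lemma adjmxK D : adjmx (adjmx D) = D.
Proof. by apply/matrixP => j k; rewrite !mxE conjcK. Qed.

Lemma adjmx_mul D E : adjmx (D *m E) = adjmx E *m adjmx D.
Proof.
apply/matrixP => j k; rewrite !mxE rmorph_sum; apply: eq_bigr => l _ /=.
by rewrite !mxE rmorphM mulrC.
Qed.

(* The [sigma j] are the squared singular values of [D]. *)
Lemma gram_diagonalization D : exists P : 'M[C]_n, exists2 sigma : 'I_n -> R,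
  P \in unitmx /\ (forall j, 0 <= sigma j) &
  adjmx D *m D = invmx P *m diag_mx (\row_j (sigma j)%:C%C) *m P.
Proof.
have adjE (M : 'M[C]_n) : map_mx Num.conj M^T = adjmx M.
  by apply/matrixP => j k; rewrite !mxE.
set B := adjmx D *m D.
have Bn : B \is normalmx by apply/normalmxP; rewrite adjE adjmx_mul adjmxK.
have /orthomx_spectralP Beq := Bn.
set P := spectralmx B in Beq; have Pu : P \is unitarymx := spectral_unitarymx B.
have Pt := unitarymx_unit Pu.
exists P, (fun j => \sum_k normc ((P *m adjmx D) j k) ^+ 2).
  by split=> // j; apply: sumr_ge0 => k _; exact: sqr_ge0.
suff -> : \row_j (\sum_k normc ((P *m adjmx D) j k) ^+ 2)%:C%C = spectral_diag B by [].
apply/rowP => j; have : diag_mx (spectral_diag B) = (P *m adjmx D) *m adjmx (P *m adjmx D).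
  rewrite adjmx_mul adjmxK !mulmxA -(mulmxA P) -/B {2}Beq !mulmxA mulmxV// mul1mx.
  by rewrite -mulmxA -adjE; have /unitarymxP -> := Pu; rewrite mulmx1.
move=> /matrixP/(_ j j); rewrite !mxE eqxx mulr1n => ->.
rewrite rmorph_sum; apply: eq_bigr => k _.
by rewrite [adjmx _ _ _]mxE; exact: (esym (mulc_conj _)).
Qed.

End GramSpectrum.

Section SymbolSpectrum.
Variables (R : realType) (G : zmodType) (n : nat).
Local Notation C := R[i].
Local Notation H := (hilbert R G n).
Variables (s : seq (G * 'M[C]_n)) (chi : G -> C) (v : 'rV[C]_n) (t : C).
Hypotheses (chiP : is_character chi) (vE : v *m opr_symbol s chi = t *: v).

Lemma sum_mem_le (S' S : {fset G}) : \sum_(h <- S') (h \in S)%:R <= #|` S|%:R :> R.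
Proof.
rewrite (bigID (fun g => g \in S))/= [X in _ + X]big1 ?addr0; last by move=> g /negPf ->.
rewrite -big_filter; set r := [seq i <- S' | i \in S].
have rS : {subset r <= S} by move=> g; rewrite mem_filter => /andP[].
rewrite (eq_big_seq (fun=> 1)); last by move=> g /rS ->.
rewrite big_const_seq count_predT iter_addr_0 -mulr_natl mulr1 ler_nat.
by apply: (@uniq_leq_size _ r S) => //; rewrite filter_uniq ?fset_uniq.
Qed.

Lemma wave_subproof (S : {fset G}) (j : 'I_n) :
  (fun g : G => v 0 j * (chi g)^*%C * (g \in S)%:R) \in @square_summable R G.
Proof.
apply: (@bounded_square_summable _ _ _ (normc (v 0 j) ^+ 2 * #|` S|%:R)) => S'.
apply: le_trans (ler_wpM2l (sqr_ge0 _) (sum_mem_le S' S)); rewrite mulr_sumr.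
apply: ler_sum => g _; case: (g \in S); last by rewrite !mulr0 normc0 expr0n.
by rewrite !mulr1 normcM normcJ' chiP.2 mulr1.
Qed.

(* A plane wave cut off to S; it is an almost eigenvector of [opr s] when S is
   a Folner set, so that [t] cannot be outside the spectrum. *)
Definition wave (S : {fset G}) : H := [ffun j => Ell2 (wave_subproof S j)].

Lemma entry_wave S j g : entry (wave S) j g = v 0 j * (chi g)^*%C * (g \in S)%:R.
Proof. by rewrite /entry ffunE. Qed.

Lemma hsq_wave_ge S : (\sum_j normc (v 0 j) ^+ 2) * #|` S|%:R <= hsq (wave S).
Proof.
apply: le_trans (partial_hsq_le S _).
rewrite /partial_hsq mulr_suml; apply: ler_sum => j _.
rewrite [X in _ <= X](eq_big_seq (fun=> normc (v 0 j) ^+ 2)); last first.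
  by move=> g gS; rewrite entry_wave gS mulr1 normcM normcJ' chiP.2 mulr1.
by rewrite big_const_seq count_predT iter_addr_0 mulr_natr.
Qed.

Let w (p : G * 'M[C]_n) k := \sum_j p.2 j k * v 0 j.

(** Without cutoff the wave would be an eigenvector: with the conjugate of [chi] in it, translation
    by g multiplies it by chi g. What remains is the difference between the indicators of [S] and of
    its translates. *)
Lemma entry_wave_defect S k h :
  entry (sub_scalar (opr s) t (wave S)) k h =
  (chi h)^*%C * \sum_(p <- s) chi p.1 * w p k * ((h - p.1 \in S)%:R - (h \in S)%:R).
Proof.
have -> : sub_scalar (opr s) t (wave S) = opr s (wave S) + (- t) *: wave S.
  by rewrite /sub_scalar scaleNr.
rewrite entryDE entryZE entry_wave /opr entry_sumE.
have -> : - t * (v 0 k * (chi h)^*%C * (h \in S)%:R) =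
    - (\sum_(p <- s) chi p.1 * w p k) * (chi h)^*%C * (h \in S)%:R.
  have -> : \sum_(p <- s) chi p.1 * w p k = t * v 0 k.
    move: vE => /matrixP/(_ 0 k); rewrite [RHS]mxE => <-.
    rewrite /opr_symbol mulmx_sumr summxE; apply: eq_bigr => p _.
    rewrite mxE mulr_sumr; apply: eq_bigr => j _.
    by rewrite mxE; ring.
  by rewrite !mulNr !mulrA.
rewrite mulNr mulr_suml mulNr mulr_suml -sumrN -big_split mulr_sumr; apply: eq_bigr => p _ /=.
rewrite entry_conv_term.
have -> : \sum_j p.2 j k * entry (wave S) j (h - p.1) =
   w p k * ((chi h)^*%C * chi p.1) * (h - p.1 \in S)%:R.
  rewrite /w !mulr_suml; apply: eq_bigr => j _; rewrite entry_wave chiP.1 rmorphM /=.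
  by rewrite (characterN chiP) conjcK; ring.
by ring.
Qed.

Lemma hsq_wave_defect_le : exists2 c : R, 0 <= c & forall (S : {fset G}) (e : R),
  (forall p, p \in s -> #|` [fset x in S | (x + p.1)%R \notin S]%fset|%:R <= e * #|` S|%:R /\
     #|` [fset x in S | (x + - p.1)%R \notin S]%fset|%:R <= e * #|` S|%:R) ->
  hsq (sub_scalar (opr s) t (wave S)) <= c * (e * #|` S|%:R).
Proof.
pose c := 2 ^+ size s * (\sum_k \sum_(p <- s) normc (w p k) ^+ 2 * 2).
have c0 : 0 <= c.
  rewrite mulr_ge0 ?exprn_ge0// sumr_ge0// => k _; rewrite sumr_ge0// => p _.
  by rewrite mulr_ge0 ?sqr_ge0.
exists c => // S e Se; apply: hsq_le_bound => S'.
have edge (g : G) : \sum_(h <- S') normc ((h - g \in S)%:R - (h \in S)%:R : C) ^+ 2 <=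
   #|` [fset x in S | (x + g)%R \notin S]%fset|%:R + #|` [fset x in S | (x + - g)%R \notin S]%fset|%:R :> R.
  have -> : #|` [fset x in S | (x + g)%R \notin S]%fset| =
      #|` [fset (h + g)%R | h in [fset x in S | (x + g)%R \notin S]%fset]%fset|.
    by rewrite [RHS]card_imfset// => x y /addIr.
  apply: le_trans (lerD (sum_mem_le S' _) (sum_mem_le S' _)); rewrite -big_split.
  apply: ler_sum => h _ /=.
  case: (boolP (h - g \in S)) => h1; case: (boolP (h \in S)) => h2.
  - by rewrite subrr normc0 expr0n addr_ge0.
  - rewrite subr0 normc1 expr1n (_ : h \in _ = true) ?lerDl//.
    by apply/imfsetP; exists (h - g); rewrite ?subrK// !inE h1 subrK.
  - rewrite sub0r normcN normc1 expr1n [X in _ <= _ + X](_ : _ = 1) ?lerDr//.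
    by rewrite !inE h2 h1.
  - by rewrite subrr normc0 expr0n addr_ge0.
rewrite /partial_hsq /c -mulrA mulr_suml mulr_sumr; apply: ler_sum => k _.
apply: le_trans (_ : _ <= \sum_(h <- S') 2 ^+ size s * \sum_(p <- s)
  normc (w p k) ^+ 2 * normc ((h - p.1 \in S)%:R - (h \in S)%:R : C) ^+ 2) _.
  apply: ler_sum => h _; rewrite entry_wave_defect normcM normcJ' chiP.2 mul1r.
  apply: le_trans (sqr_normc_sum_le _ _) _; rewrite ler_wpM2l ?exprn_ge0//.
  by apply: ler_sum => p _; rewrite !normcM chiP.2 mul1r exprMn.
rewrite -mulr_sumr ler_wpM2l ?exprn_ge0// exchange_big mulr_suml /=.
rewrite big_seq [X in _ <= X]big_seq; apply: ler_sum => p ps.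
rewrite -mulr_sumr -[X in _ <= X]mulrA; apply: ler_wpM2l; first exact: sqr_ge0.
apply: le_trans (edge _) _.
by have [h1 h2] := Se _ ps; lra.
Qed.

Lemma symbol_eigenvalue_in_spectrum : finitely_generated G -> v != 0 -> spectrum (opr s) t.
Proof.
move=> fgG v0 [S' [[_ [K S'K]] S'T TS']].
have [c c0 cP] := hsq_wave_defect_le.
pose V : R := \sum_j normc (v 0 j) ^+ 2.
have V0 : 0 < V.
  have [j vj] : exists j, v 0 j != 0.
    by apply/existsP; move: v0; apply: contraNT => /existsPn H; apply/eqP/rowP => j; rewrite mxE; apply/eqP; have := H j; rewrite negbK.
  rewrite /V (bigD1 j)//= ltr_pwDl//; last by apply: sumr_ge0 => i _; exact: sqr_ge0.
  rewrite exprn_gt0// lt_neqAle normc_ge0 andbT eq_sym; apply: contraNneq vj => /eq0_normc ->//.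
(* Small enough that K^2 c e < V, against V |S| <= |wave|^2 <= K^2 c e |S|, where [K] bounds the
   supposed inverse. *)
pose e := V / (2 * (K ^+ 2 * c + 1)).
have Kc : 0 <= K ^+ 2 * c by rewrite mulr_ge0 ?sqr_ge0.
have e0 : 0 < e by rewrite divr_gt0// mulr_gt0// ltr_wpDl.
have [S [S0 SP]] := @folner R _ (map fst s ++ map (fun p => - p.1) s) _ fgG e0.
have h : hsq (sub_scalar (opr s) t (wave S)) <= c * (e * #|` S|%:R).
  apply: cP => p ps; split; apply: SP; rewrite mem_cat.
    by apply/orP; left; apply: map_f.
  by apply/orP; right; apply/mapP; exists p.
have := hsq_wave_ge S; rewrite -/V.
have : hsq (wave S) <= K ^+ 2 * hsq (sub_scalar (opr s) t (wave S)).
  rewrite -!hnormE -exprMn ler_pXn2r ?nnegrE ?hnorm_ge0//.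
    by rewrite -{1}(S'T (wave S)); exact: S'K.
  by apply: le_trans (S'K _); exact: hnorm_ge0.
have N0 : 0 < #|` S|%:R :> R by rewrite ltr0n.
have eV : e * (2 * (K ^+ 2 * c + 1)) = V by rewrite /e divfK// gt_eqF// mulr_gt0// ltr_wpDl.
move: h N0; set N : R := _%:R; set a := hsq _; set b := hsq _ => h N0 ba Vb.
have : K ^+ 2 * a <= (K ^+ 2 * c) * (e * N) by rewrite -mulrA ler_wpM2l ?sqr_ge0.
have eN : 0 < e * N by rewrite mulr_gt0.
have := mulr_ge0 Kc (ltW eN).
move: (K ^+ 2 * c) Kc eV => q q0 eV.
have : V * N = 2 * q * (e * N) + 2 * (e * N) by rewrite -eV; ring.
by lra.
Qed.

End SymbolSpectrum.

Lemma normc_real (R : realType) (r : R) : normc r%:C%C = `|r|.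
Proof. by rewrite /normc /= expr0n addr0 sqrtr_sqr. Qed.

Lemma Re_realM (R : realType) (r : R) (z : R[i]) : complex.Re (r%:C%C * z) = r * complex.Re z.
Proof. by case: z => a b /=; rewrite mul0r subr0. Qed.

Lemma ln_sqrt (R : realType) (u : R) : 0 < u -> ln (Num.sqrt u) = 2^-1 * ln u.
Proof.
move=> u0; have uE := sqr_sqrtr (ltW u0).
by rewrite -[in RHS]uE lnXn ?sqrtr_gt0// -[X in _ = _ * X]mulr_natl mulrA mulVf ?mul1r.
Qed.

(** * Neumann series and the logarithm of a positive operator *)

Section SelfAdjoint.
Variables (R : realType) (G : zmodType) (n : nat).
Local Notation C := R[i].
Local Notation H := (hilbert R G n).
Implicit Types (x y : H).

Section LinearMaps.
Variable T : H -> H.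
Hypothesis Tl : linear T.

Lemma operD x y : T (x + y) = T x + T y.
Proof. by have := Tl 1 x y; rewrite !scale1r. Qed.

Lemma oper0 : T 0 = 0.
Proof. by have := operD 0 0; rewrite addr0 -[LHS]addr0 => /addrI/esym. Qed.

Lemma operZ c x : T (c *: x) = c *: T x.
Proof. by have := Tl c x 0; rewrite !addr0 oper0 addr0. Qed.

Lemma operN x : T (- x) = - T x.
Proof. by rewrite -scaleN1r operZ scaleN1r. Qed.

Lemma operB x y : T (x - y) = T x - T y.
Proof. by rewrite operD operN. Qed.

Lemma oper_sum I (r : seq I) (F : I -> H) : T (\sum_(i <- r) F i) = \sum_(i <- r) T (F i).
Proof.
elim: r => [|i r IH]; first by rewrite !big_nil oper0.
by rewrite !big_cons operD IH.
Qed.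

Lemma poly_operator_large (p : {poly C}) m x : (size p <= m)%N ->
  poly_operator p T x = \sum_(k < m) p`_k *: iter k T x.
Proof.
move=> pm; rewrite /poly_operator (big_ord_widen _ (fun k => p`_k *: iter k T x) pm).
rewrite big_mkcond; apply: eq_bigr => k _; case: ltnP => // kp.
by rewrite nth_default ?scale0r.
Qed.

Lemma poly_operatorD p q x :
  poly_operator (p + q) T x = poly_operator p T x + poly_operator q T x.
Proof.
pose m := maxn (size p) (size q).
rewrite !(@poly_operator_large _ m) ?leq_maxl ?leq_maxr ?size_polyD//.
by rewrite -big_split; apply: eq_bigr => k _; rewrite coefD scalerDl.
Qed.

Lemma poly_operatorZ c p x : poly_operator (c *: p) T x = c *: poly_operator p T x.
Proof.
rewrite (@poly_operator_large _ (size p)) ?size_scale_leq// scaler_sumr.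
by apply: eq_bigr => k _; rewrite coefZ scalerA.
Qed.

Lemma poly_operatorMX p x : poly_operator ('X * p) T x = T (poly_operator p T x).
Proof.
rewrite (@poly_operator_large _ (size p).+1); last first.
  by rewrite mulrC; apply: leq_trans (size_polyMleq _ _) _; rewrite size_polyX addnS addn1.
rewrite big_ord_recl coefXM eqxx scale0r add0r oper_sum.
by apply: eq_bigr => k _; rewrite coefXM operZ.
Qed.

Lemma poly_operator1 x : poly_operator 1 T x = x.
Proof. by rewrite /poly_operator size_poly1 big_ord1 coef1 scale1r. Qed.

Lemma poly_operator_sum I (r : seq I) (F : I -> {poly C}) x :
  poly_operator (\sum_(i <- r) F i) T x = \sum_(i <- r) poly_operator (F i) T x.
Proof.
elim: r => [|i r IH]; last by rewrite !big_cons poly_operatorD IH.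
by rewrite !big_nil /poly_operator size_poly0 big_ord0.
Qed.

Lemma poly_operator_exp c k x :
  poly_operator ((1 - c *: 'X) ^+ k) T x = iter k (fun y => y - c *: T y) x.
Proof.
elim: k => [|k IH]; first by rewrite expr0 poly_operator1.
have -> : (1 - c *: 'X) ^+ k.+1 = (1 - c *: 'X) ^+ k + (- c) *: ('X * (1 - c *: 'X) ^+ k).
  by rewrite [LHS]exprS mulrBl mul1r -scalerAl scaleNr.
by rewrite poly_operatorD poly_operatorZ poly_operatorMX IH /= scaleNr.
Qed.

End LinearMaps.

Lemma neumann (K : H -> H) rho : linear K -> 0 <= rho -> rho < 1 ->
  (forall x, hnorm (K x) <= rho * hnorm x) ->
  exists L : H -> H, [/\ bounded_operator L,
    forall x, L (x - K x) = x & forall x, L x - K (L x) = x].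
Proof.
move=> Kl r0 r1 Kr; have d0 : 0 < 1 - rho by rewrite subr_gt0.
have [|L [Ll LP]] := @power_series_operator _ _ _ K (fun=> 1) _ Kl r0 r1 Kr.
  by move=> k; rewrite normc1.
pose S m x := \sum_(k < m) (1 : C) *: iter k K x.
have iterK m x : hnorm (iter m K x) <= rho ^+ m * hnorm x.
  elim: m => [|m IH]; first by rewrite expr0 mul1r.
  by rewrite exprS -mulrA; apply: le_trans (Kr _) _; rewrite ler_wpM2l.
have qK m x : hnorm (iter m K x) <= rho ^+ m / (1 - rho) * hnorm x.
  apply: le_trans (iterK m x) _; rewrite ler_wpM2r ?hnorm_ge0// ler_peMr ?exprn_ge0//.
  by rewrite invf_ge1// gerBl.
have SK m x : S m x - K (S m x) = x - iter m K x.
  rewrite /S (oper_sum Kl); elim: m => [|m IH]; first by rewrite !big_ord0 subr0 subrr.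
  by rewrite !big_ord_recr/= opprD addrACA IH operZ// !scale1r addrA subrK.
have KS m x : S m (x - K x) = x - iter m K x.
  rewrite -SK /S (oper_sum Kl) -sumrN -big_split; apply: eq_bigr => k _ /=.
  rewrite !scale1r; elim: (val k) => [//|j IH]; by rewrite !iterS IH operB.
have small (y : H) (c : R) : 0 <= c ->
    (forall m, hnorm y <= rho ^+ m / (1 - rho) * c) -> y = 0.
  move=> c0 ym; apply: hnorm_eq0; apply/ler_addgt0Pr => e e0; rewrite add0r.
  have c1 : 0 < c + 1 by rewrite ltr_wpDl.
  have [m Hm] := geometric_small r0 r1 (divr_gt0 e0 c1).
  apply: le_trans (ym m) _; apply: le_trans (ler_wpM2r c0 Hm) _.
  by rewrite mulrAC ler_pdivrMr// ler_pM2l// lerDl.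
exists L; split.
- split=> //; exists (1 - rho)^-1 => x.
  by have := LP 0%N x; rewrite big_ord0 subr0 expr0 mul1r.
- move=> x; apply/eqP; rewrite -subr_eq0; apply/eqP.
  apply: (small _ (hnorm (x - K x) + hnorm x)); first by rewrite addr_ge0 ?hnorm_ge0.
  move=> m; have -> : L (x - K x) - x = (L (x - K x) - S m (x - K x)) + (- iter m K x).
    by rewrite KS opprB addrA addrAC addrK.
  apply: le_trans (hnormD _ _) _; rewrite hnormN mulrDr.
  exact: lerD (LP m _) (qK m x).
- move=> x; apply/eqP; rewrite -subr_eq0; apply/eqP.
  apply: (small _ (3 * hnorm x)); first by rewrite mulr_ge0 ?hnorm_ge0.
  move=> m; have -> : L x - K (L x) - x =
      (L x - S m x) + - K (L x - S m x) + (- iter m K x).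
    have -> : K (L x - S m x) = K (L x) - (S m x - x + iter m K x).
      by rewrite operB//; congr (_ - _); rewrite -[LHS](subKr (S m x)) SK opprB addrA addrAC.
    move: (L x) (K _) (S m x) (iter _ _ _) => l k s t.
    by rewrite opprB !addrA subrK [RHS]addrAC addrK [RHS]addrAC.
  have -> : 3 * hnorm x = hnorm x + hnorm x + hnorm x by ring.
  rewrite !mulrDr.
  apply: le_trans (hnormD _ _) (lerD _ _); last by rewrite hnormN.
  apply: le_trans (hnormD _ _) (lerD (LP m x) _).
  rewrite hnormN; apply: le_trans (Kr _) _; apply: le_trans (_ : _ <= hnorm (L x - S m x)) (LP m x).
  by rewrite ler_piMl ?hnorm_ge0// ltW.
Qed.

Section PositiveOperator.
Variables (T : H -> H) (m M : R).
Hypotheses (Tl : linear T) (T_sym : forall x y, inner (T x) y = inner x (T y)).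
Hypotheses (m0 : 0 < m) (mM : m <= M).
Hypothesis T_lower : forall x, m * hsq x <= complex.Re (inner (T x) x).
Hypothesis T_upper : forall x, complex.Re (inner (T x) x) <= M * hsq x.

Let M0 : 0 < M := lt_le_trans m0 mM.
Let c : C := (M^-1)%:C%C.
(** T = M (1 - K), where K is positive of norm at most [rho] < 1: resolvents and the logarithm of T
    become power series in K. *)
Let K x := x - c *: T x.
Let rho := 1 - m / M.

Let rho0 : 0 <= rho. Proof. by rewrite subr_ge0 ler_pdivrMr// mul1r. Qed.
Let rho1 : rho < 1. Proof. by rewrite gtrBl divr_gt0. Qed.

Let K_linear : linear K.
Proof.
move=> a x y; rewrite /K Tl scalerDr scalerBr !scalerA mulrC opprD addrACA.
by rewrite [a * c]mulrC.
Qed.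

Let innerK x y : inner (K x) y = inner x y - c * inner (T x) y.
Proof. by rewrite /K addrC -scaleNr inner_linear mulNr addrC. Qed.

Let Re_K x : complex.Re (inner (K x) x) = hsq x - M^-1 * complex.Re (inner (T x) x).
Proof. by rewrite innerK [LHS]raddfB /= Re_realM. Qed.

Let K_ge0 x : 0 <= complex.Re (inner (K x) x).
Proof. by rewrite Re_K subr_ge0 mulrC ler_pdivrMr// mulrC T_upper. Qed.

Let K_le x : complex.Re (inner (K x) x) <= rho * hsq x.
Proof.
rewrite Re_K /rho mulrBl mul1r lerD2l lerN2 -mulrA mulrCA ler_pM2l ?invr_gt0//.
Qed.

(* Cauchy-Schwarz for the semi-inner product [<K x, y>]. *)
Let K_contraction x : hnorm (K x) <= rho * hnorm x.
Proof.
have KC u v : inner (K v) u = (inner (K u) v)^*%C.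
  rewrite (innerK v) (innerK u) T_sym (innerJ u v) (innerJ (T u) v) /c.
  move: (inner u v) (inner (T u) v) => [a1 a2] [b1 b2].
  by apply/eqP; rewrite eq_complex /=; apply/andP; split; apply/eqP; ring.
have CS : hsq (K x) ^+ 2 <= complex.Re (inner (K x) x) * complex.Re (inner (K (K x)) (K x)).
  rewrite -[hsq (K x) ^+ 2]real_normK ?num_real// -normc_real -inner_self.
  apply: (@semi_cauchy_schwarz _ _ (fun u v => inner (K u) v) _ KC K_ge0 x (K x)) => a u v w.
  by rewrite K_linear inner_linear.
apply: hnorm_le_sq; first by rewrite mulr_ge0 ?hnorm_ge0.
rewrite exprMn hnormE.
have [-> |k0] := eqVneq (hsq (K x)) 0; first by rewrite mulr_ge0 ?sqr_ge0 ?hsq_ge0.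
have kpos : 0 < hsq (K x) by rewrite lt_neqAle eq_sym k0 hsq_ge0.
rewrite -(ler_pM2r kpos) -expr2.
have -> : rho ^+ 2 * hsq x * hsq (K x) = (rho * hsq x) * (rho * hsq (K x)).
  by rewrite expr2 -!mulrA; congr (_ * _); rewrite mulrCA.
exact: le_trans CS (ler_pM (K_ge0 _) (K_ge0 _) (K_le _) (K_le _)).
Qed.

Let T_K x : T x = M%:C%C *: (x - K x).
Proof.
rewrite /K opprB addrC subrK scalerA /c -rmorphM /= mulfV ?scale1r// gt_eqF//.
Qed.

(** With l = 1 - t / M, the operator T - t equals M l (1 - K / l), which the Neumann series inverts
    when |l| > rho. *)
Lemma spectrum_positive_operator t : spectrum T t%:C%C -> `|1 - t / M| <= rho.
Proof.
move=> spT; rewrite leNgt; apply/negP => lt; apply: spT.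
set l := 1 - t / M in lt; have l0 : l != 0 by rewrite -normr_gt0 (le_lt_trans rho0).
have ln : 0 < `|l| by rewrite normr_gt0.
pose K' x := (l^-1)%:C%C *: K x.
have K'l : linear K' by move=> a x y; rewrite /K' K_linear scalerDr !scalerA mulrC.
have K'c x : hnorm (K' x) <= rho / `|l| * hnorm x.
  rewrite /K' hnormZ normc_real normfV [rho / _]mulrC -mulrA.
  by rewrite ler_pM2l ?invr_gt0// K_contraction.
have [||L [[Ll [k Lk]] LK KL]] := neumann K'l _ _ K'c.
- by rewrite divr_ge0.
- by rewrite ltr_pdivrMr// mul1r.
pose d : C := (M * l)^-1%:C%C.
have tE x : sub_scalar T t%:C%C x = (M * l)%:C%C *: (x - K' x).
  rewrite /sub_scalar T_K [X in X - _]scalerBr [RHS]scalerBr /K' scalerA.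
  have -> : (M * l)%:C%C * (l^-1)%:C%C = M%:C%C by rewrite -rmorphM mulfK.
  rewrite addrAC -scalerBl -rmorphB.
  by congr (_ *: _ - _); rewrite mulrBr mulr1 mulrCA mulfV ?mulr1// gt_eqF.
have dE : d * (M * l)%:C%C = 1.
  by rewrite -rmorphM mulVf ?mulf_neq0// gt_eqF.
exists (fun x => d *: L x); split.
- split; first by move=> a x y; rewrite Ll scalerDr !scalerA mulrC.
  exists (normc d * k) => x; rewrite hnormZ -mulrA ler_wpM2l ?normc_ge0//.
- move=> x; rewrite tE (operZ Ll) LK scalerA dE; exact: scale1r.
- by move=> x; rewrite tE (operZ K'l) -scalerBr KL scalerA mulrC dE scale1r.
Qed.

Let f (t : R) := ln (Num.sqrt t).

(** ln (sqrt t) is half of ln M + ln (1 - w) with w = 1 - t / M. The same series, in w on the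
    spectrum and in K for operators, is truncated at the same order, and both remainders are
    geometric in [rho]. *)
Let log_operator : exists2 L, bounded_operator L & forall e : R, 0 < e -> exists p : {poly C},
      (forall t : R, spectrum T t%:C%C -> normc (p.[t%:C%C] - (f t)%:C%C) <= e) /\
      (forall x, hnorm (poly_operator p T x - L x) <= e * hnorm x).
Proof.
(* The inverse of 0 is 0, so that the term of index 0 vanishes; [N.+1] terms here are the first [N]
   terms of the logarithmic series. *)
pose a (k : nat) : C := (- (2 * k%:R)^-1)%:C%C.
have a1 k : normc (a k) <= 1.
  rewrite normc_real normrN normfV ger0_norm; last by rewrite mulr_ge0.
  case: k => [|k]; first by rewrite mulr0 invr0.
  by rewrite invf_le1 ?mulr_gt0// -natrM ler1n.
have [L [Ll LP]] := power_series_operator K_linear rho0 rho1 K_contraction a1.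
pose b : C := (2^-1 * ln M)%:C%C.
exists (fun x => b *: x + L x).
  split; first by move=> z x y; rewrite Ll !scalerDr !scalerA mulrC addrACA.
  exists (normc b + (1 - rho)^-1) => x; apply: le_trans (hnormD _ _) _.
  rewrite hnormZ mulrDl lerD2l.
  by have := LP 0%N x; rewrite big_ord0 subr0 expr0 mul1r.
move=> e e0; have [N HN] := geometric_small rho0 rho1 e0.
exists (b *: 1 + \sum_(k < N.+1) a k *: (1 - c *: 'X) ^+ k); split.
  move=> t /spectrum_positive_operator; set w := 1 - t / M => wr.
  have w1 : w < 1 by apply: le_lt_trans rho1; apply: le_trans wr; exact: ler_norm.
  have t0 : 0 < t by move: w1; rewrite gtrBl pmulr_lgt0 ?invr_gt0.
  have ft : f t = 2^-1 * ln M + 2^-1 * ln (1 - w).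
    have -> : t = M * (1 - w) by rewrite /w opprB addrC subrK mulrCA mulfV ?mulr1// gt_eqF.
    have w0 : 0 < 1 - w by rewrite subr_gt0.
    rewrite /f -mulrDr -lnM ?posrE//; set u := M * _; have u0 : 0 < u by rewrite mulr_gt0.
    exact: ln_sqrt.
  have -> : (b *: 1 + \sum_(k < N.+1) a k *: (1 - c *: 'X) ^+ k).[t%:C%C] =
      (2^-1 * ln M + \sum_(k < N.+1) - (2 * k%:R)^-1 * w ^+ k)%:C%C.
    rewrite hornerD hornerZ hornerC mulr1 horner_sum rmorphD rmorph_sum; congr (_ + _).
    apply: eq_bigr => k _; rewrite hornerZ horner_exp rmorphM rmorphXn; congr (_ * _ ^+ _).
    by rewrite hornerD hornerN hornerZ hornerX hornerC rmorphB -rmorphM mulrC.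
  rewrite -rmorphB normc_real ft opprD addrACA subrr add0r big_ord_recl mulr0 invr0 oppr0 mul0r add0r.
  apply: le_trans HN; apply: le_trans (log_series_bound N rho0 rho1 wr).
  have -> : \sum_(i < N) - (2 * (lift ord0 i)%:R)^-1 * w ^+ lift ord0 i - 2^-1 * ln (1 - w) =
      - 2^-1 * (ln (1 - w) + \sum_(j < N) w ^+ j.+1 / j.+1%:R).
    rewrite mulrDr addrC mulNr; congr (_ + _); rewrite mulr_sumr; apply: eq_bigr => i _.
    by rewrite lift0 invfM; ring.
  rewrite normrM; apply: ler_piMl; first exact: normr_ge0.
  by rewrite normrN ger0_norm ?invr_ge0// invf_le1// ler1n.
move=> x; rewrite poly_operatorD poly_operatorZ poly_operator1 poly_operator_sum.
rewrite opprD addrACA subrr add0r -hnormN opprB.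
rewrite (eq_bigr (fun k : 'I_N.+1 => a k *: iter k K x)); last first.
  by move=> k _; rewrite poly_operatorZ poly_operator_exp.
apply: le_trans (LP N.+1 x) _; rewrite ler_wpM2r ?hnorm_ge0//.
apply: le_trans HN; apply: ler_wpM2r; first by rewrite invr_ge0 subr_ge0 ltW.
rewrite exprS.
by apply: ler_piMl; [exact: exprn_ge0|exact: ltW].
Qed.

(** [log_operator] shows that the choice succeeds; the chosen operator is then known through its
    polynomial approximations, which determine its trace. *)
Lemma functional_calculus_ln_sqrt : let L := functional_calculus f T in
  bounded_operator L /\ forall e : R, 0 < e -> exists p : {poly C},
      (forall t : R, spectrum T t%:C%C -> normc (p.[t%:C%C] - (f t)%:C%C) <= e) /\
      (forall x, hnorm (poly_operator p T x - L x) <= e * hnorm x).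
Proof.
rewrite /functional_calculus /the_operator; set P := [set L | _].
have [L0 L1 L2] := log_operator.
exact: (xgetPex (fun=> 0) (ex_intro P L0 (conj L1 L2))).
Qed.

End PositiveOperator.
End SelfAdjoint.

(** * The trace of the logarithm as a Haar integral *)

Section LogTrace.
Variables (R : realType) (G : zmodType) (n : nat).
Local Notation C := R[i].
Local Notation H := (hilbert R G n).
Local Notation Mn := 'M[C]_n.

Lemma opr_cons p s (x : H) : opr (p :: s) x = conv_term p.1 p.2 x + opr s x.
Proof. by rewrite /opr big_cons. Qed.

Lemma opr_scalar c (x : H) : opr [:: (0, c%:M)] x = c *: x.
Proof. by rewrite /opr big_seq1 conv_term_scalar. Qed.

Lemma opr_symbol_cons p s (chi : G -> C) :
  opr_symbol (p :: s) chi = chi p.1 *: p.2 + opr_symbol s chi :> Mn.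
Proof. by rewrite /opr_symbol big_cons. Qed.

Lemma opr_symbol_scalar c (chi : G -> C) : is_character chi ->
  opr_symbol [:: (0, c%:M)] chi = c%:M :> Mn.
Proof. by move=> chiP; rewrite /opr_symbol big_seq1 /= character0// scale1r. Qed.

Lemma diag_conjD (P : Mn) (t : 'I_n -> C) c : P \in unitmx ->
  invmx P *m diag_mx (\row_j t j) *m P + c%:M =
  invmx P *m diag_mx (\row_j (t j + c)) *m P.
Proof.
move=> Pu; have -> : diag_mx (\row_j (t j + c)) = diag_mx (\row_j t j) + c%:M.
  by apply/matrixP => i j; rewrite !mxE; case: eqP; rewrite ?mulr1n ?mulr0n ?addr0.
by rewrite mulmxDr mulmxDl; congr (_ + _); rewrite mul_mx_scalar -scalemxAl mulVmx// scalemx1.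
Qed.

(** Horner's scheme on lists: a polynomial in [opr s] is again a convolution operator, whose symbol
    and trace can be read off. *)
Fixpoint opr_horner (cs : seq C) (s : seq (G * Mn)) : seq (G * Mn) :=
  if cs is c :: cs' then (0, c%:M) :: opr_comp s (opr_horner cs' s) else [::].

Lemma opr_hornerE cs s (x : H) :
  opr (opr_horner cs s) x = \sum_(k < size cs) cs`_k *: iter k (opr s) x.
Proof.
elim: cs => [|c cs IH] /=; first by rewrite big_ord0 /opr big_nil.
rewrite opr_cons conv_term_scalar opr_compE IH big_ord_recl; congr (_ + _).
rewrite (oper_sum (opr_linear s)); apply: eq_bigr => k _.
by rewrite (operZ (opr_linear s)).
Qed.

Lemma opr_symbol_horner cs s chi (P : Mn) (t : 'I_n -> C) : is_character chi -> P \in unitmx ->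
  opr_symbol s chi = invmx P *m diag_mx (\row_j t j) *m P ->
  opr_symbol (opr_horner cs s) chi = invmx P *m diag_mx (\row_j horner_rec cs (t j)) *m P.
Proof.
move=> chiP Pu sE; elim: cs => [|c cs IH] /=.
  rewrite /opr_symbol big_nil (_ : diag_mx _ = 0) ?mulmx0 ?mul0mx//.
  by apply/matrixP => i j; rewrite !mxE mul0rn.
rewrite opr_symbol_cons (character0 chiP) scale1r (opr_symbol_comp _ _ chiP) IH sE.
rewrite !mulmxA (mulmxK Pu) -(mulmxA (invmx P) (diag_mx _)) mulmx_diag addrC.
set D := \row_j (_ * _); have -> : D = \row_j (horner_rec cs (t j) * t j).
  by apply/rowP => j; rewrite !mxE.
exact: diag_conjD Pu.
Qed.

Lemma mxtrace_diag_conj (P : Mn) (t : 'I_n -> C) : P \in unitmx ->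
  \tr (invmx P *m diag_mx (\row_j t j) *m P) = \sum_j t j.
Proof.
move=> Pu; rewrite mxtrace_mulC mulmxA mulmxV// mul1mx mxtrace_diag.
by apply: eq_bigr => j _; rewrite mxE.
Qed.

Lemma det_diag_conj (P : Mn) (t : 'I_n -> C) : P \in unitmx ->
  \det (invmx P *m diag_mx (\row_j t j) *m P) = \prod_j t j.
Proof.
move=> Pu; rewrite !det_mulmx mulrAC -det_mulmx mulVmx// det1 mul1r det_diag.
by apply: eq_bigr => j _; rewrite mxE.
Qed.

Lemma eigenvector_diag_conj (P : Mn) (t : 'I_n -> C) j : P \in unitmx ->
  row j P != 0 /\ row j P *m (invmx P *m diag_mx (\row_j t j) *m P) = t j *: row j P.
Proof.
move=> Pu; split.
  apply/eqP => P0; have := congr1 (fun M => row j M *m invmx P) (erefl P).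
  rewrite {1}P0 mul0mx -row_mul mulmxV// row1 => /matrixP/(_ 0 j).
  by rewrite !mxE !eqxx => /esym/eqP; rewrite oner_eq0.
rewrite -row_mul !mulmxA mulmxV// mul1mx.
by apply/rowP => k; rewrite [RHS]mxE [LHS]mxE mul_diag_mx !mxE.
Qed.

Definition regularized_seq (s : seq (G * Mn)) (e : R) : seq (G * Mn) :=
  opr_comp s (opr_adj s) ++ [:: (0, e%:C%C%:M)].

Lemma regularized_square_opr s e : regularized_square (opr s) e = opr (regularized_seq s e).
Proof.
apply/funext => x; rewrite /regularized_square adjoint_opr opr_cat opr_compE.
by rewrite opr_scalar.
Qed.

Lemma regularized_symbol s e chi : is_character chi ->
  opr_symbol (regularized_seq s e) chi =
  adjmx (opr_symbol s chi) *m opr_symbol s chi + e%:C%C%:M.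
Proof.
move=> chiP; by rewrite opr_symbol_cat (opr_symbol_comp _ _ chiP) (opr_symbol_adj _ chiP) (opr_symbol_scalar _ chiP).
Qed.

(** One matrix [P] and one family [sigma] serve for all [e], so that the determinant of the symbol
    is an explicit polynomial in [e]. *)
Lemma regularized_diagonalization s chi : is_character chi ->
  exists P : Mn, exists2 sigma : 'I_n -> R, P \in unitmx /\ (forall j, 0 <= sigma j) &
  forall e, opr_symbol (regularized_seq s e) chi =
    invmx P *m diag_mx (\row_j (sigma j + e)%:C%C) *m P.
Proof.
move=> chiP; have [P [sigma [Pu s0] E]] := gram_diagonalization (opr_symbol s chi).
exists P, sigma => [|e]; first by split.
rewrite (regularized_symbol s e chiP) E (diag_conjD _ _ Pu).
have -> : (\row_j ((sigma j)%:C%C + e%:C%C)) = \row_j (sigma j + e)%:C%C.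
  by apply/rowP => j; rewrite !mxE rmorphD.
reflexivity.
Qed.

Section Haar.
Variables (d : measure_display) (T : measurableType d) (P : probability T R).
Variable chi : T -> G -> R[i].
Hypothesis haarP : haar_family P chi.

Implicit Types s : seq (G * Mn).

Let chiP t : is_character (chi t). Proof. by case: haarP. Qed.

Lemma trace_symbolE s t : \tr (opr_symbol s (chi t)) =
  \sum_(i < size s) \tr (tnth (in_tuple s) i).2 * chi t (tnth (in_tuple s) i).1.
Proof.
rewrite /opr_symbol raddf_sum big_tnth; apply: eq_bigr => i _.
by rewrite -[LHS]/(\tr _) mxtraceZ mulrC.
Qed.

Lemma haar_trace s : \int[P]_t complex.Re (\tr (opr_symbol s (chi t))) =
  complex.Re (trace (@opr R G n s)).
Proof.
rewrite trace_opr big_tnth (eq_bigr (fun i : 'I_(size s) => \tr (tnth (in_tuple s) i).2 * ((tnth (in_tuple s) i).1 == 0)%:R)); last first.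
  by move=> i _; rewrite mulrC.
rewrite -(haar_integral_Re_sum haarP); apply: eq_Rintegral => t _.
by rewrite trace_symbolE.
Qed.

Lemma measurable_trace_symbol s :
  measurable_fun setT (fun t => complex.Re (\tr (opr_symbol s (chi t)))).
Proof.
under eq_fun do rewrite trace_symbolE.
exact: (measurable_Re_sum haarP).
Qed.

Lemma trace_symbol_bounded s : exists B, forall t,
  `|complex.Re (\tr (opr_symbol s (chi t)))| <= B.
Proof.
eexists => t; rewrite trace_symbolE; exact: (Re_sum_bounded haarP).
Qed.

(** Half of ln det (D^* D + e) with D the symbol of [s], that is, the trace of ln sqrt of the symbol
    of the regularized square. *)
Definition log_symbol s (e : R) t : R :=
  2^-1 * ln (complex.Re (\det (opr_symbol (regularized_seq s e) (chi t)))).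

Lemma log_symbol_approx s e (p : {poly C}) (dl : R) : finitely_generated G -> 0 < e ->
  (forall t : R, spectrum (@opr R G n (regularized_seq s e)) t%:C%C ->
     normc (p.[t%:C%C] - (ln (Num.sqrt t))%:C%C) <= dl) ->
  forall t, `|complex.Re (\tr (opr_symbol (opr_horner p (regularized_seq s e)) (chi t))) -
     log_symbol s e t| <= n%:R * dl.
Proof.
move=> fgG e0 pP t; have [Q [sigma [Qu s0] E]] := regularized_diagonalization s (chiP t).
have se j : 0 < sigma j + e by rewrite ltr_wpDl.
rewrite (opr_symbol_horner p (chiP t) Qu (E e)) mxtrace_diag_conj//.
rewrite /log_symbol E det_diag_conj// -rmorph_prod /=.
have -> : 2^-1 * ln (\prod_j (sigma j + e)) = \sum_j ln (Num.sqrt (sigma j + e)).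
  have -> : ln (\prod_j (sigma j + e)) = \sum_j ln (sigma j + e).
    elim: (index_enum _) => [|j r IH]; first by rewrite !big_nil ln1.
    by rewrite !big_cons lnM ?IH// posrE// prodr_gt0.
  by rewrite mulr_sumr; apply: eq_bigr => j _; rewrite ln_sqrt.
rewrite raddf_sum -sumrB; apply: le_trans (ler_norm_sum _ _ _) _.
have -> : n%:R * dl = \sum_(j < n) dl by rewrite sumr_const card_ord mulr_natl.
apply: ler_sum => j _.
have spj : spectrum (@opr R G n (regularized_seq s e)) (sigma j + e)%:C%C.
  have [v0 vE] := eigenvector_diag_conj (fun j => (sigma j + e)%:C%C) j Qu.
  by apply: (symbol_eigenvalue_in_spectrum (chiP t) _ fgG v0); rewrite E.
apply: le_trans (pP _ spj); apply: le_trans (Re_le_normc _).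
by rewrite [complex.Re (_ - _)]raddfB.
Qed.

(** For a polynomial in the operator, the trace is the Haar integral of the trace of the symbol.
    When the polynomial is within [dl] of ln sqrt on the spectrum, both sides are within n dl of
    this common value, uniformly in the character for the integrand. *)
Lemma log_symbol_integrable s e : finitely_generated G -> 0 < e ->
  P.-integrable setT (EFin \o log_symbol s e) /\
  complex.Re (trace (functional_calculus (fun t => ln (Num.sqrt t))
    (regularized_square (@opr R G n s) e))) = \int[P]_t log_symbol s e t.
Proof.
move=> fgG e0; have [c [c0 cP]] := opr_bounded (opr_adj s).
(* The regularized square lies between e and c^2 + e, where [c] bounds the norm of the adjoint. *)
pose M := c ^+ 2 + e; have eM : e <= M by rewrite lerDr sqr_ge0.
set W := regularized_square _ _.
have Wl : linear W by rewrite /W regularized_square_opr; exact: opr_linear.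
have innerW x y : inner (W x) y = inner (opr (opr_adj s) x) (opr (opr_adj s) y) + e%:C%C * inner x y.
  by rewrite /W /regularized_square adjoint_opr addrC inner_linear addrC opr_adjE.
have W_sym x y : inner (W x) y = inner x (W y).
  rewrite (innerJ (W y) x) !innerW rmorphD rmorphM /= -!innerJ.
  by congr (_ + _ * _); congr (_ +i* _)%C; rewrite oppr0.
have ReW x : complex.Re (inner (W x) x) = hsq (opr (opr_adj s) x) + e * hsq x.
  by rewrite innerW [LHS]raddfD /= Re_realM.
have W_lower x : e * hsq x <= complex.Re (inner (W x) x) by rewrite ReW lerDr hsq_ge0.
have W_upper x : complex.Re (inner (W x) x) <= M * hsq x.
  by rewrite ReW /M mulrDl lerD2r -!hnormE -exprMn ler_pXn2r ?nnegrE ?mulr_ge0 ?hnorm_ge0.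
have [_ LP] := functional_calculus_ln_sqrt Wl W_sym e0 eM W_lower W_upper.
set L := functional_calculus _ _ in LP *.
pose u (p : {poly C}) t := complex.Re (\tr (opr_symbol (opr_horner p (regularized_seq s e)) (chi t))).
have WE : W = opr (regularized_seq s e) by exact: regularized_square_opr.
have approx dl : 0 < dl -> exists p : {poly C},
    (forall t, `|u p t - log_symbol s e t| <= n%:R * dl) /\
    `|\int[P]_t u p t - complex.Re (trace L)| <= n%:R * dl.
  move=> dl0; have [p [pP pL]] := LP _ dl0; exists p; split.
    by apply: log_symbol_approx => //; rewrite -WE.
  rewrite haar_trace.
  have -> : opr (opr_horner p (regularized_seq s e)) = poly_operator p W.
    by apply/funext => x; rewrite opr_hornerE WE.
  rewrite /trace [X in `|X - _|]raddf_sum [X in `|_ - X|]raddf_sum -sumrB; apply: le_trans (ler_norm_sum _ _ _) _.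
  have -> : n%:R * dl = \sum_(j < n) dl by rewrite sumr_const card_ord mulr_natl.
  apply: ler_sum => j _.
  have := pL (unit_vector R G j); rewrite hnorm_unit_vector mulr1; apply: le_trans.
  have := cauchy_schwarz (poly_operator p W (unit_vector R G j) - L (unit_vector R G j)) (unit_vector R G j).
  rewrite hnorm_unit_vector mulr1; apply: le_trans; apply: le_trans (Re_le_normc _).
  rewrite [_ - L _]addrC -scaleN1r inner_linear mulN1r.
  by rewrite [X in _ <= `|complex.Re X|]addrC [complex.Re (_ - _)]raddfB.
have um p : measurable_fun setT (u p) by exact: measurable_trace_symbol.
have ub p : exists B, forall t, `|u p t| <= B by exact: trace_symbol_bounded.
have /choice[p pP] : forall k : nat, exists p : {poly C},
    (forall t, `|u p t - log_symbol s e t| <= n%:R * (k.+1%:R)^-1) /\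
    `|\int[P]_t u p t - complex.Re (trace L)| <= n%:R * (k.+1%:R)^-1.
  by move=> k; apply: approx; rewrite invr_gt0.
have small (x : R) (N : R) : 0 <= N -> (forall k : nat, `|x| <= N * (k.+1%:R)^-1) -> x = 0.
  move=> N0 xk; apply/eqP; rewrite -normr_le0; apply/ler_addgt0Pr => dl dl0; rewrite add0r.
  have q0 : 0 < dl / (N + 1) by rewrite divr_gt0// ltr_wpDl.
  have [k _ /(_ k (leqnn k)) kP] := near_infty_natSinv_lt (PosNum q0).
  apply: le_trans (xk k) _; apply: le_trans (ler_wpM2l N0 (ltW kP)) _ => /=.
  by rewrite mulrCA ger_pMr// ler_pdivrMr ?mul1r ?lerDl// ltr_wpDl.
have lm : measurable_fun setT (log_symbol s e).
  apply: (measurable_fun_cvg (h := fun k => u (p k))) => [k|t _]; first exact: um.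
  apply/cvgrPdist_le => dl dl0.
  have q0 : 0 < dl / n.+1%:R by rewrite divr_gt0.
  near=> k.
  rewrite distrC; apply: le_trans ((pP k).1 t) _.
  apply: le_trans (_ : _ <= n.+1%:R * (dl / n.+1%:R)) _; last by rewrite mulrC divfK.
  apply: ler_pM => //; first by rewrite ler_nat.
  by apply: ltW; near: k; exact: (near_infty_natSinv_lt (PosNum q0)).
have li : P.-integrable setT (EFin \o log_symbol s e).
  have [B HB] := ub (p 0%N).
  apply: (@bounded_measurable_integrable _ _ _ _ _ (B + n%:R)) => // t.
  have := (pP 0%N).1 t; rewrite invr1 mulr1 => h.
  rewrite -[log_symbol s e t](subrK (u (p 0%N) t)) addrC; apply: le_trans (ler_normD _ _) _.
  by apply: lerD => //; rewrite distrC.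
split => //; apply/eqP; rewrite -subr_eq0; apply/eqP.
apply: (small _ (n%:R + n%:R)) => [|k]; first by rewrite addr_ge0.
have ui : P.-integrable setT (EFin \o u (p k)).
  by have [B HB] := ub (p k); exact: bounded_measurable_integrable HB.
rewrite mulrDl; apply: le_trans (ler_distD (\int[P]_t u (p k) t) _ _) (lerD _ _).
  by rewrite distrC; exact: (pP k).2.
rewrite -RintegralB//.
have iD : P.-integrable setT (EFin \o (fun t => u (p k) t - log_symbol s e t)).
  rewrite (_ : EFin \o _ = fun t => ((u (p k) t)%:E - (log_symbol s e t)%:E)%E)//.
  exact: integrableB.
apply: le_trans (le_normr_Rintegral _ iD) _ => //.
rewrite -[leRHS](Rintegral_prob_cst P); apply: le_Rintegral => //.
- exact: (integrable_abse iD).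
- apply: (@bounded_measurable_integrable _ _ _ _ _ (n%:R * k.+1%:R^-1)) => // t.
  by rewrite ger0_norm// mulr_ge0.
- by move=> t _; exact: (pP k).1.
Unshelve. all: by end_near. Qed.

End Haar.
End LogTrace.

(** * The Fuglede-Kadison determinant *)

Section FugledeKadison.
Variables (R : realType) (G : zmodType) (n : nat).
Local Notation C := R[i].
Local Notation Mn := 'M[C]_n.
Variables (d : measure_display) (T : measurableType d) (P : probability T R).
Variable chi : T -> G -> C.
Hypothesis haarP : haar_family P chi.
Variable s : seq (G * Mn).

Let chiP t : is_character (chi t). Proof. by case: haarP. Qed.

Lemma det_adjmx (M : Mn) : \det (adjmx M) = (\det M)^*%C.
Proof.
by rewrite -det_map_mx -det_tr; congr (\det _); apply/matrixP => i j; rewrite !mxE.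
Qed.

Definition sqr_det t : R := normc (\det (opr_symbol s (chi t))) ^+ 2.

(** The determinant is the product of the sigma j + e, nondecreasing and continuous in e >= 0:
    monotonicity gives the bounds at e = 0 and e = 1, and continuity gives the limit. *)
Lemma log_symbol_limit t : sqr_det t != 0 ->
  (forall e, 0 < e -> e <= 1 ->
    2^-1 * ln (sqr_det t) <= log_symbol chi s e t <= log_symbol chi s 1 t) /\
  log_symbol chi s e t @[e --> 0^'+] --> 2^-1 * ln (sqr_det t).
Proof.
move=> q0; have [Q [sigma [Qu s0] E]] := regularized_diagonalization s (chiP t).
have detE e : complex.Re (\det (opr_symbol (regularized_seq s e) (chi t))) = \prod_j (sigma j + e).
  by rewrite E (det_diag_conj _ Qu) -rmorph_prod.
have qE : sqr_det t = \prod_j (sigma j + 0).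
  rewrite -detE (regularized_symbol _ _ (chiP t)) raddf0 addr0 det_mulmx det_adjmx mulrC.
  by rewrite mulc_conj.
have qpos : 0 < sqr_det t by rewrite lt_neqAle eq_sym q0 sqr_ge0.
have mono e e' : 0 <= e -> e <= e' -> \prod_j (sigma j + e) <= \prod_j (sigma j + e').
  by move=> h h'; apply: ler_prod => j _; rewrite addr_ge0//= lerD2l.
have lmono e e' : 0 <= e -> e <= e' ->
    2^-1 * ln (\prod_j (sigma j + e)) <= 2^-1 * ln (\prod_j (sigma j + e')).
  move=> h h'; rewrite ler_pM2l ?invr_gt0// ler_ln ?posrE ?mono//.
    by apply: lt_le_trans (mono 0 e _ h) => //; rewrite -qE.
  by apply: lt_le_trans (mono 0 e' _ (le_trans h h')) => //; rewrite -qE.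
split.
  by move=> e e0 e1; rewrite /log_symbol !detE qE !lmono// ltW.
under eq_fun do rewrite /log_symbol detE.
rewrite qE; apply: (@cvgM _ _ _ _ (fun=> 2^-1)); first exact: cvg_cst.
have -> : \prod_j (sigma j + 0) = (\prod_j ('X + (sigma j)%:P)).[0].
  by rewrite horner_prod; apply: eq_bigr => j _; rewrite hornerD hornerX hornerC addrC.
apply: (@cvg_trans _ (ln (\prod_j ('X + (sigma j)%:P)).[e] @[e --> 0^'+])).
  apply: near_eq_cvg; near=> e; congr ln.
  by rewrite horner_prod; apply: eq_bigr => j _; rewrite hornerD hornerX hornerC addrC.
have pc : (\prod_j ('X + (sigma j)%:P)).[e] @[e --> 0^'+] --> (\prod_j ('X + (sigma j)%:P)).[0].
  by apply: cvg_at_right_filter; exact: continuous_horner.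
apply: (cvg_comp _ _ pc); apply: continuous_ln.
have -> : (\prod_j ('X + (sigma j)%:P)).[0] = \prod_j (sigma j + 0).
  by rewrite horner_prod; apply: eq_bigr => j _; rewrite hornerD hornerX hornerC addrC.
by rewrite -qE.
Unshelve. all: by end_near. Qed.

(** Dominated convergence between the values at e = 0 and e = 1. The determinant is then the
    exponential of a real number, so that [lne] does not take the value -oo. *)
Lemma log_fuglede_kadisonE : finitely_generated G ->
  {ae P, forall t, sqr_det t != 0} ->
  P.-integrable setT (EFin \o (fun t => 2^-1 * ln (sqr_det t))) ->
  log_fuglede_kadison (@opr R G n s) = (\int[P]_t (2^-1 * ln (sqr_det t)))%:E.
Proof.
move=> fgG q0 qi.
suff cvg : \int[P]_t log_symbol chi s e t @[e --> 0^'+] --> \int[P]_t (2^-1 * ln (sqr_det t)).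
  rewrite /log_fuglede_kadison /fuglede_kadison.
  have -> : lim (expR (complex.Re (trace (functional_calculus (fun t => ln (Num.sqrt t))
      (regularized_square (@opr R G n s) e)))) @[e --> 0^'+]) = expR (\int[P]_t (2^-1 * ln (sqr_det t))).
    apply: cvg_lim => //.
    apply: (@cvg_trans _ (expR (\int[P]_t log_symbol chi s e t) @[e --> 0^'+])).
      apply: near_eq_cvg; near=> e.
      have e0 : 0 < e by near: e; exact: nbhs_right_gt.
      by have [_ ->] := log_symbol_integrable haarP s fgG e0.
    by apply: continuous_cvg => //; exact: continuous_expR.
  by rewrite lne_EFin ?expR_gt0// expRK.
apply/cvg_at_rightP => u [u0 uc].
(* The truncation at 1 keeps the sequence where the domination holds and does not change its
   tail. *)
pose v k := Num.min (u k) 1.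
have v0 k : 0 < v k by rewrite lt_min u0 ltr01.
have v1 k : v k <= 1 by rewrite ge_min lexx orbT.
have vu : \forall k \near \oo, v k = u k.
  near=> k; apply/min_idPl/ltW; near: k.
  have /cvgrPdist_lt/(_ 1 ltr01) := uc; apply: filterS => k.
  by rewrite sub0r normrN => h; exact: le_lt_trans (ler_norm _) h.
have vc : v k @[k --> \oo] --> 0^'+.
  move=> B [e /= e0 eB]; have /cvgrPdist_lt/(_ e e0) h := uc.
  suff : \forall k \near \oo, B (v k) by [].
  apply: filterS2 vu h => k vk uk; apply: eB => //=.
  by rewrite vk.
have li e : 0 < e -> P.-integrable setT (EFin \o log_symbol chi s e).
  by move=> e0; have [] := log_symbol_integrable haarP s fgG e0.
have [||||| _ _ lim] := @dominated_convergence _ _ _ P setT measurableT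
  (fun k t => (log_symbol chi s (v k) t)%:E) (fun t => (2^-1 * ln (sqr_det t))%:E)
  (fun t => (`|2^-1 * ln (sqr_det t)| + `|log_symbol chi s 1 t|)%:E).
- by move=> k; exact: measurable_int (li _ (v0 k)).
- exact: measurable_int qi.
- apply: filterS q0 => t qt _; apply/fine_cvgP; split; first by apply: nearW.
  have [_ tl] := log_symbol_limit qt.
  exact: (cvg_comp _ _ vc tl).
- exact: (integrableD measurableT (integrable_abse qi) (integrable_abse (li 1 ltr01))).
- apply: filterS q0 => t qt k _; have [/(_ _ (v0 k) (v1 k))/andP[h1 h2] _] := log_symbol_limit qt.
  rewrite /= lee_fin; move: h1 h2; move: (_ * _) (log_symbol _ _ _ _) (log_symbol _ _ _ _) => a b c h1 h2.
  have b1 := ler_norm b; have a1 := ler_norm (- a); rewrite normrN in a1.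
  have a0 := normr_ge0 a; have b0 := normr_ge0 b.
  by rewrite ler_norml; apply/andP; split; lra.
apply: (@cvg_trans _ (\int[P]_t log_symbol chi s (v k) t @[k --> \oo])).
  by apply: near_eq_cvg; apply: filterS vu => k ->.
apply: (@fine_cvg _ _ _ _ (fun k => \int[P]_t (log_symbol chi s (v k) t)%:E)%E).
rewrite /Rintegral fineK//; exact: integrable_fin_num.
Unshelve. all: by end_near. Qed.

End FugledeKadison.

(** * Null sets, Fubini and the Brown measure *)

Section NullModification.
Variables (d : measure_display) (T : measurableType d) (R : realType).
Variables (mu : {measure set T -> \bar R}) (N : set T).
Hypotheses (mN : measurable N) (N0 : mu N = 0%E).
Local Open Scope ereal_scope.
Import HBNNSimple.

(** The integral is a supremum over simple functions, and restricting a simple function to the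
    complement of [N] does not change its integral. This serves for the logarithm of the
    determinant, which is identified only off a null set of [z]. *)
Let le_integral (f g : T -> \bar R) : (forall x, 0 <= f x) -> (forall x, 0 <= g x) ->
  (forall x, ~ N x -> f x = g x) -> \int[mu]_x f x <= \int[mu]_x g x.
Proof.
move=> f0 g0 fg; rewrite [leLHS]ge0_integralE// [leRHS]ge0_integralE// !patch_setT.
apply: ge_ereal_sup => _ [h hf <-].
pose h' := proj_nnsfun h (measurableC mN).
apply: (@le_trans _ _ (sintegral mu h')); last first.
  apply: ereal_sup_ubound; exists h' => // x; rewrite /h' /= mindicE.
  have [|] := boolP (x \in ~` N); first by rewrite inE mulr1 => xN; rewrite -fg// hf.
  by rewrite mulr0.
rewrite -!integralT_nnsfun le_eqVlt; apply/orP; left; apply/eqP.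
apply: ge0_ae_eq_integral => //.
- by apply/measurable_EFinP.
- by apply/measurable_EFinP.
- by move=> x _; rewrite lee_fin.
- by move=> x _; rewrite lee_fin.
exists N; split=> // x /= H; apply: contrapT => xN; apply: H => _.
by rewrite /h' /= mindicE mem_set// mulr1.
Qed.

(* Neither [f] nor [g] has to be measurable. *)
Lemma integral_null_modification (f g : T -> \bar R) :
  (forall x, ~ N x -> f x = g x) -> \int[mu]_x f x = \int[mu]_x g x.
Proof.
have nn (u v : T -> \bar R) : (forall x, 0 <= u x) -> (forall x, 0 <= v x) ->
    (forall x, ~ N x -> u x = v x) -> \int[mu]_x u x = \int[mu]_x v x.
  move=> u0 v0 uv; apply/eqP; rewrite eq_le !le_integral// => x /uv//.
move=> fg; rewrite integralE [RHS]integralE; congr (_ - _); apply: nn => // x /fg h.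
- by rewrite !funeposE h.
- by rewrite !funenegE h.
Qed.

End NullModification.

Section SigmaFinitePlane.
Variable R : realType.

(* The product of sigma-finite measures carries no canonical sigma-finite
   structure, hence this copy of the Lebesgue measure of the plane. *)
Definition plane_measure : set (plane R) -> \bar R := (@lebesgue_measure R \x @lebesgue_measure R)%E.

HB.instance Definition _ := Measure.copy plane_measure (@lebesgue_measure R \x @lebesgue_measure R)%E.

Lemma plane_measure_sigma_finite : sigma_finite setT plane_measure.
Proof.
exists (fun k : nat => box (- k%:R) k%:R (- k%:R) k%:R).
  apply/seteqP; split=> // z _.
  have [k kz] : exists k : nat, `|z.1| + `|z.2| <= k%:R.
    exists (Num.bound (`|z.1| + `|z.2|)); apply/ltW/archi_boundP.
    by rewrite addr_ge0.
  exists k => //; split; rewrite /= in_itv /= -ler_norml; apply: le_trans kz; rewrite ?lerDl ?lerDr//.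
by move=> k; split; [exact: measurable_box|exact: box_measure_lty].
Qed.

HB.instance Definition _ := Measure_isSigmaFinite.Build _ _ _ plane_measure plane_measure_sigma_finite.

End SigmaFinitePlane.

Section Fubini.
Variables (R : realType) (G : zmodType) (n : nat) (A : 'M[{group_ring R[i][G]}]_n).
Variables (d : measure_display) (T : measurableType d) (P : probability T R).
Variable chi : T -> G -> R[i].
Hypotheses (haarP : haar_family P chi) (fgG : finitely_generated G) (n0 : (0 < n)%N).
Local Notation mu2 := (@plane_measure R).

Let chiP t : is_character (chi t). Proof. by case: haarP. Qed.

Definition sqr_det_at (z : plane R) t : R := normc (\det ((of_plane z)%:M - symbol A (chi t))) ^+ 2.

Lemma measurable_sqr_det : measurable_fun setT (fun p : T * plane R => sqr_det_at p.2 p.1).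
Proof.
have [I [c [g [cc E]]]] := trig_sqr_normc (trig_det A).
have [_ mRe mIm _ _] := haarP.
rewrite (_ : (fun p => _) = fun p : T * plane R => \sum_i
  (complex.Re (c i p.2) * complex.Re (chi p.1 (g i)) - complex.Im (c i p.2) * complex.Im (chi p.1 (g i)))).
  apply: measurable_sum => i; have [c1 c2] := cc i.
  apply: measurable_funB; apply: measurable_funM.
  - exact: (measurableT_comp (continuous_measurable_plane c1) measurable_snd).
  - exact: (measurableT_comp (mRe (g i)) measurable_fst).
  - exact: (measurableT_comp (continuous_measurable_plane c2) measurable_snd).
  - exact: (measurableT_comp (mIm (g i)) measurable_fst).
apply/funext => -[t z] /=.
rewrite -[LHS]/(complex.Re (sqr_det_at z t)%:C%C) (E z (chi t) (chiP t)) raddf_sum.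
by apply: eq_bigr => i _; rewrite [LHS]Re_mulc.
Qed.

Definition shifted_seq z : seq (G * 'M[R[i]]_n) := opr_of A ++ [:: (0, (- z)%:M)].

Lemma sub_scalar_rmul z : sub_scalar (rmul A) z = opr (shifted_seq z).
Proof.
apply/funext => x; rewrite /sub_scalar /shifted_seq opr_cat opr_scalar -rmul_opr.
by rewrite scaleNr.
Qed.

Lemma sqr_det_shifted z t : sqr_det chi (shifted_seq (of_plane z)) t = sqr_det_at z t.
Proof.
rewrite /sqr_det /sqr_det_at /shifted_seq opr_symbol_cat symbol_opr_of opr_symbol_scalar; last exact: chiP.
rewrite -[_ + _]opprK -scaleN1r detZ normcM opprD raddfN opprK [- _ + _]addrC.
by rewrite -signr_odd; case: (odd n); rewrite ?expr1 ?normcN normc1 mul1r.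
Qed.

Section TestFunction.
Variable f : R * R -> R.
Hypothesis tf : test_function f.

Definition log_det_laplacian (p : T * plane R) : R :=
  2^-1 * ln (sqr_det_at p.2 p.1) * laplacian f p.2.
Local Notation g := log_det_laplacian.

Lemma measurable_log_det_laplacian : measurable_fun setT g.
Proof.
apply: measurable_funM.
  apply: measurable_funM; first exact: measurable_cst.
  apply: measurableT_comp; first exact: measurable_ln.
  exact: measurable_sqr_det.
have mL := continuous_measurable_plane (laplacian_continuous tf).
exact: (measurableT_comp mL measurable_snd).
Qed.

Let pts t := [seq to_plane x | x <- spectrum_seq (symbol A (chi t))].

Lemma log_det_sum t z : z \notin pts t ->
  g (t, z) = \sum_(p <- pts t) log_dist p.1 p.2 z * laplacian f z.
Proof.
move=> zp; rewrite /g -mulr_suml; congr (_ * _).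
have -> : sqr_det_at z t = \prod_(p <- pts t) rsq p.1 p.2 z by exact: sqr_normc_det_points.
have pos p : p \in pts t -> 0 < rsq p.1 p.2 z.
  move=> pp; rewrite lt_neqAle eq_sym rsq_ge0 andbT rsq_eq0.
  by apply: contraNneq zp => ->; rewrite -surjective_pairing.
elim: (pts t) pos => [|p s IH] pos; first by rewrite !big_nil ln1 mulr0.
have ps q : q \in s -> 0 < rsq q.1 q.2 z by move=> qs; apply: pos; rewrite inE qs orbT.
rewrite !big_cons lnM ?posrE ?pos ?mem_head//; last by rewrite big_seq prodr_gt0.
by rewrite mulrDr IH.
Qed.

(** Off the roots the function is a sum of [n] logarithmic potentials. As the roots are bounded
    uniformly in [t], so are the integrals, which gives integrability on the product. *)
Lemma log_det_potential : exists2 C : R, 0 <= C & forall t,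
  (\int[mu2]_z `|g (t, z)|%:E <= C%:E)%E /\
  (\int[mu2]_z (g (t, z))%:E = (2 * pi * eigenvalue_sum f A (chi t))%:E)%E.
Proof.
have [M HM] := symbol_root_bound A.
have [C [C0 HC]] := log_potential tf (normr_ge0 M).
exists (n%:R * C) => [|t]; first by rewrite mulr_ge0.
have [N [mN N0 ptsN]] := plane_seq_negligible (pts t).
have key (s : seq (R * R)) : (forall p, p \in s -> `|p.1| <= `|M| /\ `|p.2| <= `|M|) ->
    let h z := \sum_(p <- s) log_dist p.1 p.2 z * laplacian f z in
    [/\ mu2.-integrable setT (EFin \o h),
        (\int[mu2]_z `|h z|%:E <= ((size s)%:R * C)%:E)%E &
        (\int[mu2]_z (h z)%:E = (2 * pi * \sum_(p <- s) f p)%:E)%E].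
  elim: s => [|p s IH] sM.
    rewrite /= (_ : (fun z => _) = cst 0) ; last by apply/funext => z; rewrite big_nil.
    split; first exact: integrable0.
    - by under eq_integral do rewrite big_nil normr0; rewrite integral0 mul0r.
    - by under eq_integral do rewrite big_nil; rewrite integral0 big_nil mulr0.
  have [i1 i2 i3] := IH (fun q qs => sM q (mem_behead (s := p :: s) qs)).
  have [p1 p2] := sM p (mem_head _ _); have [j1 j2 _ j3] := HC _ _ p1 p2.
  have -> : (fun z => \sum_(p <- p :: s) log_dist p.1 p.2 z * laplacian f z) =
    (fun z => log_dist p.1 p.2 z * laplacian f z + \sum_(p <- s) log_dist p.1 p.2 z * laplacian f z).
    by apply/funext => z; rewrite big_cons.
  move: i1 i2 i3; set h := fun z => \sum_(p <- s) _ => i1 i2 i3.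
  set k := fun z => log_dist p.1 p.2 z * laplacian f z in j1 j2 j3 *.
  split.
  - exact: (integrableD measurableT j1 i1).
  - have mk := measurable_int _ j1; have mh := measurable_int _ i1.
    have ak : measurable_fun setT (fun z => `|k z|%:E).
      by apply/measurable_EFinP; apply: measurableT_comp => //; exact/measurable_EFinP.
    have ah : measurable_fun setT (fun z => `|h z|%:E).
      by apply/measurable_EFinP; apply: measurableT_comp => //; exact/measurable_EFinP.
    apply: (@le_trans _ _ (\int[mu2]_z (`|k z|%:E + `|h z|%:E))%E).
      apply: ge0_le_integral => //.
      - apply/measurable_EFinP; apply: measurableT_comp => //; apply: measurable_funD.
          exact/measurable_EFinP.
        exact/measurable_EFinP.
      - exact: emeasurable_funD.
      - by move=> z _; rewrite -EFinD lee_fin ler_normD.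
    rewrite ge0_integralD//= -[in leRHS]natr1 mulrDl mul1r addrC EFinD.
    exact: leeD i2 j2.
  - rewrite big_cons mulrDr EFinD -i3.
    have -> : (2 * pi * f p)%:E = (\int[mu2]_z (k z)%:E)%E by rewrite j3 -surjective_pairing.
    exact: (integralD measurableT j1 i1).
have ptsM p : p \in pts t -> `|p.1| <= `|M| /\ `|p.2| <= `|M|.
  move=> /mapP[x xs ->]; have xM := le_trans (HM.2 _ (chiP t) _ xs) (ler_norm M).
  by split; [exact: le_trans (Re_le_normc _) xM|exact: le_trans (Im_le_normc _) xM].
have [i1 i2 i3] := key _ ptsM.
have gE z : ~ N z -> g (t, z) = \sum_(p <- pts t) log_dist p.1 p.2 z * laplacian f z.
  move=> zN; apply: log_det_sum; apply/negP => zp; apply: zN; exact: ptsN.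
split.
- rewrite (integral_null_modification mN N0 (g := fun z => `|\sum_(p <- pts t) log_dist p.1 p.2 z * laplacian f z|%:E)).
    by move: i2; rewrite size_map size_spectrum_seq.
  by move=> z /gE ->.
- rewrite (integral_null_modification mN N0 (g := fun z => (\sum_(p <- pts t) log_dist p.1 p.2 z * laplacian f z)%:E)).
    by rewrite i3 /eigenvalue_sum big_map.
  by move=> z /gE ->.
Qed.

Lemma log_det_integrable : (P \x mu2)%E.-integrable setT (EFin \o g).
Proof.
have mg : measurable_fun setT (EFin \o g).
  by apply/measurable_EFinP; exact: measurable_log_det_laplacian.
have H := @integrable12ltyP _ _ _ _ _ P mu2 (EFin \o g) mg; apply: H.2.
have [C C0 HC] := log_det_potential.
apply: (@le_lt_trans _ _ (\int[P]_t C%:E)%E).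
  apply: ge0_le_integral => //.
  - by move=> t _; exact: integral_ge0.
  - have ma : measurable_fun setT (abse \o (EFin \o g)) by exact: measurableT_comp.
    have Hm := @measurable_fun_fubini_tonelli_F _ _ _ _ _ mu2 (abse \o (EFin \o g)).
    exact: (Hm ma (fun x => abse_ge0 _)).
  - by move=> t _; exact: (HC t).1.
by rewrite integral_cst//= probability_setT mule1 ltry.
Qed.

Lemma fubini_log_det : (\int[mu2]_z \int[P]_t (g (t, z))%:E =
  (2 * pi * \int[P]_t eigenvalue_sum f A (chi t))%:E)%E.
Proof.
rewrite -(Fubini log_det_integrable).
have [C C0 HC] := log_det_potential.
under eq_integral do rewrite (HC _).2.
have mS := measurable_eigenvalue_sum haarP A n0 tf.
have [M HM] := eigenvalue_sum_bounded A tf.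
have iS := @bounded_measurable_integrable _ _ _ P _ _ mS (fun t => HM (chi t)).
under eq_integral do rewrite EFinM.
rewrite (integralZl measurableT iS) [RHS]EFinM; congr (_ * _)%E.
by rewrite /Rintegral fineK//; exact: integrable_fin_num.
Qed.

End TestFunction.

(** For each [t] the determinant vanishes at finitely many [z]; the set of singular pairs is
    therefore null, and Tonelli's theorem exchanges the variables. *)
Lemma nonsingular_ae : {ae mu2, forall z, {ae P, forall t, sqr_det_at z t != 0}}.
Proof.
pose E := [set p : T * plane R | sqr_det_at p.2 p.1 = 0].
have mE : measurable E.
  by have := measurable_sqr_det measurableT (measurable_set1 0); rewrite setTI.
have mI : measurable_fun setT (EFin \o (\1_E : T * plane R -> R)).
  by apply/measurable_EFinP; exact: measurable_indic.
have I0 p : (0 <= (EFin \o (\1_E : T * plane R -> R)) p)%E by rewrite lee_fin.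
have zero t : (\int[mu2]_z (\1_E (t, z) : R)%:E = 0)%E.
  have [N [mN N0 ptsN]] := plane_seq_negligible [seq to_plane x | x <- spectrum_seq (symbol A (chi t))].
  rewrite (integral_null_modification mN N0 (g := fun=> 0%E)) ?integral0// => z zN.
  rewrite indicE memNset// => /= z0; apply: zN; apply: ptsN => /=.
  have := sqr_normc_det_points A (chi t) z; rewrite -/(sqr_det_at z t) z0.
  move/esym/eqP; rewrite prodf_seq_eq0 => /hasP[p pp /andP[_]].
  by rewrite rsq_eq0 -surjective_pairing => /eqP ->.
have := @fubini_tonelli _ _ _ _ _ P mu2 _ mI I0.
under eq_integral do rewrite zero.
rewrite integral0 => /esym h0.
have mh := @measurable_fun_fubini_tonelli_G _ _ _ _ _ P _ mI I0.
have nn (u : T -> R) : (forall t, 0 <= u t) -> (\int[P]_t (u t)%:E = \int[P]_t `|(u t)%:E|)%E.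
  by move=> u0; apply: eq_integral => t _; rewrite /= ger0_norm.
have ae0 : ae_eq mu2 setT (fubini_G P (EFin \o (\1_E : T * plane R -> R))) (cst 0%E).
  apply/ae_eq_integral_abs => //; rewrite -[RHS]h0; apply: eq_integral => z _.
  by rewrite gee0_abs//; exact: integral_ge0.
apply: filterS ae0 => z /(_ Logic.I) z0.
have mz : measurable_fun setT (fun t => (\1_E (t, z) : R)%:E).
  exact: (measurableT_comp mI (measurable_pair2 z)).
have : ae_eq P setT (fun t => (\1_E (t, z) : R)%:E) (cst 0%E).
  by apply/ae_eq_integral_abs => //; rewrite -nn.
apply: filterS => t /(_ Logic.I) /= [] e1; apply/negP => /eqP t0.
by move: e1; rewrite indicE mem_set// => /eqP; rewrite oner_eq0.
Qed.

Lemma torus_is_brown_measure : is_brown_measure (rmul A) (torus_measure haarP A n0).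
Proof.
move=> f tf; rewrite (torus_measure_test haarP A n0 tf).
have good : {ae mu2, forall z, {ae P, forall t, sqr_det_at z t != 0} /\
    P.-integrable setT (fun t => (log_det_laplacian f (t, z))%:E)}.
  have := ae_integrable2 (log_det_integrable tf); have := nonsingular_ae.
  by apply: filterS2 => z; split.
have [N [mN N0 NP]] := good.
have E z : ~ N z -> (log_fuglede_kadison (sub_scalar (rmul A) (of_plane z)) * (laplacian f z)%:E =
    \int[P]_t (log_det_laplacian f (t, z))%:E)%E.
  move=> zN; have [ns zi] : {ae P, forall t, sqr_det_at z t != 0} /\
      P.-integrable setT (fun t => (log_det_laplacian f (t, z))%:E).
    by apply: contrapT => H; apply: zN; exact: NP.
  (* Integrability of the logarithm in [t] is recovered by dividing by the Laplacian; where the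
     Laplacian vanishes, both sides are 0 whatever the determinant. *)
  have [L0|L0] := eqVneq (laplacian f z) 0.
    rewrite L0 mule0; under eq_integral do rewrite /log_det_laplacian /= L0 mulr0.
    by rewrite integral0.
  have li : P.-integrable setT (EFin \o (fun t => 2^-1 * ln (sqr_det_at z t))).
    have := integrableZr measurableT (laplacian f z)^-1 zi.
    apply: eq_integrable => // t _ /=; rewrite -EFinM /log_det_laplacian /=.
    by rewrite mulfK.
  have sE t : sqr_det chi (shifted_seq (of_plane z)) t = sqr_det_at z t by exact: sqr_det_shifted.
  rewrite sub_scalar_rmul (log_fuglede_kadisonE haarP fgG); last 2 first.
  - by apply: filterS ns => t; rewrite sE.
  - by apply: eq_integrable li => // t _ /=; rewrite sE.
  under eq_Rintegral do rewrite sE.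
  rewrite /Rintegral fineK ?integrable_fin_num// -integralZr//.
rewrite [X in (_ * X)%E](_ : _ = (2 * pi * \int[P]_t eigenvalue_sum f A (chi t))%:E); last first.
  exact: etrans (integral_null_modification mN N0 E) (fubini_log_det tf).
rewrite -EFinM mulrA mulVf ?mul1r//.
by rewrite mulf_neq0// gt_eqF// pi_gt0.
Qed.

End Fubini.

(** The defining property fixes the integrals of test functions and these, being finite, fix the
    measure on Borel sets: the choice made by [brown_measure] is immaterial. *)
Lemma brown_measure_eq (R : realType) (G : zmodType) (n : nat)
    (T : hilbert R G n -> hilbert R G n) (mu : {measure set (plane R) -> \bar R}) :
  is_brown_measure T mu -> (forall f, test_function f -> (\int[mu]_z (f z)%:E < +oo)%E) ->
  forall E, measurable E -> brown_measure T E = mu E.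
Proof.
move=> muT mu_fin; rewrite /brown_measure; case: pselect => [ex|[]]; last by exists mu.
case: (cid ex) => nu nuT /=; apply: test_function_measure_unique => f tf.
- by rewrite (nuT f tf) -(muT f tf).
- by rewrite (nuT f tf) -(muT f tf); exact: mu_fin.
Qed.

Theorem theorem1p1 (R : realType) (G : zmodType) (n : nat)
    (A : 'M[{group_ring R[i][G]}]_n) :
  finitely_generated G -> (0 < n)%N ->
  [/\ forall N : residual_chain G, exists l : R,
        eigenvalue_measure A N i [set to_plane 0] @[i --> \oo] --> l%:E,
      forall (N N' : residual_chain G),
        lim (eigenvalue_measure A N i [set to_plane 0] @[i --> \oo]) =
        lim (eigenvalue_measure A N' i [set to_plane 0] @[i --> \oo])
    & forall N : residual_chain G,
        weak_convergence (eigenvalue_measure A N) (brown_measure (rmul A))].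
Proof.
move=> fgG n0; have [l lP] := zero_eigenvalue_limit A fgG; split.
- by move=> N; exists l; exact: lP.
- by move=> N N'; rewrite !(cvg_lim _ (lP _)).
- have [d [T [P [chi haarP]]]] := haar_family_exists R fgG.
  have brownE E : measurable E -> brown_measure (rmul A) E = torus_measure haarP A n0 E.
    apply: brown_measure_eq; first exact: torus_is_brown_measure.
    by move=> f tf; rewrite torus_measure_test// ltry.
  move=> N f cf bf; rewrite (eq_measure_integral (torus_measure haarP A n0)).
    exact: weak_convergence_torus cf bf.
  by move=> E mE _; exact: brownE.
Qed.
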